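(* Let $p<q$ be odd primes with $p\mid q-1$ and let $G$ be the nonabelian group of order $pq$, with presentation $G=\langle a,b\mid a^p,\,b^q,\,ba=ab^k\rangle$. Let $$V=t\mathbb{R}\oplus\bigoplus_{i=1}^{(p-1)/2}r_iV_i\oplus\bigoplus_{j\in J}s_jW_j$$ be a virtual real $G$-representation, with $t,r_i,s_j\in\mathbb{Z}$, and let $r=\sum_i r_i$ and $s=\sum_j s_j$. Then the Mackey functor valued homology groups $\underline{H}_*(S^V;\underline{\mathbb{Z}})$ are the direct sum of the following Mackey functors: (1) In dimension $t+2r+2ps$: $$\underline{H}_{t+2r+2ps}(S^V;\underline{\mathbb{Z}})\cong\begin{cases}\underline{\mathbb{Z}}&\text{if }r+(p-1)s\ge 0\text{ and }s\ge 0,\\ \underline{\mathbb{Z}}^{1,q}&\text{if }r+(p-1)s\ge 0\text{ and }s<0,\\ \underline{\mathbb{Z}}^{p,1}&\text{if }r+(p-1)s<0\text{ and }s\ge 0,\\ \underline{\mathbb{Z}}^{p,q}&\text{if }r+(p-1)s<0\text{ and }s<0.\end{cases}$$ (2) If $r+(p-1)s>0$, a $\widehat{\mathbb{Z}/p}$ in dimension $t+2s+2i$ for $i=0,\ldots,r+(p-1)s-1$. (3) If $r+(p-1)s<0$, a $\widehat{\mathbb{Z}/p}$ in dimension $t+2s-2i-1$ for $i=1,\ldots,-(r+(p-1)s+1)$. (4) If $s>0$, a $\widehat{\mathbb{Z}/q(k^i)}$ in dimension $t+2r+2i$ for $i=0,\ldots,ps-1$. (5) If $s<0$, a $\widehat{\mathbb{Z}/q(k^{-i})}$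 in dimension $t+2r-2i-1$ for $i=1,\ldots,-(ps+1)$.
   Context: Group: $k$ is an integer with $k^p\equiv 1$, $k\not\equiv 1\pmod q$. Write $C_p=\langle a\rangle$ and $C_q=\langle b\rangle$; $C_q$ is normal and $W_G(C_q)=G/C_q\cong C_p$ is generated by the image of $a$. Up to conjugacy the subgroups of $G$ are $e,C_p,C_q,G$. Representations: $\mathbb{R}$ is the trivial representation. For $1\le i\le (p-1)/2$, $V_i$ is the 2-dimensional real representation on which $a$ acts by rotation by $2\pi i/p$ and $b$ acts trivially. For $1\le j\le q-1$, let $V'_j$ be the 1-dimensional complex $C_q$-representation on which $b$ acts by rotation by $2\pi j/q$, and let $W_j$ be the $2p$-dimensional real representation underlying $\mathrm{Ind}_{C_q}^GV'_j$. The set $J\subset\{1,\ldots,q-1\}$, of cardinality $(q-1)/(2p)$, is chosen so that $\mathbb{R}$, the $V_i$ ($1\le i\le (p-1)/2$) and the $W_j$ ($j\in J$) form a complete list of irreducible real $G$-representations without repetition. Homology: $\underline{H}_n(S^V;\underline{\mathbb{Z}})$ is the Mackey functor $G/H\mapsto\pi_n^H(S^V\wedge H\underline{\mathbb{Z}})$, i.e. reduced Bredon homology of the representation sphere $S^V$ (a virtual sphere spectrum in general) with coefficients in the constant Mackey functor $\underline{\mathbb{Z}}$. A $G$-Mackey functor $\underline{M}$ has restriction maps $R^H_K:\underline{M}(G/H)\to\underline{M}(G/K)$, transfer maps $\mathrm{Tr}_K^H:\underline{M}(G/K)\to\underline{M}(G/H)$ for $K\le H\le G$, and conjugation maps $c_g:\underline{M}(G/H)\to\underline{M}(G/gHg^{-1})$.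 The following $G$-Mackey functors are specified at the levels $G/e,G/C_p,G/C_q,G/G$ (the values at conjugates of $C_p$ are determined by conjugation). For $\alpha\in\{1,p\}$ and $\beta\in\{1,q\}$, $\underline{\mathbb{Z}}^{\alpha,\beta}$ has value $\mathbb{Z}$ at every level, trivial actions, and: $R^G_{C_q}$ and $R^{C_p}_e$ are multiplication by $\alpha$; $\mathrm{Tr}_{C_q}^G$ and $\mathrm{Tr}_e^{C_p}$ are multiplication by $p/\alpha$; $R^G_{C_p}$ and $R^{C_q}_e$ are multiplication by $\beta$; $\mathrm{Tr}_{C_p}^G$ and $\mathrm{Tr}_e^{C_q}$ are multiplication by $q/\beta$. In particular $\underline{\mathbb{Z}}=\underline{\mathbb{Z}}^{1,1}$ is the constant Mackey functor. $\widehat{\mathbb{Z}/p}$ has value $\mathbb{Z}/p$ at $G/G$ and $G/C_p$ and $0$ at $G/C_q$ and $G/e$, with $R^G_{C_p}=1$ and $\mathrm{Tr}_{C_p}^G=1$. For $\epsilon$ with $\epsilon^p\equiv 1\pmod q$, $\widehat{\mathbb{Z}/q(\epsilon)}$ has value $\mathbb{Z}/q$ at $G/C_q$ with the generator $a$ of $C_p\cong W_G(C_q)$ acting by multiplication by $\epsilon$, and value $0$ at $G/C_p$ and $G/e$. If $\epsilon\not\equiv 1\pmod q$ its value at $G/G$ is $0$; if $\epsilon\equiv 1\pmod q$ its value at $G/G$ is $\mathbb{Z}/q$ with $R^G_{C_q}=1$ and $\mathrm{Tr}^G_{C_q}=p$.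
   Formalization: The generator a acts on the value at G/C_q on the right, through c_{a^{-1}}; with c_a and ba=ab^k the powers of k in (4) and (5) would be inverted. Homology of the virtual sphere S^{V1-V2} is modelled by equivariant chain maps of reduced singular chains up to homotopy. *)

(* Defs.v *)
From HB Require Import structures.
From mathcomp Require Import all_boot all_order all_algebra all_fingroup all_character.
From mathcomp Require Import freeg ring_quotient.
From mathcomp Require Import boolp classical_sets functions reals topology normedtype trigo.

Set Implicit Arguments.
Unset Strict Implicit.
Unset Printing Implicit Defensive.

Import Order.TTheory GRing.Theory Num.Theory.
Import numFieldNormedType.Exports.

Local Open Scope ring_scope.
Local Open Scope classical_set_scope.

(* All group actions are right actions, as in MathComp: representations act on
   row vectors, x ^ g = g^-1 * x * g and H :^ g = g^-1 H g. *)

Section Induction.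
Variables (F : fieldType) (gT : finGroupType) (G H : {group gT}) (n : nat).
Variables (sHG : H \subset G) (rH : mx_representation F H n).

(* The induced module is the direct sum of the rH \otimes t, t in a right
   transversal of H in G, with (v \otimes t) g = v (t g u^-1) \otimes u when
   H t g = H u. *)
Definition ind_transv (x : 'I_#|rcosets H G|) : gT := repr (enum_val x).

Definition ind_mx (g : gT) :=
  \mxblock_(x < #|rcosets H G|, y < #|rcosets H G|)
    (if (ind_transv x * g * (ind_transv y)^-1)%g \in H
     then rH (ind_transv x * g * (ind_transv y)^-1)%g else (0 : 'M_n)).

Lemma ind_transvE x : (H :* ind_transv x)%g = enum_val x.
Proof.
have /rcosetsP[u Gu e] : enum_val x \in rcosets H G := enum_valP x.
by rewrite /ind_transv e rcoset_repr.
Qed.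

Lemma ind_transv_in x : ind_transv x \in G.
Proof.
have /rcosetsP[u Gu e] : enum_val x \in rcosets H G := enum_valP x.
have : ind_transv x \in (H :* u)%g by rewrite -e -ind_transvE rcoset_refl.
by case/rcosetP=> h Hh ->; rewrite groupM // (fintype.subsetP sHG).
Qed.

Lemma ind_transvP x y :
  ((ind_transv x * (ind_transv y)^-1)%g \in H) = (x == y).
Proof.
rewrite -mem_rcoset; apply/idP/eqP => [Hxy|->]; last exact: rcoset_refl.
by apply: enum_val_inj; rewrite -!ind_transvE (rcoset_eqP Hxy).
Qed.

Lemma ind_mx_repr : mx_repr G ind_mx.
Proof.
split=> [|g h Gg Gh].
  rewrite /ind_mx -mxdiagZ /mxdiag; apply: eq_mxblock => x y.
  rewrite mulg1 ind_transvP; case: eqP => // <-.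
  by rewrite mulgV repr_mx1 conform_mx_id.
rewrite /ind_mx mul_mxblock; apply: eq_mxblock => x y.
have [z Hz] : exists z, (ind_transv x * g * (ind_transv z)^-1)%g \in H.
  have xgG : (H :* (ind_transv x * g))%g \in rcosets H G.
    by apply/rcosetsP; exists (ind_transv x * g)%g; rewrite // groupM ?ind_transv_in.
  exists (enum_rank_in xgG (H :* (ind_transv x * g))%g).
  rewrite -mem_rcoset ind_transvE enum_rankK_in //; exact: rcoset_refl.
rewrite (bigD1 z) //= Hz big1 ?addr0 => [|w wz]; last first.
  case: ifP => [Hw|_]; last by rewrite mul0mx.
  case/negP: wz; rewrite eq_sym -ind_transvP.
  have := groupM (groupVr Hz) Hw.
  by rewrite !invMg !mulgA invgK mulgKV mulgVK.
set u := (ind_transv x * g * _)%g in Hz *.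
have -> : (ind_transv x * (g * h) * (ind_transv y)^-1 =
           u * (ind_transv z * h * (ind_transv y)^-1))%g.
  by rewrite /u !mulgA mulgKV.
by rewrite groupMl //; case: ifP => Hv; rewrite ?mulmx0 // repr_mxM.
Qed.
Definition ind_repr := MxRepresentation ind_mx_repr.
End Induction.

Record gspace (gT : finGroupType) := GSpace {
  gspace_top :> topologicalType;
  gs_act : gspace_top -> gT -> gspace_top;
  _ : forall g, continuous (gs_act^~ g);
  _ : forall x, gs_act x 1%g = x;
  _ : forall x g h, gs_act x (g * h)%g = gs_act (gs_act x g) h }.

Section GSpaceTheory.
Variables (gT : finGroupType) (X : gspace gT).
Lemma gs_act_continuous g : continuous (@gs_act gT X ^~ g). Proof. by case: X. Qed.
Lemma gs_act1 (x : X) : gs_act x 1%g = x. Proof. by case: X x. Qed.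
Lemma gs_actM (x : X) g h : gs_act x (g * h)%g = gs_act (gs_act x g) h.
Proof. by case: X x. Qed.
End GSpaceTheory.

Section MatrixContinuity.
Variable R : realType.

Lemma mx_continuous (T : topologicalType) m n (f : T -> 'M[R]_(m, n)) :
  (forall i j, continuous (fun x => f x i j)) -> continuous f.
Proof.
move=> cf x U [P nP PU].
apply: (@filterS _ _ _ (fun y => forall ij : 'I_m * 'I_n, P ij.1 ij.2 (f y ij.1 ij.2))).
  by move=> y Py; apply: PU => i j; exact: (Py (i, j)).
by apply: filter_forall => -[i j] /=; exact: (cf i j x _ (nP i j)).
Qed.

Lemma sumr_continuous (T : topologicalType) (I : Type) (s : seq I)
    (F : I -> T -> R) :
  (forall i, continuous (F i)) -> continuous (fun x => \sum_(i <- s) F i x).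
Proof.
move=> cF; elim: s => [|i s IHs].
  have -> : (fun x => \sum_(i <- [::]) F i x) = cst 0.
    by apply/funext => x; rewrite big_nil.
  exact: cst_continuous.
have -> : (fun x => \sum_(j <- i :: s) F j x) =
          F i \+ (fun x => \sum_(j <- s) F j x).
  by apply/funext => x; rewrite big_cons.
by move=> x; apply: continuousD; [exact: cF | exact: IHs].
Qed.

Lemma mulmxr_continuous m p (A : 'M[R]_(m, p)) :
  continuous (fun v : 'rV[R]_m => v *m A).
Proof.
apply: mx_continuous => i j.
have -> : (fun v : 'rV[R]_m => (v *m A) i j) =
          (fun v => \sum_(k <- index_enum 'I_m) v i k * A k j).
  by apply/funext => v; rewrite mxE.
apply: sumr_continuous => k v; apply: continuousM; [exact: coord_continuous | exact: cst_continuous].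
Qed.
End MatrixContinuity.

Section RepSphere.
Variables (R : realType) (gT : finGroupType) (n : nat).
Variable rG : mx_representation R [set: gT]%G n.

Definition rep_sphere_act (v : one_point_compactification 'rV[R]_n) (g : gT) :
  one_point_compactification 'rV[R]_n := omap (mulmx^~ (rG g)) v.

Lemma rep_sphere_act_continuous g : continuous (rep_sphere_act^~ g).
Proof.
case=> [v|] U /=.
  move=> nU; have cv := @mulmxr_continuous R n n (rG g) v (Some @^-1` U) nU.
  change (nbhs v (fun w : 'rV[R]_n => U (Some (w *m rG g)))); exact: cv.
case=> C [cC clC] CU.
exists (mulmx^~ (rG g^-1%g) @` C); first split.
- apply: continuous_compact => //; apply: continuous_subspaceT.
  exact: (@mulmxr_continuous R n n (rG g^-1%g)).
- have -> : mulmx^~ (rG g^-1%g) @` C = mulmx^~ (rG g) @^-1` C.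
    apply/seteqP; split=> [_ [v Cv <-] | v Cv] /=.
      by rewrite repr_mxKV ?finset.in_setT.
    by exists (v *m rG g); rewrite ?repr_mxK ?finset.in_setT.
  apply: preimage_closed => // w _; exact: (@mulmxr_continuous R n n (rG g)).
move=> [v|] /= [[w nCw]|] //=; last by move=> _; apply: CU; right.
move=> [<-]; apply: CU; left; exists (w *m rG g) => // Cw; apply: nCw.
by exists (w *m rG g); rewrite ?repr_mxK ?finset.in_setT.
Qed.

Lemma rep_sphere_act1 v : rep_sphere_act v 1%g = v.
Proof. by case: v => //= v; rewrite /rep_sphere_act /= repr_mx1 mulmx1. Qed.

Lemma rep_sphere_actM v g h :
  rep_sphere_act v (g * h)%g = rep_sphere_act (rep_sphere_act v g) h.
Proof. by case: v => //= v; rewrite /rep_sphere_act /= repr_mxM ?finset.in_setT // mulmxA. Qed.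

Definition rep_sphere : gspace gT :=
  GSpace rep_sphere_act_continuous rep_sphere_act1 rep_sphere_actM.
End RepSphere.

Section Simplices.
Variable R : realType.

(* The index counts the vertices: std_simplex n has dimension n - 1, and
   std_simplex 0 is empty. *)
Definition std_simplex n : set 'rV[R]_n :=
  [set x | (forall i, 0 <= x 0 i) /\ \sum_i x 0 i = 1].
Arguments std_simplex : clear implicits.

Definition face_mx n (i : 'I_n.+1) (x : 'rV[R]_n) : 'rV[R]_n.+1 :=
  \row_j (if unlift i j is Some j' then x 0 j' else 0).

Lemma face_subproof n (i : 'I_n.+1) (x : std_simplex n) :
  face_mx i (val x) \in std_simplex n.+1.
Proof.
case: x => x /=; rewrite inE => -[x0 x1]; apply/mem_set; split=> [j|].
  by rewrite mxE; case: unlift.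
rewrite (bigD1_ord i) //= mxE unlift_none add0r -[RHS]x1.
by apply: eq_bigr => j _; rewrite mxE liftK.
Qed.

Definition face n (i : 'I_n.+1) (x : std_simplex n) : std_simplex n.+1 :=
  exist _ (face_mx i (val x)) (face_subproof i x).

Lemma face_continuous n (i : 'I_n.+1) : continuous (face i).
Proof.
apply/continuous_comp_initial; apply: mx_continuous => i' j.
rewrite /comp /=.
have -> : (fun x : std_simplex n => face_mx i (val x) i' j) =
  (fun x : std_simplex n => if unlift i j is Some j' then val x 0 j' else 0).
  by apply/funext => x; rewrite mxE.
case: unlift => [j'|]; last exact: cst_continuous.
move=> x U /coord_continuous nU.
exact: (@initial_continuous _ _ (set_val : std_simplex n -> 'rV[R]_n) x _ nU).
Qed.
End Simplices.
Arguments std_simplex : clear implicits.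

Section FreeGroup.
Variable K : choiceType.

HB.instance Definition _ (M : lmodType int) (f : K -> M) :=
  GRing.isZmodMorphism.Build {freeg K / int} M (fglift f) (lift_is_additive f).

Lemma freegUE (m : int) (x : K) : << m *g x >> = << x >> *~ m :> {freeg K / int}.
Proof. by rewrite freegU_mulz intz. Qed.

Lemma fgliftU (M : lmodType int) (f : K -> M) x : fglift f << x >> = f x.
Proof. by rewrite liftU scale1r. Qed.

Lemma freeg_ext (M : zmodType) (f g : {additive {freeg K / int} -> M}) :
  (forall x, f << x >> = g << x >>) -> f =1 g.
Proof.
move=> fg D; rewrite -[D]freeg_sumE !raddf_sum; apply: eq_bigr => x _.
by rewrite freegUE !raddfMz fg.
Qed.
End FreeGroup.

Section Chains.
Variables (R : realType).

(* Since std_simplex 0 is empty, there is exactly one simplex of tag 0, and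
   (simplex, simplex_bd) is the augmented singular chain complex, that is, the
   reduced one; the simplices of tag n have degree n - 1. *)
Definition simplex (X : topologicalType) : choiceType :=
  {n : nat & continuousType (std_simplex R n) X}.

Definition mk_simplex (X : topologicalType) n (u : std_simplex R n -> X)
    (cu : continuous u) : simplex X :=
  existT (fun m => continuousType (std_simplex R m) X) n (mkcts cu).

Lemma eq_mk_simplex (X : topologicalType) n (u v : std_simplex R n -> X)
    (cu : continuous u) (cv : continuous v) :
  u =1 v -> mk_simplex cu = mk_simplex cv.
Proof.
by move=> uv; congr existT; apply/continuousEP => x; exact: uv.
Qed.

Lemma comp_face_continuous (X : topologicalType) n
    (u : continuousType (std_simplex R n.+1) X) (i : 'I_n.+1) :
  continuous (u \o face i).
Proof.
by move=> x; apply: continuous_comp; [exact: face_continuous | exact: cts_fun].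
Qed.

Definition simplex_bd (X : topologicalType) (s : simplex X) : {freeg (simplex X) / int} :=
  match s with
  | existT 0 _ => 0
  | existT n.+1 u =>
      \sum_(i < n.+1) << (-1) ^+ i *g mk_simplex (@comp_face_continuous X n u i) >>
  end.

Lemma simplex_bd_tag (X : topologicalType) (s u : simplex X) :
  u \in dom (simplex_bd s) -> tag s = (tag u).+1.
Proof.
case: s => -[|n] s; first by rewrite dom0.
move=> /dom_sum_subset /flatten_mapP[i _].
by rewrite domU ?signr_eq0 // inE => /eqP ->.
Qed.
End Chains.

Section ChainHom.
Variables (R : realType) (gT : finGroupType).
Implicit Types X Y : gspace gT.
Notation chain X := {freeg (simplex R X) / int}.

Lemma comp_act_continuous X n (u : continuousType (std_simplex R n) X) g :
  continuous (@gs_act gT X ^~ g \o u).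
Proof.
by move=> x; apply: continuous_comp; [exact: cts_fun | exact: gs_act_continuous].
Qed.

Definition simplex_act X (s : simplex R X) (g : gT) : simplex R X :=
  mk_simplex (@comp_act_continuous X _ (tagged s) g).

Lemma simplex_act1 X (s : simplex R X) : simplex_act s 1%g = s.
Proof.
case: s => n u; congr existT; apply/continuousEP => x /=; exact: gs_act1.
Qed.

Lemma simplex_actM X (s : simplex R X) g h :
  simplex_act s (g * h)%g = simplex_act (simplex_act s g) h.
Proof. by apply: eq_mk_simplex => x /=; exact: gs_actM. Qed.

Definition chain_bd X : chain X -> chain X := fglift (@simplex_bd R X).

Definition chain_act X (g : gT) : chain X -> chain X :=
  fglift (fun s => << simplex_act s g >>).

HB.instance Definition _ X := GRing.Additive.on (@chain_bd X).
HB.instance Definition _ X g := GRing.Additive.on (@chain_act X g).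

Lemma chain_actU X g (s : simplex R X) :
  chain_act g << s >> = << simplex_act s g >>.
Proof. exact: fgliftU. Qed.

Lemma chain_actUm X g m (s : simplex R X) :
  chain_act g << m *g s >> = << m *g simplex_act s g >>.
Proof.
rewrite [in LHS]freegUE [RHS]freegUE [LHS]raddfMz; congr (_ *~ _).
exact: chain_actU.
Qed.

Lemma chain_bdU X (s : simplex R X) : chain_bd << s >> = simplex_bd s.
Proof. exact: fgliftU. Qed.

Lemma chain_act1 X (c : chain X) : chain_act 1%g c = c.
Proof.
rewrite -[RHS]/(idfun c); move: c; apply: freeg_ext => s /=.
by rewrite chain_actU simplex_act1.
Qed.

Lemma chain_actM X (c : chain X) g h :
  chain_act (g * h)%g c = chain_act h (chain_act g c).
Proof.
rewrite -[RHS]/((@chain_act X h \o @chain_act X g) c); move: c.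
apply: freeg_ext => s /=.
by rewrite !chain_actU simplex_actM.
Qed.

Lemma chain_bd_act X (c : chain X) g :
  chain_bd (chain_act g c) = chain_act g (chain_bd c).
Proof.
rewrite -[LHS]/((@chain_bd X \o @chain_act X g) c).
rewrite -[RHS]/((@chain_act X g \o @chain_bd X) c); move: c.
apply: freeg_ext => -[n u] /=; rewrite chain_actU !chain_bdU.
case: n u => [|n] u; first by rewrite /= raddf0.
rewrite [RHS]raddf_sum; apply: eq_bigr => i _.
rewrite [LHS]freegUE [in RHS]freegUE [RHS]raddfMz; congr (_ *~ _).
apply: etrans (esym (chain_actU _ _)).
by congr << _ >>; apply: eq_mk_simplex.
Qed.

Variables (Y X : gspace gT).
(* [chain_hom] is Hom (C Y, C X) for the free abelian groups C Y and C X on all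
   simplices, given by the values on generators; [homogeneous n] singles out
   the homomorphisms of degree n.  Group elements act by conjugation. *)
Definition chain_hom : zmodType := simplex R Y -> chain X.
Implicit Type f : chain_hom.

Definition hom_act (g : gT) f : chain_hom :=
  fun s => chain_act g (f (simplex_act s g^-1%g)).

Definition hom_bd (n : int) f : chain_hom :=
  fun s => chain_bd (f s) - fglift f (simplex_bd s) *~ (-1) ^+ `|n|%N.

Definition homogeneous (n : int) f : Prop :=
  forall s u, u \in dom (f s) -> (tag u)%:Z = (tag s)%:Z + n.

Definition equivariant (H : {group gT}) f : Prop :=
  forall g, g \in H -> hom_act g f = f.

Definition hom_cycle (H : {group gT}) (n : int) f : Prop :=
  [/\ homogeneous n f, equivariant H f & hom_bd n f = 0].

Definition hom_boundary (H : {group gT}) (n : int) f : Prop :=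
  exists h, [/\ homogeneous (n + 1) h, equivariant H h & f = hom_bd (n + 1) h].

Lemma hom_act1 f : hom_act 1%g f = f.
Proof.
by apply/funext => s; rewrite /hom_act invg1 chain_act1 simplex_act1.
Qed.

Lemma hom_actM f g h : hom_act (g * h)%g f = hom_act h (hom_act g f).
Proof.
by apply/funext => s; rewrite /hom_act chain_actM invMg simplex_actM.
Qed.

Lemma hom_act_is_additive g : additive (hom_act g).
Proof. by move=> f h; apply/funext => s; rewrite /hom_act [LHS]raddfB. Qed.
HB.instance Definition _ g :=
  GRing.isZmodMorphism.Build _ _ (hom_act g) (hom_act_is_additive g).

Lemma fgliftB f h c : fglift (f - h) c = fglift f c - fglift h c.
Proof.
rewrite -[RHS]/((fglift f \- fglift h) c); move: c; apply: freeg_ext => s.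
by rewrite /= !fgliftU.
Qed.

Lemma hom_bd_is_additive n : additive (hom_bd n).
Proof.
move=> f h; apply/funext => s.
rewrite -[RHS]/(hom_bd n f s - hom_bd n h s) /hom_bd fgliftB [chain_bd _]raddfB.
rewrite mulrzBl !opprB addrACA [RHS]addrACA; congr (_ + _); exact: addrC.
Qed.
HB.instance Definition _ n :=
  GRing.isZmodMorphism.Build _ _ (hom_bd n) (hom_bd_is_additive n).

Lemma fglift_hom_act g f c :
  fglift (hom_act g f) c = chain_act g (fglift f (chain_act g^-1%g c)).
Proof.
rewrite -[RHS]/((@chain_act X g \o (fglift f \o @chain_act Y g^-1%g)) c).
move: c; apply: freeg_ext => s /=.
by rewrite fgliftU chain_actU fgliftU.
Qed.

Lemma simplex_bd_act (Z : gspace gT) (s : simplex R Z) g :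
  simplex_bd (simplex_act s g) = chain_act g (simplex_bd s).
Proof. by rewrite -chain_bdU -chain_actU chain_bd_act chain_bdU. Qed.

Lemma hom_bd_act n f g : hom_bd n (hom_act g f) = hom_act g (hom_bd n f).
Proof.
apply/funext => s; rewrite /hom_bd fglift_hom_act -simplex_bd_act.
rewrite /hom_act chain_bd_act [RHS]raddfB; congr (_ - _).
by rewrite [RHS]raddfMz.
Qed.

Lemma homogeneousB n f h :
  homogeneous n f -> homogeneous n h -> homogeneous n (f - h).
Proof.
by move=> nf nh s u /domB; rewrite mem_cat => /orP[/nf | /nh].
Qed.

Lemma homogeneous0 n : homogeneous n 0.
Proof. by move=> s u; rewrite dom0. Qed.

Lemma chain_act_dom (Z : gspace gT) g (c : chain Z) u :
  u \in dom (chain_act g c) -> exists2 v, v \in dom c & tag u = tag v.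
Proof.
rewrite -{1}[c]freeg_sumE [chain_act g _]raddf_sum.
move=> /dom_sum_subset/flatten_mapP[v]; rewrite filter_predT => cv.
rewrite -[X in dom X]/(chain_act g _) chain_actUm => ucv; exists v => //.
rewrite domU -?coeff_neq0 -?mem_dom // inE in ucv; by move/eqP: ucv => ->.
Qed.

Lemma homogeneous_act n f g : homogeneous n f -> homogeneous n (hom_act g f).
Proof. by move=> nf s u /chain_act_dom[v /nf + ->] => ->. Qed.

Section Homology.
Variables (H : {group gT}) (n : int).

(* The free abelian group on the singular simplicial set of a based H-space A,
   modulo the base point, is a model of A /\ HZ (HZ the Eilenberg-Mac Lane
   spectrum of the constant Mackey functor Z).  Hence the group
   pi_n^H (S^-Y /\ X /\ HZ) = [S^n /\ Y, X /\ HZ]^H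
   is the group of H-equivariant chain maps of degree n from the reduced
   singular chains of Y to those of X, up to H-equivariant chain homotopy.
   For Y = S^0 this is the n-th homology of the complex of H-invariant reduced
   singular chains of X, the Bredon homology of X with coefficients in Z. *)

Definition cycle_pred : {pred chain_hom} := fun f => `[< hom_cycle H n f >].

Lemma cycle_pred_zmod_closed : zmod_closed cycle_pred.
Proof.
split=> [|f h /asboolP[nf Hf df] /asboolP[nh Hh dh]]; apply/asboolP; split.
- exact: homogeneous0.
- by move=> g _; exact: raddf0.
- exact: raddf0.
- exact: homogeneousB.
- by move=> g Hg; rewrite [LHS]raddfB /= Hf ?Hh.
- by rewrite raddfB /= df dh subrr.
Qed.
HB.instance Definition _ :=
  GRing.isZmodClosed.Build chain_hom cycle_pred cycle_pred_zmod_closed.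

Definition cycles := {f : chain_hom | f \in cycle_pred}.
HB.instance Definition _ := SubChoice.on cycles.
HB.instance Definition _ := [SubChoice_isSubZmodule of cycles by <:].

Definition boundary_pred : {pred cycles} :=
  fun z => `[< hom_boundary H n (val z) >].

Lemma boundary_pred_zmod_closed : zmod_closed boundary_pred.
Proof.
split=> [|y z /asboolP[f [nf Hf ef]] /asboolP[h [nh Hh eh]]]; apply/asboolP.
  exists 0; split; first exact: homogeneous0.
    by move=> g _; exact: raddf0.
  by rewrite !raddf0.
exists (f - h); split; first exact: homogeneousB.
  by move=> g Hg; rewrite [LHS]raddfB /= Hf ?Hh.
by rewrite [LHS]raddfB [RHS]raddfB; congr (_ - _); [exact: ef | exact: eh].
Qed.
HB.instance Definition _ :=
  GRing.isZmodClosed.Build cycles boundary_pred boundary_pred_zmod_closed.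

Definition homology : zmodType := Quotient.quot boundary_pred.

End Homology.

Lemma hom_resP (H K : {group gT}) n (z : cycles H n) : K \subset H ->
  val z \in cycle_pred K n.
Proof.
move=> sKH; case: z => f /= /asboolP[nf Hf df]; apply/asboolP; split=> // g Kg.
exact/Hf/(fintype.subsetP sKH).
Qed.

Lemma hom_conjP (H K : {group gT}) g n (z : cycles H n) :
  K = (H :^ g)%g :> {set gT} ->
  hom_act g (val z) \in cycle_pred K n.
Proof.
move=> defK; case: z => f /= /asboolP[nf Hf df]; apply/asboolP; split.
- exact: homogeneous_act.
- move=> h; rewrite defK => /imsetP[u Hu ->].
  by rewrite -hom_actM mulgA mulgV mul1g hom_actM Hf.
- by rewrite hom_bd_act df; exact: raddf0.
Qed.

Definition hom_tr (H K : {group gT}) f : chain_hom :=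
  \sum_(C in rcosets K H) hom_act (repr C) f.

Lemma homogeneous_tr (H K : {group gT}) n f :
  homogeneous n f -> homogeneous n (hom_tr H K f).
Proof.
move=> nf; rewrite /hom_tr; elim/big_ind: _ => [|f1 f2 n1 n2|C _].
- exact: homogeneous0.
- rewrite -[f2]opprK; apply: homogeneousB => //.
  by rewrite -sub0r; apply: homogeneousB => //; exact: homogeneous0.
- exact: homogeneous_act.
Qed.

Lemma hom_bd_tr (H K : {group gT}) n f :
  hom_bd n (hom_tr H K f) = hom_tr H K (hom_bd n f).
Proof.
by rewrite [LHS]raddf_sum; apply: eq_bigr => C _; exact: hom_bd_act.
Qed.

Lemma equivariant_tr (H K : {group gT}) f : K \subset H ->
  equivariant K f -> equivariant H (hom_tr H K f).
Proof.
move=> sKH Kf g Hg; rewrite [LHS]raddf_sum /=.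
have act_repr u : hom_act (repr (K :* u)%g) f = hom_act u f.
  by have [v Kv ->] := rcosetP (mem_repr_rcoset K u); rewrite hom_actM Kf.
rewrite /hom_tr [RHS](reindex_inj (@rcoset_inj _ g))/=.
have memC (C : {set gT}) :
    ((C :* g)%g \in rcosets K H) = (C \in rcosets K H).
  apply/rcosetsP/rcosetsP => -[u Hu eC]; last first.
    by exists (u * g)%g; rewrite ?groupM // eC rcosetM.
  exists (u * g^-1)%g; rewrite ?groupM ?groupV //.
  by rewrite rcosetM -eC -rcosetM mulgV mulg1.
rewrite (eq_bigl _ _ memC); apply: eq_bigr => C /rcosetsP[u Hu ->].
by rewrite -hom_actM -rcosetM act_repr !hom_actM act_repr.
Qed.

Lemma hom_trP (H K : {group gT}) n (z : cycles K n) : K \subset H ->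
  hom_tr H K (val z) \in cycle_pred H n.
Proof.
move=> sKH; case: z => f /= /asboolP[nf Kf df]; apply/asboolP; split.
- exact: homogeneous_tr.
- exact: equivariant_tr.
- rewrite hom_bd_tr df /hom_tr big1 // => C _; exact: raddf0.
Qed.

Lemma hom_trB (H K : {group gT}) f h :
  hom_tr H K (f - h) = hom_tr H K f - hom_tr H K h.
Proof.
by rewrite /hom_tr -sumrB; apply: eq_bigr => C _; exact: raddfB.
Qed.

Definition homology_res (H K : {group gT}) n (sKH : K \subset H)
    (x : homology H n) : homology K n :=
  \pi_(homology K n)%qT
    (exist _ (val (generic_quotient.repr x))
             (hom_resP (generic_quotient.repr x) sKH)).

Definition homology_tr (H K : {group gT}) n (sKH : K \subset H)
    (x : homology K n) : homology H n :=
  \pi_(homology H n)%qT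
    (exist _ (hom_tr H K (val (generic_quotient.repr x)))
             (hom_trP (generic_quotient.repr x) sKH)).

Definition homology_conj (H K : {group gT}) n (g : gT)
    (defK : K = (H :^ g)%g :> {set gT}) (x : homology H n) : homology K n :=
  \pi_(homology K n)%qT
    (exist _ (hom_act g (val (generic_quotient.repr x)))
             (hom_conjP (generic_quotient.repr x) defK)).

(* These maps do not depend on the choice of representatives. *)
Lemma homology_mapE (H K : {group gT}) n (phi : chain_hom -> chain_hom)
    (phiP : forall z : cycles H n, phi (val z) \in cycle_pred K n) :
  (forall f h, phi (f - h) = phi f - phi h) ->
  (forall f, hom_boundary H n f -> hom_boundary K n (phi f)) ->
  forall z : cycles H n,
    \pi_(homology K n)%qT
      (exist _ (phi (val (generic_quotient.repr (\pi_(homology H n)%qT z))))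
               (phiP (generic_quotient.repr (\pi_(homology H n)%qT z))))
    = \pi_(homology K n)%qT (exist _ (phi (val z)) (phiP z)).
Proof.
move=> phiB phibd z; set y := generic_quotient.repr _.
have yz : y - z \in @boundary_pred H n.
  by rewrite Quotient.idealrBE reprK.
apply/eqP; rewrite -Quotient.idealrBE; apply/asboolP.
move/asboolP/phibd: yz; rewrite [val (y - z)]raddfB phiB; exact.
Qed.

Lemma homology_resE (H K : {group gT}) n (sKH : K \subset H)
    (z : cycles H n) :
  homology_res sKH (\pi_(homology H n)%qT z) =
  \pi_(homology K n)%qT (exist _ (val z) (hom_resP z sKH)).
Proof.
apply: (@homology_mapE H K n id (fun z => hom_resP z sKH)) => // f.
case=> h [nh Hh ->]; exists h; split=> // g Kg.
exact/Hh/(fintype.subsetP sKH).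
Qed.

Lemma homology_trE (H K : {group gT}) n (sKH : K \subset H)
    (z : cycles K n) :
  homology_tr sKH (\pi_(homology K n)%qT z) =
  \pi_(homology H n)%qT (exist _ (hom_tr H K (val z)) (hom_trP z sKH)).
Proof.
apply: (@homology_mapE K H n (hom_tr H K) (fun z => hom_trP z sKH)) => [|f].
  exact: hom_trB.
case=> h [nh Kh ->]; exists (hom_tr H K h); split.
- exact: homogeneous_tr.
- exact: equivariant_tr.
- by rewrite hom_bd_tr.
Qed.

Lemma homology_conjE (H K : {group gT}) n (g : gT)
    (defK : K = (H :^ g)%g :> {set gT}) (z : cycles H n) :
  homology_conj defK (\pi_(homology H n)%qT z) =
  \pi_(homology K n)%qT (exist _ (hom_act g (val z)) (hom_conjP z defK)).
Proof.
apply: (@homology_mapE H K n (hom_act g) (fun z => hom_conjP z defK)) => [|f].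
  exact: raddfB.
case=> h [nh Hh ->]; exists (hom_act g h); split.
- exact: homogeneous_act.
- move=> u; rewrite defK => /imsetP[v Hv ->].
  by rewrite -hom_actM mulgA mulgV mul1g hom_actM Hh.
- by rewrite hom_bd_act.
Qed.

End ChainHom.

(* Structure maps of a Mackey functor.  The conjugation map c_g of the
   literature, from the value at H to the value at g H g^-1, is
   [mconj g^-1].  The usual axioms play no role in the notion of isomorphism
   and are not recorded. *)
Record mackey (gT : finGroupType) := Mackey {
  mval :> {group gT} -> zmodType;
  mres : forall H K : {group gT}, K \subset H -> mval H -> mval K;
  mtr : forall H K : {group gT}, K \subset H -> mval K -> mval H;
  mconj : forall (g : gT) (H K : {group gT}),
    K = (H :^ g)%g :> {set gT} -> mval H -> mval K }.

Section Mackey.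
Variable gT : finGroupType.
Implicit Types M N : mackey gT.

Definition mackey_iso M N : Prop :=
  exists phi : forall H, {additive M H -> N H},
  [/\ forall H, bijective (phi H),
      forall (H K : {group gT}) (sKH : K \subset H) x,
        phi K (mres sKH x) = mres sKH (phi H x),
      forall (H K : {group gT}) (sKH : K \subset H) x,
        phi H (mtr sKH x) = mtr sKH (phi K x)
    & forall g (H K : {group gT}) (defK : K = (H :^ g)%g :> {set gT}) x,
        phi K (mconj defK x) = mconj defK (phi H x)].

Definition mackey0 : mackey gT :=
  @Mackey gT (fun=> 'I_1 : zmodType) (fun _ _ _ => id) (fun _ _ _ => id)
    (fun _ _ _ _ => id).

Definition mackey_add M N : mackey gT :=
  @Mackey gT (fun H => (M H * N H)%type : zmodType)
    (fun H K sKH x => (mres sKH x.1, mres sKH x.2))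
    (fun H K sKH x => (mtr sKH x.1, mtr sKH x.2))
    (fun g H K defK x => (mconj defK x.1, mconj defK x.2)).

Definition mackey_sum (s : seq (mackey gT)) : mackey gT :=
  foldr mackey_add mackey0 s.

Definition mackey_homology (R : realType) (Y X : gspace gT) (n : int) :
    mackey gT :=
  Mackey (fun H K sKH => @homology_res R gT Y X H K n sKH)
    (fun H K sKH => @homology_tr R gT Y X H K n sKH)
    (fun g H K defK => @homology_conj R gT Y X H K n g defK).

(* The homology of the virtual sphere S^(V1 - V2), where S^V is the one-point
   compactification of V. *)
Definition sphere_homology (R : realType)
    (V1 V2 : representation R [set: gT]%G) (n : int) : mackey gT :=
  mackey_homology R (rep_sphere V2) (rep_sphere V1) n.

Section Examples.
Variables p q : nat.

(* A restriction or transfer is determined by the prime factors of the index: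
   the maps between 1 or <[b]> and the level of index p above it involve alpha,
   those between 1 or <[a]> and the level of index q above it involve beta, and
   the composite from G to 1 involves both. *)
Definition mackeyZ (alpha beta : nat) : mackey gT :=
  @Mackey gT (fun=> int : zmodType)
    (fun H K _ x => x *+ ((if p %| #|H : K|%g then alpha else 1) *
                          (if q %| #|H : K|%g then beta else 1))%N)
    (fun H K _ x => x *+ ((if p %| #|H : K|%g then p %/ alpha else 1) *
                          (if q %| #|H : K|%g then q %/ beta else 1))%N)
    (fun _ _ _ _ => id).

Definition level (c : bool) (A : zmodType) : zmodType := if c then A else 'I_1.

Definition level_map (A : zmodType) (c d : bool) (f : A -> A) :
    level c A -> level d A :=
  match c, d with
  | true, true => f
  | _, _ => fun=> 0
  end.

Definition mackeyZp : mackey gT :=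
  let lev (H : {group gT}) := (p %| #|H|)%N in
  @Mackey gT (fun H => level (lev H) 'F_p)
    (fun H K _ => @level_map _ (lev H) (lev K) id)
    (fun H K _ => @level_map _ (lev K) (lev H) id)
    (fun _ H K _ => @level_map _ (lev H) (lev K) id).

(* The x < p such that g lies in the coset a^x <b>. *)
Definition coset_exponent (a b g : gT) : nat :=
  find (fun x => (a ^- x * g)%g \in <[b]>%g) (iota 0 p).

(* Right action of <a> on the value at <[b]>: the generator a acts through
   [mconj a], as multiplication by eps.  With the left action through c_a the
   same functor has a acting as eps^-1. *)
Definition mackeyZq (a b : gT) (eps : 'F_q) : mackey gT :=
  let lev (H : {group gT}) :=
    (q %| #|H|)%N && ((eps == 1) || ~~ (p %| #|H|)%N) in
  @Mackey gT (fun H => level (lev H) 'F_q)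
    (fun H K _ => @level_map _ (lev H) (lev K) id)
    (fun H K _ => @level_map _ (lev K) (lev H) (fun x => x *+ #|H : K|%g))
    (fun g H K _ => @level_map _ (lev H) (lev K)
                      (fun x => eps ^+ coset_exponent a b g * x)).

End Examples.
End Mackey.

Definition expgz (gT : finGroupType) (x : gT) (k : int) : gT :=
  match k with Posz n => (x ^+ n)%g | Negz n => (x ^- n.+1)%g end.

(* A group of order p * q generated by a and b with these relations is
   presented by them: they allow at most p * q elements a^x b^y. *)
Definition group_pq (gT : finGroupType) (p q : nat) (k : int) (a b : gT) :
    Prop :=
  [/\ <<[set a; b]%SET>>%g = [set: gT]%SET, #|gT| = (p * q)%N,
      (a ^+ p = 1)%g, (b ^+ q = 1)%g & (b * a = a * expgz b k)%g].

Definition rotation (R : realType) (theta : R) : 'M[R]_2 :=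
  \matrix_(i, j) (if i == j then cos theta
                  else if i == 0 then sin theta else - sin theta).

Section Representations.
Variables (F : fieldType) (gT : finGroupType) (G : {group gT}).

Lemma triv_mx_repr : mx_repr G (fun=> 1%:M : 'M[F]_1).
Proof. by split=> // x y _ _; rewrite mulmx1. Qed.

Definition triv_grepr : representation F G :=
  Representation (MxRepresentation triv_mx_repr).

Definition complete_irr (L : seq (representation F G)) : Prop :=
  [/\ forall i, (i < size L)%N -> mx_irreducible (nth grepr0 L i),
      forall i j, (i < j < size L)%N ->
        ~ mx_rsim (nth grepr0 L i) (nth grepr0 L j)
    & forall U : representation F G, mx_irreducible U ->
        exists2 i, (i < size L)%N & mx_rsim U (nth grepr0 L i)].

Definition sum_grepr (I : finType) (A : {pred I})
    (U : I -> representation F G) (m : I -> nat) : representation F G :=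
  \big[dadd_grepr/grepr0]_(i in A) muln_grepr (U i) (m i).

End Representations.

(* Main.v *)
(* The homology at G/H is that of the H-invariants of the complex
   E = Hom(C Y, C X).  Covering V \ 0 by half-spaces permuted by G shows that
   the singular chains of S^V are equivariantly finite-dimensional, so the
   invariants have no homology in degrees of large absolute value.  Without
   the action E has homology Z in degree N = dim X - dim Y only.  For <g> of
   prime order l, let tau = 1 - g and sigma = 1 + g + ... + g^(l-1) act on E.
   Then ker sigma = im tau, and the quotient of the complex of invariants
   ker tau by im sigma only sees the fixed points: it has homology Z/l in
   degree f = dim X^g - dim Y^g only.  Zigzags between d, tau and sigma give
   periodicity isomorphisms H_n = H_(n+2) of the homology of ker tau except
   near the degrees f and N; starting from the vanishing in large degrees they
   determine it.  An element x with g^x = g^k turns a zigzag into k times a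
   zigzag, so each period multiplies its action by k.
   For G of order pq the group at H embeds, by transfer, in the groups at its
   cyclic subgroups: conjugates of <a> detect the p-part and <b> the q-part
   away from degree N, and in degree N the homology is an ideal of Z computed
   by Bezout. *)

Require Import Defs.
From HB Require Import structures.
From mathcomp Require Import all_boot all_order all_algebra all_fingroup all_character.
From mathcomp Require Import all_solvable freeg ring_quotient.
From mathcomp Require Import boolp classical_sets functions reals topology normedtype sequences trigo.
From mathcomp Require Import zify ring lra.

Set Implicit Arguments.
Unset Strict Implicit.
Unset Printing Implicit Defensive.

Import Order.TTheory GRing.Theory Num.Theory.
Import numFieldNormedType.Exports.

Local Open Scope ring_scope.

(** Singular complexes have infinite rank, so comparisons are made by explicit equivariant chain
    homotopies. They come from acyclic carriers in which each cell is fixed by the stabilizer of the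
    cell carried: a choice at one representative then spreads over its orbit without ambiguity.
    Hence the recurring intersections with fixed points of stabilizers. Using all chain maps from C
    Y to C X makes virtual representations no harder than actual ones, but E is then a product, and
    exactness for tau and sigma has to be proved for functions on cells as well as for chains. The
    action on the homology Z of E is trivial because it is by signs and the group has odd order. In
    degrees other than N, multiplication by the order of H kills the homology at G/H, so the p-part
    and the q-part are found separately and added by the Chinese remainder theorem. The p-part at G
    is all of the group at the subgroup generated by a, because the transfer from there, restricted
    back, differs from the identity by boundaries of norms. *)

Notation chain S := {freeg S / int}.

(* [abel] decides equalities of integral linear combinations in an abelian
   group: both sides are reified and their coefficients compared. *)
Section Abel.
Inductive abexpr :=
  | AbVar of nat | AbZero | AbAdd of abexpr & abexpr | AbOpp of abexpr.

Variable M : zmodType.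

Fixpoint abeval (e : seq M) x : M := match x with
  | AbVar n => nth 0 e n
  | AbZero => 0
  | AbAdd x y => abeval e x + abeval e y
  | AbOpp x => - abeval e x end.

Fixpoint abcoef x k : int := match x with
  | AbVar n => (n == k)%:R
  | AbZero => 0
  | AbAdd x y => abcoef x k + abcoef y k
  | AbOpp x => - abcoef x k end.

Fixpoint abwf n x : bool := match x with
  | AbVar k => (k < n)%N
  | AbZero => true
  | AbAdd x y => abwf n x && abwf n y
  | AbOpp x => abwf n x end.

Lemma abevalE e x : abwf (size e) x ->
  abeval e x = \sum_(k < size e) e`_k *~ abcoef x k.
Proof.
elim: x => [n ne||x IHx y IHy /andP[/IHx ex /IHy ey]|x IHx /IHx ex] /=.
- rewrite (bigD1 (Ordinal ne)) //= eqxx mulr1z big1 ?addr0 // => k kn.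
  by case: eqP => [e'|]; rewrite ?mulr0z //; case/eqP: kn; exact: val_inj.
- by rewrite big1.
- by rewrite ex ey -big_split; apply: eq_bigr => k _; rewrite mulrzDr.
- by rewrite ex -sumrN; apply: eq_bigr => k _; rewrite mulrNz.
Qed.

Lemma abeval_eq e x y : abwf (size e) x -> abwf (size e) y ->
  all (fun k => abcoef x k == abcoef y k) (iota 0 (size e)) ->
  abeval e x = abeval e y.
Proof.
move=> wx wy /allP H; rewrite !abevalE //; apply: eq_bigr => k _.
by rewrite (eqP (H k _)) // mem_iota ltn_ord.
Qed.
End Abel.

Ltac ab_index t l :=
  match l with
  | t :: _ => constr:(0%N)
  | _ :: ?l' => let n := ab_index t l' in constr:(n.+1)
  end.
Ltac ab_insert t l :=
  match l with
  | _ => let n := ab_index t l in constr:(l)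
  | _ => constr:(t :: l)
  end.
Ltac ab_atoms t l :=
  lazymatch t with
  | (?a + ?b)%R => let l := ab_atoms a l in ab_atoms b l
  | (- ?a)%R => ab_atoms a l
  | 0%R => constr:(l)
  | _ => ab_insert t l
  end.
Ltac ab_reify t l :=
  lazymatch t with
  | (?a + ?b)%R => let x := ab_reify a l in let y := ab_reify b l in constr:(AbAdd x y)
  | (- ?a)%R => let x := ab_reify a l in constr:(AbOpp x)
  | 0%R => constr:(AbZero)
  | _ => let n := ab_index t l in constr:(AbVar n)
  end.
Ltac abel :=
  lazymatch goal with
  | |- @eq ?T ?x ?y =>
    let l := ab_atoms x constr:(@nil T) in
    let l := ab_atoms y l in
    let ex := ab_reify x l in
    let ey := ab_reify y l in
    let M := constr:((T : zmodType)) in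
    change (@abeval M l ex = @abeval M l ey); apply: abeval_eq; by vm_compute
  end.

(** * Chain complexes with group action and acyclic carriers *)

Section Support.
Variable S : choiceType.
Implicit Types (c : chain S) (A : S -> Prop).

Definition on A c : Prop := forall u, u \in dom c -> A u.

Lemma on0 A : on A 0. Proof. by move=> u; rewrite dom0. Qed.

Lemma onB A c e : on A c -> on A e -> on A (c - e).
Proof. by move=> Ac Ae u /domB; rewrite mem_cat => /orP[/Ac|/Ae]. Qed.

Lemma onN A c : on A c -> on A (- c).
Proof. by move=> Ac; rewrite -sub0r; apply: onB => //; exact: on0. Qed.

Lemma onD A c e : on A c -> on A e -> on A (c + e).
Proof. by move=> Ac Ae; rewrite -[e]opprK; apply: onB => //; exact: onN. Qed.

Lemma on_sum A (I : Type) (r : seq I) (P : pred I) (F : I -> chain S) :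
  (forall i, P i -> on A (F i)) -> on A (\sum_(i <- r | P i) F i).
Proof. by move=> AF; apply: big_ind => //; [exact: on0|exact: onD]. Qed.

Lemma onMz A c m : on A c -> on A (c *~ m).
Proof.
move=> Ac; suff An n : on A (c *+ n) by case: m => n; rewrite ?NegzE ?mulrNz; [|apply: onN]; exact: An.
by elim: n => [|n IH]; rewrite ?mulr0n ?mulrS; [exact: on0|exact: onD].
Qed.

Lemma onU A u : A u -> on A << u >>.
Proof. by move=> Au v; rewrite domU1 inE => /eqP ->. Qed.

Lemma onS A B c : (forall u, A u -> B u) -> on A c -> on B c.
Proof. by move=> AB Ac u /Ac/AB. Qed.

Lemma onI A B c : on A c -> on B c -> on (fun u => A u /\ B u) c.
Proof. by move=> Ac Bc u cu; split; [exact: Ac|exact: Bc]. Qed.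

Lemma on_dom c : on (fun u => u \in dom c) c. Proof. by []. Qed.

Lemma on_false A c : (forall u, ~ A u) -> on A c -> c = 0.
Proof.
move=> nA Ac; apply/eqP; rewrite -dom_eq0; case E: (dom c) => [//|u r].
by case: (nA u); apply: Ac; rewrite E inE eqxx.
Qed.

(** Integer coefficients are iterated sums and differences, so closure under subtraction is the only
    algebra to check. Most identities between operators on chains below are proved this way. *)
Lemma on_ind A (P : chain S -> Prop) :
  P 0 -> (forall x y, P x -> P y -> P (x - y)) -> (forall u, A u -> P << u >>) ->
  forall c, on A c -> P c.
Proof.
move=> P0 PB PU c Ac; rewrite -[c]freeg_sumE big_seq.
have PD x y : P x -> P y -> P (x + y).
  by move=> Px Py; rewrite -[y]opprK -[- y]sub0r; apply: (PB) => //; exact: PB.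
apply: big_ind => // u /Ac/PU Pu; rewrite freegUE.
case: (coeff u c) => n; rewrite ?NegzE ?mulrNz.
  by rewrite -pmulrn; elim: n => [|n IH]; rewrite ?mulr0n // mulrS; apply: PD.
rewrite -sub0r; apply: PB => //.
by rewrite -pmulrn; elim: n => [|n IH]; rewrite ?mulr1n // mulrS; apply: PD.
Qed.

Lemma eq_on (M : zmodType) (f g : {additive chain S -> M}) A c :
  (forall u, A u -> f << u >> = g << u >>) -> on A c -> f c = g c.
Proof.
move=> fg; apply: (@on_ind A (fun c => f c = g c)) => [|x y fx fy|//].
  by rewrite !raddf0.
by rewrite !raddfB fx fy.
Qed.

Lemma eq_fglift (M : lmodType int) (f g : S -> M) c :
  (forall u, u \in dom c -> f u = g u) -> fglift f c = fglift g c.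
Proof.
move=> fg; apply: (@eq_on M (fglift f) (fglift g) _ _ _ (@on_dom c)) => u cu.
by rewrite /= !fgliftU fg.
Qed.

Lemma fgliftE0 (M : lmodType int) (f : S -> M) : fglift f 0 = 0.
Proof. exact: raddf0. Qed.

Lemma fgliftEB (M : lmodType int) (f : S -> M) c e :
  fglift f (c - e) = fglift f c - fglift f e.
Proof. exact: raddfB. Qed.

Lemma fglift_add (M : lmodType int) (f g : S -> M) c :
  fglift (fun s => f s + g s) c = fglift f c + fglift g c.
Proof.
apply: (@on_ind (fun=> True) (fun c => fglift (fun s => f s + g s) c = _)) => //.
- by rewrite !fgliftE0 addr0.
- by move=> x y ex ey; rewrite !fgliftEB ex ey opprD addrACA.
- by move=> u _; rewrite !fgliftU.
Qed.

Lemma fglift_opp (M : lmodType int) (f : S -> M) c :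
  fglift (fun s => - f s) c = - fglift f c.
Proof.
apply: (@on_ind (fun=> True) (fun c => fglift (fun s => - f s) c = _)) => //.
- by rewrite !fgliftE0 oppr0.
- by move=> x y ex ey; rewrite !fgliftEB ex ey opprD.
- by move=> u _; rewrite !fgliftU.
Qed.

Lemma fglift_sub (M : lmodType int) (f g : S -> M) c :
  fglift (fun s => f s - g s) c = fglift f c - fglift g c.
Proof. by rewrite fglift_add fglift_opp. Qed.

Lemma fglift_mulz (M : lmodType int) (f : S -> M) m c :
  fglift (fun s => f s *~ m) c = fglift f c *~ m.
Proof.
apply: (@on_ind (fun=> True) (fun c => fglift (fun s => f s *~ m) c = _)) => //.
- by rewrite !fgliftE0 mul0rz.
- by move=> x y ex ey; rewrite !fgliftEB ex ey mulrzBl.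
- by move=> u _; rewrite !fgliftU.
Qed.

Lemma fglift_id c : fglift (fun s => << s >>) c = c.
Proof.
apply: (@on_ind (fun=> True) (fun c => fglift (fun s => << s >>) c = c)) => //.
- by rewrite fgliftE0.
- by move=> x y ex ey; rewrite fgliftEB ex ey.
- by move=> u _; rewrite fgliftU.
Qed.

Lemma fglift0 (M : lmodType int) c : fglift (fun=> 0 : M) c = 0.
Proof.
apply: (@on_ind (fun=> True) (fun c => fglift (fun=> 0 : M) c = 0)) => //.
- by rewrite fgliftE0.
- by move=> x y ex ey; rewrite fgliftEB ex ey subrr.
- by move=> u _; rewrite fgliftU.
Qed.
End Support.

Lemma on_fglift (S T : choiceType) (A : S -> Prop) (B : T -> Prop)
    (f : S -> chain T) c :
  (forall u, A u -> on B (f u)) -> on A c -> on B (fglift f c).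
Proof.
move=> AB; apply: (@on_ind _ A (fun c => on B (fglift f c))) => [|x y|u /AB].
- by rewrite fgliftE0; exact: on0.
- by rewrite fgliftEB; exact: onB.
- by rewrite fgliftU.
Qed.

Lemma fglift_comp (S T : choiceType) (M : lmodType int)
    (f : S -> chain T) (h : T -> M) c :
  fglift h (fglift f c) = fglift (fun s => fglift h (f s)) c.
Proof.
apply: (@eq_on _ _ (fglift h \o fglift f) (fglift (fun s => fglift h (f s)))
  (fun=> True)) => // u _ /=.
by rewrite !fgliftU.
Qed.

(** Recursion with non-unique choices: [Q s v x] reads [x] only below the tag of [s], so the values
    at one tag can be chosen once those at lower tags are. *)
Lemma rec_choice (S : Type) (D : choiceType) (tag : S -> nat) (Q : S -> D -> (S -> D) -> Prop)
    (d0 : D) :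
  (forall s v x x', (forall t, (tag t < tag s)%N -> x t = x' t) ->
     Q s v x -> Q s v x') ->
  (forall s x, (forall t, (tag t < tag s)%N -> Q t (x t) x) -> exists v, Q s v x) ->
  exists x, forall s, Q s (x s) x.
Proof.
move=> Qx Qs.
(* Stage [n] is meaningful on tags below [n]. It fills in tag [n - 1] from stage [n - 1], so later
   stages only extend it. *)
pose x := fix x n := fun s : S => if (tag s < n)%N then
   (if n is n'.+1 then
      (if tag s == n' then xget d0 [set v : D | Q s v (x n')] else x n' s)
    else d0) else d0.
have xE n m s : (tag s < n)%N -> (n <= m)%N -> x m s = x n s.
  move=> sn; elim: m => [|m IH]; first by rewrite leqn0 => /eqP n0; rewrite n0 in sn.
  rewrite leq_eqVlt => /predU1P[->//|]; rewrite ltnS => nm.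
  rewrite -IH //= (leq_trans sn) ?(leqW nm) //; case: eqP => // e.
  by move: (leq_trans sn nm); rewrite e ltnn.
exists (fun s => x (tag s).+1 s) => s; have [n] := ubnP (tag s).
elim: n s => // n IH s; rewrite ltnS => sn.
have {}IH t : (tag t < tag s)%N -> Q t (x (tag s) t) (x (tag s)).
  move=> ts; have /IH := leq_trans ts sn.
  rewrite (xE (tag t).+1 (tag s)) // => /Qx; apply => u ut.
  by rewrite (xE (tag u).+1) // (leq_trans ut) // ltnW.
apply: Qx (_ : Q s _ (x (tag s))); first by move=> t ts; rewrite (xE (tag t).+1 (tag s)).
rewrite /= ltnSn eqxx; have [v Qv] := Qs _ _ IH.
by apply: (@xgetPex _ d0 [set w | Q s w (x (tag s))]%classic); exists v.
Qed.

(** Complexes with a basis permuted by the group. They model the augmented singular complexes and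
    the complexes of flags alike; tag 0 is the empty cell, in degree -1. *)
Record gcomplex (gT : finGroupType) := GComplex {
  cells :> choiceType;
  ctag : cells -> nat;
  cact : cells -> gT -> cells;
  cbd : cells -> chain cells;
  cact1 : forall s, cact s 1%g = s;
  cactM : forall s g h, cact s (g * h)%g = cact (cact s g) h;
  ctag_act : forall s g, ctag (cact s g) = ctag s;
  cbd_tag : forall s u, u \in dom (cbd s) -> ctag s = (ctag u).+1;
  cbd_act : forall s g, cbd (cact s g) = fglift (fun u => << cact u g >>) (cbd s);
  cbdK : forall s, fglift cbd (cbd s) = 0 }.

Section GComplexTheory.
Variables (gT : finGroupType) (X : gcomplex gT).
Implicit Types (s u : X) (c : chain X) (g h : gT).

Definition act g c : chain X := fglift (fun u => << cact u g >>) c.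
Definition bd c : chain X := fglift (@cbd gT X) c.

Lemma act_is_additive g : zmod_morphism (act g).
Proof. by move=> c e; rewrite /act fgliftEB. Qed.
HB.instance Definition _ g :=
  GRing.isZmodMorphism.Build (chain X) (chain X) (act g) (act_is_additive g).

Lemma bd_is_additive : zmod_morphism bd.
Proof. by move=> c e; rewrite /bd fgliftEB. Qed.
HB.instance Definition _ :=
  GRing.isZmodMorphism.Build (chain X) (chain X) bd bd_is_additive.

Lemma bd0 : bd 0 = 0. Proof. exact: raddf0. Qed.
Lemma bdB c e : bd (c - e) = bd c - bd e. Proof. exact: raddfB. Qed.
Lemma bdN c : bd (- c) = - bd c. Proof. exact: raddfN. Qed.
Lemma bdD c e : bd (c + e) = bd c + bd e. Proof. exact: raddfD. Qed.
Lemma bdMz c m : bd (c *~ m) = bd c *~ m. Proof. exact: raddfMz. Qed.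
Lemma act0 g : act g 0 = 0. Proof. exact: raddf0. Qed.
Lemma actB g c e : act g (c - e) = act g c - act g e. Proof. exact: raddfB. Qed.
Lemma actD g c e : act g (c + e) = act g c + act g e. Proof. exact: raddfD. Qed.
Lemma actMz g c m : act g (c *~ m) = act g c *~ m. Proof. exact: raddfMz. Qed.

Lemma actU g s : act g << s >> = << cact s g >>. Proof. exact: fgliftU. Qed.
Lemma bdU s : bd << s >> = cbd s. Proof. exact: fgliftU. Qed.

Lemma act1 c : act 1%g c = c.
Proof.
rewrite /act -[RHS](fglift_id c); congr fglift; apply/funext => s.
by rewrite cact1.
Qed.

Lemma actM g h c : act (g * h)%g c = act h (act g c).
Proof.
rewrite /act fglift_comp; congr fglift; apply/funext => s.
by rewrite fgliftU cactM.
Qed.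

Lemma bd_act g c : bd (act g c) = act g (bd c).
Proof.
rewrite /bd /act !fglift_comp; congr fglift; apply/funext => s.
by rewrite fgliftU cbd_act.
Qed.

Lemma bdK c : bd (bd c) = 0.
Proof.
rewrite /bd fglift_comp -[RHS](fglift0 _ c); congr fglift; apply/funext => s.
exact: cbdK.
Qed.

Lemma cactK g s : cact (cact s g) g^-1%g = s.
Proof. by rewrite -cactM mulgV cact1. Qed.

Lemma cactKV g s : cact (cact s g^-1%g) g = s.
Proof. by rewrite -cactM mulVg cact1. Qed.

Lemma on_act (A : X -> Prop) g c :
  (forall u, A u -> A (cact u g)) -> on A c -> on A (act g c).
Proof. by move=> Ag; apply: on_fglift => u Au; apply: onU; exact: Ag. Qed.

Lemma on_actW (A B : X -> Prop) g c :
  (forall u, A u -> B (cact u g)) -> on A c -> on B (act g c).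
Proof. by move=> Ag; apply: on_fglift => u Au; apply: onU; exact: Ag. Qed.

Lemma act_id g c : on (fun u => cact u g = u) c -> act g c = c.
Proof.
move=> cg; rewrite -[RHS]fglift_id; apply: eq_fglift => u /cg e.
by rewrite e.
Qed.

Definition crep s : X := xget s [set u : X | exists g, u = cact s g].

Lemma crepP s : exists g, s = cact (crep s) g.
Proof.
rewrite /crep; case: xgetP => [u _ [g ->]|/(_ s)[]]; first by exists g^-1%g; rewrite cactK.
by exists 1%g; rewrite cact1.
Qed.

Lemma crep_act s g : crep (cact s g) = crep s.
Proof.
rewrite /crep; have -> : [set u : X | exists h, u = cact (cact s g) h]%classic =
    [set u : X | exists h, u = cact s h]%classic.
  apply/seteqP; split=> u [h ->]; first by exists (g * h)%g; rewrite cactM.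
  by exists (g^-1 * h)%g; rewrite -cactM mulKVg.
rewrite /xget; case: pselect => [//|n]; case: n.
by exists s; apply/asboolP; exists 1%g; rewrite cact1.
Qed.
End GComplexTheory.

Section EquivariantChoice.
Variables (gT : finGroupType) (X Y : gcomplex gT).
Implicit Types (x : X -> chain Y).

Definition equivar x : Prop := forall s g, x (cact s g) = act g (x s).

Lemma equiv_fglift x c g : equivar x -> fglift x (act g c) = act g (fglift x c).
Proof.
move=> ex; rewrite /act !fglift_comp; congr fglift; apply/funext => s.
by rewrite fgliftU ex.
Qed.

(** A value is chosen at one cell of each orbit and moved along the orbit. This is consistent
    because a valid value is fixed by the stabilizer of its cell, the fifth hypothesis. *)
Lemma equivariant_choice (A : X -> Prop) (Q : X -> chain Y -> (X -> chain Y) -> Prop) :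
  (forall s u, A s -> u \in dom (cbd s) -> A u) ->
  (forall s g, A s -> A (cact s g)) ->
  (forall s v x x', (forall t, t \in dom (cbd s) -> x t = x' t) ->
     Q s v x -> Q s v x') ->
  (forall s g v x, equivar x -> A s -> Q s v x -> Q (cact s g) (act g v) x) ->
  (forall s g v x, A s -> Q s v x -> cact s g = s -> act g v = v) ->
  (forall s x, equivar x -> A s -> (forall t, t \in dom (cbd s) -> Q t (x t) x) ->
     exists v, Q s v x) ->
  exists2 x, equivar x & forall s, A s -> Q s (x s) x.
Proof.
move=> Ad Ag Qx Qg Qst Qs.
have [gg ggE] := boolp.choice (@crepP gT X).
(* [hat] spreads the values at representatives over the orbits. Cutting [x] off from tag [n] on by
   [trunc] makes [hat] equivariant already in the middle of the recursion, when only lower values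
   are known to be fixed by stabilizers. *)
pose hat x (s : X) : chain Y := if asbool (A s) then act (gg s) (x (crep s)) else 0.
pose trunc n x (s : X) : chain Y := if (ctag s < n)%N then x s else 0.
have tag_crep (s : X) : ctag (crep s) = ctag s by rewrite [in RHS](ggE s) ctag_act.
have Agr s g : A (cact s g) -> A s by move/(Ag _ g^-1%g); rewrite cactK.
have Acrep s : A s -> A (crep s) by rewrite {1}(ggE s) => /Agr.
have crepK (s : X) : crep (crep s) = crep s by rewrite [in RHS](ggE s) crep_act.
have hatE x : (forall s g, A s -> s = crep s -> cact s g = s -> act g (x s) = x s) ->
    equivar (hat x).
  move=> sx s g; rewrite /hat; have [As|nAs] := asboolP (A s); last first.
    by rewrite asboolF ?raddf0 // => /Agr.
  rewrite asboolT; last exact: Ag.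
  rewrite crep_act; set r := crep s.
  have : cact r (gg (cact s g) * g^-1 * (gg s)^-1)%g = r.
    by rewrite !cactM /r -{1}(crep_act s g) -ggE cactK [X in cact X _](ggE s) cactK.
  move/(sx r _ (Acrep _ As) (esym (crepK s))) => e.
  by rewrite -actM -[in RHS]e -actM !mulgA !mulgKV.
pose Q' s v x := A s -> s = crep s -> Q s v (hat (trunc (ctag s) x)) /\
   forall g, cact s g = s -> act g v = v.
have stE x n : (forall t, (ctag t < n)%N -> Q' t (x t) x) -> equivar (hat (trunc n x)).
  move=> H; apply: hatE => s g As sr sg; rewrite /trunc; case: ifP => [sn|]; last by rewrite raddf0.
  by have [_] := H _ sn As sr; apply.
have QE x n s : (forall t, (ctag t < n)%N -> Q' t (x t) x) -> (ctag s < n)%N -> A s ->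
    Q s (hat (trunc n x) s) (hat (trunc n x)).
  move=> H sn As; have rn : (ctag (crep s) < n)%N by rewrite tag_crep.
  have [Qr _] := H _ rn (Acrep _ As) (esym (crepK s)).
  have -> : hat (trunc n x) s = act (gg s) (x (crep s)) by rewrite /hat /trunc asboolT // rn.
  rewrite [X in Q X](ggE s).
  apply: Qg (stE _ _ H) (Acrep _ As) _.
  apply: Qx Qr => t /cbd_tag; rewrite tag_crep => ts; rewrite /hat /trunc !tag_crep ts ltnSn.
  by rewrite (ltn_trans _ sn) // ts.
have [x Hx] : exists x, forall s, Q' s (x s) x.
  apply: (@rec_choice _ _ (@ctag gT X) _ (0 : chain Y)) => [s v x x' xx'|s x IH].
    have -> // : Q' s v x = Q' s v x'.
    rewrite /Q'; suff -> : trunc (ctag s) x = trunc (ctag s) x' by [].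
    by apply/funext => t; rewrite /trunc; case: ifP => // /xx'.
  have [[As sr]|nAs] := pselect (A s /\ s = crep s); last by exists 0 => As sr; case: nAs.
  have [||v Qv] := Qs s (hat (trunc (ctag s) x)) _ As; first exact: stE.
    by move=> t ts; apply: QE => //; [rewrite (cbd_tag ts)|exact: Ad ts].
  by exists v => _ _; split=> // g; apply: Qst Qv.
exists (hat x) => [|s As]; first by apply: hatE => s g As sr; case: (Hx s As sr) => _; apply.
have := QE x (ctag s).+1 s (fun t _ => Hx t) (ltnSn _) As.
have -> : hat (trunc (ctag s).+1 x) s = hat x s.
  by rewrite /hat /trunc tag_crep ltnSn.
apply: Qx => t /cbd_tag ts; rewrite /hat /trunc tag_crep ts.
by rewrite (@leq_trans (ctag t).+1) // ltnW.
Qed.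
End EquivariantChoice.

Section Carriers.
Variables (gT : finGroupType) (X Y : gcomplex gT).
Implicit Types (x w : X -> chain Y) (Phi : Y -> Prop).

(** The index is the tag of the filling rather than that of the cycle, which avoids a predecessor;
    at [n = 0] the chain is 0. *)
Definition acyclic Phi : Prop := forall n (c : chain Y),
  on (fun u => Phi u /\ (ctag u).+1 = n) c -> bd c = 0 ->
  exists2 v, on (fun u => Phi u /\ ctag u = n) v & bd v = c.

(** Equivariant acyclic carriers. With [e = 0], [eps = -1], [w = 0] the solution is a chain map;
    with [e = 1], [eps = 1] it is a homotopy for the difference [w] of two maps. Below tag [m] the
    solution is prescribed by [x0], and carriers need not be acyclic there. Values are fixed by
    stabilizers because every cell in the carrier of [s] is. *)
Lemma carrier_ext (A : X -> Prop) (Phi : X -> Y -> Prop) (e m : nat) (eps : int)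
    w (x0 : X -> chain Y) :
  (forall s u, A s -> u \in dom (cbd s) -> A u) ->
  (forall s g, A s -> A (cact s g)) ->
  (forall s t u, A s -> t \in dom (cbd s) -> Phi t u -> Phi s u) ->
  (forall s u g, A s -> Phi s u -> Phi (cact s g) (cact u g)) ->
  (forall s u g, A s -> Phi s u -> cact s g = s -> cact u g = u) ->
  eps * eps = 1 -> equivar w -> equivar x0 ->
  (forall s, A s -> (m <= ctag s)%N ->
     on (fun u => Phi s u /\ (ctag u).+1 = (ctag s + e)%N) (w s)) ->
  (forall s, A s -> bd (w s) = fglift w (cbd s) *~ eps) ->
  (forall s, A s -> (ctag s < m)%N ->
     on (fun u => Phi s u /\ ctag u = (ctag s + e)%N) (x0 s)
     /\ bd (x0 s) + fglift x0 (cbd s) *~ eps = w s) ->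
  (forall s, A s -> (m <= ctag s)%N -> acyclic (Phi s)) ->
  exists2 x, equivar x & forall s, A s ->
    [/\ on (fun u => Phi s u /\ ctag u = (ctag s + e)%N) (x s),
        bd (x s) + fglift x (cbd s) *~ eps = w s
      & (ctag s < m)%N -> x s = x0 s].
Proof.
move=> Ad Ag F1 F2 F3 ee ew ex0 won wd x0P ac.
apply: (@equivariant_choice _ X Y A (fun s v x =>
    [/\ on (fun u => Phi s u /\ ctag u = (ctag s + e)%N) v,
        bd v + fglift x (cbd s) *~ eps = w s
      & (ctag s < m)%N -> v = x0 s])) => // [s v x x' xx'|s g v x ex As|s g v x As|s x ex As H].
- by rewrite (eq_fglift xx').
- case=> von vd vm; split.
  + by apply: on_actW von => u [Pu tu]; rewrite !ctag_act; split=> //; exact: F2.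
  + rewrite ew -vd raddfD /= -bd_act cbd_act; congr (_ + _).
    by rewrite [in RHS]raddfMz /= -(equiv_fglift _ _ ex).
  + by rewrite ctag_act => /vm ->; rewrite ex0.
- by case=> von _ _ sg; apply: act_id => u /von[/F3-/(_ _ As sg)].
have [sm|ms] := ltnP (ctag s) m.
  have [on0 d0] := x0P s As sm; exists (x0 s); split=> //.
  rewrite -[RHS]d0; congr (_ + _ *~ _); apply: eq_fglift => t ts.
  by have [_ _ ->] := H t ts; rewrite // (leq_trans _ sm) // (cbd_tag ts) ltnW.
pose c := w s - fglift x (cbd s) *~ eps.
have con : on (fun u => Phi s u /\ (ctag u).+1 = (ctag s + e)%N) c.
  apply: onB; first exact: won.
  apply: onMz; apply: on_fglift (@on_dom _ _) => t ts.
  have [xon _ _] := H t ts; apply: onS xon => u [Pu tu].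
  by split; [exact: F1 ts Pu|rewrite tu (cbd_tag ts)].
(* The equation already solved at the faces and the compatibility of [w] with the boundary make the
   obstruction a cycle. *)
have cd : bd c = 0.
  rewrite /c raddfB /= wd // raddfMz /= [bd (fglift _ _)]fglift_comp.
  suff -> : fglift (fun t => fglift (@cbd gT Y) (x t)) (cbd s) = fglift w (cbd s).
    by rewrite subrr.
  rewrite (@eq_fglift _ _ _ (fun t => w t - fglift x (cbd t) *~ eps)); last first.
    by move=> t ts; have [_ <- _] := H t ts; rewrite addrK.
  rewrite fglift_sub fglift_mulz -fglift_comp.
  by rewrite (cbdK s) fgliftE0 mul0rz subr0.
have [v von vd] := ac s As ms _ _ con cd.
by exists v; split=> //; rewrite vd subrK.
Qed.
End Carriers.

Section AlternatingFaces.
(** The term (i + 1, j) cancels the term (j, i) for j <= i. This serves singular boundaries and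
    boundaries of linear simplices. *)
Lemma alt_faces (M : zmodType) n (F : 'I_n.+2 -> 'I_n.+1 -> M) :
  (forall i j : 'I_n.+1, (j <= i)%N ->
     F (fintype.lift ord0 i) j = F (widen_ord (leqnSn _) j) i) ->
  \sum_i \sum_j F i j *~ ((-1) ^+ i * (-1) ^+ j) = 0.
Proof.
move=> FE.
rewrite (eq_bigr (fun i : 'I_n.+2 => \sum_(j : 'I_n.+1 | (j < i)%N) F i j *~ ((-1) ^+ i * (-1) ^+ j)
   + \sum_(j : 'I_n.+1 | (i <= j)%N) F i j *~ ((-1) ^+ i * (-1) ^+ j))); last first.
  move=> i _; rewrite (bigID (fun j : 'I_n.+1 => (j < i)%N)) /=; congr (_ + _).
  by apply: eq_bigl => j; rewrite -leqNgt.
rewrite big_split /= big_ord_recl big_pred0 // add0r.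
rewrite [X in _ + X](exchange_big_dep xpredT) //=.
rewrite -big_split /= big1 // => i _.
rewrite big_mkcond [X in _ + X]big_mkcond /= [X in _ + X]big_ord_recr /= ltnNge.
rewrite -ltnS ltn_ord /= addr0 -big_split /= big1 // => j _.
rewrite /bump /= add1n ltnS; case: ifP => ji; rewrite ?addr0 // FE //.
by rewrite exprS mulN1r mulNr mulrNz [X in _ *~ X]mulrC addNr.
Qed.
End AlternatingFaces.

(** * Singular simplices and cones *)

Section Simplices.
Variable R : realType.

Lemma mk_simplexK (X : topologicalType) (s : simplex R X) :
  mk_simplex (@cts_fun _ _ (tagged s)) = s.
Proof. by case: s => n u; congr existT; apply/continuousEP. Qed.

Lemma face_mxE n (i : 'I_n.+1) (x : 'rV[R]_n) :
  face_mx i x = \sum_k x 0 k *: delta_mx 0 (fintype.lift i k).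
Proof.
apply/rowP => j; rewrite summxE !mxE; case: unliftP => [k ->|->].
  rewrite (bigD1 k) //= !mxE !eqxx mulr1 big1 ?addr0 // => l lk.
  by rewrite !mxE eqxx (inj_eq lift_inj) eq_sym (negPf lk) mulr0.
by rewrite big1 // => k _; rewrite !mxE eqxx (negPf (neq_lift _ _)) mulr0.
Qed.

Lemma face_mx_face n (i j : 'I_n.+1) (x : 'rV[R]_n) : (j <= i)%N ->
  face_mx (fintype.lift ord0 i) (face_mx j x) =
  face_mx (widen_ord (leqnSn _) j) (face_mx i x).
Proof.
move=> ji; rewrite [LHS]face_mxE [RHS]face_mxE.
rewrite (bigD1_ord j) //= [RHS](bigD1_ord i) //=.
rewrite !mxE !unlift_none !scale0r !add0r; apply: eq_bigr => k _.
rewrite !mxE !liftK; congr (_ *: delta_mx _ _); apply: val_inj => /=.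
rewrite /bump /=; lia.
Qed.

Definition comp_face (X : topologicalType) n
    (u : continuousType (std_simplex R n.+1) X) i : simplex R X :=
  mk_simplex (@comp_face_continuous R X n u i).

Lemma simplex_bdE (X : topologicalType) n (u : continuousType (std_simplex R n.+1) X) :
  simplex_bd (existT _ n.+1 u) = \sum_(i < n.+1) << comp_face u i >> *~ (-1) ^+ i.
Proof. by apply: eq_bigr => i _; rewrite freegUE. Qed.

Lemma simplex_bdK (X : topologicalType) (s : simplex R X) :
  fglift (@simplex_bd R X) (simplex_bd s) = 0.
Proof.
case: s => -[|[|n]] u; first by rewrite /= fgliftE0.
  rewrite simplex_bdE raddf_sum /= big1 // => i _.
  by rewrite raddfMz /= fgliftU mul0rz.
pose F (i : 'I_n.+2) (j : 'I_n.+1) :=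
  << comp_face (tagged (comp_face u i) : continuousType (std_simplex R n.+1) X) j >> : chain (simplex R X).
rewrite -[RHS](@alt_faces _ _ F) => [|i j ji].
  rewrite simplex_bdE raddf_sum; apply: eq_bigr => i _ /=.
  rewrite raddfMz /= fgliftU simplex_bdE mulrz_suml; apply: eq_bigr => j _.
  by rewrite -mulrzA mulrC.
congr << _ >>; apply: eq_mk_simplex => x /=; congr (u _).
by apply: val_inj => /=; exact: face_mx_face.
Qed.

Variable gT : finGroupType.

Definition simp (X : gspace gT) : gcomplex gT :=
  @GComplex gT (simplex R X) (fun s => tag s) (@simplex_act R gT X)
    (@simplex_bd R X) (@simplex_act1 R gT X) (@simplex_actM R gT X)
    (fun _ _ => erefl) (@simplex_bd_tag R X)
    (fun s g => @simplex_bd_act R gT X s g) (@simplex_bdK X).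

End Simplices.

Local Open Scope classical_set_scope.

Section SimplexTopology.
Variable R : realType.

Definition pt n (a : std_simplex R n) : 'rV[R]_n := val a.

Lemma std_simplex_valP n (a : std_simplex R n) : std_simplex R n (pt a).
Proof. by have := valP a; rewrite inE. Qed.

Lemma rV_coord_le n (v : 'rV[R]_n) j : `|v 0 j| <= `|v|.
Proof.
rewrite [X in _ <= X]/Num.norm /= mx_normrE.
exact: (le_bigmax _ (fun ij => `|v ij.1 ij.2|) (0, j)).
Qed.

Lemma rV_nbhsP n (x : 'rV[R]_n) (U : set 'rV[R]_n) :
  nbhs x U <-> exists2 d : R, 0 < d & forall y, `|x - y| < d -> U y.
Proof.
split=> [/nbhs_ballP[d /= d0 dU]|[d d0 dU]].
  by exists d => // y xy; apply: dU; rewrite mx_norm_ball.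
by apply/nbhs_ballP; exists d => //= y; rewrite mx_norm_ball; apply: dU.
Qed.

Lemma simplex_nbhsP n (a : std_simplex R n) (W : set (std_simplex R n)) :
  nbhs a W <-> exists2 d : R, 0 < d & forall b, `|pt a - pt b| < d -> W b.
Proof.
split=> [|[d d0 dW]].
  rewrite nbhsE => -[B [[O oO OB] Ba] BW].
  have : nbhs (pt a) O by apply: open_nbhs_nbhs; split=> //; move: Ba; rewrite -OB.
  move=> /rV_nbhsP[d d0 dO]; exists d => // b ab; apply: BW; rewrite -OB.
  exact: dO.
have : nbhs (pt a) [set y | `|pt a - y| < d] by apply/rV_nbhsP; exists d.
move/(@initial_continuous _ _ (set_val : std_simplex R n -> 'rV[R]_n) a).
move=> H; have {}H : nbhs a (@pt n @^-1` [set y | `|pt a - y| < d]) := H.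
by apply: filterS H => b /= ab; exact: (dW b ab).
Qed.

Lemma coord_cts n (i : 'I_n) : continuous (fun x : 'rV[R]_n => x 0 i).
Proof. exact: coord_continuous. Qed.

Lemma rV_continuous_at (T : topologicalType) n (f : T -> 'rV[R]_n) (x : T) :
  (forall j, {for x, continuous (fun y => f y 0 j)}) -> {for x, continuous f}.
Proof.
move=> cf U [P nP PU].
apply: (@filterS _ _ _ (fun y => forall ij : 'I_1 * 'I_n, P ij.1 ij.2 (f y ij.1 ij.2))).
  by move=> y Py; apply: PU => i j; exact: (Py (i, j)).
apply: filter_forall => -[i j] /=; rewrite (ord1 i).
exact: (cf j _ (nP 0 j)).
Qed.

Lemma std_simplex_closed n : closed (std_simplex R n).
Proof.
have -> : std_simplex R n = (\bigcap_(i in [set: 'I_n]) [set x | 0 <= x 0 i]) `&`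
    [set x | \sum_i x 0 i = 1].
  by apply/seteqP; split=> x [x0 x1]; split=> // i; [move=> _|]; exact: x0.
apply: closedI.
  apply: closed_bigI => i _.
  apply: (@preimage_closed _ _ (fun x : 'rV[R]_n => x 0 i) [set y | 0 <= y]).
    by move=> x _; exact: coord_cts.
  exact: closed_ge.
apply: (@preimage_closed _ _ (fun x : 'rV[R]_n => \sum_i x 0 i) [set y | y = 1]).
  by move=> x _; apply: sumr_continuous => i; exact: coord_cts.
exact: closed_eq.
Qed.

Lemma std_simplex_le1 n (x : 'rV[R]_n) i : std_simplex R n x -> x 0 i <= 1.
Proof.
by case=> x0 <-; rewrite (bigD1 i) //= lerDl; apply: sumr_ge0 => j _; exact: x0.
Qed.

Lemma std_simplex_compact n : compact (std_simplex R n).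
Proof.
pose K := [set v : 'rV[R]_n | forall i : 'I_n, `[0, 1]%classic (v ord0 i)].
apply: (@subclosed_compact _ _ K); first exact: std_simplex_closed.
  by apply: (@rV_compact R n (fun=> `[0, 1]%classic)) => i; exact: segment_compact.
by move=> x sx i; rewrite /= in_itv /= std_simplex_le1 // andbT; case: sx.
Qed.

(** Compactness of the simplex in filter form. It gives the continuity of a cone at its apex and the
    Lebesgue number of a cover. *)
Lemma simplex_covering n (I : Type) (F : set_system I)
    (P : I -> std_simplex R n -> Prop) : Filter F ->
  (forall a, exists2 d : R, 0 < d & \forall i \near F, forall b, `|pt a - pt b| < d -> P i b) ->
  \forall i \near F, forall b, P i b.
Proof.
move=> FF H.
have /compact_near_coveringP/(_ I F (fun i v => forall b, pt b = v -> P i b) FF) cK :=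
  @std_simplex_compact n.
have {}cK := cK _; apply: filterS (cK _) => [i Hi b|x sx].
  exact: (Hi (pt b) (std_simplex_valP b)).
have [d d0 Hd] := H (exist _ x (mem_set sx)).
exists ([set y | `|x - y| < d], [set i | forall b, `|x - pt b| < d -> P i b]) => /=.
  by split=> //; apply/rV_nbhsP; exists d.
by move=> [y i] /= [yx Hi] b eb; apply: Hi; rewrite eb.
Qed.
End SimplexTopology.

Section Cone.
Variables (R : realType) (X : topologicalType).

Definition inside (A : set X) (s : simplex R X) : Prop := forall x, A (tagged s x).

Lemma inside_bd (A : set X) s u : u \in dom (simplex_bd s) -> inside A s -> inside A u.
Proof.
move=> us As; move: u us.
change (on (inside A) (simplex_bd s)).
case: s As => -[|n] s As; first exact: on0.
by rewrite simplex_bdE; apply: on_sum => i _; apply: onMz; apply: onU => x; exact: As.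
Qed.

Variables (A : set X) (e : X) (h : R -> X -> X).
Implicit Types (t d : R).
Hypotheses (Ae : A e) (hA : forall t x, 0 <= t <= 1 -> A x -> A (h t x)).
Hypotheses (h0 : forall x, A x -> h 0 x = x) (h1 : forall x, A x -> h 1 x = e).
(** Joint continuity, spelled out for times in [0, 1] and points of [A] only: the homotopies in use
    are not continuous on the whole sphere. *)
Hypothesis hc : forall t x W, 0 <= t <= 1 -> A x -> nbhs (h t x) W ->
  exists2 d, 0 < d & exists2 Q, nbhs x Q &
    forall t' x', 0 <= t' <= 1 -> `|t - t'| < d -> Q x' -> A x' -> W (h t' x').

Lemma simplex_sum1 n (x : 'rV[R]_n.+1) : std_simplex R n.+1 x ->
  \sum_(i < n) x 0 (fintype.lift ord0 i) = 1 - x 0 0.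
Proof. by case=> _; rewrite big_ord_recl => <-; rewrite addrC addKr. Qed.

Definition base n (x : 'rV[R]_n.+1) : 'rV[R]_n :=
  \row_j (x 0 (fintype.lift ord0 j) / (1 - x 0 0)).

Lemma baseP n (x : std_simplex R n.+1) : pt x 0 0 != 1 -> base (pt x) \in std_simplex R n.
Proof.
have sx := std_simplex_valP x; move=> x1; apply/mem_set; split=> [i|].
  by rewrite mxE divr_ge0 ?subr_ge0 ?std_simplex_le1 //; case: sx.
under eq_bigr do rewrite mxE.
by rewrite -mulr_suml simplex_sum1 // divff // subr_eq0 eq_sym.
Qed.

Definition baseS n (x : std_simplex R n.+1) (x1 : pt x 0 0 != 1) : std_simplex R n :=
  exist _ (base (pt x)) (baseP x1).

(** The first barycentric coordinate is the time of the contraction; the others, rescaled to sum 1,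
    are the point of the base. At time 1 the base point is undefined and the value is the apex. *)
Definition cone_fun n (u : std_simplex R n -> X) (x : std_simplex R n.+1) : X :=
  if pselect (pt x 0 0 != 1) is left ne
  then h (pt x 0 0) (u (baseS ne)) else e.

Lemma cone_fun1 n u (x : std_simplex R n.+1) : pt x 0 0 = 1 -> cone_fun u x = e.
Proof. by move=> x1; rewrite /cone_fun; case: pselect => // ne; case/eqP: (ne). Qed.

Lemma cone_funE n u (x : std_simplex R n.+1) (y : std_simplex R n) :
  pt x 0 0 != 1 -> pt y = base (pt x) -> cone_fun u x = h (pt x 0 0) (u y).
Proof.
move=> x1 ey; rewrite /cone_fun; case: pselect => [ne|//].
by congr (h _ (u _)); apply: val_inj.
Qed.

Lemma cone_fun_in n u (x : std_simplex R n.+1) : (forall y, A (u y)) -> A (cone_fun u x).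
Proof.
move=> Au; have sx := std_simplex_valP x.
have [x1|x1] := eqVneq (pt x 0 0) 1; first by rewrite cone_fun1.
rewrite (@cone_funE _ _ _ (baseS x1)) //; apply: hA => //.
by rewrite std_simplex_le1 // andbT; case: sx.
Qed.

Lemma base_continuous n (x : 'rV[R]_n.+1) : x 0 0 != 1 -> {for x, continuous (@base n)}.
Proof.
move=> x1; apply: rV_continuous_at => j.
have -> : (fun y : 'rV[R]_n.+1 => base y 0 j) =
    (fun y => y 0 (fintype.lift ord0 j) / (1 - y 0 0)).
  by apply/funext => y; rewrite mxE.
apply: continuousM; first exact: coord_cts.
apply: continuousV; first by rewrite subr_eq0 eq_sym.
by apply: continuousB; [exact: cst_continuous|exact: coord_cts].
Qed.

Lemma cone_continuous n (u : std_simplex R n -> X) : (forall y, A (u y)) ->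
  continuous u -> continuous (cone_fun u).
Proof.
move=> Au cu x W nW; have sx := std_simplex_valP x; apply/simplex_nbhsP.
have xi : 0 <= pt x 0 0 <= 1 by rewrite std_simplex_le1 // andbT; case: sx.
have bi (b : std_simplex R n.+1) : 0 <= pt b 0 0 <= 1.
  by have sb := std_simplex_valP b; rewrite std_simplex_le1 // andbT; case: sb.
have coordle (b : std_simplex R n.+1) d : `|pt x - pt b| < d -> `|pt x 0 0 - pt b 0 0| < d.
  by apply: le_lt_trans; have := rV_coord_le (pt x - pt b) 0; rewrite !mxE.
have [x1|x1] := eqVneq (pt x 0 0) 1.
  rewrite cone_fun1 // in nW.
  (* Points near the apex lie over arbitrary points of the base, so the time from which [h] stays in
     [W] has to be uniform over the base. *)
  have [d d0 Hd] : exists2 d : R, 0 < d & forall t y, 0 <= t <= 1 -> `|1 - t| < d -> W (h t (u y)).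
    have : \forall t \near (1 : R), forall y, 0 <= t <= 1 -> W (h t (u y)).
      apply: (@simplex_covering R n R (nbhs (1 : R)) (fun t y => 0 <= t <= 1 -> W (h t (u y))) _) => y.
      have nWy : nbhs (h 1 (u y)) W by rewrite h1.
      have [|d d0 [Q nQ HQ]] := hc _ (Au y) nWy; first by rewrite ler01 lexx.
      have /simplex_nbhsP[d' d'0 Hd'] := cu y Q nQ.
      exists d' => //; apply/nbhs_normP; exists d => //= t t1 b yb ti.
      by apply: HQ => //; exact: Hd'.
    move=> /nbhs_normP[d /= d0 Hd]; exists d => // t y ti t1; exact: Hd.
  exists d => // b /coordle; rewrite x1 => xb.
  have [b1|b1] := eqVneq (pt b 0 0) 1.
    by rewrite /= cone_fun1 //; exact: nbhs_singleton.
  by rewrite /= (@cone_funE _ _ _ (baseS b1)) //; exact: Hd.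
pose y : std_simplex R n := baseS x1.
rewrite (@cone_funE _ _ _ y) // in nW.
have [d d0 [Q nQ HQ]] := hc xi (Au y) nW.
have /simplex_nbhsP[d' d'0 Hd'] := cu y Q nQ.
have nb : nbhs (base (pt x)) [set z | `|base (pt x) - z| < d'].
  by apply/rV_nbhsP; exists d'.
have /rV_nbhsP[d2 /= d20 Hd2] := base_continuous x1 nb.
have nx1 : 0 < `|pt x 0 0 - 1| by rewrite normr_gt0 subr_eq0.
exists (Num.min d (Num.min d2 `|pt x 0 0 - 1|)); first by rewrite !lt_min d0 d20.
move=> b; rewrite !lt_min => /and3P[/coordle db d2b /coordle b1'].
have b1 : pt b 0 0 != 1 by apply: contraTneq b1' => ->; rewrite ltxx.
rewrite /= (@cone_funE _ _ _ (baseS b1)) //; apply: HQ => //.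
by apply: Hd'; exact: Hd2.
Qed.

(** The arbitrary value outside [A] makes the operation total, so that it extends linearly to
    chains. *)
Definition cone (s : simplex R X) : simplex R X :=
  if pselect (inside A s) is left As
  then mk_simplex (cone_continuous As (@cts_fun _ _ (tagged s))) else s.

Lemma cone_inside s : inside A s -> inside A (cone s).
Proof.
by move=> As; rewrite /cone; case: pselect => // As' x; apply: cone_fun_in.
Qed.

Lemma cone_tag s : inside A s -> tag (cone s) = (tag s).+1.
Proof. by move=> As; rewrite /cone; case: pselect. Qed.

Lemma face_mx_lift0 n (i : 'I_n.+1) (x : 'rV[R]_n.+1) :
  face_mx (fintype.lift ord0 i) x 0 0 = x 0 0.
Proof.
have -> : 0 = fintype.lift (fintype.lift ord0 i) ord0 :> 'I_n.+2 by apply: val_inj.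
by rewrite mxE liftK.
Qed.

Lemma base_face n (i : 'I_n.+1) (x : 'rV[R]_n.+1) :
  base (face_mx (fintype.lift ord0 i) x) = face_mx i (base x).
Proof.
apply/rowP => j; rewrite [LHS]mxE face_mx_lift0 [RHS]mxE.
case: (unliftP i j) => [k ->|->]; last by rewrite mxE unlift_none mul0r.
have -> : fintype.lift ord0 (fintype.lift i k) =
    fintype.lift (fintype.lift ord0 i) (fintype.lift ord0 k).
  by apply: val_inj; rewrite /= /bump; lia.
by rewrite !mxE liftK.
Qed.

(** Face 0 of the cone is the simplex at time 0, where [h] is the identity; face i + 1 is the cone
    on face i. Tag 0 is included: the cone on the empty simplex is the vertex [e], whose boundary is
    the empty simplex. *)
Lemma simplex_bd_cone s : inside A s ->
  simplex_bd (cone s) = << s >> - fglift (fun u => << cone u >>) (simplex_bd s).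
Proof.
move=> As; rewrite /cone; case: pselect => // {}As.
rewrite simplex_bdE big_ord_recl expr0 mulr1z; congr (_ + _).
  case: s As => n u As; rewrite -[X in _ = << X >>](mk_simplexK (existT _ n u)).
  congr << _ >>; apply: eq_mk_simplex => x /=; have sx := std_simplex_valP x.
  have e0 : pt (face ord0 x) 0 0 = 0 by rewrite mxE unlift_none.
  have bx : pt x = base (pt (face ord0 x)).
    by apply/rowP => j; rewrite mxE e0 subr0 divr1 mxE liftK.
  rewrite -[LHS]/(cone_fun u (face ord0 x)).
  by rewrite (cone_funE _ _ bx) e0 ?h0 // eq_sym oner_eq0.
case: s As => -[|n] u As; first by rewrite big_ord0 fgliftE0 oppr0.
rewrite simplex_bdE raddf_sum -sumrN; apply: eq_bigr => i _ /=.
rewrite raddfMz /= fgliftU exprS mulN1r mulrNz; congr (- (_ *~ _)).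
congr << _ >>; rewrite /cone; case: pselect => [Ai|[]]; last by move=> x; exact: As.
apply: eq_mk_simplex => x /=.
have e0 : pt (face (fintype.lift ord0 i) x) 0 0 = pt x 0 0 by exact: face_mx_lift0.
have [x1|x1] := eqVneq (pt x 0 0) 1; first by rewrite [RHS]cone_fun1 ?[LHS]cone_fun1 ?e0.
rewrite [RHS](@cone_funE _ _ x (baseS x1)) // [LHS](@cone_funE _ _ _ (face i (baseS x1))) ?e0 //.
by rewrite [RHS]base_face.
Qed.
End Cone.

Section Acyclic.
Variables (R : realType) (gT : finGroupType) (X : gspace gT).

Lemma contractible_acyclic (A : set X) (e : X) (h : R -> X -> X) :
  A e -> (forall (t : R) x, 0 <= t <= 1 -> A x -> A (h t x)) ->
  (forall x, A x -> h 0 x = x) -> (forall x, A x -> h 1 x = e) ->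
  (forall (t : R) x W, 0 <= t <= 1 -> A x -> nbhs (h t x) W ->
  exists2 d : R, 0 < d & exists2 Q, nbhs x Q &
    forall (t' : R) x', 0 <= t' <= 1 -> `|t - t'| < d -> Q x' -> A x' -> W (h t' x')) ->
  @acyclic gT (simp R X) (inside A).
Proof.
move=> Ae hA h0 h1 hc n c con cd.
pose C (s : simplex R X) : chain (simplex R X) := << cone h1 hc s >>.
exists (fglift C c).
  apply: on_fglift con => u [Au tu]; apply: onU; split; first exact: cone_inside.
  by rewrite -tu [ctag _]cone_tag.
have -> : bd (X := simp R X) (fglift C c) = c - fglift C (bd (X := simp R X) c).
  have Ac : on (inside A) c by apply: onS con => u [].
  apply: (@on_ind _ (inside A) (fun c => bd (X := simp R X) (fglift C c) = c - fglift C (bd (X := simp R X) c))) Ac.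
  - by rewrite fgliftE0 bd0 fgliftE0; exact: esym (subrr _).
  - move=> x y ex ey; rewrite fgliftEB !bdB ex ey fgliftEB.
    by rewrite !opprB addrACA [RHS]addrACA; congr (_ + _); rewrite addrC.
  - by move=> u Au; rewrite fgliftU /C !bdU; exact: simplex_bd_cone.
by rewrite cd fgliftE0 subr0.
Qed.
End Acyclic.

(** * Barycentric subdivision *)

Local Open Scope classical_set_scope.

Section LinearChains.
Variable R : realType.

Definition mkpt n (v : 'rV[R]_n) (sv : std_simplex R n v) : std_simplex R n :=
  exist (fun v => v \in std_simplex R n) v (mem_set sv).

Section Fixed.
Variable n : nat.
Notation V := 'rV[R]_n.
(** A linear simplex: its number of vertices and a sequence that lists them. Entries beyond the
    number have no meaning, which keeps deletion and insertion of vertices free of dependent types;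
    [trimmed] normalizes them to 0. *)
Notation lcell := (nat * (nat -> V))%type.
Implicit Types (w : nat -> V) (p q : lcell) (b : V).

Definition del i w : nat -> V := fun k => w (bump i k).
Definition lcons b w : nat -> V := fun k => if k is k'.+1 then w k' else b.

Definition lbd p : chain lcell :=
  if p.1 is m.+1 then \sum_(i < m.+1) << (m, del i p.2) >> *~ (-1) ^+ i else 0.

Definition lcone b : chain lcell -> chain lcell :=
  fglift (fun p => << (p.1.+1, lcons b p.2) >>).

Lemma lbdK p : fglift lbd (lbd p) = 0.
Proof.
case: p => -[|[|m]] w; first by rewrite fgliftE0.
  by rewrite /lbd /= raddf_sum /= big1 // => i _; rewrite raddfMz /= fgliftU mul0rz.
pose F (i : 'I_m.+2) (j : 'I_m.+1) := << (m, del j (del i w)) >> : chain lcell.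
rewrite -[RHS](@alt_faces _ _ F) => [|i j ji].
  rewrite {2}/lbd raddf_sum; apply: eq_bigr => i _ /=.
  rewrite raddfMz /= fgliftU /lbd /= mulrz_suml; apply: eq_bigr => j _.
  by rewrite -mulrzA mulrC.
congr << (_, _) >>; apply/funext => k; congr (w _) => /=.
by rewrite /bump /=; lia.
Qed.

Lemma lbd_cone b c : fglift lbd (lcone b c) = c - lcone b (fglift lbd c).
Proof.
apply: (@on_ind _ (fun=> True) (fun c => fglift lbd (lcone b c) = c - lcone b (fglift lbd c))) => //.
- by rewrite /lcone !fgliftE0; exact: esym (subrr _).
- move=> x y ex ey; rewrite /lcone !fgliftEB -!/(lcone _ _) ex ey.
  by rewrite !opprB addrACA [RHS]addrACA; congr (_ + _); rewrite addrC.
move=> [m w] _; rewrite /lcone fgliftU fgliftU [in RHS]fgliftU {1}/lbd /= big_ord_recl expr0 mulr1z.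
congr (_ + _); case: m => [|m]; first by rewrite big_ord0 /lbd fgliftE0 oppr0.
rewrite /lbd /= raddf_sum -sumrN; apply: eq_bigr => i _ /=.
rewrite raddfMz /= fgliftU /= exprS mulN1r mulrNz; congr (- (_ *~ _)).
have -> // : del (bump 0 i) (lcons b w) = lcons b (del i w).
apply/funext => -[|k] //=; rewrite /del (_ : bump (bump 0 i) k.+1 = (bump i k).+1) //.
by rewrite /bump; lia.
Qed.

Definition bary m w : V := m%:R^-1 *: \sum_(k < m) w k.

Fixpoint sdr m w : chain lcell :=
  if m is m'.+1 then lcone (bary m w) (\sum_(i < m) sdr m' (del i w) *~ (-1) ^+ i)
  else << (0%N, w) >>.

Fixpoint hdr m w : chain lcell :=
  if m is m'.+1 then
    lcone (bary m w) (<< (m, w) >> - \sum_(i < m) hdr m' (del i w) *~ (-1) ^+ i)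
  else 0.

Definition sd p := sdr p.1 p.2.
Definition hd p := hdr p.1 p.2.

Lemma fglift_lbd (f : lcell -> chain lcell) m w :
  fglift f (lbd (m.+1, w)) = \sum_(i < m.+1) f (m, del i w) *~ (-1) ^+ i.
Proof.
rewrite /lbd /= raddf_sum; apply: eq_bigr => i _ /=.
by rewrite raddfMz /= fgliftU.
Qed.

(** The boundary of a cone is its base minus the cone on the boundary of the base. For the base in
    the recursion of [hd] that boundary is, by induction, the subdivided boundary of [p], whose cone
    is [sd p]. *)
Lemma sd_homotopy p : fglift lbd (hd p) + fglift hd (lbd p) = << p >> - sd p.
Proof.
case: p => m; elim: m => [|m IH] w.
  by rewrite /hd /sd /= /lbd !fgliftE0 subrr addr0.
rewrite /hd /sd -/hd -/sd /= -!(fglift_lbd hd) -!(fglift_lbd sd).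
rewrite lbd_cone fgliftEB fgliftU.
have -> : fglift lbd (fglift hd (lbd (m.+1, w))) = lbd (m.+1, w) - fglift sd (lbd (m.+1, w)).
  rewrite fglift_comp (@eq_fglift _ _ _ (fun q => (<< q >> - sd q) - fglift hd (lbd q))).
    by rewrite !fglift_sub fglift_id -fglift_comp lbdK fgliftE0 subr0.
  move=> q; rewrite /lbd /= => /dom_sum_subset/flatten_mapP[i _].
  have : on (fun q : lcell => q.1 = m) (<< (m, del i w) >> *~ (-1) ^+ i).
    by apply: onMz; apply: onU.
  by case: q => m' w' H /H /= ->; rewrite -IH addrK.
by rewrite opprB addrCA subrr addr0 addrAC subrK.
Qed.

Definition ptsin (D : V -> Prop) p : Prop := forall k, (k < p.1)%N -> D (p.2 k).
Definition trimmed p : Prop := forall k, (p.1 <= k)%N -> p.2 k = 0.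
Definition convexp (D : V -> Prop) : Prop :=
  forall m w, ptsin D (m.+1, w) -> D (bary m.+1 w).

Lemma on_lcone (A B : lcell -> Prop) b c :
  (forall q, A q -> B (q.1.+1, lcons b q.2)) -> on A c -> on B (lcone b c).
Proof. by move=> AB; apply: on_fglift => q Aq; apply: onU; exact: AB. Qed.

Lemma ptsin_cons D b q : D b -> ptsin D q -> ptsin D (q.1.+1, lcons b q.2).
Proof. by move=> Db Dq [|k] //=; rewrite ltnS; exact: Dq. Qed.

Lemma ptsin_del D m w i : (i < m.+1)%N -> ptsin D (m.+1, w) -> ptsin D (m, del i w).
Proof. by move=> im Dw k /= km; apply: Dw => /=; rewrite /bump; lia. Qed.

Lemma trimmed_cons b q : trimmed q -> trimmed (q.1.+1, lcons b q.2).
Proof. by move=> tq [|k] //=; rewrite ltnS; exact: tq. Qed.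

Lemma trimmed_del m w i : (i < m.+1)%N -> trimmed (m.+1, w) -> trimmed (m, del i w).
Proof. by move=> im tw k /= km; apply: tw => /=; rewrite /bump; lia. Qed.

Lemma sd_ptsin D p : convexp D -> ptsin D p -> on (ptsin D) (sd p).
Proof.
move=> cD; case: p => m; elim: m => [|m IH] w Dw; first exact: onU.
rewrite /sd /=; apply: (@on_lcone (ptsin D)); first by move=> q; apply: ptsin_cons; exact: cD.
by apply: on_sum => i _; apply: onMz; apply: IH; exact: ptsin_del Dw.
Qed.

Lemma hd_ptsin D p : convexp D -> ptsin D p -> on (ptsin D) (hd p).
Proof.
move=> cD; case: p => m; elim: m => [|m IH] w Dw; first exact: on0.
rewrite /hd /=; apply: (@on_lcone (ptsin D)); first by move=> q; apply: ptsin_cons; exact: cD.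
apply: onB; first exact: onU.
by apply: on_sum => i _; apply: onMz; apply: IH; exact: ptsin_del Dw.
Qed.

Lemma sd_trimmed p : trimmed p -> on trimmed (sd p).
Proof.
case: p => m; elim: m => [|m IH] w Dw; first exact: onU.
rewrite /sd /=; apply: (@on_lcone trimmed); first by move=> q; apply: trimmed_cons.
by apply: on_sum => i _; apply: onMz; apply: IH; exact: trimmed_del Dw.
Qed.

Lemma sd_tag p : on (fun q => q.1 = p.1) (sd p).
Proof.
case: p => m; elim: m => [|m IH] w; first exact: onU.
rewrite /sd /=; apply: (@on_lcone (fun q => q.1 = m)); first by move=> q /= ->.
by apply: on_sum => i _; apply: onMz; exact: IH.
Qed.

Lemma hd_tag p : on (fun q => q.1 = p.1.+1) (hd p).
Proof.
case: p => m; elim: m => [|m IH] w; first exact: on0.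
rewrite /hd /=; apply: (@on_lcone (fun q => q.1 = m.+1)); first by move=> q /= ->.
apply: onB; first exact: onU.
by apply: on_sum => i _; apply: onMz; exact: IH.
Qed.

Definition mesh (d : R) p : Prop :=
  forall k l, (k < p.1)%N -> (l < p.1)%N -> `|p.2 k - p.2 l| <= d.

Lemma bary_norm m w b (d : R) : (forall k, (k < m.+1)%N -> `|b - w k| <= d) ->
  `|b - bary m.+1 w| <= d.
Proof.
move=> H; have m0 : (m.+1%:R : R) != 0 by rewrite pnatr_eq0.
have -> : b - bary m.+1 w = m.+1%:R^-1 *: \sum_(k < m.+1) (b - w k).
  by rewrite /bary sumrB scalerBr sumr_const card_ord -[b *+ _]scaler_nat scalerA mulVf // scale1r.
rewrite normrZ gtr0_norm ?invr_gt0 ?ltr0Sn // mulrC ler_pdivrMr ?ltr0Sn //.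
apply: le_trans (ler_norm_sum _ _ _) _.
apply: (@le_trans _ _ (\sum_(k < m.+1) d)); first by apply: ler_sum => k _; exact: H.
by rewrite sumr_const card_ord mulr_natr.
Qed.

Lemma convexp_ball b (d : R) : convexp (fun z => `|b - z| <= d).
Proof. by move=> m w Dw; apply: bary_norm => k km; exact: Dw. Qed.

(** In the average of the differences w j - w k the term j = k is 0; hence the factor m / (m +
    1). *)
Lemma bary_dist m w (d : R) k : mesh d (m.+1, w) -> (k < m.+1)%N ->
  `|bary m.+1 w - w k| <= (1 - m.+1%:R^-1) * d.
Proof.
move=> mw km; have m0 : (m.+1%:R : R) != 0 by rewrite pnatr_eq0.
have -> : bary m.+1 w - w k = m.+1%:R^-1 *: \sum_(j < m.+1) (w j - w k).
  rewrite /bary sumrB scalerBr sumr_const card_ord -[X in _ - _ *: X]scaler_nat scalerA mulVf //.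
  by rewrite scale1r.
rewrite normrZ gtr0_norm ?invr_gt0 ?ltr0Sn //.
have d0 : 0 <= d by apply: le_trans (mw k k km km).
rewrite (bigD1 (Ordinal km)) //= subrr add0r.
have -> : (1 - m.+1%:R^-1) * d = m.+1%:R^-1 * (m%:R * d).
  by rewrite mulrA; congr (_ * _); rewrite -[in RHS]natr1 in m0 *; field; rewrite natr1.
rewrite ler_pM2l ?invr_gt0 ?ltr0Sn //.
apply: le_trans (ler_norm_sum _ _ _) _.
apply: (@le_trans _ _ (\sum_(i < m.+1 | i != Ordinal km) d)).
  by apply: ler_sum => j _; apply: mw => /=.
by rewrite sumr_const cardC1 card_ord mulr_natl.
Qed.

Lemma sd_mesh M p (d : R) : (p.1 <= M.+1)%N -> mesh d p ->
  on (mesh ((1 - M.+1%:R^-1) * d)) (sd p).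
Proof.
case: p => m; elim: m => [|m IH] w /= mM mw; first by apply: onU => k l.
set c := _ * d; have d0 : 0 <= d by apply: le_trans (mw 0%N 0%N isT isT).
have bc k : (k < m.+1)%N -> `|bary m.+1 w - w k| <= c.
  move=> km; apply: le_trans (bary_dist mw km) _; apply: ler_wpM2r => //.
  by rewrite lerD2l lerN2 lef_pV2 ?posrE ?ltr0Sn // ler_nat.
have c0 : 0 <= c by apply: le_trans (bc 0%N isT).
(* Two vertices of a piece either both come from the subdivision of one face or include the
   barycentre. The ball around the barycentre contains the vertices and is convex, so it contains
   the whole subdivided boundary. *)
rewrite /sd /=; apply: (@on_lcone (fun q => mesh c q /\ ptsin (fun z => `|bary m.+1 w - z| <= c) q)).
  move=> q [mq bq] [|k] [|l] //= kq lq; rewrite ?subrr ?normr0 //.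
  - exact: bq.
  - by rewrite distrC; exact: bq.
  - exact: mq.
apply: on_sum => i _; apply: onMz; apply: onI.
  apply: IH; first exact: ltnW.
  by move=> k l /= km lm; apply: mw => /=; have := ltn_ord i; rewrite /bump; lia.
apply: (@sd_ptsin _ (m, del i w)); first exact: convexp_ball.
by apply: (@ptsin_del _ m w) => // k km; exact: bc.
Qed.

End Fixed.

Section Natural.
Variables (n n' : nat) (f : {linear 'rV[R]_n -> 'rV[R]_n'}).
Definition lmap (p : nat * (nat -> 'rV[R]_n)) : nat * (nat -> 'rV[R]_n') := (p.1, f \o p.2).
Notation fmap := (fglift (fun p => << lmap p >>)).

Lemma lmap_cone b c : fmap (lcone b c) = lcone (f b) (fmap c).
Proof.
rewrite /lcone !fglift_comp; congr fglift; apply/funext => p.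
rewrite !fgliftU /lmap /=; congr << (_, _) >>.
by apply/funext => -[].
Qed.

Lemma lmap_bary m w : f (bary m w) = bary m (f \o w).
Proof. by rewrite /bary linearZ /= linear_sum. Qed.

Lemma sd_lmap p : sd (lmap p) = fmap (sd p).
Proof.
case: p => m; elim: m => [|m IH] w; first by rewrite /sd /= fgliftU.
rewrite /sd /= lmap_cone lmap_bary; congr lcone.
rewrite raddf_sum; apply: eq_bigr => i _; rewrite raddfMz; congr (_ *~ _).
exact: IH.
Qed.

Lemma hd_lmap p : hd (lmap p) = fmap (hd p).
Proof.
case: p => m; elim: m => [|m IH] w; first by rewrite /hd /= fgliftE0.
rewrite /hd /= lmap_cone lmap_bary; congr lcone; rewrite fgliftEB fgliftU; congr (_ - _).
rewrite raddf_sum; apply: eq_bigr => i _; rewrite raddfMz; congr (_ *~ _).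
exact: IH.
Qed.
End Natural.
End LinearChains.

(** * Subdivision of singular chains and small simplices *)

Section SingularSubdivision.
Variables (R : realType) (X : topologicalType).
Implicit Types s : simplex R X.

Section Push.
Variable n : nat.
Notation V := 'rV[R]_n.
Implicit Types p q : (nat * (nat -> V))%type.

Definition comb (w : nat -> V) m (x : 'rV[R]_m) : V := \sum_(k < m) x 0 k *: w k.

Lemma comb_in p (x : std_simplex R p.1) : ptsin (std_simplex R n) p ->
  comb p.2 (pt x) \in std_simplex R n.
Proof.
move=> gp; have [x0 x1] := std_simplex_valP x; apply/mem_set; split=> [i|].
  rewrite summxE; apply: sumr_ge0 => k _; rewrite mxE mulr_ge0 //.
  by have [] := gp k (ltn_ord k).
rewrite (eq_bigr (fun i => \sum_(k < p.1) pt x 0 k * p.2 k 0 i)); last first.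
  by move=> i _; rewrite summxE; apply: eq_bigr => k _; rewrite mxE.
rewrite exchange_big /= -[RHS]x1; apply: eq_bigr => k _.
by rewrite -mulr_sumr; have [_ ->] := gp k (ltn_ord k); rewrite mulr1.
Qed.

Definition aff p (gp : ptsin (std_simplex R n) p) (x : std_simplex R p.1) : std_simplex R n :=
  exist _ (comb p.2 (pt x)) (comb_in x gp).

Lemma aff_continuous p (gp : ptsin (std_simplex R n) p) : continuous (aff gp).
Proof.
apply/continuous_comp_initial => x; apply: rV_continuous_at => j.
have -> : (fun y : std_simplex R p.1 => (set_val \o aff gp) y 0 j) =
    (fun y => \sum_(k <- index_enum 'I_p.1) pt y 0 k * p.2 k 0 j).
  by apply/funext => y; rewrite /= summxE; apply: eq_bigr => k _; rewrite mxE.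
apply: sumr_continuous => k y; apply: continuousM; last exact: cst_continuous.
move=> U /coord_continuous nU.
exact: (@initial_continuous _ _ (set_val : std_simplex R p.1 -> 'rV[R]_p.1) y _ nU).
Qed.

Variable u : continuousType (std_simplex R n) X.

Lemma push_continuous p (gp : ptsin (std_simplex R n) p) : continuous (u \o aff gp).
Proof. by move=> x; apply: continuous_comp; [exact: aff_continuous|exact: cts_fun]. Qed.

(** When the vertices leave the standard simplex the value is arbitrary; taking [u] itself keeps
    [push_inside] free of side conditions. *)
Definition push p : simplex R X :=
  if pselect (ptsin (std_simplex R n) p) is left gp then mk_simplex (@push_continuous _ gp)
  else existT _ n u.

Lemma pushE p (gp : ptsin (std_simplex R n) p) : push p = mk_simplex (@push_continuous _ gp).
Proof.
rewrite /push; case: pselect => // gp'; apply: eq_mk_simplex => x /=.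
by congr (u _); apply: val_inj.
Qed.

Lemma push_tag p : ptsin (std_simplex R n) p -> tag (push p) = p.1.
Proof. by move=> gp; rewrite (pushE gp). Qed.

Lemma push_inside A p : inside A (existT _ n u : simplex R X) -> inside A (push p).
Proof.
by move=> Au; rewrite /push; case: pselect => // gp x; exact: Au.
Qed.

Lemma push_bd p : ptsin (std_simplex R n) p ->
  simplex_bd (push p) = fglift (fun q => << push q >>) (lbd p).
Proof.
case: p => -[|m] w gp; first by rewrite (pushE gp) /lbd /= fgliftE0.
rewrite (pushE gp) simplex_bdE /lbd raddf_sum; apply: eq_bigr => i _ /=.
rewrite raddfMz /= fgliftU; congr (<< _ >> *~ _).
rewrite (pushE (ptsin_del (ltn_ord i) gp)); apply: eq_mk_simplex => x /=.
congr (u _); apply: val_inj; rewrite /= /comb (bigD1_ord i) //= mxE unlift_none scale0r add0r.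
by apply: eq_bigr => k _; rewrite mxE liftK.
Qed.

Definition vtx (k : nat) : V := \row_j ((j : nat) == k)%:R.

Lemma vtx_in : ptsin (std_simplex R n) (n, vtx).
Proof.
move=> k kn; split=> [i|]; first by rewrite mxE ler0n.
rewrite (bigD1 (Ordinal kn)) //= mxE eqxx big1 ?addr0 // => i ik.
by rewrite mxE; case: eqP => // e; case/eqP: ik; exact: val_inj.
Qed.

Lemma vtx_trimmed : trimmed (n, vtx).
Proof.
move=> k /= nk; apply/rowP => j; rewrite !mxE; case: eqP => // e.
by have := ltn_ord j; rewrite e ltnNge nk.
Qed.

Lemma comb_vtx (x : V) : comb vtx x = x.
Proof.
apply/rowP => j; rewrite summxE (bigD1 j) //= !mxE eqxx mulr1 big1 ?addr0 // => k kj.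
rewrite !mxE; case: eqP => [e|]; last by rewrite mulr0.
by case/eqP: kj; exact/esym/val_inj.
Qed.

Lemma push_vtx : push (n, vtx) = existT _ n u.
Proof.
rewrite (pushE vtx_in) -[RHS]mk_simplexK; apply: eq_mk_simplex => x /=.
by congr (u _); apply: val_inj; exact: comb_vtx.
Qed.

Lemma convexp_simplex : convexp (std_simplex R n).
Proof.
move=> m w Dw; have m0 : (m.+1%:R : R) != 0 by rewrite pnatr_eq0.
pose x : 'rV[R]_m.+1 := const_mx m.+1%:R^-1.
have sx : x \in std_simplex R m.+1.
  apply/mem_set; split=> [i|]; first by rewrite mxE invr_ge0 ler0n.
  under eq_bigr do rewrite mxE.
  by rewrite sumr_const card_ord -[_ *+ _]mulr_natr mulVf.
have := comb_in (p := (m.+1, w)) (exist _ x sx) Dw; rewrite inE.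
rewrite /comb /=; under eq_bigr do rewrite mxE.
by rewrite -scaler_sumr.
Qed.
End Push.

Lemma comb_linear n (w : nat -> 'rV[R]_n) m : linear (@comb n w m).
Proof.
move=> a x y; rewrite /comb scaler_sumr -big_split; apply: eq_bigr => k _ /=.
by rewrite !mxE scalerDl scalerA.
Qed.
HB.instance Definition _ n (w : nat -> 'rV[R]_n) m :=
  GRing.isLinear.Build R 'rV[R]_m 'rV[R]_n *:%R (@comb n w m) (@comb_linear n w m).

(** The entries of [vtx] beyond the vertices are 0 and a linear map sends them to 0, so only a
    trimmed sequence can be recovered. *)
Lemma comb_vtxs n (w : nat -> 'rV[R]_n) m : trimmed (m, w) -> lmap (@comb n w m) (m, @vtx m) = (m, w).
Proof.
move=> tw; congr (_, _); apply/funext => k /=; rewrite /comb.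
have [mk|km] := leqP m k.
  have /= -> := tw k mk; rewrite big1 // => i _; rewrite mxE; case: eqP => [e|]; last by rewrite scale0r.
  by have := ltn_ord i; rewrite e ltnNge mk.
rewrite (bigD1 (Ordinal km)) //= mxE eqxx scale1r big1 ?addr0 // => i ik.
rewrite mxE; case: eqP => [e|]; last by rewrite scale0r.
by case/eqP: ik; exact: val_inj.
Qed.

Lemma comb_comb n (w : nat -> 'rV[R]_n) m (v : nat -> 'rV[R]_m) l (x : 'rV[R]_l) :
  comb w (comb v x) = comb (@comb n w m \o v) x.
Proof. by rewrite {2}/comb linear_sum; apply: eq_bigr => k _; rewrite linearZ. Qed.

Definition pushc s (c : chain (nat * (nat -> 'rV[R]_(tag s)))) : chain (simplex R X) :=
  fglift (fun q => << push (tagged s) q >>) c.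
Definition sub s := pushc (sd (tag s, @vtx (tag s))).
Definition subh s := pushc (hd (tag s, @vtx (tag s))).

Lemma pushc_lmap n (u : continuousType (std_simplex R n) X) p
    (gp : ptsin (std_simplex R n) p) c : on (ptsin (std_simplex R p.1)) c ->
  pushc (s := mk_simplex (@push_continuous n u p gp)) c =
  pushc (s := existT _ n u) (fglift (fun q => << lmap (@comb n p.2 p.1) q >>) c).
Proof.
rewrite /pushc fglift_comp => gc; apply: eq_fglift => q /gc gq /=.
rewrite fgliftU; congr << _ >>.
have gq' : ptsin (std_simplex R n) (lmap (@comb n p.2 p.1) q).
  move=> k kq /=; pose y : std_simplex R p.1 := mkpt (gq k kq).
  by have := comb_in y gp; rewrite inE.
rewrite (pushE _ gq) (pushE _ gq'); apply: eq_mk_simplex => x /=.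
by congr (u _); apply: val_inj; exact: comb_comb.
Qed.

Lemma vtx_ptsin n : ptsin (std_simplex R n) (n, @vtx n).
Proof. exact: vtx_in. Qed.

(** Naturality: the subdivision of a piece is the image of the subdivided standard simplex under the
    linear map with vertices [p.2], and [sd] commutes with linear maps. *)
Lemma sub_push n (u : continuousType (std_simplex R n) X) p :
  ptsin (std_simplex R n) p -> trimmed p ->
  sub (push u p) = pushc (s := existT _ n u) (sd p).
Proof.
move=> gp tp; rewrite (pushE _ gp) /sub pushc_lmap; last first.
  apply: sd_ptsin; [exact: convexp_simplex|exact: vtx_ptsin].
by rewrite -sd_lmap /= comb_vtxs //; case: p tp {gp}.
Qed.

Lemma subh_push n (u : continuousType (std_simplex R n) X) p :
  ptsin (std_simplex R n) p -> trimmed p ->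
  subh (push u p) = pushc (s := existT _ n u) (hd p).
Proof.
move=> gp tp; rewrite (pushE _ gp) /subh pushc_lmap; last first.
  apply: hd_ptsin; [exact: convexp_simplex|exact: vtx_ptsin].
by rewrite -hd_lmap /= comb_vtxs //; case: p tp {gp}.
Qed.

Lemma bd_pushc n (u : continuousType (std_simplex R n) X) c :
  on (ptsin (std_simplex R n)) c ->
  fglift (@simplex_bd R X) (pushc (s := existT _ n u) c) =
  pushc (s := existT _ n u) (fglift (@lbd R n) c).
Proof.
rewrite /pushc !fglift_comp => gc; apply: eq_fglift => q /gc gq.
by rewrite fgliftU /= push_bd.
Qed.

Lemma sub_homotopy s :
  fglift (@simplex_bd R X) (subh s) + fglift subh (simplex_bd s) = << s >> - sub s.
Proof.
case: s => n u; have gv := @vtx_ptsin n.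
have -> : simplex_bd (existT _ n u : simplex R X) =
    pushc (s := existT _ n u) (lbd (n, @vtx n)) by rewrite /pushc -push_bd // push_vtx.
have -> : fglift subh (pushc (s := existT _ n u) (lbd (n, @vtx n))) =
    pushc (s := existT _ n u) (fglift (@hd R n) (lbd (n, @vtx n))).
  rewrite /pushc !fglift_comp; apply: eq_fglift => q; move: q.
  suff H : on (fun q => ptsin (std_simplex R n) q /\ trimmed q) (lbd (n, @vtx n)).
    by move=> q /H[gq tq]; rewrite fgliftU /= subh_push.
  case: n u gv => [|n] u gv; first exact: on0.
  apply: on_sum => i _; apply: onMz; apply: onU; split; first exact: ptsin_del gv.
  by apply: trimmed_del; [|exact: vtx_trimmed].
rewrite bd_pushc; last by apply: hd_ptsin => //; exact: convexp_simplex.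
rewrite /pushc -raddfD /= sd_homotopy fgliftEB fgliftU /= push_vtx.
by [].
Qed.

Lemma push_chain_inside (A : set X) s c : inside A s -> on (inside A) (pushc (s := s) c).
Proof.
case: s c => n u c As; rewrite /pushc; apply: (@on_fglift _ _ (fun=> True)) => // q _.
by apply: onU; exact: push_inside.
Qed.

Lemma sub_inside (A : set X) s : inside A s -> on (inside A) (sub s).
Proof. exact: push_chain_inside. Qed.

Lemma subh_inside (A : set X) s : inside A s -> on (inside A) (subh s).
Proof. exact: push_chain_inside. Qed.

Lemma sub_tag s : on (fun u => tag u = tag s) (sub s).
Proof.
case: s => n u; have gv := @vtx_ptsin n; apply: (@on_fglift _ _ (fun q =>
  ptsin (std_simplex R n) q /\ q.1 = n)).
  by move=> q [gq tq]; apply: onU; rewrite push_tag.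
apply: onI; last exact: sd_tag.
by apply: sd_ptsin => //; exact: convexp_simplex.
Qed.

Lemma subh_tag s : on (fun u => tag u = (tag s).+1) (subh s).
Proof.
case: s => n u; have gv := @vtx_ptsin n; apply: (@on_fglift _ _ (fun q =>
  ptsin (std_simplex R n) q /\ q.1 = n.+1)).
  by move=> q [gq tq]; apply: onU; rewrite push_tag.
apply: onI; last exact: hd_tag.
by apply: hd_ptsin => //; exact: convexp_simplex.
Qed.

(** The size of a piece is measured in the source simplex, since the target has no metric. The bound
    on the number of vertices fixes the factor of [sd_mesh] for all iterations. *)
Definition fine s (d : R) (v : simplex R X) : Prop :=
  exists p, [/\ ptsin (std_simplex R (tag s)) p, trimmed p, (p.1 <= (tag s).+1)%N, mesh d p
               & v = push (tagged s) p].

Lemma sub_fine s d v : fine s d v -> on (fine s ((1 - (tag s).+1%:R^-1) * d)) (sub v).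
Proof.
case: s => n u [p [gp tp pn mp ->]] /=; rewrite sub_push //.
apply: (@on_fglift _ _ (fun q => [/\ ptsin (std_simplex R n) q, trimmed q, (q.1 <= n.+1)%N &
   mesh ((1 - n.+1%:R^-1) * d) q])).
  by move=> q [*]; apply: onU; exists q.
have H1 := sd_ptsin (@convexp_simplex n) gp.
have H2 := sd_trimmed tp; have H3 := @sd_tag R n p; have H4 := sd_mesh pn mp.
by move=> q qp; split; [exact: H1|exact: H2|rewrite (H3 q qp)|exact: H4].
Qed.

Lemma fine_self s : exists2 d, 0 <= d & fine s d s.
Proof.
case: s => n u; exists (\sum_(i < n) \sum_(j < n) `|@vtx n i - @vtx n j|).
  by apply: sumr_ge0 => i _; apply: sumr_ge0.
exists (n, @vtx n); split => //; [exact: vtx_in|exact: vtx_trimmed| | by rewrite push_vtx].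
move=> k l /= kn ln; rewrite (bigD1 (Ordinal kn)) //= (bigD1 (Ordinal ln)) //=.
by rewrite -addrA lerDl addr_ge0 // ?sumr_ge0 // => i _; apply: sumr_ge0.
Qed.

Section Small.
Variables (I : Type) (i0 : I) (U : I -> set X).

Definition small (v : simplex R X) : Prop := exists i, inside (U i) v.
(** Neighbourhoods are taken in the simplex, so the sets [U i] have to be open only after pulling
    back; later they are traces of open sets on a subspace. *)
Definition covered s : Prop := forall x, exists i, nbhs (x : std_simplex R (tag s)) [set y : std_simplex R (tag s) | U i (tagged s y)].

Lemma small_bd v : small v -> on small (simplex_bd v).
Proof. by case=> i vi u uv; exists i; exact: inside_bd vi. Qed.

Lemma sub_small v : small v -> on small (sub v).
Proof. by case=> i vi u uv; exists i; exact: (sub_inside vi). Qed.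

Lemma subh_small v : small v -> on small (subh v).
Proof. by case=> i vi u uv; exists i; exact: (subh_inside vi). Qed.

Lemma lebesgue_number s : covered s -> exists2 d, 0 < d & forall v, fine s d v -> small v.
Proof.
case: s => n u cs.
have : \forall d \near (0 : R), forall a : std_simplex R n, 0 < d ->
    exists i, forall b, `|pt a - pt b| <= d -> U i (u b).
  apply: (@simplex_covering R n R (nbhs (0 : R)) (fun d a => 0 < d -> exists i, forall b, `|pt a - pt b| <= d -> U i (u b)) _) => a.
  have [i /simplex_nbhsP[d d0 Hd]] := cs a; exists (d / 2); first by rewrite divr_gt0.
  apply/nbhs_normP; exists (d / 2) => /=; first by rewrite divr_gt0.
  move=> e; rewrite /ball_ /= sub0r normrN => ed b ab e0; exists i => c bc; apply: Hd.
  have := ler_normD (pt a - pt b) (pt b - pt c); rewrite addrA subrK => /le_lt_trans -> //.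
  rewrite gtr0_norm // in ed; rewrite [d]splitr; apply: ltrD => //; exact: le_lt_trans ed.
move=> /nbhs_normP[d /= d0 Hd]; exists (d / 2); first by rewrite divr_gt0.
move=> v [[m w] [gp _ _ mp ->]]; rewrite /= in gp mp *; rewrite (pushE _ gp).
case: m gp mp => [|m] gp mp.
  (* A piece without vertices is the empty simplex and lies in every set of the cover. *)
  exists i0 => /= x; have [_] := std_simplex_valP x; rewrite big_ord0 => /eqP.
  by rewrite eq_sym oner_eq0.
have [||i Hi] := Hd (d / 2) _ (mkpt (gp 0%N isT)).
- by rewrite /ball_ /= sub0r normrN gtr0_norm ?divr_gt0 // ltr_pdivrMr // mulr2n; lra.
- by rewrite divr_gt0.
exists i => x /=; apply: Hi; rewrite /pt /=.
have [x0 x1] := std_simplex_valP x.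
have -> : w 0%N - comb w (pt x) = \sum_(k < m.+1) pt x 0 k *: (w 0%N - w k).
  by under eq_bigr do rewrite scalerBr; rewrite sumrB -scaler_suml x1 scale1r.
apply: le_trans (ler_norm_sum _ _ _) _.
apply: (@le_trans _ _ (\sum_(k < m.+1) pt x 0 k * (d / 2))); last first.
  by rewrite -mulr_suml x1 mul1r.
apply: ler_sum => k _; rewrite normrZ (ger0_norm (x0 k)) ler_wpM2l //.
exact: mp.
Qed.

Notation subc := (fglift sub).

Lemma iter_on (A : simplex R X -> Prop) N c :
  (forall v, A v -> on A (sub v)) -> on A c -> on A (iter N subc c).
Proof. by move=> HA Ac; elim: N => //= N IH; apply: on_fglift IH. Qed.

Lemma iter_fine s d N c : on (fine s d) c ->
  on (fine s ((1 - (tag s).+1%:R^-1) ^+ N * d)) (iter N subc c).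
Proof.
move=> sc; elim: N => [|N IH] /=; first by rewrite expr0 mul1r.
by rewrite exprS -mulrA; apply: on_fglift IH => v; exact: sub_fine.
Qed.

Lemma small_iterU s : covered s -> exists N, forall N', (N <= N')%N -> on small (iter N' subc << s >>).
Proof.
move=> cs; have [d d0 Hd] := lebesgue_number cs; have [e e0 se] := fine_self s.
have [N HN] : exists N, (1 - (tag s).+1%:R^-1 : R) ^+ N * e <= d.
  have z1 : `|1 - (tag s).+1%:R^-1 : R| < 1.
    have i0' : 0 < (tag s).+1%:R^-1 :> R by rewrite invr_gt0 ltr0Sn.
    have i1 : (tag s).+1%:R^-1 <= 1 :> R by rewrite invf_le1 ?ltr0Sn // ler1n.
    by rewrite ger0_norm ?subr_ge0 // gtrDl oppr_lt0.
  have de : 0 < d / (e + 1) by rewrite divr_gt0 // ltr_pwDr.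
  have /cvgr0Pnorm_lt/(_ _ de)[N _ HN] := cvg_expr z1.
  exists N; have := HN N (leqnn N); set z := _ ^+ N => zd.
  apply: le_trans (ler_norm _) _; rewrite normrM (ger0_norm e0).
  apply: (@le_trans _ _ (d / (e + 1) * e)); first by rewrite ler_wpM2r // ltW.
  rewrite mulrAC ler_pdivrMr ?ltr_pwDr // ler_pM2l // lerDl.
  exact: ler01.
exists N => N' NN'.
have H : on small (iter N subc << s >>).
  have H1 : on (fine s e) << s >> by exact: onU.
  have H2 := @iter_fine s e N _ H1.
  move=> v /H2[p [gp tp pn mp ->]]; apply: Hd.
  by exists p; split=> // k l kp lp; apply: le_trans HN; exact: mp.
by rewrite -(subnK NN') iterD; apply: iter_on H => v; exact: sub_small.
Qed.

Lemma iterB N c e : iter N subc (c - e) = iter N subc c - iter N subc e.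
Proof. by elim: N => //= N ->; rewrite fgliftEB. Qed.

Lemma small_iter c : on covered c -> exists N, on small (iter N subc c).
Proof.
move=> cc; suff [N HN] : exists N, forall N', (N <= N')%N -> on small (iter N' subc c).
  by exists N; exact: HN.
move: c cc; apply: on_ind => [|x y [N1 H1] [N2 H2]|s cs].
- by exists 0%N => N' _; apply: iter_on; [exact: sub_small|exact: on0].
- exists (maxn N1 N2) => N'; rewrite geq_max iterB => /andP[/H1 ? /H2 ?].
  exact: onB.
- exact: small_iterU.
Qed.

(** Each subdivision changes the chain by a boundary and by the homotopy applied to its boundary;
    the latter term is small because the boundary is. The first clause keeps the filling in every
    set that contains the chain, which is what carriers need. *)
Lemma small_homologous c : on covered c ->
  on small (fglift (@simplex_bd R X) c) ->
  exists v, [/\ forall A : set X, on (inside A) c -> on (inside A) v,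
    forall n, on (fun u => tag u = n) c -> on (fun u => tag u = n.+1) v
    & on small (c - fglift (@simplex_bd R X) v)].
Proof.
move=> cc cd; have [N HN] := small_iter cc.
(* Generalized for an induction on the number of subdivisions: [e] collects the small homotopy
   terms. *)
suff [v [vA vt [e se ve]]] : exists v, [/\ forall A : set X, on (inside A) c -> on (inside A) v,
    forall n, on (fun u => tag u = n) c -> on (fun u => tag u = n.+1) v
    & exists2 e, on small e & c - fglift (@simplex_bd R X) v = iter N subc c + e].
  by exists v; split=> //; rewrite ve; exact: onD.
elim: N {HN} => [|N [v [vA vt [e se ve]]]].
  exists 0; split=> [A _|n _|]; [exact: on0|exact: on0|].
  by exists 0; [exact: on0|rewrite fgliftE0 subr0 addr0].
pose y := iter N subc c; exists (v + fglift subh y); split.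
- move=> A Ac; apply: onD; first exact: vA.
  apply: (@on_fglift _ _ (inside A)); first by move=> u; exact: subh_inside.
  by apply: iter_on Ac => u; exact: sub_inside.
- move=> n nc; apply: onD; first exact: vt.
  apply: (@on_fglift _ _ (fun u => tag u = n)); first by move=> u <-; exact: subh_tag.
  by apply: iter_on nc => w <-; exact: sub_tag.
have yd : on small (fglift (@simplex_bd R X) y).
  have -> : y = (c - fglift (@simplex_bd R X) v) - e by rewrite ve addrK.
  rewrite !fgliftEB; apply: onB; last by apply: on_fglift se; exact: small_bd.
  rewrite (_ : fglift _ (fglift _ v) = 0) ?subr0 //.
  rewrite fglift_comp -[RHS](fglift0 _ v); congr fglift; apply/funext => u.
  exact: simplex_bdK.
exists (e + fglift subh (fglift (@simplex_bd R X) y)).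
  by apply: onD => //; apply: on_fglift yd; exact: subh_small.
have id_y : fglift (@simplex_bd R X) (fglift subh y) + fglift subh (fglift (@simplex_bd R X) y) =
    y - subc y.
  rewrite !fglift_comp -fglift_add -[X in X - _]fglift_id -fglift_sub; congr fglift.
  by apply/funext => u; exact: sub_homotopy.
rewrite [fglift _ (_ + _)]raddfD opprD addrA ve -/y /=.
rewrite (_ : subc y = y - (fglift (@simplex_bd R X) (fglift subh y) +
  fglift subh (fglift (@simplex_bd R X) y))); last by rewrite id_y opprB addrC subrK.
by rewrite opprD [y + (_ - _)]addrA [RHS]addrACA addNr addr0 addrAC.
Qed.
End Small.
End SingularSubdivision.

Local Close Scope classical_set_scope.

(** * Homology of linear spheres *)

Local Open Scope classical_set_scope.

Section SphereLike.
Variables (gT : finGroupType) (X : gcomplex gT).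
Implicit Types (Phi Psi : X -> Prop) (c z : chain X).

Definition bounds Phi n c : Prop :=
  exists2 v, on (fun u => Phi u /\ ctag u = n.+1) v & bd v = c.

Definition cycle Phi n c : Prop :=
  on (fun u => Phi u /\ ctag u = n) c /\ bd c = 0.

(** The reduced homology of the cells in [Phi] is Z, generated by [z], at tag [n], that is, in
    dimension n - 1. *)
Definition sphere_like Phi n z : Prop :=
  [/\ cycle Phi n z, forall m c, cycle Phi m c -> m != n -> bounds Phi m c,
      forall c, cycle Phi n c -> exists a, bounds Phi n (c - z *~ a)
    & forall a, bounds Phi n (z *~ a) -> a = 0].

Lemma on_or Phi Psi c : on (fun u => Phi u \/ Psi u) c ->
  exists c1 c2, [/\ on Phi c1, on Psi c2 & c = c1 + c2].
Proof.
move: c; apply: on_ind => [|x y [x1 [x2 [? ? ->]]] [y1 [y2 [? ? ->]]]|u].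
- by exists 0, 0; rewrite addr0; split=> //; exact: on0.
- exists (x1 - y1), (x2 - y2); split; try exact: onB.
  by rewrite opprD addrACA.
- case=> Pu; [exists << u >>, 0|exists 0, << u >>]; split=> //;
    by [exact: onU|exact: on0|rewrite addr0|rewrite add0r].
Qed.

Definition face_closed Phi : Prop := forall s u, Phi s -> u \in dom (cbd s) -> Phi u.

Lemma on_bd Phi n c : face_closed Phi ->
  on (fun u => Phi u /\ ctag u = n) c -> on (fun u => Phi u /\ (ctag u).+1 = n) (bd c).
Proof.
move=> fP; apply: on_fglift => s [Ps ts] u us.
by rewrite -ts (cbd_tag us); split=> //; exact: fP us.
Qed.

(** The new generator suspends [z]: it is a filling of [z] in [PhiU] minus one in [PhiV]. The
    hypothesis on splitting chains stands for excision and is met by subdivision. *)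
Lemma mayer_vietoris Phi PhiU PhiV n z :
  face_closed PhiU -> face_closed PhiV ->
  (forall u, PhiU u -> Phi u) -> (forall u, PhiV u -> Phi u) ->
  (forall m c, on (fun u => Phi u /\ ctag u = m) c -> on (fun u => PhiU u \/ PhiV u) (bd c) ->
    exists2 v, on (fun u => Phi u /\ ctag u = m.+1) v & on (fun u => PhiU u \/ PhiV u) (c - bd v)) ->
  acyclic PhiU -> acyclic PhiV ->
  sphere_like (fun u => PhiU u /\ PhiV u) n z -> exists z', sphere_like Phi n.+1 z'.
Proof.
move=> fU fV UP VP sm aU aV [[zon zd] z0 zn zu].
have onUP m c : on (fun u => PhiU u /\ ctag u = m) c -> on (fun u => Phi u /\ ctag u = m) c.
  by apply: onS => u [/UP].
have onVP m c : on (fun u => PhiV u /\ ctag u = m) c -> on (fun u => Phi u /\ ctag u = m) c.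
  by apply: onS => u [/VP].
have sp m c : on (fun u => Phi u /\ ctag u = m) c -> on (fun u => PhiU u \/ PhiV u) (bd c) ->
    exists v cU cV, [/\ on (fun u => Phi u /\ ctag u = m.+1) v,
      on (fun u => PhiU u /\ ctag u = m) cU, on (fun u => PhiV u /\ ctag u = m) cV
      & c - bd v = cU + cV].
  move=> cm cs; have [v von vs] := sm m c cm cs; exists v.
  have tv : on (fun u => ctag u = m) (c - bd v).
    apply: onB; first by apply: onS cm => u [].
    by apply: (@on_fglift _ _ (fun u => ctag u = m.+1)) => [u tu w /cbd_tag|u /von[]//]; rewrite tu => -[].
  have : on (fun u => (PhiU u /\ ctag u = m) \/ (PhiV u /\ ctag u = m)) (c - bd v).
    by move=> u uc; case: (vs u uc) => Pu; [left|right]; split=> //; exact: tv.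
  by move=> /on_or[cU [cV [? ? ?]]]; exists cU, cV.
have [x xon xd] : exists2 v, on (fun u => PhiU u /\ ctag u = n.+1) v & bd v = z.
  by apply: aU => //; apply: onS zon => u [[? ?] ->].
have [y yon yd] : exists2 v, on (fun u => PhiV u /\ ctag u = n.+1) v & bd v = z.
  by apply: aV => //; apply: onS zon => u [[? ?] ->].
(* Split the cycle as cU + cV up to a boundary. Then [bd cU] is a cycle of the intersection, equal
   to a z up to a boundary; after subtracting a (x - y) and this correction, the two halves are
   cycles in acyclic parts. *)
have key m c : cycle Phi m c -> exists a, [/\ bounds Phi m (c - (x - y) *~ a) & m != n.+1 -> a = 0].
  move=> [cm cd]; have [|v [cU [cV [von cUon cVon cE]]]] := sp m c cm; first by rewrite cd; exact: on0.
  have wE : bd cU = - bd cV.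
    have : bd (cU + cV) = 0 by rewrite -cE bdB cd bdK subr0.
    by rewrite bdD => /eqP; rewrite addr_eq0 => /eqP.
  have won : on (fun u => (PhiU u /\ PhiV u) /\ (ctag u).+1 = m) (bd cU).
    have H1 := on_bd fU cUon; have H2 := on_bd fV cVon.
    have {}H2 : on (fun u => PhiV u /\ (ctag u).+1 = m) (bd cU) by rewrite wE; exact: onN.
    by move=> u uw; have [? ?] := H1 u uw; have [? ?] := H2 u uw.
  have [a [e [eon ae am]]] : exists a e, [/\ on (fun u => (PhiU u /\ PhiV u) /\ ctag u = m) e,
      bd cU = z *~ a + bd e & m != n.+1 -> a = 0].
    case: m won {cm cUon cVon von} => [|m] won.
      exists 0, 0; split=> //; first exact: on0.
      rewrite bd0 mulr0z addr0; apply: on_false won => u [].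
      by [].
    have cw : cycle (fun u => PhiU u /\ PhiV u) m (bd cU).
      by split; [apply: onS won => u [? []]|exact: bdK].
    have [e|mn] := eqVneq m n.
      rewrite e in cw *; have [a [e' e'on e'd]] := zn _ cw.
      by exists a, e'; rewrite e'd addrC subrK eqxx.
    by have [e' e'on e'd] := z0 _ _ cw mn; exists 0, e'; rewrite mulr0z add0r e'd.
  exists a; split=> //.
  have [p pon pd] : exists2 v, on (fun u => PhiU u /\ ctag u = m.+1) v & bd v = cU - x *~ a - e.
    apply: aU; last by rewrite !bdB bdMz xd ae; abel.
    apply: onB; [apply: onB|].
    - by apply: onS cUon => u [? ->].
    - have [mn|/am ->] := eqVneq m n.+1; last by rewrite mulr0z; exact: on0.
      by apply: onMz; apply: onS xon => u [? ->]; rewrite mn.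
    - by apply: onS eon => u [[? ?] ->].
  have [r ron rd] : exists2 v, on (fun u => PhiV u /\ ctag u = m.+1) v & bd v = cV + y *~ a + e.
    apply: aV; last first.
      by rewrite !bdD bdMz yd -[bd cV]opprK -wE ae; abel.
    apply: onD; [apply: onD|].
    - by apply: onS cVon => u [? ->].
    - have [mn|/am ->] := eqVneq m n.+1; last by rewrite mulr0z; exact: on0.
      by apply: onMz; apply: onS yon => u [? ->]; rewrite mn.
    - by apply: onS eon => u [[? ?] ->].
  exists (v + p + r).
    by apply: onD; [apply: onD => //; exact: onUP|exact: onVP].
  have -> : c = cU + cV + bd v by rewrite -cE subrK.
  by rewrite !bdD pd rd mulrzBl; abel.
exists (x - y); split.
- split; first by apply: onB; [exact: onUP|exact: onVP].
  by rewrite bdB xd yd subrr.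
- move=> m c /key[a [ba am]] mn; move: ba; rewrite am // mulr0z subr0.
  by [].
- by move=> c /key[a [ba _]]; exists a.
- move=> a [v von vd].
  have xyUV : on (fun u => PhiU u \/ PhiV u) ((x - y) *~ a).
    by apply: onMz; apply: onB; [apply: onS xon => u []; left|apply: onS yon => u []; right].
  have [|t [vU [vV [ton vUon vVon vE]]]] := sp _ v von; first by rewrite vd.
  apply: zu; exists (x *~ a - bd vU); last first.
    by rewrite bdB bdK subr0 bdMz xd.
  have eE : x *~ a - bd vU = y *~ a + bd vV.
    have : bd vU + bd vV = (x - y) *~ a by rewrite -bdD -vE bdB bdK subr0 vd.
    by rewrite mulrzBl => /(canRL (addrK _)) ->; abel.
  have H1 : on (fun u => PhiU u /\ ctag u = n.+1) (x *~ a - bd vU).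
    by apply: onB; [exact: onMz|apply: onS (on_bd fU vUon) => u [? []]].
  have H2 : on (fun u => PhiV u /\ ctag u = n.+1) (x *~ a - bd vU).
    by rewrite eE; apply: onD; [exact: onMz|apply: onS (on_bd fV vVon) => u [? []]].
  by move=> u uw; have [? ?] := H1 u uw; have [? ?] := H2 u uw.
Qed.
End SphereLike.

(** * Topology of the one-point compactification and its star-shaped subsets *)

Section RepresentationSphere.
Variables (R : realType) (gT : finGroupType) (n : nat).
Variable rG : mx_representation R [set: gT]%G n.
Notation V := 'rV[R]_n.
Notation SV := (rep_sphere rG).
Notation C := (simp R SV).

Definition finpart (A : set V) : set SV := fun x : option V => if x is Some v then A v else False.
Definition infpart (A : set V) : set SV := fun x : option V => if x is Some v then A v else True.

Lemma nbhs_finpart (A : set V) (v : V) : nbhs v A -> nbhs (Some v : SV) (finpart A).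
Proof. by []. Qed.

Lemma nbhs_someP (v : V) (W : set SV) : nbhs (Some v : SV) W ->
  exists2 d : R, 0 < d & forall v', `|v - v'| < d -> W (Some v').
Proof.
move=> nW; have {}nW : nbhs v (fun w => W (Some w)) by exact: nW.
by move/rV_nbhsP: nW.
Qed.

(** The compactification is defined by complements of closed compact sets; in finite dimension these
    may be taken to be balls. *)
Lemma nbhs_noneP (W : set SV) : nbhs (None : SV) W <->
  W None /\ exists M : R, forall v, M < `|v| -> W (Some v).
Proof.
split=> [[K [cK _] KW]|[W0 [M WM]]].
  split; first by apply: KW; right.
  have [M [_ HM]] := compact_bounded cK; exists (M + 1) => v Mv; apply: KW; left; exists v => // Kv.
  have := HM (M + 1); rewrite ltrDl ltr01 => /(_ isT v Kv) /=.
  by rewrite leNgt Mv.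
pose B : set V := [set v | `|v| <= M].
exists B => [|[v|] //=]; last first.
  by case=> [[w nw [<-]]|//]; apply: WM; rewrite ltNge; apply/negP.
have clB : closed B.
  apply: (@preimage_closed _ _ (fun v : V => `|v|) [set y | y <= M]).
    by move=> x _; exact: norm_continuous.
  exact: closed_le.
split => //; apply: bounded_closed_compact => //.
exists M; split; first exact: num_real.
by move=> N MN v /= vB; exact: le_trans vB (ltW MN).
Qed.

Lemma open_infpart_neq0 : open (infpart [set v | v != 0]).
Proof.
rewrite openE => -[v|] /= v0; rewrite /interior.
  apply: (@nbhs_finpart [set v | v != 0]).
  apply/rV_nbhsP; exists `|v|; first by rewrite normr_gt0.
  by move=> w vw; apply: contraTneq vw => ->; rewrite subr0 ltxx.
apply/nbhs_noneP; split=> //; exists 0 => v /=.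
by rewrite normr_gt0.
Qed.

Lemma star_acyclic (A : set V) (e : V) : A e ->
  (forall t v, 0 <= t <= 1 -> A v -> A ((1 - t) *: v + t *: e)) ->
  @acyclic gT C (inside (finpart A)).
Proof.
move=> Ae Ast.
pose h (t : R) (x : SV) : SV := omap (fun v => (1 - t) *: v + t *: e) x.
apply: (@contractible_acyclic R gT SV (finpart A) (Some e) h) => //.
- by move=> t [v|] //= ti Av; exact: Ast.
- by move=> [v|] //= _; rewrite subr0 scale1r scale0r addr0.
- by move=> [v|] //= _; rewrite subrr scale0r add0r scale1r.
move=> t [v|] //= W /andP[t0 t1] Av /nbhs_someP[d d0 dW].
pose m := `|v - e| + 1; have m0 : 0 < m by rewrite ltr_pwDr.
exists (d / 2 / m); first by rewrite !divr_gt0.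
exists (finpart [set v' | `|v - v'| < d / 2]).
  by apply/nbhs_finpart/rV_nbhsP; exists (d / 2); rewrite ?divr_gt0.
move=> t' [v'|] //= /andP[t'0 t'1] tt' vv' Av'; apply: dW.
have -> : (1 - t) *: v + t *: e - ((1 - t') *: v' + t' *: e) =
    (t' - t) *: (v - e) + (1 - t') *: (v - v').
  by apply/rowP => j; rewrite !mxE; ring.
apply: le_lt_trans (ler_normD _ _) _; rewrite !normrZ [d]splitr.
apply: ltr_leD.
  rewrite distrC; apply: (@le_lt_trans _ _ (`|t - t'| * m)).
    by rewrite ler_wpM2l // lerDl.
  by rewrite -ltr_pdivlMr.
apply: le_trans (ltW vv'); rewrite ger0_norm ?subr_ge0 // ler_piMl //.
by rewrite gerBl.
Qed.

(** Scaling by 1 / (1 - t) moves [A] to the point at infinity, reached at t = 1. The origin is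
    excluded because scaling does not move it. *)
Lemma infstar_acyclic (A : set V) : ~ A 0 ->
  (forall c v, 1 <= c -> A v -> A (c *: v)) ->
  @acyclic gT C (inside (infpart A)).
Proof.
move=> A0 Ast.
pose h (t : R) (x : SV) : SV := if t == 1 then None else omap (fun v => (1 - t)^-1 *: v) x.
have ci (t : R) : 0 <= t <= 1 -> t != 1 -> 1 <= (1 - t)^-1.
  move=> /andP[t0 t1] t1'; have p : 0 < 1 - t by rewrite subr_gt0 lt_neqAle t1'.
  by rewrite invf_ge1 // gerBl.
apply: (@contractible_acyclic R gT SV (infpart A) None h) => //.
- move=> t [v|] ti Av; rewrite /h; case: eqVneq => // t1 /=.
  by apply: Ast => //; exact: ci.
- by move=> [v|] _; rewrite /h eq_sym oner_eq0 //= subr0 invr1 scale1r.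
- by move=> x _; rewrite /h eqxx.
move=> t [v|] W ti Av nW; last first.
  have {nW} /nbhs_noneP[W0 [M WM]] : nbhs (None : SV) W by move: nW; rewrite /h; case: ifP.
  exists 1 => //; exists (infpart [set v | M < `|v|]).
    by apply/nbhs_noneP; split=> //; exists M.
  move=> t' [v|] t'i _ /= Mv Av'; rewrite /h; case: eqVneq => // t1.
  apply: WM; apply: lt_le_trans Mv _; rewrite normrZ ler_peMl //.
  by apply: le_trans (ci _ t'i t1) (ler_norm _).
have v0 : v != 0 by apply: contra_notN A0 => /eqP <-.
have nv : 0 < `|v| by rewrite normr_gt0.
have [t1|t1] := eqVneq t 1.
  have {nW} /nbhs_noneP[W0 [M WM]] : nbhs (None : SV) W by move: nW; rewrite /h t1 eqxx.
  (* A vector within |v| / 2 of [v] has norm above |v| / 2, so dividing it by 1 - t' < |v| / (2 M')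
     takes it beyond radius [M'], which is larger than [M] and positive. *)
  pose M' := Num.max M 0 + 1; have M'0 : 0 < M' by rewrite ltr_pwDr // le_max lexx orbT.
  exists (`|v| / 2 / M'); first by rewrite !divr_gt0.
  exists (finpart [set v' | `|v - v'| < `|v| / 2]).
    by apply/nbhs_finpart/rV_nbhsP; exists (`|v| / 2); rewrite ?divr_gt0.
  move=> t' [v'|] //= t'i tt' vv' Av'; rewrite /h; case: eqVneq => // t1'.
  apply: WM; have p : 0 < 1 - t' by rewrite subr_gt0 lt_neqAle t1'; case/andP: t'i.
  rewrite normrZ gtr0_norm ?invr_gt0 // mulrC ltr_pdivlMr //.
  rewrite t1 gtr0_norm // ltr_pdivlMr // in tt'.
  have nv' : `|v| / 2 < `|v'|.
    by have := ler_distD v' v 0; rewrite !subr0; lra.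
  apply: le_lt_trans (_ : (1 - t') * M' < _); last exact: lt_trans nv'.
  rewrite mulrC ler_pM2l //.
  by rewrite /M'; apply: le_trans (_ : Num.max M 0 <= _); [rewrite le_max lexx|rewrite lerDl].
have {nW} : nbhs (Some ((1 - t)^-1 *: v) : SV) W by move: nW; rewrite /h (negPf t1).
move=> /nbhs_someP[d d0 dW].
have t1' : t < 1 by rewrite lt_neqAle t1; case/andP: ti.
pose k := (1 - t)^-1; have cti : {for t, continuous (fun x : R => (1 - x)^-1)}.
  apply: continuousV; first by rewrite subr_eq0 eq_sym.
  by apply: continuousB; [exact: cst_continuous|exact: cvg_id].
pose e1 := Num.min 1 (d / 2 / (`|v| + 1)).
have e10 : 0 < e1 by rewrite lt_min ltr01 !divr_gt0 // ltr_pwDr.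
have : \forall x \near t, `|k - (1 - x)^-1| < e1.
  by have /cvgrPdist_lt/(_ _ e10) := cti.
move=> /nbhs_normP[d1 /= d10 Hd1].
exists (Num.min d1 (1 - t)); first by rewrite lt_min d10 subr_gt0.
pose d2 := d / 2 / (`|k| + 1); have d20 : 0 < d2 by rewrite !divr_gt0 // ltr_pwDr.
exists (finpart [set v' | `|v - v'| < d2]).
  by apply/nbhs_finpart/rV_nbhsP; exists d2.
move=> t' [v'|] //= t'i; rewrite lt_min => /andP[td1 tt1] vv' Av'.
have t'1 : t' != 1.
  by apply: contraTneq tt1 => ->; rewrite -leNgt ler0_norm ?opprB // subr_le0 ltW.
rewrite /h (negPf t'1); apply: dW; rewrite -/k.
have := Hd1 t' td1; set k' := (1 - t')^-1; rewrite /= lt_min => /andP[kk1 kk2].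
have -> : k *: v - k' *: v' = (k - k') *: v + k' *: (v - v').
  by apply/rowP => j; rewrite !mxE; ring.
apply: le_lt_trans (ler_normD _ _) _; rewrite !normrZ [d]splitr.
apply: ltrD.
  apply: (@le_lt_trans _ _ (`|k - k'| * (`|v| + 1))); first by rewrite ler_wpM2l // lerDl.
  by rewrite -ltr_pdivlMr // ltr_pwDr.
apply: (@le_lt_trans _ _ ((`|k| + 1) * `|v - v'|)).
  rewrite ler_wpM2r // -lerBlDl; apply: le_trans (ltW kk1).
  by apply: le_trans (ler_norm _) _; rewrite distrC; exact: ler_dist_dist.
by rewrite mulrC -ltr_pdivlMr // ltr_pwDr.
Qed.

Lemma inside_face (A : set SV) : face_closed (X := C) (inside A).
Proof. by move=> s u As us; exact: inside_bd us As. Qed.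

Lemma insideS (A B : set SV) : A `<=` B -> forall u : C, inside A u -> inside B u.
Proof. by move=> AB u Au x; apply: AB. Qed.

(** [L] is arbitrary: only the openness of [U] and [V0] enters, after pulling back to a simplex that
    already lies in [L]. *)
Lemma open_cover_sphere (L U V0 : set SV) k z :
  open U -> open V0 ->
  acyclic (Y := C) (inside (L `&` U)) -> acyclic (Y := C) (inside (L `&` V0)) ->
  sphere_like (X := C) (inside (L `&` (U `&` V0))) k z ->
  exists z', sphere_like (X := C) (inside (L `&` (U `|` V0))) k.+1 z'.
Proof.
move=> oU oV aU aV sz.
apply: (@mayer_vietoris _ C _ (inside (L `&` U)) (inside (L `&` V0)) k z) => //.
- exact: inside_face.
- exact: inside_face.
- by apply: insideS => x [? ?]; split=> //; left.
- by apply: insideS => x [? ?]; split=> //; right.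
- move=> m c con cd; pose W (b : bool) := if b then L `&` U else L `&` V0.
  have smE (u : C) : small W u <-> inside (L `&` U) u \/ inside (L `&` V0) u.
    by split=> [[[] ?]|[?|?]]; [left|right|exists true|exists false].
  have [||v [vA vt vs]] := @small_homologous R SV bool true W c.
  - move=> s /con[sL _] x; case: (sL x) => Lx [Ux|Vx]; [exists true|exists false].
      have : nbhs (x : std_simplex R (tag s)) (tagged s @^-1` U).
        by apply: (@cts_fun _ _ (tagged s)); exact: open_nbhs_nbhs.
      by apply: filterS => y Uy; split=> //; case: (sL y).
    have : nbhs (x : std_simplex R (tag s)) (tagged s @^-1` V0).
      by apply: (@cts_fun _ _ (tagged s)); exact: open_nbhs_nbhs.
    by apply: filterS => y Uy; split=> //; case: (sL y).
  - by apply: onS cd => u /smE.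
  exists v; last by apply: onS vs => u /smE.
  apply: onI; [apply: vA|apply: vt]; by apply: onS con => u [].
have -> : (fun u : C => inside (L `&` U) u /\ inside (L `&` V0) u) = inside (L `&` (U `&` V0)).
  apply/funext => u; apply/propext; split=> [[uU uV] x|uUV].
    by have [? ?] := uU x; have [? ?] := uV x.
  by split=> x; have [? [? ?]] := uUV x.
exact: sz.
Qed.

(** The empty set is the sphere of dimension -1, with the empty simplex as generator; here the
    induction on the dimension starts. *)
Lemma empty_simplex_sphere (A : set SV) : (forall x, ~ A x) ->
  exists z, sphere_like (X := C) (inside A) 0 z.
Proof.
move=> A0; have noelt (x : std_simplex R 0) : False.
  by have [_] := std_simplex_valP x; rewrite big_ord0 => /eqP; rewrite eq_sym oner_eq0.
have c0 : continuous (fun _ : std_simplex R 0 => None : SV) by move=> x; case: (noelt x).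
pose s0 : C := mk_simplex c0.
have tag0 (u : C) : ctag u = 0%N -> u = s0.
  case: u => m u /= m0; rewrite [m]m0 /= in u *.
  rewrite -[LHS]mk_simplexK; apply: eq_mk_simplex => x; by case: (noelt x).
have tagA (u : C) : inside A u -> ctag u = 0%N.
  case: u => -[|m] u Au //; case: (A0 (u (mkpt (vtx_in (k := 0) (ltn0Sn m))))).
  exact: Au.
have cE (c : chain C) : on (fun u => inside A u) c -> exists a, c = << s0 >> *~ a.
  apply: (@on_ind _ (inside A) (fun c => exists a, c = << s0 >> *~ a)) => [|x y [a ->] [b ->]|u Au].
  - by exists 0; rewrite mulr0z.
  - by exists (a - b); rewrite mulrzBr.
  - by exists 1; rewrite mulr1z (tag0 u (tagA u Au)).
exists << s0 >>; split.
- split; last by rewrite bdU.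
  by apply: onU; split=> // x; case: (noelt x).
- move=> m c [con _] m0; exists 0; first exact: on0.
  rewrite bd0; suff -> : c = 0 by [].
  by apply: (on_false _ con) => u [/tagA -> um]; rewrite -um eqxx in m0.
- move=> c [con _]; have [|a ->] := cE c; first by apply: onS con => u [].
  by exists a, 0; [exact: on0|rewrite subrr bd0].
- move=> a [v von vd].
  have v0 : v = 0.
    by apply: (on_false _ von) => u [/tagA ->].
  move: vd; rewrite v0 bd0 => /esym/(congr1 (coeff s0)).
  rewrite coeff0 -freegUE coeffU eqxx mulr1.
  by [].
Qed.
End RepresentationSphere.

Section LinearSphere.
Variables (R : realType) (gT : finGroupType) (n d : nat).
Variable rG : mx_representation R [set: gT]%G n.
Variables (B : 'M[R]_(d, n)) (M : 'M[R]_(n, d)).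
Hypothesis BM : B *m M = 1%:M.
Notation V := 'rV[R]_n.
Notation SV := (rep_sphere rG).
Notation C := (simp R SV).

Let L : set V := [set v | v = v *m M *m B].
(** Within [L], the row space of [B] with coordinates read off by [M], this is a homotopy sphere of
    dimension m - 1. Admitting one more coordinate suspends it. *)
Let nz m (v : V) := exists2 i : 'I_d, (i < m)%N & (v *m M) 0 i != 0.

Lemma open_finpart (O : set V) : (forall v, O v -> nbhs v O) -> open (finpart (rG := rG) O).
Proof.
move=> oO; rewrite openE => -[v|] //= Ov; rewrite /interior.
exact: nbhs_finpart (oO v Ov).
Qed.

Lemma coordM_cts (i : 'I_d) : continuous (fun v : V => (v *m M) 0 i).
Proof.
move=> v; apply: (@continuous_comp _ _ _ (fun v : V => v *m M) (fun w : 'rV[R]_d => w 0 i)).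
  exact: mulmxr_continuous.
exact: coord_cts.
Qed.

Lemma nbhs_coord (i : 'I_d) (P : set R) (v : V) : open P -> P ((v *m M) 0 i) ->
  nbhs v [set w : V | P ((w *m M) 0 i)].
Proof. by move=> oP Pv; apply: (@coordM_cts i v P); exact: open_nbhs_nbhs. Qed.

Lemma open_nz m v : nz m v -> nbhs v [set w | nz m w].
Proof.
case=> i im vi; have : nbhs v [set w : V | (fun x : R => x != 0) ((w *m M) 0 i)].
  by apply: (@nbhs_coord i (fun x => x != 0) v _ vi); exact: open_neq.
by apply: filterS => w wi; exists i.
Qed.

(** The centre is [s] times the m-th basis vector. Moving towards it only scales the other
    coordinates, so a nonzero one stays nonzero before t = 1, and at t = 1 the m-th coordinate has
    the right sign. *)
Lemma half_star (m : 'I_d) (s : R) : s = 1 \/ s = -1 ->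
  acyclic (Y := C) (inside (finpart L `&` finpart [set v | nz m v \/ 0 < s * (v *m M) 0 m])).
Proof.
move=> s1; pose e : V := s *: row m B.
have eM : e *m M = s *: delta_mx 0 m by rewrite -scalemxAl -row_mul BM row1.
have ss : s * s = 1 by case: s1 => ->; rewrite ?mulrNN mulr1.
have -> : finpart L `&` finpart [set v | nz m v \/ 0 < s * (v *m M) 0 m] =
   finpart (rG := rG) [set v | L v /\ (nz m v \/ 0 < s * (v *m M) 0 m)].
  by apply/seteqP; split=> -[v|] //= [].
apply: (@star_acyclic _ _ _ _ _ e).
  split; first by rewrite /L /= eM -scalemxAl -rowE.
  by right; rewrite eM !mxE !eqxx mulr1 ss.
move=> t v /andP[t0 t1] [Lv cv]; split.
  rewrite /L /= !mulmxDl -!scalemxAl -[X in _ = X + _](congr1 _ Lv).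
  by rewrite -row_mul BM row1 -rowE.
have vM i : (((1 - t) *: v + t *: e) *m M) 0 i = (1 - t) * (v *m M) 0 i + t * (s * (i == m)%:R).
  by rewrite mulmxDl -[((1 - t) *: v) *m _]scalemxAl -[(t *: e) *m _]scalemxAl eM !mxE eqxx andTb.
have [te|t1'] := eqVneq t 1.
  by right; rewrite vM te subrr mul0r add0r mul1r eqxx mulr1 ss.
have p : 0 < 1 - t by rewrite subr_gt0 lt_neqAle t1'.
case: cv => [[i im vi]|vm]; [left|right].
  have im' : (i == m) = false by apply/negP => /eqP e'; rewrite e' ltnn in im.
  exists i => //; rewrite vM im' !mulr0 addr0; apply: mulf_neq0 => //.
  by rewrite gt_eqF.
rewrite vM eqxx mulr1 mulrDr (mulrCA s t) ss mulr1 (mulrCA s).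
by rewrite ltr_pwDl // mulr_gt0.
Qed.

Lemma nz_sphere m : (m <= d)%N ->
  exists z, sphere_like (X := C) (inside (finpart L `&` finpart [set v | nz m v])) m z.
Proof.
elim: m => [|m IH] md.
  by apply: empty_simplex_sphere => -[v|] [] //= _ [].
have [z sz] := IH (ltnW md).
pose i := Ordinal md.
(* The two sides of a coordinate hyperplane, each enlarged by the points of the previous stage,
   which are exactly their intersection. *)
pose O s : set V := [set v | nz m v \/ 0 < s * (v *m M) 0 i].
have oO s v : O s v -> nbhs v (O s).
  case=> [/open_nz|si]; first by apply: filterS => w ?; left.
  have : nbhs v [set w : V | [set x : R | 0 < s * x] ((w *m M) 0 i)].
    apply: nbhs_coord si.
    apply: (@open_comp _ _ (fun x : R => s * x) [set y | 0 < y]); last exact: open_gt.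
    by move=> x _; apply: continuousM; [exact: cst_continuous|exact: cvg_id].
  by apply: filterS => w ?; right.
have -> : finpart L `&` finpart [set v | nz m.+1 v] =
   finpart L `&` (finpart (rG := rG) (O 1) `|` finpart (O (-1))).
  apply/seteqP; split=> -[v|] //=; last first.
  - by case=> _ [].
  - case=> Lv [] [[j jm vj]|].
    + by split=> //; exists j => //; exact: ltnW.
    + by rewrite mul1r => v0; split=> //; exists i => //; rewrite gt_eqF.
    + by split=> //; exists j => //; exact: ltnW.
    + by rewrite mulN1r oppr_gt0 => v0; split=> //; exists i => //; rewrite lt_eqF.
  - by case.
  - case=> Lv [j jm vj]; split=> //; move: jm; rewrite ltnS leq_eqVlt => /predU1P[e|jm]; last by left; left; exists j.
    have ej : j = i by apply: val_inj.
    rewrite ej in vj; case: (ltgtP ((v *m M) 0 i) 0) => [v0|v0|v0].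
    + by right; right; rewrite mulN1r oppr_gt0.
    + by left; right; rewrite mul1r.
    + by rewrite v0 eqxx in vj.
apply: (@open_cover_sphere _ _ _ _ _ _ _ m z).
- by apply: open_finpart => v; exact: oO.
- by apply: open_finpart => v; exact: oO.
- by apply: (@half_star i); left.
- by apply: (@half_star i); right.
have -> // : finpart L `&` (finpart (O 1) `&` finpart (O (-1))) = finpart L `&` finpart (rG := rG) [set v | nz m v].
apply/seteqP; split=> -[v|] //= [Lv //]; last by move=> ?; split=> //; split; left.
case=> [[nv|v0] [nv'|v1]]; try by split.
by exfalso; rewrite mulN1r in v1; rewrite mul1r in v0; lra.
Qed.

(** The compactified subspace is covered by the subspace, which contracts to 0, and by the
    complement of 0, which contracts to infinity. *)
Lemma linear_sphere : exists z, sphere_like (X := C) (inside (infpart L)) d.+1 z.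
Proof.
have [z sz] := nz_sphere (leqnn d).
have L0 : L 0 by rewrite /L /= !mul0mx.
have nzE v : L v -> nz d v <-> v != 0.
  move=> Lv; split=> [[i _]|v0]; first by apply: contraNneq => ->; rewrite mul0mx mxE.
  have : v *m M != 0 by apply: contraNneq v0 => vM; rewrite Lv vM mul0mx.
  by move=> /rV0Pn[i vi]; exists i.
have -> : infpart L = infpart L `&` (finpart (rG := rG) setT `|` infpart [set v | v != 0]).
  by apply/seteqP; split=> -[v|] //=; [move=> ?; split=> //; left|move=> _; split=> //; right|case].
apply: (@open_cover_sphere _ _ _ _ _ _ _ d z).
- by apply: open_finpart => v _; exact: filterT.
- exact: open_infpart_neq0.
- have -> : infpart L `&` finpart setT = finpart (rG := rG) L.
    by apply/seteqP; split=> -[v|] //= [].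
  apply: (@star_acyclic _ _ _ _ _ 0) => // t v _ Lv.
  by rewrite /L /= scaler0 addr0 -!scalemxAl -Lv.
- have -> : infpart L `&` infpart [set v | v != 0] = infpart (rG := rG) [set v | L v /\ v != 0].
    by apply/seteqP; split=> -[v|] //= [].
  apply: infstar_acyclic => [[_]|c v c1 [Lv v0]]; first by rewrite eqxx.
  split; first by rewrite /L /= -!scalemxAl -Lv.
  by rewrite scaler_eq0 negb_or v0 andbT gt_eqF // (lt_le_trans ltr01).
have -> // : infpart L `&` (finpart setT `&` infpart [set v | v != 0]) =
  finpart L `&` finpart (rG := rG) [set v | nz d v].
apply/seteqP; split=> -[v|] //=; first by case=> Lv [_ v0]; split=> //; exact/(nzE v Lv).
- by case=> _ [].
- by case=> Lv /(nzE v Lv).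
- by case.
Qed.
End LinearSphere.

Local Close Scope classical_set_scope.

(** * Equivariant finite dimensionality of representation spheres *)

Local Open Scope classical_set_scope.

Section Stabilizers.
Variables (R : realType) (gT : finGroupType) (X : gspace gT).
Notation C := (simp R X).
Implicit Types (s u : C) (g : gT).

Lemma inside_dom (A : set X) s u : u \in dom (cbd s) -> inside A s -> inside A u.
Proof. exact: (@inside_bd R X A s u). Qed.

Lemma inside_sub (A B : set X) s : A `<=` B -> inside A s -> inside B s.
Proof. by move=> AB As x; apply: AB. Qed.

Lemma simplex_fixP s g : cact s g = s <-> forall x, gs_act (tagged s x) g = tagged s x.
Proof.
split=> [|fs]; last by rewrite -[RHS]mk_simplexK; apply: eq_mk_simplex => x; exact: fs.
by case: s => m s H x; have /= e := eq_from_Tagged H; rewrite -[in RHS]e.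
Qed.

Definition fixset (P : gT -> Prop) : set X := [set x | forall g, P g -> gs_act x g = x].
Definition stab (T : Type) (a : T -> gT -> T) (t : T) (g : gT) : Prop := a t g = t.

Lemma inside_stab s : inside (fixset (stab (@cact gT C) s)) s.
Proof. by move=> x g /simplex_fixP. Qed.

Lemma inside_fix P s g : inside (fixset P) s -> P g -> cact s g = s.
Proof. by move=> sP Pg; apply/simplex_fixP => x; exact: sP. Qed.

Lemma fixsetS (P Q : gT -> Prop) : (forall g, Q g -> P g) -> fixset P `<=` fixset Q.
Proof. by move=> QP x xP g /QP/xP. Qed.

Lemma stab_face s u g : u \in dom (cbd s) -> cact s g = s -> cact u g = u.
Proof.
move=> us sg; apply: (@inside_fix (stab (@cact gT C) s)) => //.
exact: (inside_dom us (@inside_stab s)).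
Qed.

Lemma fixset_act (T : Type) (a : T -> gT -> T) t g x :
  (forall t g h, a t (g * h)%g = a (a t g) h) -> (forall t, a t 1%g = t) ->
  fixset (stab a t) x -> fixset (stab a (a t g)) (gs_act x g).
Proof.
move=> aM a1 xt h; rewrite /stab -aM => e.
have : a t (g * h * g^-1)%g = t by rewrite aM e -aM mulgV a1.
by move=> /xt e'; rewrite -{2}e' -!gs_actM mulgKV.
Qed.

Lemma inside_act (A B : set X) s g : (forall x, A x -> B (gs_act x g)) ->
  inside A s -> inside B (cact s g).
Proof. by move=> AB As x; apply: AB; exact: As. Qed.

Lemma insideI (A B : set X) s : inside (A `&` B) s <-> inside A s /\ inside B s.
Proof.
by split=> [AB|[As Bs] x]; [split=> x; case: (AB x)|split; [exact: As|exact: Bs]].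
Qed.

Definition invariant_set (A : set X) := forall x g, A x -> A (gs_act x g).

Definition invariant (A : C -> Prop) := forall s g, A s -> A (cact s g).

Lemma inside_invariant (A : set X) : invariant_set A -> invariant (inside A).
Proof. by move=> iA s g; apply: inside_act => x; exact: iA. Qed.

(* The complex spanned by [A] is equivariantly a retract up to homotopy of one
   concentrated in tags at most [d]. *)
Definition findim (A : C -> Prop) (d : nat) : Prop :=
  exists2 h : C -> chain C, equivar h & forall s, A s ->
    on (fun u => A u /\ ctag u = (ctag s).+1) (h s) /\
    ((d < ctag s)%N -> bd (h s) + fglift h (cbd s) = << s >>).

Lemma equiv_bd (h : C -> chain C) : equivar h -> equivar (fun s => bd (h s)).
Proof. by move=> eh s g; rewrite eh bd_act. Qed.

Lemma equiv_cbd (Y : gcomplex gT) (h : C -> chain Y) : equivar h -> equivar (fun s => fglift h (cbd s)).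
Proof. by move=> eh s g; rewrite cbd_act -(equiv_fglift _ _ eh). Qed.

Lemma equivD (Y Z : gcomplex gT) (h k : Y -> chain Z) : equivar h -> equivar k -> equivar (fun t => h t + k t).
Proof. by move=> eh ek t g; rewrite eh ek actD. Qed.

Lemma equivB (Y Z : gcomplex gT) (h k : Y -> chain Z) : equivar h -> equivar k -> equivar (fun t => h t - k t).
Proof. by move=> eh ek t g; rewrite eh ek actB. Qed.

Lemma equivU : equivar (fun s : C => << s >>).
Proof. by move=> s g; rewrite actU. Qed.

Lemma equiv_comp (Y Z W : gcomplex gT) (k : Z -> chain W) (h : Y -> chain Z) :
  equivar k -> equivar h -> equivar (fun t => fglift k (h t)).
Proof. by move=> ek eh t g; rewrite eh (equiv_fglift _ _ ek). Qed.

(** The number of subdivisions varies from simplex to simplex, and the homotopy absorbs the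
    discrepancy along faces. Filling inside the fixed points of the stabilizer of [s] makes the
    choice consistent along orbits. *)
Lemma small_retraction (I : Type) (i0 : I) (U : I -> set X) (W : set X) :
  invariant_set W -> invariant (small U) ->
  (forall s, inside W s -> covered U s) ->
  exists2 h : C -> chain C, equivar h & forall s, inside W s ->
    on (fun u => inside W u /\ ctag u = (ctag s).+1) (h s) /\
    on (fun u => (inside W u /\ small U u) /\ ctag u = ctag s)
       (<< s >> - bd (h s) - fglift h (cbd s)).
Proof.
move=> iW iU cW.
pose F s := fixset (stab (@cact gT C) s).
have [h eh hP] : exists2 h : C -> chain C, equivar h & forall s, inside W s ->
    on (fun u => inside (W `&` F s) u /\ ctag u = (ctag s).+1) (h s) /\
    on (small U) (<< s >> - bd (h s) - fglift h (cbd s)).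
  apply: (@equivariant_choice _ C C (inside W) (fun s v x =>
    on (fun u => inside (W `&` F s) u /\ ctag u = (ctag s).+1) v /\
    on (small U) (<< s >> - bd v - fglift x (cbd s)))).
  - by move=> s u Ws us; exact: inside_dom us Ws.
  - exact: inside_invariant.
  - by move=> s v x x' /eq_fglift ->.
  - move=> s g v x ex Ws [von vs]; split.
      apply: on_actW von => u [uW ut]; rewrite !ctag_act; split=> //.
      apply: inside_act uW => y [Wy Fy]; split; first exact: iW.
      by apply: fixset_act Fy; [exact: cactM|exact: cact1].
    have -> : << cact s g >> - bd (act g v) - fglift x (cbd (cact s g)) =
        act g (<< s >> - bd v - fglift x (cbd s)).
      by rewrite cbd_act -/(act g _) (equiv_fglift _ _ ex) bd_act !actB actU.
    by apply: (@on_actW _ C (small U) (small U)) vs => u; exact: iU.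
  - move=> s g v x Ws [von _] sg; apply: act_id => u /von[/insideI[_ uF] _].
    exact: inside_fix uF sg.
  - move=> s x ex Ws H; pose y := << s >> - fglift x (cbd s).
    have yin : on (fun u => inside (W `&` F s) u /\ ctag u = ctag s) y.
      apply: onB; first by apply: onU; split=> // z; split; [exact: Ws|exact: inside_stab].
      apply: on_fglift (@on_dom _ _) => t ts; have [xon _] := H t ts.
      apply: onS xon => u [/insideI[uW uF] ut]; rewrite ut (cbd_tag ts); split=> //.
      apply/insideI; split=> //; apply: inside_sub (uF); apply: fixsetS => g.
      exact: stab_face ts.
    (* The boundary of [y] is the sum of the corrected faces, which are small by induction. *)
    have ysm : on (small U) (bd y).
      have -> : bd y = fglift (fun t => << t >> - bd (x t) - fglift x (cbd t)) (cbd s).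
        rewrite !fglift_sub fglift_id -(fglift_comp (@cbd gT C)) cbdK fgliftE0 subr0.
        by rewrite bdB bdU; congr (_ - _); rewrite /bd fglift_comp.
      by apply: on_fglift (@on_dom _ _) => t ts; have [_] := H t ts.
    have [||v [vA vt vs]] := @small_homologous R X I i0 U y.
    + by move=> u /yin[/insideI[/cW]].
    + exact: ysm.
    exists v; split.
      by apply: onI; [apply: vA|apply: vt]; apply: onS yin => u [].
    by move: vs; rewrite /y; congr (on _ _); rewrite -!addrA; congr (_ + _); exact: addrC.
exists h => // s Ws; have [hon hs] := hP s Ws; split.
  by apply: onS hon => u [/insideI[]].
have H1 : on (fun u => inside W u /\ ctag u = ctag s) (<< s >> - bd (h s) - fglift h (cbd s)).
  apply: onB; [apply: onB|].
  - by apply: onU.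
  - apply: onS (on_bd (fun s u As us => inside_dom us As) hon) => u [/insideI[? _] [? ]].
    by [].
  - apply: on_fglift (@on_dom _ _) => t ts; have [] := hP t (inside_dom ts Ws).
    by move=> ton _; apply: onS ton => u [/insideI[? _] ->]; rewrite (cbd_tag ts).
by move=> u us; have [? ?] := H1 u us; split=> //; split=> //; exact: hs.
Qed.

Lemma findim_small (I : Type) (i0 : I) (U : I -> set X) (W : set X) d :
  invariant_set W -> invariant (small U) ->
  (forall s, inside W s -> covered U s) ->
  findim (fun s => inside W s /\ small U s) d -> findim (inside W) d.
Proof.
move=> iW iU cW [H eH HP].
have [h eh hP] := small_retraction i0 iW iU cW.
(* [r] is a chain map into small chains, homotopic to the identity by [h]; composing the contraction
   [H] of small chains with it contracts everything in high tags. *)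
pose r s := << s >> - bd (h s) - fglift h (cbd s).
have er : equivar r.
  by apply: equivB; [apply: equivB; [exact: equivU|exact: equiv_bd]|exact: equiv_cbd].
exists (fun s => h s + fglift H (r s)); first by apply: equivD => //; exact: equiv_comp.
move=> s Ws; have [hon hs] := hP s Ws; split.
  apply: onD => //; apply: on_fglift hs => u [[uW uU] ut].
  by have [Hon _] := HP u (conj uW uU); apply: onS Hon => w [[? _] ->]; rewrite ut.
move=> ds; rewrite fglift_add bdD.
have -> : fglift (fun s => fglift H (r s)) (cbd s) = fglift H (bd (r s)).
  rewrite -fglift_comp; congr (fglift H _).
  rewrite /r !bdB bdU bdK subr0 !fglift_sub fglift_id -(fglift_comp (@cbd gT C)) cbdK fgliftE0 subr0.
  by congr (_ - _); rewrite /bd !fglift_comp.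
have -> : bd (fglift H (r s)) = r s - fglift H (bd (r s)).
  apply/eqP; rewrite eq_sym subr_eq; apply/eqP.
  rewrite /bd !fglift_comp -fglift_add -[LHS]fglift_id; apply: eq_fglift => u.
  by move=> /hs[uA ut]; have [_ ->] := HP u uA; rewrite ?ut.
by rewrite /r; abel.
Qed.

(** The carriers are the points of [A] fixed by stabilizers. Nothing is prescribed ([m = 0]), so
    even the empty simplex is filled. *)
Lemma equivariant_contraction (A : set X) : invariant_set A ->
  (forall s, inside A s -> acyclic (Y := C) (inside (A `&` fixset (stab (@cact gT C) s)))) ->
  exists2 k : C -> chain C, equivar k & forall s, inside A s ->
    on (fun u => inside A u /\ ctag u = (ctag s).+1) (k s) /\
    bd (k s) + fglift k (cbd s) = << s >>.
Proof.
move=> iA aA; pose F s := fixset (stab (@cact gT C) s).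
have [k ek kP] : exists2 k : C -> chain C, equivar k & forall s, inside A s ->
    [/\ on (fun u => inside (A `&` F s) u /\ ctag u = (ctag s + 1)%N) (k s),
        bd (k s) + fglift k (cbd s) *~ 1 = << s >> & (ctag s < 0)%N -> k s = 0].
  apply: (@carrier_ext _ C C (inside A) (fun s => inside (A `&` F s)) 1 0 1
    (fun s => << s >>) (fun=> 0)) => //.
  - by move=> s u As us; exact: inside_dom us As.
  - exact: inside_invariant.
  - move=> s t u As ts /insideI[uA uF]; apply/insideI; split=> //.
    by apply: inside_sub (uF); apply: fixsetS => g; exact: stab_face ts.
  - move=> s u g As; apply: inside_act => x [Ax Fx]; split; first exact: iA.
    by apply: fixset_act Fx; [exact: cactM|exact: cact1].
  - by move=> s u g As /insideI[_ uF] sg; exact: inside_fix uF sg.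
  - by move=> s g; rewrite actU.
  - by move=> s g; rewrite act0.
  - move=> s As _; apply: onU; split; last by rewrite addn1.
    by apply/insideI; split=> //; exact: inside_stab.
  - by move=> s As; rewrite bdU fglift_id.
  - by move=> s As _; exact: aA.
exists k => // s As; have [kon kd _] := kP s As; split; last by rewrite -kd.
by apply: onS kon => u [/insideI[? _] ->]; rewrite addn1.
Qed.

(** Contracting by [k] on simplices in [A] and by [l] on the others fails only along faces that pass
    into [A]. These lie in the intersection, where [l - k] anticommutes with the boundary, so the
    contraction [h'] of the intersection corrects the defect. *)
Lemma findim_union (A B : set X) d : invariant_set A -> invariant_set B ->
  (forall s, covered (fun b : bool => if b then A else B) s) ->
  (forall s, inside A s -> acyclic (Y := C) (inside (A `&` fixset (stab (@cact gT C) s)))) ->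
  (forall s, inside B s -> acyclic (Y := C) (inside (B `&` fixset (stab (@cact gT C) s)))) ->
  findim (inside (A `&` B)) d -> findim (inside setT) d.+1.
Proof.
move=> iA iB cAB aA aB [h' eh' hP'].
have [k ek kP] := equivariant_contraction iA aA.
have [l el lP] := equivariant_contraction iB aB.
pose U (b : bool) := if b then A else B.
have iU : invariant (small U).
  by move=> s g [b sb]; exists b; move: sb; apply: inside_act => x; rewrite /U; case: b => Hx; [exact: iA|exact: iB].
apply: (@findim_small bool true U) => //.
pose inA s := `[< inside A s >].
have inAg s g : inA (cact s g) = inA s.
  apply/asboolP/asboolP; last exact: inside_invariant.
  by move=> Ag; have := @inside_invariant A iA _ g^-1%g Ag; rewrite cactK.
pose p t : chain C := if inA t then << t >> else 0.
pose q t : chain C := if inA t then 0 else << t >>.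
(* The connecting map: the part in [A] of the boundary of a simplex outside [A]. Such a small
   simplex lies in [B], so the value lies in the intersection. It lowers tags by one, whence the
   bound d + 1. *)
pose D s : chain C := if inA s then 0 else fglift p (cbd s).
pose m t := l t - k t.
pose h2 s := if inA s then k s else l s.
pose h3 s := - fglift m (fglift h' (D s)).
have ep : equivar p by move=> s g; rewrite /p inAg; case: ifP => _; rewrite ?actU ?act0.
have eD : equivar D.
  by move=> s g; rewrite /D inAg; case: ifP => _; rewrite ?act0 ?(equiv_cbd ep).
have eh2 : equivar h2 by move=> s g; rewrite /h2 inAg; case: ifP => _; rewrite ?ek ?el.
have eh3 : equivar h3.
  move=> s g; rewrite /h3 eD (equiv_fglift _ _ eh') (equiv_fglift _ _ (equivB el ek)).
  by rewrite [in RHS]raddfN.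
have pon (c : chain C) : on (inside A) (fglift p c).
  apply: (@on_fglift _ _ (fun=> True)) => // t _; rewrite /p /inA; case: (asboolP (inside A t)) => At.
    exact: onU.
  exact: on0.
have pid (c : chain C) : on (inside A) c -> fglift p c = c.
  move=> Ac; rewrite -[RHS]fglift_id; apply: eq_fglift => t /Ac At.
  by rewrite /p /inA asboolT.
have Don s : small U s -> on (fun u => inside (A `&` B) u /\ (ctag u).+1 = ctag s) (D s).
  move=> sU; rewrite /D /inA; case: (asboolP (inside A s)) => As; first exact: on0.
  have Bs : inside B s by case: sU => -[].
  apply: on_fglift (@on_dom _ _) => t ts; rewrite /p /inA; case: (asboolP (inside A t)) => At; last exact: on0.
  apply: onU; split; last by rewrite (cbd_tag ts).
  by apply/insideI; split=> //; exact: inside_dom ts Bs.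
have Dbd s : fglift D (cbd s) = - bd (D s).
  rewrite {2}/D /inA; case: (asboolP (inside A s)) => As.
    rewrite bd0 oppr0 -[RHS](fglift0 _ (cbd s)); apply: eq_fglift => t ts.
    by rewrite /D /inA asboolT //; exact: inside_dom ts As.
  have -> : fglift D (cbd s) = fglift p (bd (fglift q (cbd s))).
    rewrite /bd !fglift_comp; apply: eq_fglift => t _; rewrite /D /q.
    by case: ifP => _; rewrite ?fgliftE0 // fgliftU.
  have -> : fglift q (cbd s) = cbd s - fglift p (cbd s).
    rewrite -[X in X - _]fglift_id -fglift_sub; apply: eq_fglift => t _.
    by rewrite /q /p; case: ifP => _; rewrite ?subrr ?subr0.
  rewrite bdB; have -> : bd (cbd s) = 0 by exact: cbdK.
  rewrite sub0r raddfN /=; congr (- _); apply: pid.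
  apply: on_fglift (pon (cbd s)) => t At u tu; exact: inside_dom tu At.
have mbd (c : chain C) : on (inside (A `&` B)) c -> bd (fglift m c) = - fglift m (bd c).
  move=> cAB'; apply/eqP; rewrite -addr_eq0; apply/eqP.
  rewrite /bd !fglift_comp -fglift_add -[RHS](fglift0 _ c); apply: eq_fglift => t /cAB'/insideI[At Bt].
  have [_ kt] := kP t At; have [_ lt] := lP t Bt.
  rewrite /m fglift_sub [fglift (@cbd gT C) (_ - _)]fgliftEB -!/(bd _).
  by rewrite addrACA -opprD lt kt subrr.
exists (fun s => h2 s + h3 s); first exact: equivD.
move=> s [_ sU]; have Ds := Don s sU.
have hDs : on (fun u => inside (A `&` B) u /\ ctag u = ctag s) (fglift h' (D s)).
  apply: on_fglift Ds => t [tAB tt]; have [hon _] := hP' t tAB.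
  by apply: onS hon => u [? ->]; rewrite tt.
split.
  apply: onD.
    rewrite /h2 /inA; case: (asboolP (inside A s)) => As.
      have [kon _] := kP s As; apply: onS kon => u [uA ut]; split=> //; split=> //.
      by exists true.
    have Bs : inside B s by case: sU => -[].
    have [lon _] := lP s Bs; apply: onS lon => u [uA ut]; split=> //; split=> //.
    by exists false.
  apply: onN; apply: on_fglift hDs => t [/insideI[At Bt] tt].
  have [kon _] := kP t At; have [lon _] := lP t Bt.
  apply: onB; [apply: onS lon|apply: onS kon] => u [uA ut]; rewrite ut tt; split=> //; split=> //;
    by [exists false|exists true].
move=> ds; rewrite bdD fglift_add.
have h2P : bd (h2 s) + fglift h2 (cbd s) = << s >> - fglift m (D s).
  rewrite /h2 /D /inA; case: (asboolP (inside A s)) => As.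
    have [_ <-] := kP s As; rewrite fgliftE0 subr0; congr (_ + _); apply: eq_fglift => t ts.
    by rewrite /inA asboolT //; exact: inside_dom ts As.
  have Bs : inside B s by case: sU => -[].
  have [_ <-] := lP s Bs; rewrite -addrA; congr (_ + _).
  rewrite fglift_comp -fglift_sub; apply: eq_fglift => t _.
  by rewrite /p -/(inA t); case: (inA t); rewrite ?fgliftU ?fgliftE0 ?subr0 // /m subKr.
have h3P : bd (h3 s) + fglift h3 (cbd s) = fglift m (D s).
  have -> : fglift h3 (cbd s) = fglift m (fglift h' (bd (D s))).
    rewrite /h3 fglift_opp -(fglift_comp (fun s => fglift h' (D s)) m) -(fglift_comp D h') Dbd.
    by rewrite !raddfN /= opprK.
  have -> : bd (h3 s) = fglift m (bd (fglift h' (D s))).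
    by rewrite /h3 bdN mbd ?opprK //; apply: onS hDs => u [].
  have -> : bd (fglift h' (D s)) = D s - fglift h' (bd (D s)).
    apply/eqP; rewrite eq_sym subr_eq; apply/eqP.
    rewrite /bd !fglift_comp -fglift_add -[LHS]fglift_id; apply: eq_fglift => t /Ds[tAB tt].
    by have [_ ->] := hP' t tAB; rewrite // -ltnS tt.
  by rewrite fgliftEB subrK.
by rewrite -[RHS](subrK (fglift m (D s))) -h2P -h3P; abel.
Qed.
End Stabilizers.

Local Close Scope classical_set_scope.

Local Open Scope classical_set_scope.

(** * Flags of subsets: the subdivided nerve *)

Section Flags.
Variables (gT : finGroupType) (I : finType) (ia : I -> gT -> I).
Hypotheses (ia1 : forall i, ia i 1%g = i)
  (iaM : forall i g h, ia i (g * h)%g = ia (ia i g) h).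
Notation flag := (seq {set I}).
Implicit Types F : flag.

Definition set_act (J : {set I}) (g : gT) : {set I} := [set ia i g | i in J]%SET.

Lemma set_act1 J : set_act J 1%g = J.
Proof.
by apply/setP => i; apply/imsetP/idP => [[j jJ ->]|iJ]; rewrite ?ia1 //; exists i; rewrite ?ia1.
Qed.

Lemma set_actM J g h : set_act J (g * h)%g = set_act (set_act J g) h.
Proof.
rewrite /set_act -imset_comp; apply: eq_imset => i /=; exact: iaM.
Qed.

Definition flag_act F g : flag := [seq set_act J g | J <- F].

Definition push_flag J (c : chain flag) : chain flag := fglift (fun F => << J :: F >>) c.

Fixpoint flag_bd F : chain flag :=
  if F is J :: F' then << F' >> - push_flag J (flag_bd F') else 0.

Lemma flag_act1 F : flag_act F 1%g = F.
Proof. by rewrite /flag_act -[RHS]map_id; apply: eq_map => J; exact: set_act1. Qed.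

Lemma flag_actM F g h : flag_act F (g * h)%g = flag_act (flag_act F g) h.
Proof. by rewrite /flag_act -map_comp; apply: eq_map => J /=; exact: set_actM. Qed.

Lemma flag_bd_subseq F : on (fun u => subseq u F /\ size F = (size u).+1) (flag_bd F).
Proof.
elim: F => [|J F IH] /=; first exact: on0.
apply: onB; first by apply: onU; split=> //; exact: subseq_cons.
by apply: on_fglift IH => u [uF sF]; apply: onU; rewrite /= eqxx sF.
Qed.

Lemma flag_bd_push J c : fglift flag_bd (push_flag J c) = c - push_flag J (fglift flag_bd c).
Proof.
rewrite /push_flag !fglift_comp -[X in X - _]fglift_id -fglift_sub.
by apply: eq_fglift => F _; rewrite fgliftU.
Qed.

Lemma flag_bdK F : fglift flag_bd (flag_bd F) = 0.
Proof.
elim: F => [|J F IH] /=; first by rewrite fgliftE0.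
by rewrite fgliftEB fgliftU flag_bd_push IH /push_flag fgliftE0 subr0 subrr.
Qed.

Lemma flag_bd_act F g : flag_bd (flag_act F g) = fglift (fun u => << flag_act u g >>) (flag_bd F).
Proof.
elim: F => [|J F IH] /=; first by rewrite fgliftE0.
rewrite fgliftEB fgliftU -/(flag_act F g) IH; congr (_ - _).
by rewrite /push_flag !fglift_comp; apply: eq_fglift => u _; rewrite !fgliftU.
Qed.

(** All finite sequences of sets are cells; strict inclusion is imposed later by predicates. Flags
    replace the simplices of the nerve because an element that fixes a flag fixes each of its
    members, as carriers demand. *)
Definition flag_cx : gcomplex gT :=
  @GComplex gT flag size flag_act flag_bd flag_act1 flag_actM (fun F g => size_map _ F)
    (fun F u uF => (flag_bd_subseq uF).2) flag_bd_act flag_bdK.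

Lemma flag_size F : sorted (fun J K : {set I} => J \proper K) F -> (size F <= #|I|.+1)%N.
Proof.
case: F => [//|J F] /= sF; suff : (size F + #|J| <= #|last J F|)%N.
  by move=> H; have := leq_trans H (max_card _); rewrite ltnS; apply: leq_trans; exact: leq_addr.
elim: F J sF => [|K F IH] J //= /andP[/proper_card JK /IH].
by move=> H; apply: leq_trans H; rewrite addSn -addnS leq_add2l.
Qed.

Lemma flag_act_fix F g J : flag_act F g = F -> J \in F -> set_act J g = J.
Proof.
elim: F => [//|K F IH] /= [KK FF]; rewrite inE => /predU1P[->//|]; exact: IH.
Qed.

Lemma flag_fix F g : (forall J, J \in F -> set_act J g = J) -> flag_act F g = F.
Proof. by move=> H; rewrite -[RHS]map_id; apply/eq_in_map => J; exact: H. Qed.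

(* Prepending the least element [J0] contracts the flags above it. *)
Lemma flag_acyclic (J0 : {set I}) (P : {set I} -> Prop) : P J0 ->
  acyclic (Y := flag_cx) (fun F => sorted (fun J K : {set I} => J \proper K) F /\
    forall J, J \in F -> P J /\ J0 \subset J).
Proof.
move=> PJ n c con cd.
pose h F : chain flag := if ohead F == Some J0 then 0 else << J0 :: F >>.
pose Q F := sorted (fun J K : {set I} => J \proper K) F /\ forall J, J \in F -> P J /\ J0 \subset J.
have hQ F : Q F -> (ohead F == Some J0) = false -> Q (J0 :: F).
  move=> [sF QF] hF; split; last first.
    by move=> J; rewrite inE => /predU1P[->|/QF//]; split.
  case: F sF QF hF => [//|K F] /= -> QF; rewrite andbT finset.properEneq eq_sym => /negbT.
  by rewrite (inj_eq Some_inj) => ->; case: (QF K) => //; rewrite inE eqxx.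
exists (fglift h c).
  apply: on_fglift con => F [QF <-]; rewrite /h; case: eqP => [|/eqP/negPf hF]; first by move=> _; exact: on0.
  by apply: onU; split=> //; exact: hQ.
have hd (F : flag) : Q F -> fglift flag_bd (h F) + fglift h (flag_bd F) = << F >>.
  move=> [sF QF]; rewrite /h; case: eqP => [|/eqP/negPf hF].
    case: F sF QF => [//|K F] /= sF QF [KJ]; rewrite KJ in sF QF *.
    rewrite fgliftE0 add0r fgliftEB fgliftU -/h.
    have -> : (if ohead F == Some J0 then 0 else << J0 :: F >>) = << J0 :: F >>.
      case: eqP => // hF; case: F hF sF {QF} => [//|L F] [->] /=.
      by rewrite fintype.properxx.
    rewrite -[RHS]subr0; congr (_ - _); rewrite /push_flag fglift_comp -[RHS](fglift0 _ (flag_bd F)).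
    by apply: eq_fglift => u _; rewrite fgliftU /h /= eqxx.
  rewrite fgliftU /= -addrA -[RHS]addr0; congr (_ + _).
  rewrite addrC; apply/eqP; rewrite subr_eq0; apply/eqP.
  case: F sF QF hF => [|K F] sF QF hF; first by rewrite /= /push_flag !fgliftE0.
  rewrite /push_flag; apply: eq_fglift => u uF; rewrite /h.
  have [us _] := flag_bd_subseq uF; case: eqP => // hu.
  have : J0 \in (K :: F).
    by apply: (mem_subseq us); case: u hu {us uF} => [//|L u] [->]; rewrite inE eqxx.
  rewrite inE => /predU1P[e|JF]; first by rewrite /= e eqxx in hF.
  have := order_path_min (T := {set I}) (leT := fun J K : {set I} => J \proper K).
  move=> /(_ K F (fun J K L => @fintype.proper_trans _ K J L) sF) /allP/(_ _ JF) KJ.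
  have [|_ JK] := QF K; first by rewrite inE eqxx.
  by move: (fintype.proper_sub_trans KJ JK); rewrite fintype.properxx.
have : bd (X := flag_cx) (fglift h c) + fglift h (bd (X := flag_cx) c) = c.
  rewrite /bd !fglift_comp -fglift_add -[RHS]fglift_id; apply: eq_fglift => F /con[QF _].
  exact: hd.
by rewrite cd fgliftE0 addr0.
Qed.
End Flags.

(** * Comparison of singular chains with the nerve of an invariant cover *)

Section Nerve.
Variables (R : realType) (gT : finGroupType) (X : gspace gT) (x0 : X).
Variables (I : finType) (ia : I -> gT -> I) (Z : I -> set X).
Hypotheses (ia1 : forall i, ia i 1%g = i)
  (iaM : forall i g h, ia i (g * h)%g = ia (ia i g) h)
  (Zact : forall i x g, Z i x -> Z (ia i g) (gs_act x g)).
Hypothesis Zopen : forall i, open (Z i).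
Notation C := (simp R X).
Notation N := (flag_cx ia1 iaM).

Definition meet_of (J : {set I}) : set X := [set x | forall i, i \in J -> Z i x].

Hypothesis meet_acyclic : forall (J : {set I}) (P : gT -> Prop),
  J != finset.set0 -> meet_of J !=set0 -> (forall g, P g -> set_act ia J g = J) ->
  acyclic (Y := C) (inside (meet_of J `&` fixset P)).

Lemma iaK i g : ia (ia i g) g^-1%g = i.
Proof. by rewrite -iaM mulgV ia1. Qed.

Lemma ZactE i x g : Z (ia i g) (gs_act x g) <-> Z i x.
Proof.
split=> [/(@Zact _ _ g^-1%g)|]; last exact: Zact.
by rewrite iaK -gs_actM mulgV gs_act1.
Qed.

Lemma meet_act J x g : meet_of J x -> meet_of (set_act ia J g) (gs_act x g).
Proof. by move=> xJ _ /imsetP[i iJ ->]; apply: Zact; exact: xJ. Qed.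

Lemma meetS (J K : {set I}) : J \subset K -> meet_of K `<=` meet_of J.
Proof. by move=> /fintype.subsetP JK x xK i /JK/xK. Qed.

Definition nerve_flag (F : N) : Prop := sorted (fun J K : {set I} => J \proper K) F /\
  forall J : {set I}, J \in F -> J != finset.set0 /\ meet_of J !=set0.

(** The first set of a strict flag is the smallest and so has the largest intersection, which
    contains those of all other members. The empty flag carries only the empty simplex. *)
Definition flag_set (F : N) : set X := if F is J :: _ then meet_of J else set0.

Definition carried (s : C) : {set I} := [set i | `[< inside (Z i) s >]]%SET.

Lemma carriedP (s : C) i : reflect (inside (Z i) s) (i \in carried s).
Proof. by rewrite inE; apply: asboolP. Qed.

Lemma carried_act (s : C) g : carried (cact s g) = set_act ia (carried s) g.
Proof.
apply/setP => i; apply/carriedP/imsetP => [si|[j /carriedP sj ->]].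
  exists (ia i g^-1%g); last by rewrite -iaM mulVg ia1.
  apply/carriedP => x; apply/(ZactE _ _ g); rewrite -iaM mulVg ia1; exact: (si x).
by apply: inside_act sj => x; exact: Zact.
Qed.

Lemma carried_face (s u : C) : u \in dom (cbd s) -> carried s \subset carried u.
Proof. by move=> us; apply/fintype.subsetP => i /carriedP si; apply/carriedP; exact: inside_dom us si. Qed.

Lemma carried_inside (s : C) : inside (meet_of (carried s)) s.
Proof. by move=> x i /carriedP. Qed.

Definition cover (i : option I) : set X := if i is Some j then Z j else set0.

Lemma small_cover_invariant : invariant (X := X) (small (R := R) cover).
Proof.
move=> s g [[i|] si]; last by exists None => x; case: (si x).
by exists (Some (ia i g)); apply: inside_act si => x; exact: Zact.
Qed.

Lemma simplex_point (s : C) : (0 < ctag s)%N -> exists x : std_simplex R (tag s), True.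
Proof. by case: s => -[//|m] u _; exists (mkpt (vtx_in (k := 0) (ltn0Sn m))). Qed.

Lemma inside_nonempty (A : set X) (s : C) : (0 < ctag s)%N -> inside A s -> A !=set0.
Proof. by move=> /simplex_point[x _] sA; exists (tagged s x). Qed.

Lemma carried_neq0 (s : C) : (0 < ctag s)%N -> small cover s -> carried s != finset.set0.
Proof.
move=> s0 [[i|] si]; last by have [x []] := inside_nonempty s0 si.
by apply/finset.set0Pn; exists i; apply/carriedP.
Qed.

Lemma inside_carried_small (s u : C) : (0 < ctag s)%N -> small cover s ->
  inside (meet_of (carried s)) u -> small cover u.
Proof.
move=> s0 sU uA; have /finset.set0Pn[i iI] := carried_neq0 s0 sU.
by exists (Some i) => x; exact: (uA x).
Qed.

Lemma small_face (s u : C) : u \in dom (cbd s) -> small cover s -> small cover u.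
Proof. by move=> us [i si]; exists i; exact: inside_dom us si. Qed.

Lemma flag_setS (F u : N) : nerve_flag F -> subseq u F -> flag_set u `<=` flag_set F.
Proof.
case: u => [|J u] [sF _] uF; first by [].
have JF : J \in F by apply: (mem_subseq uF); rewrite inE eqxx.
case: F sF JF {uF} => [//|K F] sF; rewrite inE => /predU1P[->//|JF] /=; apply: meetS.
have := order_path_min (T := {set I}) (leT := fun J K : {set I} => J \proper K).
move=> /(_ K F (fun J K L => @fintype.proper_trans _ K J L) sF) /allP/(_ _ JF).
exact: proper_sub.
Qed.

Lemma nerve_flagS (F u : N) : nerve_flag F -> subseq u F -> nerve_flag u.
Proof.
move=> [sF HF] uF; split; last by move=> J /(mem_subseq uF)/HF.
by apply: subseq_sorted uF sF => J K L; exact: fintype.proper_trans.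
Qed.

Lemma flag_stabS (F u : N) g : subseq u F -> cact F g = F -> cact u g = u.
Proof. by move=> uF Fg; apply: flag_fix => J /(mem_subseq uF) /(flag_act_fix Fg). Qed.

Lemma flag_set_act (F : N) g x : flag_set F x -> flag_set (cact F g) (gs_act x g).
Proof. by case: F => [//|J F]; exact: meet_act. Qed.

Lemma set_act_eq0 (J : {set I}) g : (set_act ia J g == finset.set0) = (J == finset.set0).
Proof. exact: imset_eq0. Qed.

Lemma nerve_flag_act (F : N) g : nerve_flag F -> nerve_flag (cact F g).
Proof.
move=> [sF HF]; split; last first.
  move=> _ /mapP[J /HF[J0 [x xJ]] ->]; rewrite set_act_eq0; split=> //.
  by exists (gs_act x g); exact: meet_act.
rewrite /= /flag_act sorted_map; apply: sub_sorted sF => J K /=.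
rewrite !properE => /andP[JK KJ]; rewrite imsetS //=; apply: contra KJ => /(imsetS (ia^~ g^-1%g)).
by rewrite -/(set_act _ _ _) -/(set_act ia (set_act ia J g) g^-1) -!(set_actM iaM) mulgV !(set_act1 ia1).
Qed.

Lemma empty_simplex_continuous : continuous (fun _ : std_simplex R 0 => x0).
Proof. exact: cst_continuous. Qed.

Definition empty_simplex : C := mk_simplex empty_simplex_continuous.

Lemma tag0P (u : C) : ctag u = 0%N -> u = empty_simplex.
Proof.
case: u => m u /= m0; rewrite [m]m0 /= in u *.
rewrite -[LHS]mk_simplexK; apply: eq_mk_simplex => x.
by have [_] := std_simplex_valP x; rewrite big_ord0 => /eqP; rewrite eq_sym oner_eq0.
Qed.

Lemma empty_inside (A : set X) : inside A empty_simplex.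
Proof.
by move=> x; have [_] := std_simplex_valP x; rewrite big_ord0 => /eqP; rewrite eq_sym oner_eq0.
Qed.

(** The carrier of a flag, cut down to the fixed points of its stabilizer, is acyclic by
    [meet_acyclic], since the stabilizer preserves the first member. *)
Lemma realization_map : exists2 f : N -> chain C, equivar f & forall F, nerve_flag F ->
  [/\ on (fun u : C => inside (flag_set F `&` fixset (stab (@cact gT N) F)) u /\ ctag u = ctag F) (f F),
      bd (f F) = fglift f (cbd F) & ctag F = 0%N -> f F = << empty_simplex >>].
Proof.
have [f ef fP] : exists2 f : N -> chain C, equivar f & forall F, nerve_flag F ->
    [/\ on (fun u : C => inside (flag_set F `&` fixset (stab (@cact gT N) F)) u /\ ctag u = (ctag F + 0)%N) (f F),
      bd (f F) + fglift f (cbd F) *~ (-1) = 0 & (ctag F < 1)%N -> f F = << empty_simplex >>].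
  apply: (@carrier_ext _ N C nerve_flag
     (fun F => inside (flag_set F `&` fixset (stab (@cact gT N) F))) 0 1 (-1)
     (fun=> 0) (fun=> << empty_simplex >>)) => //.
  - by move=> F u HF /flag_bd_subseq[+ _]; exact: nerve_flagS.
  - by move=> F g; exact: nerve_flag_act.
  - move=> F t u HF /flag_bd_subseq[tF _]; apply: inside_sub => x [xt xs]; split.
      exact: flag_setS xt.
    by apply: fixsetS xs => g; exact: flag_stabS.
  - move=> F u g HF; apply: inside_act => x [xF xs]; split; first exact: flag_set_act.
    by apply: fixset_act xs; [exact: cactM|exact: cact1].
  - by move=> F u g HF /insideI[_ uF] Fg; exact: inside_fix uF Fg.
  - by move=> s g; rewrite act0.
  - by move=> s g; rewrite actU; congr << _ >>; rewrite [RHS]tag0P.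
  - by move=> F _ _; exact: on0.
  - by move=> F _; rewrite bd0 fglift0 mul0rz.
  - move=> [|//] _ _; split; last by rewrite bdU /= fgliftE0 mul0rz addr0.
    by apply: onU; split=> //; exact: empty_inside.
  - move=> [//|J F] [_ HF] _; have [|J0 JX] := HF J; first by rewrite inE eqxx.
    apply: meet_acyclic => // g Fg; apply: (flag_act_fix (F := J :: F)) => //.
    by rewrite inE eqxx.
exists f => // F HF; have [fon fd f0] := fP F HF; split.
- by apply: onS fon => u; rewrite addn0.
- by move/eqP: fd; rewrite mulrN1z subr_eq0 => /eqP.
- by move=> F0; apply: f0; rewrite F0.
Qed.

Lemma nerve_map : exists2 f : C -> chain N, equivar f & forall s : C, small cover s ->
  [/\ on (fun F => (nerve_flag F /\ (forall J : {set I}, J \in F -> carried s \subset J) /\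
         forall g, cact s g = s -> cact F g = F) /\ ctag F = ctag s) (f s),
      bd (f s) = fglift f (cbd s) & ctag s = 0%N -> f s = << ([::] : N) >>].
Proof.
pose Phi (s : C) (F : N) := nerve_flag F /\ (forall J : {set I}, J \in F -> carried s \subset J) /\
         forall g, cact s g = s -> cact F g = F.
have [f ef fP] : exists2 f : C -> chain N, equivar f & forall s : C, small cover s ->
    [/\ on (fun F => Phi s F /\ ctag F = (ctag s + 0)%N) (f s),
      bd (f s) + fglift f (cbd s) *~ (-1) = 0 & (ctag s < 1)%N -> f s = << ([::] : N) >>].
  apply: (@carrier_ext _ C N (small cover) Phi 0 1 (-1)
     (fun=> 0) (fun=> << ([::] : N) >>)) => //.
  - by move=> s u + us; exact: small_face.
  - exact: small_cover_invariant.
  - move=> s t F sU ts [HF [JF sF]]; split=> //; split=> [J /JF|g sg].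
      by apply: fintype.subset_trans; exact: carried_face.
    by apply: sF; exact: stab_face sg.
  - move=> s F g sU [HF [JF sF]]; split; first exact: nerve_flag_act.
    split=> [_ /mapP[J /JF sJ ->]|h sh]; first by rewrite carried_act imsetS.
    have : cact s (g * h * g^-1)%g = s by rewrite !cactM sh -cactM mulgV cact1.
    by move=> /sF e; rewrite -[in RHS]e -!cactM mulgKV.
  - by move=> s F g sU [_ [_ sF]] /sF.
  - by move=> s g; rewrite act0.
  - by move=> s g; rewrite actU.
  - by move=> s _ _; exact: on0.
  - by move=> s _; rewrite bd0 fglift0 mul0rz.
  - move=> s sU; rewrite ltnS leqn0 => /eqP s0; split.
      by apply: onU; split; [split=> //; split=> //|rewrite s0].
    have -> : cbd s = 0 by rewrite [s]tag0P.
    by rewrite bdU fgliftE0 mul0rz addr0.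
  - move=> s sU s0.
    have := @flag_acyclic gT I ia ia1 iaM (carried s) (fun J => [/\ J != finset.set0, meet_of J !=set0 &
      forall g, cact s g = s -> set_act ia J g = J]).
    move=> H n c con cd.
    have HE F : Phi s F <-> sorted (fun J K : {set I} => J \proper K) F /\
      forall J : {set I}, J \in F -> [/\ J != finset.set0, meet_of J !=set0 &
      forall g, cact s g = s -> set_act ia J g = J] /\ carried s \subset J.
      split=> [[[sF HF] [JF Fg]]|[sF HF]].
        split=> // J JinF; split; last exact: JF.
        have [J0 JX] := HF J JinF; split=> // g /Fg e.
        exact: flag_act_fix JinF.
      split; first by split=> // J /HF[[]].
      by split=> [J /HF[]//|g sg]; apply: flag_fix => J /HF[[_ _]] /(_ g sg).
    have [||//|v von vd] := H _ n c.
    + split; [exact: carried_neq0|exact: inside_nonempty (@carried_inside s)|].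
      by move=> g sg; rewrite -carried_act sg.
    + by apply: onS con => F [/HE].
    by exists v => //; apply: onS von => F [/HE].
exists f => // s sU; have [fon fd f0] := fP s sU; split.
- by apply: onS fon => u; rewrite addn0.
- by move/eqP: fd; rewrite mulrN1z subr_eq0 => /eqP.
- by move=> s0; apply: f0; rewrite s0.
Qed.

(** The round trip through flags is homotopic to the identity, both being carried by [Phi s]. It
    vanishes above tag #|I| + 1, where strict flags run out, so the homotopy is a contraction
    there. *)
Lemma nerve_findim : findim (R := R) (inside (\bigcup_i Z i)) #|I|.+1.
Proof.
have iW : invariant_set (\bigcup_i Z i).
  by move=> x g [i _ xi]; exists (ia i g) => //; exact: Zact.
apply: (findim_small None iW small_cover_invariant).
  move=> s sW x; have [i _ xi] := sW x; exists (Some i).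
  apply: (@cts_fun _ _ (tagged s) x (Z i)); apply: open_nbhs_nbhs; split=> //; exact: Zopen.
have [f ef fP] := nerve_map; have [g eg gP] := realization_map.
pose Phi (s u : C) := inside (meet_of (carried s) `&` fixset (stab (@cact gT C) s)) u.
have gfon (s : C) : small cover s -> on (fun u : C => Phi s u /\ ctag u = ctag s) (fglift g (f s)).
  move=> sU; have [fon _ _] := fP s sU; apply: on_fglift fon => F [[HF [JF Fs]] Ft].
  have [gon _ _] := gP F HF; apply: onS gon => u [uF ut]; rewrite ut Ft; split=> //.
  apply: inside_sub uF => x [xF xs]; split; last exact: fixsetS xs.
  case: F {HF Fs Ft ut xs} JF xF => [//|J F] JF xF; apply: meetS xF.
  by apply: JF; rewrite inE eqxx.
have gf0 (s : C) : small cover s -> ctag s = 0%N -> fglift g (f s) = << s >>.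
  move=> sU s0; have [_ _ /(_ s0) ->] := fP s sU; rewrite fgliftU [in RHS](tag0P s0).
  by have [|_ _ ->] := gP ([::] : N).
have gfd (s : C) : small cover s -> bd (fglift g (f s)) = fglift (fun s => fglift g (f s)) (cbd s).
  move=> sU; have [fon fd _] := fP s sU; rewrite -(fglift_comp f) -fd.
  rewrite /bd !fglift_comp; apply: eq_fglift => F /fon[[HF _] _].
  by have [_ gd _] := gP F HF; exact: gd.
have [k ek kP] : exists2 k : C -> chain C, equivar k & forall s : C, small cover s ->
    [/\ on (fun u : C => Phi s u /\ ctag u = (ctag s + 1)%N) (k s),
      bd (k s) + fglift k (cbd s) *~ 1 = << s >> - fglift g (f s) & (ctag s < 1)%N -> k s = 0].
  apply: (@carrier_ext _ C C (small cover) Phi 1 1 1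
     (fun s => << s >> - fglift g (f s)) (fun=> 0)) => //.
  - by move=> s u + us; exact: small_face.
  - exact: small_cover_invariant.
  - move=> s t u sU ts; apply: inside_sub => x [xt xs]; split.
      by apply: meetS xt; exact: carried_face.
    by apply: fixsetS xs => h; exact: stab_face.
  - move=> s u h sU; apply: inside_act => x [xF xs]; split.
      by rewrite carried_act; exact: meet_act.
    by apply: fixset_act xs; [exact: cactM|exact: cact1].
  - by move=> s u h _ /insideI[_ uF] Fg; exact: inside_fix uF Fg.
  - apply: equivB; first exact: equivU.
    exact: equiv_comp.
  - by move=> s h; rewrite act0.
  - move=> s sU s0; rewrite addn1; apply: onB; last by apply: onS (gfon s sU) => u [? ->].
    by apply: onU; split=> //; apply/insideI; split; [exact: carried_inside|exact: inside_stab].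
  - move=> s sU; rewrite bdB bdU gfd // mulr1z fglift_sub fglift_id.
    by [].
  - move=> s sU; rewrite ltnS leqn0 => /eqP s0; split; first exact: on0.
    by rewrite bd0 fglift0 mul0rz addr0 gf0 // subrr.
  - move=> s sU s0; apply: meet_acyclic; [exact: carried_neq0|exact: inside_nonempty (@carried_inside s)|].
    by move=> h sh; rewrite -carried_act sh.
exists k => // s [sW sU]; have [kon kd k0] := kP s sU; split.
  have [s0|s0] := posnP (ctag s); first by rewrite k0 ?s0 //; exact: on0.
  apply: onS kon => u [/insideI[uZ _] ->]; rewrite addn1; split=> //; split; last exact: inside_carried_small uZ.
  have /finset.set0Pn[i iI] := carried_neq0 s0 sU.
  by move=> x; exists i => //; exact: (uZ x).
move=> ds; rewrite -[RHS]subr0 -[fglift k _]mulr1z kd; congr (_ - _).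
have [fon _ _] := fP s sU; suff -> : f s = 0 by rewrite fgliftE0.
apply: (on_false _ fon) => F [[[sF _] _] Ft]; have := flag_size sF.
by move: ds; rewrite -Ft /= => ds /(leq_trans ds); rewrite ltnn.
Qed.
End Nerve.

Local Close Scope classical_set_scope.

Local Open Scope classical_set_scope.

(** * The cover by half-spaces *)

Section FiniteDimension.
Variables (R : realType) (gT : finGroupType) (n : nat).
Variable rG : mx_representation R [set: gT]%G n.
Notation V := 'rV[R]_n.
Notation SV := (rep_sphere rG).
Notation C := (simp R SV).
Notation I := (gT * 'I_n * bool)%type.

(** With right actions, v lies in the half-space (g, j, e) exactly when v h lies in (h^-1 g, j,
    e). *)
Definition half_act (i : I) (h : gT) : I := ((h^-1 * i.1.1)%g, i.1.2, i.2).

Lemma half_act1 i : half_act i 1%g = i.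
Proof. by case: i => -[g j] e; rewrite /half_act invg1 mul1g. Qed.

Lemma half_actM i g h : half_act i (g * h)%g = half_act (half_act i g) h.
Proof. by rewrite /half_act invMg mulgA. Qed.

Definition half (i : I) (v : V) : R := (-1) ^+ i.2 * (v *m rG i.1.1) 0 i.1.2.

Lemma half_linear i a v w : half i (a *: v + w) = a * half i v + half i w.
Proof. by rewrite /half mulmxDl -scalemxAl !mxE; ring. Qed.

Lemma halfZ i a v : half i (a *: v) = a * half i v.
Proof. by rewrite /half -scalemxAl !mxE; ring. Qed.

Lemma half0 i : half i 0 = 0.
Proof. by rewrite /half mul0mx mxE mulr0. Qed.

Lemma half_sum i (J : finType) (P : pred J) (F : J -> V) :
  half i (\sum_(j | P j) F j) = \sum_(j | P j) half i (F j).
Proof. by rewrite /half mulmx_suml summxE mulr_sumr. Qed.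

Lemma half_actE i g v : half (half_act i g) (v *m rG g) = half i v.
Proof.
by rewrite /half /= -mulmxA -repr_mxM ?finset.in_setT // mulKVg.
Qed.

Definition half_space (i : I) : set SV := finpart [set v | 0 < half i v].

Lemma half_space_act i x g : half_space i x -> half_space (half_act i g) (gs_act x g).
Proof. by case: x => [v|//] /=; rewrite half_actE. Qed.

Lemma half_space_open i : open (half_space i).
Proof.
apply: open_finpart => v v0.
have oH : open (half i @^-1` [set y | 0 < y]); last by apply: open_nbhs_nbhs.
apply: open_comp; last exact: open_gt.
move=> w _.
apply: (@continuousM _ _ (fun=> (-1) ^+ i.2) (fun v : V => (v *m rG i.1.1) 0 i.1.2)).
  exact: cst_continuous.
apply: (@continuous_comp _ _ _ (fun v : V => v *m rG i.1.1) (fun w : 'rV[R]_n => w 0 i.1.2)).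
  exact: mulmxr_continuous.
exact: coord_cts.
Qed.

Definition fixed (P : gT -> Prop) : set V := [set v | forall g, P g -> v *m rG g = v].

Lemma fixset_finpart (A : set V) P : finpart A `&` fixset P = finpart (rG := rG) (A `&` fixed P).
Proof.
apply/seteqP; split=> -[v|] //=; try by case.
  by move=> [Av Pv]; split=> // g /Pv [].
by move=> [Av Pv]; split=> // g gP; apply: (congr1 Some); exact: Pv.
Qed.

Lemma fixset_infpart (A : set V) P : infpart A `&` fixset P = infpart (rG := rG) (A `&` fixed P).
Proof.
apply/seteqP; split=> -[v|] //=; first by move=> [Av Pv]; split=> // g /Pv [].
by move=> [Av Pv]; split=> // g gP; apply: (congr1 Some); exact: Pv.
Qed.

Lemma half_space_meet (J : {set I}) : J != finset.set0 ->
  meet_of half_space J = finpart (rG := rG) [set v | forall i, i \in J -> 0 < half i v].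
Proof.
move=> /finset.set0Pn[i iJ]; apply/seteqP; split=> -[v|] //= H.
exact: (H i).
Qed.

(* Averaging a point over the stabilizer of [J] makes the intersection star-shaped about a fixed point. *)
Lemma half_space_meet_acyclic (J : {set I}) (P : gT -> Prop) :
  J != finset.set0 -> meet_of half_space J !=set0 -> (forall g, P g -> set_act half_act J g = J) ->
  acyclic (Y := C) (inside (meet_of half_space J `&` fixset P)).
Proof.
move=> J0; rewrite half_space_meet // => -[[v|] //= vJ] PJ; rewrite fixset_finpart.
pose S := [set g : gT | set_act half_act J g == J]%SET.
have S1 : 1%g \in S by rewrite inE (set_act1 half_act1).
have SM g h : h \in S -> (g * h)%g \in S = (g \in S).
  rewrite !inE (set_actM half_actM) => /eqP Jh; apply/eqP/eqP => [e|->//].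
  rewrite -[LHS](set_act1 half_act1) -(mulgV h) !(set_actM half_actM) e.
  by rewrite -{1}Jh -(set_actM half_actM) mulgV (set_act1 half_act1).
have Sv g i : g \in S -> i \in J -> 0 < half i (v *m rG g).
  rewrite inE => /eqP Jg; rewrite -{1}Jg => /imsetP[j jJ ->].
  by rewrite half_actE; exact: vJ.
apply: (@star_acyclic _ _ _ _ _ (\sum_(g in S) v *m rG g)).
  split=> [i iJ|g /PJ gJ] /=.
    rewrite half_sum (bigD1 1%g) //= ltr_wpDr ?Sv //.
    by apply: sumr_ge0 => g /andP[gS _]; rewrite ltW ?Sv.
  have gS : g \in S by rewrite inE; apply/eqP.
  rewrite mulmx_suml [RHS](reindex_inj (mulIg g)) /=.
  by apply: eq_big => h; rewrite ?SM // => hS; rewrite -mulmxA -repr_mxM ?finset.in_setT.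
move=> t w /andP[t0 t1] [wJ wP]; split=> [i iJ|g gP] /=.
  rewrite half_linear halfZ; have wi := wJ i iJ.
  have ei : 0 < half i (\sum_(g in S) v *m rG g).
    rewrite half_sum (bigD1 1%g) //= ltr_wpDr ?Sv //.
    by apply: sumr_ge0 => g /andP[gS _]; rewrite ltW ?Sv.
  have [->|t1'] := eqVneq t 1; first by rewrite subrr mul0r add0r mul1r.
  apply: ltr_wpDr; first by apply: mulr_ge0 => //; exact: ltW.
  by apply: mulr_gt0 => //; rewrite subr_gt0 lt_neqAle t1'.
have gS : g \in S by rewrite inE PJ.
rewrite mulmxDl -!scalemxAl wP //; congr (_ + _ *: _).
rewrite mulmx_suml [RHS](reindex_inj (mulIg g)) /=.
by apply: eq_big => h; rewrite ?SM // => hS; rewrite -mulmxA -repr_mxM ?finset.in_setT.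
Qed.

Lemma half_space_cover : \bigcup_i half_space i = finpart (rG := rG) [set v | v != 0].
Proof.
apply/seteqP; split=> -[v|] /=.
- by move=> [i _] /= vi; apply: contraTneq vi => ->; rewrite half0 ltxx.
- by case.
- move=> /rV0Pn[j vj]; exists (1%g, j, v 0 j < 0) => //=.
  rewrite /half /= repr_mx1 mulmx1; case: (ltrP (v 0 j) 0) => v0 /=.
    by rewrite mulN1r oppr_gt0.
  by rewrite mul1r lt_neqAle eq_sym vj.
- by [].
Qed.

(** V and the complement of 0 contract by scalings, which commute with the group, and meet in the
    union of the half-spaces. The nerve gives #|I| + 1 and the union adds one. *)
Lemma rep_sphere_findim : findim (R := R) (X := SV) (inside setT) #|{: I}|.+2.
Proof.
have iA : invariant_set (X := SV) (finpart setT) by move=> [v|].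
have iB : invariant_set (X := SV) (infpart [set v | v != 0]).
  move=> [v|] g //= v0; apply: contraNneq v0 => /(congr1 (mulmx^~ (rG g^-1%g))).
  by rewrite repr_mxK ?finset.in_setT // mul0mx => ->.
have AB : finpart setT `&` infpart [set v | v != 0] = finpart (rG := rG) [set v | v != 0].
  by apply/seteqP; split=> -[v|] //= [].
apply: (findim_union iA iB).
- move=> s x; case E: (tagged s x) => [v|].
    exists true; apply: (@cts_fun _ _ (tagged s) x (finpart setT)); apply: open_nbhs_nbhs.
    by split; [apply: open_finpart => w _; exact: filterT|rewrite E].
  exists false; apply: (@cts_fun _ _ (tagged s) x (infpart [set v | v != 0])); apply: open_nbhs_nbhs.
  by split; [exact: open_infpart_neq0|rewrite E].
- move=> s _; rewrite fixset_finpart; apply: (@star_acyclic _ _ _ _ _ 0).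
    by split=> // g _; rewrite mul0mx.
  move=> t v _ [_ vP]; split=> // g gP; rewrite scaler0 addr0 -scalemxAl.
  by congr (_ *: _); exact: vP.
- move=> s _; rewrite fixset_infpart; apply: infstar_acyclic => [[/=]|c v c1 [v0 vP]].
    by rewrite eqxx.
  split; first by rewrite /= scaler_eq0 negb_or v0 andbT gt_eqF // (lt_le_trans ltr01).
  by move=> g gP; rewrite -scalemxAl vP.
rewrite AB -half_space_cover; apply: (@nerve_findim R gT SV None _ half_act half_space half_act1 half_actM half_space_act half_space_open).
exact: half_space_meet_acyclic.
Qed.
End FiniteDimension.

Local Close Scope classical_set_scope.

(** * Homomorphism complexes over a cyclic group of prime order *)

Section CyclicAction.
Variables (gT : finGroupType) (X : gcomplex gT) (g : gT) (l : nat).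
Hypotheses (pr_l : prime l) (ord_g : #[g]%g = l).
Implicit Types (u v r : X) (c e : chain X) (A : X -> Prop).

Definition fixd u : Prop := cact u g = u.
Definition tau c : chain X := c - act g c.
Definition norm c : chain X := \sum_(i < l) act (g ^+ i)%g c.

Lemma tauB c e : tau (c - e) = tau c - tau e.
Proof. by rewrite /tau actB; abel. Qed.

Lemma normB c e : norm (c - e) = norm c - norm e.
Proof. by rewrite /norm -sumrB; apply: eq_bigr => i _; rewrite actB. Qed.

Lemma norm0 : norm 0 = 0.
Proof. by rewrite /norm big1 // => i _; rewrite act0. Qed.

Lemma order_gt0 : (0 < l)%N. Proof. exact: prime_gt0. Qed.

Lemma expg_l : (g ^+ l = 1)%g. Proof. by rewrite -ord_g expg_order. Qed.

Lemma norm_act c : norm (act g c) = norm c.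
Proof.
rewrite /norm; case: l order_gt0 expg_l => // m _ gm.
rewrite big_ord_recr big_ord_recl /= expg0 act1 addrC; congr (_ + _).
  by rewrite -actM -expgS gm act1.
by apply: eq_bigr => i _; rewrite -actM -expgS.
Qed.

Lemma act_norm c : act g (norm c) = norm c.
Proof.
rewrite -[RHS]norm_act /norm raddf_sum; apply: eq_bigr => i _ /=.
by rewrite -!actM -expgSr -expgS.
Qed.

Lemma norm_tau c : norm (tau c) = 0.
Proof. by rewrite normB norm_act subrr. Qed.

Lemma coeff_act h u c : coeff u (act h c) = coeff (cact u h^-1%g) c.
Proof.
apply: (@on_ind _ (fun=> True) (fun c => coeff u (act h c) = coeff (cact u h^-1%g) c)) => // [|x y ex ey|v _].
- by rewrite act0 !coeff0.
- by rewrite actB !coeffB ex ey.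
rewrite actU !coeffU; congr (_ * _%:R); congr (nat_of_bool _).
by apply/eqP/eqP => [<-|->]; rewrite ?cactK ?cactKV.
Qed.

Definition prep u : X := xget u [set v : X | exists i, v = cact u (g ^+ i)%g].

Lemma fixdX u i : fixd u -> cact u (g ^+ i)%g = u.
Proof. by move=> gu; elim: i => [|i IH]; rewrite ?expg0 ?cact1 // expgS cactM gu. Qed.

Lemma expg_mod_l i : (g ^+ (i %% l) = g ^+ i)%g.
Proof. by rewrite -ord_g expg_mod_order. Qed.

Lemma cact_cancel u v i : v = cact u (g ^+ i)%g -> exists j, u = cact v (g ^+ j)%g.
Proof.
move=> ->; exists ((l - 1) * i)%N; rewrite -cactM -expgD -mulSn.
by rewrite subn1 prednK ?order_gt0 // expgM expg_l expg1n cact1.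
Qed.

Lemma prepP u : exists i, prep u = cact u (g ^+ i)%g.
Proof.
rewrite /prep; case: xgetP => [v _ [i ->]|/(_ u)[]]; first by exists i.
by exists 0%N; rewrite expg0 cact1.
Qed.

Lemma prep_act u i : prep (cact u (g ^+ i)%g) = prep u.
Proof.
rewrite /prep; have -> : [set v : X | exists j, v = cact (cact u (g ^+ i)%g) (g ^+ j)%g]%classic =
    [set v : X | exists j, v = cact u (g ^+ j)%g]%classic.
  apply/seteqP; split=> v [j ->]; first by exists (i + j)%N; rewrite -cactM expgD.
  have [m mE] := cact_cancel (erefl (cact u (g ^+ i)%g)).
  by exists (m + j)%N; rewrite expgD cactM -mE.
rewrite /xget; case: pselect => [//|n]; case: n.
by exists u; apply/asboolP; exists 0%N; rewrite expg0 cact1.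
Qed.

Lemma prepK u : prep (prep u) = prep u.
Proof. by have [i ri] := prepP u; rewrite {1}ri prep_act. Qed.

(** The least exponent: it is 0 at representatives and drops by one under g^-1 elsewhere, as the
    telescoping sums of [hom_ker_norm] need. *)
Definition idx u := find (fun j => u == cact (prep u) (g ^+ j)%g) (iota 0 l).

Lemma idx_has u : has (fun j => u == cact (prep u) (g ^+ j)%g) (iota 0 l).
Proof.
have [i /cact_cancel[j uE]] := prepP u; apply/hasP; exists (j %% l)%N.
  by rewrite mem_iota /= ltn_mod order_gt0.
by rewrite expg_mod_l; apply/eqP.
Qed.

Lemma idxP u : u = cact (prep u) (g ^+ idx u)%g.
Proof.
have /(nth_find 0%N) := idx_has u; rewrite -/(idx u) nth_iota.
  by move/eqP.
by have := idx_has u; rewrite has_find size_iota.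
Qed.

Lemma idx_min u j : (j < idx u)%N -> u <> cact (prep u) (g ^+ j)%g.
Proof.
move=> ji uE; have := before_find 0%N ji; rewrite nth_iota ?add0n -?uE ?eqxx //.
by apply: (ltn_trans ji); have := idx_has u; rewrite has_find size_iota.
Qed.

Lemma idx0 u : idx u = 0%N -> prep u = u.
Proof. by move=> u0; rewrite [RHS]idxP u0 expg0 cact1. Qed.

Lemma cactVX u i : cact (cact u (g ^+ i.+1)%g) g^-1%g = cact u (g ^+ i)%g.
Proof. by rewrite -cactM expgSr mulgK. Qed.

Lemma prepV u : prep (cact u g^-1%g) = prep u.
Proof. by have := prep_act (cact u g^-1%g) 1; rewrite expg1 cactKV => ->. Qed.

Lemma idxV u j : idx u = j.+1 -> idx (cact u g^-1%g) = j.
Proof.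
move=> uj; have e : cact u g^-1%g = cact (prep u) (g ^+ j)%g by rewrite {1}[u]idxP uj cactVX.
have le : (idx (cact u g^-1%g) <= j)%N.
  by rewrite leqNgt; apply/negP => /idx_min; rewrite prepV e.
apply/eqP; rewrite eqn_leq le /= leqNgt; apply/negP => lt.
have := idxP (cact u g^-1%g); set i := idx _ in lt * => /(congr1 (fun v => cact v g)).
rewrite cactKV prepV -cactM -expgSr => /esym; apply/nesym/idx_min.
by rewrite uj ltnS.
Qed.

Lemma free_orbit u i : ~ fixd u -> (0 < i < l)%N -> cact u (g ^+ i)%g <> u.
Proof.
move=> nu /andP[i0 il] ui; case: nu.
have ui' j : cact u (g ^+ (i * j))%g = u.
  by elim: j => [|j IH]; rewrite ?muln0 ?expg0 ?cact1 // mulnS expgD cactM ui.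
have : coprime i l by rewrite coprime_sym prime_coprime // gtnNdvd.
rewrite /coprime; case: (egcdnP l i0) => km kn e _ /eqP gc.
have := ui' km; rewrite mulnC e gc expgD mulnC expgM expg_l expg1n mul1g expg1.
by [].
Qed.

Lemma rep_orbit u r i : prep u = u -> prep r = r -> cact u (g ^+ i)%g = r -> u = r.
Proof. by move=> ur rr uE; rewrite -ur -rr -uE prep_act. Qed.

(** As l is prime, an orbit is free or a point: a representative occurs once in the norm of itself
    in the first case and l times in the second. *)
Lemma coeff_norm_rep r c : prep r = r -> on (fun u => prep u = u) c ->
  coeff r (norm c) = coeff r c *+ (if `[< fixd r >] then l else 1).
Proof.
move=> rr; apply: (@on_ind _ _ (fun c => coeff r (norm c) = _)) => [|x y ex ey|u uu].
- by rewrite norm0 coeff0 mul0rn.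
- by rewrite normB !coeffB ex ey mulrnBl.
rewrite /norm raddf_sum /= coeffU mul1r.
have E (i : nat) : coeff r (act (g ^+ i)%g << u >>) = (cact u (g ^+ i)%g == r)%:R.
  by rewrite actU coeffU mul1r.
under eq_bigr => i _ do rewrite E.
have [<-|ne] := eqVneq u r; last first.
  rewrite mul0rn big1 // => i _; case: eqP => // /rep_orbit -/(_ uu rr) ur.
  by rewrite ur eqxx in ne.
case: asboolP => fu.
  under eq_bigr => i _ do rewrite fixdX // eqxx.
  by rewrite sumr_const card_ord.
rewrite (bigD1 (Ordinal order_gt0)) //= expg0 cact1 eqxx big1 ?addr0 // => i i0.
case: eqP => // e; case: (free_orbit fu (i := i)) => //.
by rewrite ltn_ord lt0n andbT.
Qed.

Section Invariant.
Variable A : X -> Prop.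
Hypothesis gA : forall u i, A u -> A (cact u (g ^+ i)%g).

(** Moving a cell by g costs one term in the image of [tau]; induction on [idx] leads to the
    representative. *)
Lemma chain_reps c : on A c -> exists c' e,
  [/\ on (fun u => A u /\ prep u = u) c', on A e & c = c' + tau e].
Proof.
move: c; apply: on_ind => [|x y [x' [ex [x1 x2 ->]]] [y' [ey [y1 y2 ->]]]|u Au].
- by exists 0, 0; split; [exact: on0|exact: on0|rewrite /tau act0 subrr addr0].
- exists (x' - y'), (ex - ey); split; [exact: onB|exact: onB|].
  by rewrite tauB; abel.
have [i ri] := prepP u; have Ar : A (prep u) by rewrite ri; exact: gA.
exists << prep u >>; have := idxP u; move: (idx u) => j; elim: j u Au {i ri} Ar => [|j IH] u Au Ar uE.
  exists 0; split; [by apply: onU; rewrite prepK|exact: on0|].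
  by rewrite /tau act0 subr0 addr0 {1}uE expg0 cact1.
pose v := cact (prep u) (g ^+ j)%g; have Av : A v by exact: gA.
have vE : prep v = prep u by rewrite prep_act prepK.
have [||e [on1 on2 eE]] := IH v Av; [by rewrite vE|by rewrite vE|].
exists (e - << v >>); split; [by rewrite -vE|by apply: onB => //; exact: onU|].
have te : tau e = << v >> - << prep u >> by rewrite eE vE addrAC subrr add0r.
have tv : tau << v >> = << v >> - << u >> by rewrite /tau actU -cactM -expgSr -uE.
have H (M : zmodType) (x y z : M) : x = y + (z - y - (z - x)) by abel.
by rewrite tauB te tv; exact: H.
Qed.

(** Modulo the image of [tau] only representatives remain, where the norm multiplies coefficients by
    1 or l and is therefore injective. *)
Lemma chain_ker_norm c : on A c -> norm c = 0 -> exists2 e, on A e & c = tau e.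
Proof.
move=> Ac nc; have [c' [e [c'on eon cE]]] := chain_reps Ac; exists e => //.
rewrite cE -[RHS]add0r; congr (_ + _); apply/eqP/freeg_eqP => r; rewrite coeff0.
have [rr|nr] := pselect (prep r = r); last first.
  by apply: coeff_outdom; apply/negP => /c'on[].
have : norm c' = 0.
  have -> : c' = c - tau e by rewrite cE addrK.
  by rewrite normB nc norm_tau subrr.
move/(congr1 (coeff r)); rewrite coeff_norm_rep //; last by apply: onS c'on => u [].
rewrite coeff0; case: ifP => _ /eqP; rewrite mulrn_eq0 ?orbF => /orP[|/eqP//] //.
by rewrite eqn0Ngt order_gt0.
Qed.

(** An invariant chain is determined by its coefficients at representatives. The norm of a fixed
    cell is l times the cell, whence the divisibility. *)
Lemma chain_normP c : on A c -> act g c = c ->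
  (forall u, fixd u -> (l%:Z %| coeff u c)%Z) -> exists2 e, on A e & c = norm e.
Proof.
move=> Ac gc cd; pose w u := if `[< fixd u >] then (coeff u c %/ l%:Z)%Z else coeff u c.
pose e : chain X := \sum_(u <- dom c | prep u == u) << w u *g u >>.
have eon : on (fun u => A u /\ prep u = u) e.
  rewrite /e big_seq_cond; apply: on_sum => u /andP[/Ac Au /eqP uu].
  by rewrite freegUE; apply: onMz; apply: onU.
exists e; first by apply: onS eon => u [].
have inv b r j : act g b = b -> coeff (cact r (g ^+ j)%g) b = coeff r b.
  by move=> gb; elim: j => [|j IH]; rewrite ?expg0 ?cact1 // -[in LHS]gb coeff_act cactVX.
apply/eqP/freeg_eqP => v; have {1 2}-> := idxP v.
rewrite !inv ?act_norm //; set r := prep v; have rr : prep r = r by exact: prepK.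
rewrite coeff_norm_rep //; last by apply: onS eon => u [].
have -> : coeff r e = w r.
  rewrite /e raddf_sum /=; have [rc|rc] := boolP (r \in dom c).
    rewrite big_mkcond (bigD1_seq r) ?uniq_dom //= rr eqxx big1 ?addr0 ?coeffU ?eqxx ?mulr1 //.
    by move=> u /negPf ur; case: ifP => // _; rewrite coeffU ur mulr0.
  rewrite big_seq_cond big1 => [|u /andP[uc _]].
    by rewrite /w (coeff_outdom rc) div0z if_same.
  by rewrite coeffU; case: eqP uc rc => [->->|_ _ _]; rewrite ?mulr0.
rewrite /w; case: asboolP => // fr.
by rewrite pmulrn mulrzz divzK ?cd.
Qed.
End Invariant.
End CyclicAction.

Section Homs.
Variables (gT : finGroupType) (Y X : gcomplex gT).

Definition hom : zmodType := (Y : Type) -> chain X.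
Implicit Types (f h : hom) (g : gT).

Definition hact g f : hom := fun s => act g (f (cact s g^-1%g)).

Definition homog (n : int) f : Prop :=
  forall s, on (fun u => (ctag u)%:Z = (ctag s)%:Z + n) (f s).

Lemma homBE f h s : (f - h) s = f s - h s. Proof. by []. Qed.
Lemma homDE f h s : (f + h) s = f s + h s. Proof. by []. Qed.

Lemma hom_sumE (I : Type) (r : seq I) (P : pred I) (F : I -> hom) s :
  (\sum_(i <- r | P i) F i) s = \sum_(i <- r | P i) F i s.
Proof. by elim/big_rec2: _ => // i y z _ <-. Qed.

Lemma hact_is_additive g : zmod_morphism (hact g).
Proof. by move=> f h; apply/funext => s; rewrite /hact homBE actB. Qed.
HB.instance Definition _ g :=
  GRing.isZmodMorphism.Build hom hom (hact g) (hact_is_additive g).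

Lemma hact1 f : hact 1%g f = f.
Proof. by apply/funext => s; rewrite /hact act1 invg1 cact1. Qed.

Lemma hactM g k f : hact (g * k)%g f = hact k (hact g f).
Proof. by apply/funext => s; rewrite /hact actM invMg cactM. Qed.

Lemma hactB g f h : hact g (f - h) = hact g f - hact g h. Proof. exact: raddfB. Qed.
Lemma hactD g f h : hact g (f + h) = hact g f + hact g h. Proof. exact: raddfD. Qed.

Lemma homog0 n : homog n 0. Proof. by move=> s; exact: on0. Qed.

Lemma homogB n f h : homog n f -> homog n h -> homog n (f - h).
Proof. by move=> nf nh s; exact: onB. Qed.

Lemma homogD n f h : homog n f -> homog n h -> homog n (f + h).
Proof. by move=> nf nh s; exact: onD. Qed.

Lemma homog_act n f g : homog n f -> homog n (hact g f).
Proof. by move=> nf s; apply: on_actW (nf _) => u; rewrite !ctag_act. Qed.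

Lemma homog_sum n (I : Type) (r : seq I) (P : pred I) (F : I -> hom) :
  (forall i, P i -> homog n (F i)) -> homog n (\sum_(i <- r | P i) F i).
Proof. by move=> nF s; rewrite hom_sumE; apply: on_sum => i /nF; apply. Qed.

Section Cyclic.
Variables (g : gT) (l : nat).
Hypotheses (pr_l : prime l) (ord_g : #[g]%g = l).

Definition htau f : hom := f - hact g f.
Definition hnorm f : hom := \sum_(i < l) hact (g ^+ i)%g f.

Lemma htauB f h : htau (f - h) = htau f - htau h.
Proof. by rewrite /htau hactB; abel. Qed.

Lemma hnormB f h : hnorm (f - h) = hnorm f - hnorm h.
Proof. by rewrite /hnorm -sumrB; apply: eq_bigr => i _; rewrite raddfB. Qed.

Lemma hnorm_act f : hnorm (hact g f) = hnorm f.
Proof.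
rewrite /hnorm; case: l (order_gt0 pr_l) (expg_l ord_g) => // m _ gm.
rewrite big_ord_recr big_ord_recl /= expg0 hact1 addrC; congr (_ + _).
  by rewrite -hactM -expgS gm hact1.
by apply: eq_bigr => i _; rewrite -hactM -expgS.
Qed.

Lemma hact_norm f : hact g (hnorm f) = hnorm f.
Proof.
rewrite -[RHS]hnorm_act /hnorm raddf_sum; apply: eq_bigr => i _ /=.
by rewrite -!hactM -expgSr -expgS.
Qed.

Lemma hnorm_tau f : hnorm (htau f) = 0.
Proof. by rewrite hnormB hnorm_act subrr. Qed.

Lemma hnorm_fixd f s : fixd g s -> hnorm f s = norm g l (f s).
Proof.
move=> fs; rewrite /hnorm hom_sumE; apply: eq_bigr => i _; rewrite /hact.
by rewrite -{1}(fixdX i fs) cactK.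
Qed.

Lemma homog_norm n f : homog n f -> homog n (hnorm f).
Proof. by move=> nf; apply: homog_sum => i _; exact: homog_act. Qed.

Lemma homog_tau n f : homog n f -> homog n (htau f).
Proof. by move=> nf; apply: homogB => //; exact: homog_act. Qed.

Lemma fixdV (Z : gcomplex gT) (s : Z) : fixd g (cact s g^-1%g) -> fixd g s.
Proof. by rewrite /fixd cactKV => e; rewrite [in LHS]e cactKV. Qed.

Lemma cact_inj (Z : gcomplex gT) (s t : Z) (h : gT) : cact s h = cact t h -> s = t.
Proof. by move=> /(congr1 (fun v => cact v h^-1%g)); rewrite !cactK. Qed.

(** Telescoping sums along orbits of the source clear all values except those at representatives;
    the vanishing norm then clears free representatives, and at fixed cells the statement is
    [chain_ker_norm]. *)
Lemma hom_ker_norm n f : homog n f -> hnorm f = 0 -> exists2 e, homog n e & f = htau e.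
Proof.
move=> nf f0.
pose e1 : hom := fun s => \sum_(i < idx g l s) hact (g ^+ i)%g f s.
have ne1 : homog n e1 by move=> s; apply: on_sum => i _; exact: homog_act.
pose f1 := f - htau e1.
have f1E s : (0 < idx g l s)%N -> f1 s = 0.
  case E: (idx g l s) => [//|j] _; rewrite /f1 /htau !homBE /hact {1}/e1 /e1 (idxV pr_l ord_g E) E.
  rewrite big_ord_recl /= expg0 hact1 raddf_sum /= -[RHS](subrr (f s)); congr (_ - _).
  rewrite -[RHS]addr0 -addrA; congr (_ + _); rewrite -sumrB big1 // => i _.
  by rewrite /bump add1n expgSr hactM subrr.
have f1n : hnorm f1 = 0 by rewrite /f1 hnormB f0 hnorm_tau subrr.
have f1r s : ~ fixd g s -> f1 s = 0.
  move=> ns; have [|s0] := posnP (idx g l s); last exact: f1E.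
  move=> /(idx0 pr_l ord_g) ss; have := congr1 (fun f : hom => f s) f1n.
  rewrite /hnorm hom_sumE (bigD1 (Ordinal (order_gt0 pr_l))) //= expg0 hact1 big1 ?addr0 // => i i0.
  rewrite /hact f1E ?act0 // lt0n; apply/eqP => /(idx0 pr_l ord_g) e.
  have si : cact (cact s (g ^+ i)^-1%g) (g ^+ i)%g = s by rewrite cactKV.
  have := rep_orbit pr_l ord_g e ss si => /(congr1 (fun t => cact t (g ^+ i)%g)).
  rewrite si => /esym; apply: (free_orbit pr_l ord_g ns).
  by rewrite ltn_ord lt0n andbT.
have /boolp.choice[w wP] : forall s, exists v : chain X, on (fun u => (ctag u)%:Z = (ctag s)%:Z + n) v /\
    (fixd g s -> f1 s = tau g v) /\ (~ fixd g s -> v = 0).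
  move=> s; have [fs|ns] := pselect (fixd g s); last first.
    by exists 0; split; [exact: on0|split].
  have [|||e eon eE] := @chain_ker_norm gT X g l pr_l ord_g (fun u => (ctag u)%:Z = (ctag s)%:Z + n) _ (f1 s).
  - by move=> u i; rewrite ctag_act.
  - by apply: homogB => //; exact: homog_tau.
  - by rewrite -hnorm_fixd // f1n.
  by exists e; split.
exists (e1 + w); first by apply: homogD => // s; case: (wP s).
have -> : htau (e1 + w) = htau e1 + htau w by rewrite /htau hactD; abel.
have -> : htau w = f1; last by rewrite /f1 addrC subrK.
apply/funext => s; rewrite /htau homBE /hact; have [_ [ws1 ws2]] := wP s.
have [fs|ns] := pselect (fixd g s).
  by rewrite ws1 // /tau -{2}fs cactK.
have [_ [_ ->]] := wP (cact s g^-1%g); last by move/fixdV.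
by rewrite act0 subr0 f1r ?ws2.
Qed.

(** On a free orbit an invariant [f] is the norm of its value at the representative alone; at fixed
    cells the claim is [chain_normP]. *)
Lemma hom_normP n f : homog n f -> hact g f = f ->
  (forall s u, fixd g s -> fixd g u -> (l%:Z %| coeff u (f s))%Z) ->
  exists2 e, homog n e & f = hnorm e.
Proof.
move=> nf gf fd.
have /boolp.choice[e eP] : forall s, exists v : chain X, on (fun u => (ctag u)%:Z = (ctag s)%:Z + n) v /\
    (fixd g s -> f s = norm g l v) /\
    (~ fixd g s -> v = if prep g s == s then f s else 0).
  move=> s; have [fs|ns] := pselect (fixd g s); last first.
    exists (if prep g s == s then f s else 0); split=> //.
    by case: ifP => _; [exact: nf|exact: on0].
  have [|||e eon eE] := @chain_normP gT X g l pr_l ord_g (fun u => (ctag u)%:Z = (ctag s)%:Z + n) (f s).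
  - exact: nf.
  - by rewrite -{2}gf /hact -{2}fs cactK.
  - by move=> u; exact: fd.
  by exists e.
have gfi i : hact (g ^+ i)%g f = f.
  by elim: i => [|i IH]; rewrite ?expg0 ?hact1 // expgS hactM gf.
exists e; first by move=> s; case: (eP s).
apply/funext => s; have [fs|ns] := pselect (fixd g s).
  by rewrite hnorm_fixd //; have [_ [->]] := eP s.
have ji : (idx g l s < l)%N.
  by have := idx_has pr_l ord_g s; rewrite has_find size_iota.
rewrite /hnorm hom_sumE (bigD1 (Ordinal ji)) //= big1 => [|i ij].
  rewrite addr0 /hact; have sE := idxP pr_l ord_g s.
  have rE : cact s (g ^+ idx g l s)^-1%g = prep g s by rewrite {1}sE cactK.
  have nr : ~ fixd g (prep g s).
    by move=> fr; apply: ns; rewrite sE /fixd (fixdX _ fr).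
  rewrite rE; have [_ [_ ->]] := eP (prep g s) => //.
  by rewrite (prepK pr_l ord_g) eqxx -rE -[in LHS](gfi (idx g l s)).
rewrite /hact; set t := cact s (g ^+ i)^-1%g.
have st : s = cact t (g ^+ i)%g by rewrite /t cactKV.
have nt : ~ fixd g t by move=> ft; apply: ns; rewrite st /fixd (fixdX _ ft).
have [_ [_ ->]] := eP t => //; case: eqP => [tt|]; last by rewrite act0.
have rt : prep g s = t by rewrite st (prep_act pr_l ord_g).
have sE := idxP pr_l ord_g s; rewrite rt in sE.
exfalso; move/eqP: ij; apply; apply/val_inj/eqP => /=; rewrite eqn_leq.
apply/andP; split; rewrite leqNgt; apply/negP => lt.
  have := free_orbit pr_l ord_g nt (i := i - idx g l s); apply.
    by rewrite subn_gt0 lt (leq_ltn_trans (leq_subr _ _) (ltn_ord i)).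
  apply: (cact_inj (h := (g ^+ idx g l s)%g)).
  by rewrite -cactM -expgD subnK ?(ltnW lt) // -st -sE.
have := free_orbit pr_l ord_g nt (i := idx g l s - i); apply.
  by rewrite subn_gt0 lt (leq_ltn_trans (leq_subr _ _) ji).
apply: (cact_inj (h := (g ^+ i)%g)).
by rewrite -cactM -expgD subnK ?(ltnW lt) // -sE -st.
Qed.
End Cyclic.
End Homs.

(** * The zigzag argument in an abstract graded group with operators *)

Section TateArgument.
Variables (E : zmodType) (gr : int -> E -> Prop) (D ta sg : E -> E) (l : nat) (N f : int).
Hypothesis pr_l : prime l.
Hypotheses (gr0 : forall n, gr n 0) (grB : forall n x y, gr n x -> gr n y -> gr n (x - y)).
Hypotheses (DB : forall x y, D (x - y) = D x - D y) (DK : forall x, D (D x) = 0).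
Hypothesis grD : forall n x, gr (n + 1) x -> gr n (D x).
Hypotheses (taB : forall x y, ta (x - y) = ta x - ta y) (sgB : forall x y, sg (x - y) = sg x - sg y).
Hypotheses (grta : forall n x, gr n x -> gr n (ta x)) (grsg : forall n x, gr n x -> gr n (sg x)).
Hypotheses (Dta : forall x, D (ta x) = ta (D x)) (Dsg : forall x, D (sg x) = sg (D x)).
Hypotheses (sgta : forall x, sg (ta x) = 0) (tasg : forall x, ta (sg x) = 0).
Hypothesis ker_sg : forall n x, gr n x -> sg x = 0 -> exists2 y, gr n y & x = ta y.
Hypothesis parity : exists c : int, N = f + 2 * c.

(* The homology of [E] is infinite cyclic, in degree [N]. *)
Variables (ce : E -> int) (io : E).
Hypothesis HE : forall n x, gr n x -> D x = 0 -> (n = N -> ce x = 0) -> exists2 h, gr (n + 1) h & x = D h.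
Hypotheses (ceB : forall x y, ce (x - y) = ce x - ce y) (ceD : forall x, gr (N + 1) x -> ce (D x) = 0).
Hypothesis ce_sg : forall x, gr N x -> D x = 0 -> ce (sg x) = ce x *+ l.
Hypothesis ce_ta : forall x, gr N x -> D x = 0 -> ce (ta x) = 0.
Hypotheses (gr_io : gr N io) (D_io : D io = 0) (ce_io : ce io = 1).

(* The homology of [ker ta / im sg] is of order [l], in degree [f]. *)
Variables (cf : E -> 'F_l) (ph e0 : E).
Hypothesis HPhi : forall n y e1, gr n y -> ta y = 0 -> D y = sg e1 -> (n = f -> cf y = 0) ->
  exists a e, [/\ gr (n + 1) a, ta a = 0, gr n e & y = D a + sg e].
Hypotheses (cfB : forall x y, cf (x - y) = cf x - cf y)
  (cf_sg : forall x, gr f x -> cf (sg x) = 0)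
  (cf_D : forall x, gr (f + 1) x -> ta x = 0 -> cf (D x) = 0).
Hypotheses (gr_ph : gr f ph) (ta_ph : ta ph = 0) (gr_e0 : gr (f - 1) e0) (D_ph : D ph = sg e0) (cf_ph : cf ph = 1).

Definition cyc n y := [/\ gr n y, ta y = 0 & D y = 0].
Definition bnd n y := exists a, [/\ gr (n + 1) a, ta a = 0 & y = D a].
Definition van n := forall y, cyc n y -> bnd n y.

Hypothesis HV : exists M : int, forall n, M <= n \/ n <= - M -> van n.

(** [al i] models an element x with g^x = g^k, k = [ka i], and [S i] models 1 + g + ... + g^(k-1).
    Since (1 - g) times this sum is 1 - g^k, [taS] holds, while on invariants [S i] is
    multiplication by k; this is how k enters [up_al]. *)
Variables (I : Type) (al S : I -> E -> E) (ka : I -> nat).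
Hypotheses (alB : forall i x y, al i (x - y) = al i x - al i y)
  (gral : forall i n x, gr n x -> gr n (al i x)) (Dal : forall i x, D (al i x) = al i (D x))
  (sgal : forall i x, sg (al i x) = al i (sg x)) (taal : forall i x, ta x = 0 -> ta (al i x) = 0)
  (grS : forall i n x, gr n x -> gr n (S i x)) (DS : forall i x, D (S i x) = S i (D x))
  (taS : forall i x, ta (S i (al i x)) = al i (ta x))
  (Sta : forall i x, ta x = 0 -> S i x = x *+ ka i).
Hypothesis cf_al : forall i y e, gr f y -> ta y = 0 -> D y = sg e -> cf (al i y) = cf y.
Hypothesis ka_unit : forall i, (ka i)%:R != 0 :> 'F_l.

Lemma D0 : D 0 = 0. Proof. by rewrite -{1}(subrr 0) DB subrr. Qed.
Lemma ta0 : ta 0 = 0. Proof. by rewrite -{1}(subrr 0) taB subrr. Qed.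
Lemma sg0 : sg 0 = 0. Proof. by rewrite -{1}(subrr 0) sgB subrr. Qed.
Lemma al0 i : al i 0 = 0. Proof. by rewrite -{1}(subrr 0) alB subrr. Qed.
Lemma cf0 : cf 0 = 0. Proof. by rewrite -{1}(subrr 0) cfB subrr. Qed.
Lemma ce0 : ce 0 = 0. Proof. by rewrite -{1}(subrr 0) ceB subrr. Qed.

Lemma addBB (M : zmodType) (x y : M) : x + y = x - (0 - y).
Proof. by rewrite sub0r opprK. Qed.

Lemma DA x y : D (x + y) = D x + D y. Proof. by rewrite [x + y]addBB [RHS]addBB !DB D0. Qed.
Lemma cfA x y : cf (x + y) = cf x + cf y. Proof. by rewrite [x + y]addBB [RHS]addBB !cfB cf0. Qed.
Lemma taA x y : ta (x + y) = ta x + ta y. Proof. by rewrite [x + y]addBB [RHS]addBB !taB ta0. Qed.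

Lemma grD' n m x : gr n x -> n = m + 1 -> gr m (D x).
Proof. by move=> nx nm; apply: grD; rewrite -nm. Qed.

Lemma gr_eq n m x : gr n x -> n = m -> gr m x. Proof. by move=> + <-. Qed.

Lemma cyc0 n : cyc n 0. Proof. by split; [|exact: ta0|exact: D0]. Qed.

Lemma cycB n x y : cyc n x -> cyc n y -> cyc n (x - y).
Proof. by move=> [x1 x2 x3] [y1 y2 y3]; split; [exact: grB|rewrite taB x2 y2 subrr|rewrite DB x3 y3 subrr]. Qed.

Lemma bnd0 n : bnd n 0. Proof. by exists 0; rewrite D0 ta0. Qed.

Lemma bndB n x y : bnd n x -> bnd n y -> bnd n (x - y).
Proof.
move=> [a [a1 a2 ->]] [b [b1 b2 ->]]; exists (a - b).
by rewrite DB taB a2 b2 subrr; split=> //; exact: grB.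
Qed.

Lemma bndD n x y : bnd n x -> bnd n y -> bnd n (x + y).
Proof. by move=> bx by_; rewrite addBB; apply: bndB => //; apply: bndB => //; exact: bnd0. Qed.

Lemma bndE n a : gr (n + 1) a -> ta a = 0 -> bnd n (D a).
Proof. by move=> na ta_; exists a. Qed.

Lemma bnd_cyc n y : bnd n y -> cyc n y.
Proof. by move=> [a [a1 a2 ->]]; split; [exact: grD|rewrite -Dta a2 D0|exact: DK]. Qed.

(* The relation inducing the periodicity maps between the homology groups in degrees n and n + 2 of ker ta. *)
Definition up n y z := exists e' e,
  [/\ gr (n + 1) e', gr (n + 2) e, y = D e', ta e' = D e & z = sg e].

Lemma up_exists n y e' : gr (n + 1) e' -> y = D e' -> ta y = 0 -> n + 1 != N -> exists z, up n y z.
Proof.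
move=> ne' yE ty nN; have [||/eqP|e ne eE] := @HE (n + 1) (ta e'); [exact: grta|by rewrite Dta -yE|by rewrite (negPf nN)|].
by exists (sg e), e', e; split=> //; apply: gr_eq ne _; ring.
Qed.

Lemma up_cyc n y z : up n y z -> cyc n y /\ cyc (n + 2) z.
Proof.
move=> [e' [e [e1 e2 -> e3 ->]]]; split; split.
- exact: grD.
- by rewrite -Dta e3 DK.
- exact: DK.
- exact: grsg.
- exact: tasg.
- by rewrite Dsg -e3 sgta.
Qed.

Lemma upB n y z y' z' : up n y z -> up n y' z' -> up n (y - y') (z - z').
Proof.
move=> [e' [e [e1 e2 -> e3 ->]]] [d' [d [d1 d2 -> d3 ->]]]; exists (e' - d'), (e - d).
by rewrite !DB taB sgB e3 d3; split=> //; exact: grB.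
Qed.

Lemma up_al i n y z : up n y z -> up n (al i y *+ ka i) (al i z).
Proof.
move=> yz; have [[_ ty _] _] := up_cyc yz; move: yz => [e' [e [e1 e2 yE e3 ->]]].
exists (S i (al i e')), (al i e); split.
- by apply/grS/gral.
- exact: gral.
- by rewrite DS Dal -yE Sta //; exact: taal.
- by rewrite taS e3 Dal.
- by rewrite sgal.
Qed.

(** More than [z] being a boundary: it bounds a norm. In degree f this matters, because norms are
    invisible to [cf] and can be subtracted from [ph]. *)
Lemma up_bnd n y z : up n y z -> n + 1 != N -> n + 2 != N -> bnd n y ->
  exists2 c, gr (n + 3) c & z = D (sg c).
Proof.
move=> [e' [e [e1 e2 yE e3 ->]]] n1 n2 [a [a1 a2 aE]].
have [||/eqP|b b1 bE] := @HE (n + 1) (e' - a); [exact: grB|by rewrite DB -yE -aE subrr|by rewrite (negPf n1)|].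
have e'E : e' = a + D b by rewrite -bE addrC subrK.
have nb : gr (n + 2) b by apply: gr_eq b1 _; ring.
have [||/eqP|c c1 cE] := @HE (n + 2) (e - ta b).
- by apply: grB => //; exact: grta.
- by rewrite DB -e3 e'E taA a2 add0r Dta subrr.
- by rewrite (negPf n2).
exists c; first by apply: gr_eq c1 _; ring.
by rewrite Dsg -cE sgB sgta subr0.
Qed.

Lemma up_bnd' n y z : up n y z -> n + 1 != N -> n + 2 != N -> bnd n y -> bnd (n + 2) z.
Proof.
move=> yz n1 n2 by_; have [c c1 ->] := up_bnd yz n1 n2 by_.
by apply: bndE => //; apply/grsg; apply: gr_eq c1 _; ring.
Qed.

(** The chain [a] is a cycle modulo norms in degree n + 3, so by [HPhi] it is a boundary plus a
    norm. This corrects e to an element of the kernel of [sg], that is, of the image of [ta]. *)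
Lemma up_inj n y a : up n y (D a) -> gr (n + 3) a -> ta a = 0 -> (n + 3 = f -> cf a = 0) -> bnd n y.
Proof.
move=> [e' [e [e1 e2 -> e3 aE]]] a1 a2 af.
have [b [d [_ b2 d1 abd]]] := HPhi a1 a2 aE af.
have [||c c1 cE] := @ker_sg (n + 2) (e - D d).
- by apply: grB => //; apply: grD' d1 _; ring.
- by rewrite sgB -aE abd DA DK add0r Dsg subrr.
have DeE : D e = ta (D c) by rewrite -Dta -cE DB DK subr0.
exists (e' - D c); split.
- by apply: grB => //; apply: grD' c1 _; ring.
- by rewrite taB e3 DeE subrr.
- by rewrite DB DK subr0.
Qed.

Lemma up_inj' n y z : up n y z -> n + 3 != f -> bnd (n + 2) z -> bnd n y.
Proof.
move=> yz n3 [a [a1 a2 aE]]; rewrite aE in yz; apply: up_inj yz _ a2 _.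
  by apply: gr_eq a1 _; ring.
by move/eqP; rewrite (negPf n3).
Qed.

Lemma up_surj n z : cyc (n + 2) z -> (n + 2 = f -> cf z = 0) ->
  exists y a, [/\ gr (n + 3) a, ta a = 0 & up n y (z - D a)].
Proof.
move=> [z1 z2 z3] zf; have [|a [e [a1 a2 e1 zE]]] := @HPhi _ _ 0 z1 z2 _ zf; first by rewrite sg0.
have [||e' e'1 e'E] := @ker_sg (n + 1) (D e).
- by apply: grD' e1 _; ring.
- by rewrite -Dsg; have := z3; rewrite zE DA DK add0r.
exists (D e'), a; split=> //; first by apply: gr_eq a1 _; ring.
by exists e', e; split=> //; rewrite zE addrC addKr.
Qed.

(** Parity relative to f and, by [parity], relative to N. *)
Definition even n := exists c : int, n = f + 2 * c.
Definition odd_ n := exists c : int, n = f + 2 * c + 1.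

Lemma even_odd n : even n \/ odd_ n.
Proof.
have := divz_eq (n - f) 2; have := modz_ge0 (n - f) (isT : 2 != 0 :> int).
have := @ltz_pmod (n - f) 2 isT; set q := ((n - f) %/ 2)%Z; set r := ((n - f) %% 2)%Z => r2 r0 e.
have [r0'|r1] : r = 0 \/ r = 1 by lia.
  by left; exists q; lia.
by right; exists q; lia.
Qed.

Lemma up_step n : n + 1 != N -> n + 2 != N -> n + 2 != f -> van n -> van (n + 2).
Proof.
move=> n1 n2 nf vn z cz; have [/eqP|y [a [a1 a2 yz]]] := up_surj cz; first by rewrite (negPf nf).
have [cy _] := up_cyc yz; have := up_bnd' yz n1 n2 (vn _ cy) => zb.
rewrite -[z](subrK (D a)); apply: bndD => //; apply: bndE => //.
by apply: gr_eq a1 _; ring.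
Qed.

Lemma down_step n : n != N -> n + 1 != N -> n + 3 != f -> van (n + 2) -> van n.
Proof.
move=> nN n1 n3 vn y [y1 y2 y3]; have [/eqP|e' e'1 e'E] := HE y1 y3; first by rewrite (negPf nN).
have [z yz] := up_exists e'1 e'E y2 n1; have [_ cz] := up_cyc yz.
exact: up_inj' yz n3 (vn _ cz).
Qed.

Lemma int_up (Q : int -> Prop) (M : int) :
  (forall n, n <= M -> Q n) -> (forall n, Q n -> Q (n + 2)) -> forall n, Q n.
Proof.
move=> QM QS n; have : forall k : nat, forall n, n <= M + k%:Z -> Q n; last first.
  by move/(_ (absz (n - M))); apply; lia.
elim=> [|k IH] m mk; first by apply: QM; lia.
by rewrite -(subrK 2 m); apply/QS/IH; lia.
Qed.

Lemma int_down (Q : int -> Prop) (M : int) :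
  (forall n, M <= n -> Q n) -> (forall n, Q (n + 2) -> Q n) -> forall n, Q n.
Proof.
move=> QM QS n; have : forall k : nat, forall n, M - k%:Z <= n -> Q n; last first.
  by move/(_ (absz (n - M))); apply; lia.
elim=> [|k IH] m mk; first by apply: QM; lia.
by apply/QS/IH; lia.
Qed.

(** Vanishing spreads upwards from very negative degrees ([_lo]) and downwards from very positive
    ones ([_hi]). The bounds in these four lemmas mark where a step of the given parity would meet N
    or f. *)
Lemma van_even_lo n : even n -> n < f -> n < N -> van n.
Proof.
have [M HM] := HV; have [d Nd] := parity.
move: n; apply: (@int_up _ (- M)) => [n nM _ _ _|n IH [c nc] nf nN]; first by apply: HM; right.
by apply: up_step; [lia|lia|lia|apply: IH; [exists (c - 1); lia|lia|lia]].
Qed.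

Lemma van_even_hi n : even n -> N < n -> van n.
Proof.
have [M HM] := HV; have [d Nd] := parity.
move: n; apply: (@int_down _ M) => [n nM _ _|n IH [c nc] nN]; first by apply: HM; left.
by apply: down_step; [lia|lia|lia|apply: IH; [exists (c + 1); lia|lia]].
Qed.

Lemma van_odd_lo n : odd_ n -> n < N -> van n.
Proof.
have [M HM] := HV; have [d Nd] := parity.
move: n; apply: (@int_up _ (- M)) => [n nM _ _|n IH [c nc] nN]; first by apply: HM; right.
by apply: up_step; [lia|lia|lia|apply: IH; [exists (c - 1); lia|lia]].
Qed.

Lemma van_odd_hi n : odd_ n -> N < n -> f - 3 < n -> van n.
Proof.
have [M HM] := HV; have [d Nd] := parity.
move: n; apply: (@int_down _ M) => [n nM _ _ _|n IH [c nc] nN nf]; first by apply: HM; left.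
by apply: down_step; [lia|lia|lia|apply: IH; [exists (c + 1); lia|lia|lia]].
Qed.

Lemma van_other n : n <> N -> (forall j : nat, n = f + 2 * j%:Z -> N <= n) ->
  (forall i : nat, n = f - 2 * i.+1%:Z - 1 -> n <= N) -> van n.
Proof.
move=> nN nj ni; have [d Nd] := parity; have [[c nc]|[c nc]] := even_odd n.
  have [ltN|] := ltrP n N; last by move=> Nn; apply: van_even_hi; [exists c|lia].
  apply: van_even_lo => //; first by exists c.
  rewrite ltNge; apply/negP => fn; have := nj (absz c); rewrite nc; lia.
have [ltN|Nn] := ltrP n N; first by apply: van_odd_lo => //; exists c.
apply: van_odd_hi; [by exists c|lia|].
by rewrite ltNge; apply/negP => fn; have := ni (absz (c + 2)); lia.
Qed.

(** A zigzag takes [y] to degree N + 2, where the homology vanishes, and it is injective because N +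
    3 differs from f by parity. *)
Lemma top_inj y : cyc N y -> ce y = 0 -> bnd N y.
Proof.
move=> [y1 y2 y3] y0; have [//|e' e'1 e'E] := HE y1 y3; have [d Nd] := parity.
have [|z yz] := up_exists e'1 e'E y2; first by lia.
have [_ cz] := up_cyc yz; apply: up_inj' yz _ _; first by lia.
by apply: van_even_hi cz; [exists (d + 1); lia|lia].
Qed.

Lemma bnd_ce y : bnd N y -> ce y = 0.
Proof. by move=> [a [a1 _ ->]]; exact: ceD. Qed.

(** The generator [io] is corrected to an invariant cycle. The obstruction lies in degree N + 1,
    where for f <= N the homology of the invariants vanishes. *)
Lemma top_onto : f <= N -> exists2 y, cyc N y & ce y = 1.
Proof.
move=> fN; have [d Nd] := parity.
have [|||e1 e11 e1E] := @HE N (ta io); [exact: grta|by rewrite Dta D_io ta0|by move=> _; exact: ce_ta|].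
have vN : van (N + 1) by apply: van_odd_hi; [exists d; lia|lia|lia].
have [|a [a1 a2 aE]] := vN (sg e1).
  by split; [exact: grsg|exact: tasg|rewrite Dsg -e1E sgta].
have [|b [e2 [_ _ e21 e2E]]] := HPhi a1 a2 (esym aE); first by lia.
have [||e3 e31 e3E] := @ker_sg (N + 1) (e1 - D e2).
- by apply: grB => //; exact: grD' e21 _.
- by rewrite sgB aE e2E DA DK add0r Dsg subrr.
have tio : ta io = ta (D e3) by rewrite e1E -Dta -e3E DB DK subr0.
exists (io - D e3); last by rewrite ceB ce_io ceD // subr0.
by split; [apply: grB => //; exact: grD|rewrite taB tio subrr|rewrite DB D_io DK subrr].
Qed.

Lemma top_mul : exists2 y, cyc N y & ce y = l%:Z.
Proof.
exists (sg io); first by split; [exact: grsg|exact: tasg|rewrite Dsg D_io sg0].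
by rewrite ce_sg // ce_io; lia.
Qed.

(** Up to a boundary, [y] is the target of a zigzag from degree N - 2, where the homology vanishes
    for N < f. Hence [y] is a boundary plus the norm of a cycle, and such a norm has degree
    divisible by l. *)
Lemma top_dvd y : N < f -> cyc N y -> (l%:Z %| ce y)%Z.
Proof.
move=> Nf cy; have [d Nd] := parity.
have [||z [a [a1 a2 yz]]] := @up_surj (N - 2) y; [by rewrite subrK|by lia|].
have [cz _] := up_cyc yz.
have bz : bnd (N - 2) z by apply: van_even_lo cz; [exists (d - 1); lia|lia|lia].
move: yz => [e' [e [e1 e2 zE e3 yE]]]; move: bz => [b [b1 b2 bE]].
have [||?|c c1 cE] := @HE (N - 2 + 1) (e' - b); [exact: grB|by rewrite DB -zE -bE subrr|by lia|].
have e'E : e' = b + D c by rewrite -cE addrC subrK.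
have ge : gr N (e - ta c).
  by apply: grB; [apply: gr_eq e2 _|apply: grta; apply: gr_eq c1 _]; ring.
have De : D (e - ta c) = 0 by rewrite DB -e3 e'E taA b2 add0r Dta subrr.
have yE' : y = D a - (0 - sg (e - ta c)) by rewrite sgB sgta subr0 -yE; abel.
rewrite yE' ceB ceD; last by apply: gr_eq a1 _; ring.
by rewrite ceB ce_sg // ce0 !sub0r opprK; apply/dvdzP; exists (ce (e - ta c)); lia.
Qed.

(** The homology in degree n is of order l. The weight [w] is a function of the exponent k because
    the action of x depends only on it. *)
Definition good n (w : nat -> 'F_l) := exists chi : E -> 'F_l,
  [/\ forall y z, cyc n y -> cyc n z -> chi (y - z) = chi y - chi z,
      forall y, cyc n y -> (chi y = 0 <-> bnd n y),
      exists2 y, cyc n y & chi y = 1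
    & forall i y, cyc n y -> chi (al i y) = w (ka i) * chi y].

Lemma al_cyc i n y : cyc n y -> cyc n (al i y).
Proof. by move=> [y1 y2 y3]; split; [exact: gral|exact: taal|rewrite Dal y3 al0]. Qed.

Lemma cyc_mul n y k : cyc n y -> cyc n (y *+ k).
Proof.
move=> cy; elim: k => [|k IH]; first by rewrite mulr0n; exact: cyc0.
by rewrite mulrS addBB; apply: cycB => //; apply: cycB => //; exact: cyc0.
Qed.

Lemma chi_mul n (chi : E -> 'F_l) y k :
  (forall y z, cyc n y -> cyc n z -> chi (y - z) = chi y - chi z) ->
  cyc n y -> chi (y *+ k) = k%:R * chi y.
Proof.
move=> chiB cy; have chi0 : chi 0 = 0 by rewrite -{1}(subrr 0) chiB ?subrr //; exact: cyc0.
elim: k => [|k IH]; first by rewrite mulr0n mul0r.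
have c0 := cyc0 n; have ck := cyc_mul k cy; rewrite mulrS addBB !chiB //; last exact: cycB.
by rewrite IH chi0 sub0r opprK mulrS mulrDl mul1r.
Qed.

(** Transports a character along an additive correspondence that is single-valued only up to
    boundaries. The action picks up factors [c i] and [u i] on the two sides, and the invertible
    [c i] is divided out. *)
Lemma good_transfer m (w : nat -> 'F_l) (c : I -> nat) (u : I -> 'F_l) (chi : E -> 'F_l) (P : E -> Prop) (Rel : E -> E -> Prop) :
  (forall y z, P y -> P z -> chi (y - z) = chi y - chi z) ->
  (forall y y' z z', Rel y z -> Rel y' z' -> Rel (y - y') (z - z')) ->
  (forall z, cyc m z -> exists y, Rel y z) ->
  (forall y z, Rel y z -> P y /\ cyc m z) ->
  (forall y z, Rel y z -> (chi y = 0 <-> bnd m z)) ->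
  (exists y z, Rel y z /\ chi y = 1) ->
  (forall i y z, Rel y z -> exists2 y', Rel y' (al i z *+ c i) & chi y' = u i * chi y) ->
  (forall i, (c i)%:R != 0 :> 'F_l /\ (c i)%:R * w (ka i) = u i) ->
  good m w.
Proof.
move=> chiB RB Rt RP R0 R1 Ra cu.
(* The new character is the old one at an arbitrary partner; [R0] makes the value independent of the
   partner. *)
have [sel selP] : exists sel : E -> E, forall z, cyc m z -> Rel (sel z) z.
  suff /boolp.choice[sel selP] : forall z, exists y, cyc m z -> Rel y z by exists sel.
  by move=> z; have [/Rt[y yz]|nz] := pselect (cyc m z); [exists y|exists 0].
have wd y z : Rel y z -> chi (sel z) = chi y.
  move=> yz; have [Py cz] := RP _ _ yz; have sz := selP _ cz; have [Ps _] := RP _ _ sz.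
  apply/eqP; rewrite -subr_eq0 -chiB //; apply/eqP/(R0 _ _ (RB _ _ _ _ sz yz)).
  by rewrite subrr; exact: bnd0.
have chi'B y z : cyc m y -> cyc m z -> chi (sel (y - z)) = chi (sel y) - chi (sel z).
  move=> cy cz; have sy := selP _ cy; have sz := selP _ cz.
  by rewrite (wd _ _ (RB _ _ _ _ sy sz)) chiB //; [case: (RP _ _ sy)|case: (RP _ _ sz)].
exists (chi \o sel); split=> //=.
- by move=> y /selP/R0.
- have [y [z [yz y1]]] := R1; exists z; first by case: (RP _ _ yz).
  by rewrite (wd _ _ yz).
- move=> i y cy; have [ci wu] := cu i; apply: (mulfI ci); rewrite mulrA wu.
  rewrite -(chi_mul (chi := chi \o sel) _ chi'B) /=; last exact: al_cyc.
  by have [y' /wd -> ->] := Ra i _ _ (selP _ cy).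
Qed.

(** The character is [cf]. Cycles in its kernel come by zigzags from degree f - 2, where the
    homology vanishes; and [ph] becomes a cycle after subtracting a norm, the obstruction being a
    zigzag from degree f - 3, which vanishes too. *)
Lemma good_f : f < N -> good f (fun=> 1).
Proof.
move=> fN; have [d Nd] := parity; exists cf; split.
- by move=> y z _ _; exact: cfB.
- move=> y cy; split=> [y0|[a [a1 a2 ->]]]; last exact: cf_D.
  have [||z [a [a1 a2 yz]]] := @up_surj (f - 2) y; [by rewrite subrK|by []|].
  have [cz _] := up_cyc yz.
  have bz : bnd (f - 2) z by apply: van_even_lo cz; [exists (- 1); lia|lia|lia].
  have yb : bnd (f - 2 + 2) (y - D a) by apply: up_bnd' yz _ _ bz; lia.
  rewrite subrK in yb.
  rewrite -[y](subrK (D a)); apply: bndD => //; apply: bndE => //.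
  by apply: gr_eq a1 _; ring.
- have [||e' e'1 e'E] := @ker_sg (f - 3 + 1) (D e0).
  + by apply: grD' gr_e0 _; ring.
  + by rewrite -Dsg -D_ph DK.
  have yz : up (f - 3) (D e') (sg e0).
    by exists e', e0; split=> //; apply: gr_eq gr_e0 _; ring.
  have [cy _] := up_cyc yz.
  have by_ : bnd (f - 3) (D e') by apply: van_odd_lo cy; [exists (- 2); lia|lia].
  have [||c c1 cE] := up_bnd yz _ _ by_; try lia.
  have c1' : gr f c by apply: gr_eq c1 _; ring.
  exists (ph - sg c); last by rewrite cfB cf_ph cf_sg // subr0.
  split; [by apply: grB => //; exact: grsg|by rewrite taB ta_ph tasg subrr|].
  by rewrite DB D_ph cE subrr.
- by move=> i y [y1 y2 y3]; rewrite mul1r; apply: (@cf_al i y 0) => //; rewrite sg0.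
Qed.

Lemma good_up n w : even n -> n != N -> n + 2 != N -> n + 2 != f -> good n w ->
  good (n + 2) (fun k => k%:R * w k).
Proof.
move=> [c nc] nN n2 nf [chi [chiB chi0 [y0 cy0 y01] chia]]; have [d Nd] := parity.
pose Rel y z := exists2 a, gr (n + 3) a /\ ta a = 0 & up n y (z - D a).
have chiu y z : up n y z -> chi y = 0 <-> bnd (n + 2) z.
  move=> yz; have [cy _] := up_cyc yz; rewrite chi0 //; split; last by apply: up_inj' yz _; lia.
  by apply: up_bnd' yz _ _; lia.
have bD a : gr (n + 3) a -> ta a = 0 -> bnd (n + 2) (D a).
  by move=> a1 a2; apply: bndE => //; apply: gr_eq a1 _; ring.
apply: (@good_transfer (n + 2) _ (fun=> 1%N) (fun i => (ka i)%:R * w (ka i)) chi (cyc n) Rel) => //.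
- move=> y y' z z' [a [a1 a2] yz] [b [b1 b2] yz']; exists (a - b).
    by rewrite taB a2 b2 subrr; split=> //; exact: grB.
  by have := upB yz yz'; rewrite DB; congr (up _ _ _); abel.
- move=> z cz; have [/eqP|y [a [a1 a2 yz]]] := up_surj cz; first by rewrite (negPf nf).
  by exists y, a.
- move=> y z [a [a1 a2] yz]; have [cy cz] := up_cyc yz; split=> //.
  by have := cycB cz (cycB (cyc0 _) (bnd_cyc (bD _ a1 a2))); rewrite sub0r opprK subrK.
- move=> y z [a [a1 a2] /chiu ->]; split=> zb; last by apply: bndB => //; exact: bD.
  by rewrite -[z](subrK (D a)); apply: bndD => //; exact: bD.
- have [y1 y2 y3] := cy0; have [/eqP|e' e'1 e'E] := HE y1 y3; first by rewrite (negPf nN).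
  have [|z yz] := up_exists e'1 e'E y2; first by lia.
  exists y0, z; split=> //; exists 0; first by rewrite ta0.
  by rewrite D0 subr0.
- move=> i y z [a [a1 a2] yz]; have [cy _] := up_cyc yz.
  exists (al i y *+ ka i).
    rewrite mulr1n; exists (al i a); first by split; [exact: gral|exact: taal].
    by have := up_al i yz; rewrite alB Dal.
  by rewrite (chi_mul _ chiB) ?chia ?mulrA //; exact: al_cyc.
- by move=> i; rewrite oner_neq0 mul1r.
Qed.

Lemma good_down n w : odd_ n -> N < n -> n + 3 != f -> good (n + 2) w ->
  good n (fun k => k%:R^-1 * w k).
Proof.
move=> [c nc] nN nf [chi [chiB chi0 [z0 cz0 z01] chia]]; have [d Nd] := parity.
have chiu y z : up n y z -> chi z = 0 <-> bnd n y.
  move=> yz; have [_ cz] := up_cyc yz; rewrite chi0 //; split; first exact: up_inj' yz nf.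
  by apply: up_bnd' yz _ _; lia.
apply: (@good_transfer n _ ka (fun i => w (ka i)) chi (cyc (n + 2)) (fun z y => up n y z)) => //.
- by move=> z z' y y'; exact: upB.
- move=> y [y1 y2 y3]; have [|e' e'1 e'E] := HE y1 y3; first by lia.
  by apply: up_exists e'1 e'E y2 _; lia.
- by move=> z y /up_cyc[].
- by move=> z y; exact: chiu.
- have [|y [a [a1 a2 yz]]] := up_surj cz0; first by lia.
  exists (z0 - D a), y; split=> //; have bD : bnd (n + 2) (D a).
    by apply: bndE => //; apply: gr_eq a1 _; ring.
  by rewrite chiB ?z01 //; [rewrite (iffRL (chi0 _ (bnd_cyc bD))) ?subr0|exact: bnd_cyc].
- move=> i z y yz; have [cy cz] := up_cyc yz.
  by exists (al i z); [exact: up_al|exact: chia].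
- by move=> i; rewrite ka_unit mulrA divff ?mul1r.
Qed.

(** The boundary D ph = sg e0 of the generator modulo norms is the target of a zigzag from degree f
    - 3. The action preserves [cf] and the zigzag multiplies it by k, so the weight is 1 / k. *)
Lemma good_f3 : N < f - 3 -> good (f - 3) (fun k => k%:R^-1).
Proof.
move=> Nf; have [d Nd] := parity.
pose Rel y z := [/\ up (f - 3) z (D y), gr f y & ta y = 0].
have upe y z : Rel y z -> exists2 e, gr (f - 1) e & D y = sg e.
  move=> [[e' [e [_ e2 _ _ yE]]] _ _]; exists e => //.
  by apply: gr_eq e2 _; ring.
apply: (@good_transfer (f - 3) _ ka (fun=> 1) cf (fun=> True) Rel) => //.
- by move=> y y' z z' [yz y1 y2] [yz' z1 z2]; split; [rewrite DB; exact: upB|exact: grB|rewrite taB y2 z2 subrr].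
- move=> z [z1 z2 z3]; have [|e' e'1 e'E] := HE z1 z3; first by lia.
  have [|y zy] := up_exists e'1 e'E z2; first by lia.
  have [_ cy] := up_cyc zy.
  have vf : van (f - 3 + 2) by apply: van_odd_hi; [exists (- 1); lia|lia|lia].
  have [a [a1 a2 aE]] := vf _ cy.
  exists a; split=> //; first by rewrite -aE.
  by apply: gr_eq a1 _; ring.
- by move=> y z [/up_cyc[]].
- move=> y z yz; have [zy y1 y2] := yz; split=> [y0|zb].
    by apply: up_inj zy _ y2 _ => //; apply: gr_eq y1 _; ring.
  have [||c c1 cE] := up_bnd zy _ _ zb; try lia.
  have c1' : gr f c by apply: gr_eq c1 _; ring.
  have vf : van f by apply: van_even_hi; [exists 0; lia|lia].
  have [|a [a1 a2 aE]] := vf (y - sg c).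
    by split; [apply: grB => //; exact: grsg|rewrite taB y2 tasg subrr|rewrite DB cE subrr].
  by rewrite -[y](subrK (sg c)) cfA cf_sg // aE cf_D // addr0.
- have [||e' e'1 e'E] := @ker_sg (f - 3 + 1) (D e0).
  + by apply: grD' gr_e0 _; ring.
  + by rewrite -Dsg -D_ph DK.
  exists ph, (D e'); split=> //; split=> //; exists e', e0; split=> //.
  by apply: gr_eq gr_e0 _; ring.
- move=> i y z yz; have [e e1 eE] := upe _ _ yz; have [zy y1 y2] := yz.
  exists (al i y); last by rewrite mul1r; exact: cf_al eE.
  by split; [rewrite Dal; exact: up_al|exact: gral|exact: taal].
- by move=> i; rewrite ka_unit divff.
Qed.

Lemma good_ext n w w' : w =1 w' -> good n w -> good n w'.
Proof. by move=> ww [chi [c1 c2 c3 c4]]; exists chi; split=> // i y cy; rewrite -ww c4. Qed.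

Lemma good_even (j : nat) : f + 2 * j%:Z < N -> good (f + 2 * j%:Z) (fun k => k%:R ^+ j).
Proof.
have [d Nd] := parity; elim: j => [|j IH] jN.
  have -> : f + 2 * 0%:Z = f by ring.
  by apply: good_f; lia.
have -> : f + 2 * j.+1%:Z = f + 2 * j%:Z + 2 by lia.
apply: (@good_ext _ (fun k => k%:R * k%:R ^+ j)) => [k|]; first by rewrite exprS.
by apply: good_up; [exists j%:Z|lia|lia|lia|apply: IH; lia].
Qed.

Lemma good_odd (i : nat) : N < f - 2 * i.+1%:Z - 1 ->
  good (f - 2 * i.+1%:Z - 1) (fun k => k%:R ^- i.+1).
Proof.
have [d Nd] := parity; elim: i => [|i IH] iN.
  have -> : f - 2 * 1%:Z - 1 = f - 3 by ring.
  by apply: good_ext (good_f3 _) => [k|]; [rewrite expr1|lia].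
apply: (@good_ext _ (fun k => k%:R^-1 * k%:R ^- i.+1)) => [k|].
  by rewrite [in RHS]exprS invfM.
apply: good_down; [exists (- (i.+3)%:Z); lia|lia|lia|].
have -> : f - 2 * i.+2%:Z - 1 + 2 = f - 2 * i.+1%:Z - 1 by lia.
by apply: IH; lia.
Qed.

Lemma tate_homology :
  [/\ forall n, n <> N -> (forall j : nat, n = f + 2 * j%:Z -> N <= n) ->
        (forall i : nat, n = f - 2 * i.+1%:Z - 1 -> n <= N) -> van n,
      forall y, cyc N y -> (ce y = 0 <-> bnd N y),
      (exists2 y, cyc N y & ce y = if f <= N then 1 else l%:Z) /\
        (forall y, cyc N y -> ((if f <= N then 1 else l%:Z) %| ce y)%Z),
      forall j : nat, f + 2 * j%:Z < N -> good (f + 2 * j%:Z) (fun k => k%:R ^+ j)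
    & forall i : nat, N < f - 2 * i.+1%:Z - 1 ->
        good (f - 2 * i.+1%:Z - 1) (fun k => k%:R ^- i.+1)].
Proof.
split; [exact: van_other| |split|exact: good_even|exact: good_odd].
- by move=> y cy; split; [exact: top_inj|exact: bnd_ce].
- by case: lerP => fN; [exact: top_onto|exact: top_mul].
- by move=> y cy; case: lerP => fN; [exact: dvd1z|exact: top_dvd].
Qed.
End TateArgument.

Section Evaluation.
Variable S : choiceType.
Implicit Types (r : S -> int) (c : chain S).

(** [int^o] is int as a module over itself, the form in which [fglift] accepts it. *)
Definition ev r c : int := fglift (fun s => r s : int^o) c.

Lemma ev_is_additive r : zmod_morphism (ev r).
Proof. by move=> c e; rewrite /ev fgliftEB. Qed.
HB.instance Definition _ r :=
  GRing.isZmodMorphism.Build (chain S) int (ev r) (ev_is_additive r).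

Lemma ev0 r : ev r 0 = 0. Proof. exact: raddf0. Qed.
Lemma evB r c e : ev r (c - e) = ev r c - ev r e. Proof. exact: raddfB. Qed.
Lemma evD r c e : ev r (c + e) = ev r c + ev r e. Proof. exact: raddfD. Qed.
Lemma evMz r c m : ev r (c *~ m) = ev r c * m.
Proof. by rewrite [LHS]raddfMz /= mulrzz. Qed.
Lemma evU r s : ev r << s >> = r s.
Proof. exact: (@fgliftU S int^o (fun s => r s)). Qed.

Lemma eq_ev r r' c : (forall u, u \in dom c -> r u = r' u) -> ev r c = ev r' c.
Proof. exact: (@eq_fglift S int^o). Qed.

Lemma ev_on0 r c (A : S -> Prop) : on A c -> (forall s, A s -> r s = 0) -> ev r c = 0.
Proof.
move=> + r0; apply: (@on_ind _ A (fun c => ev r c = 0)) => [|x y ex ey|u Au].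
- exact: ev0.
- by rewrite evB ex ey subrr.
- by rewrite evU r0.
Qed.
End Evaluation.

(** * Contractions of a complex onto a single class *)

Section Contraction.
Variables (gT : finGroupType) (X : gcomplex gT).
Implicit Types (Phi : X -> Prop) (c z : chain X).

(** A homotopy equivalence of the complex on [Phi] with Z at tag [u]: [z] is the image of 1, [r] the
    map back and [k] the homotopy. The last clause says that [r] is a cocycle. *)
Definition contraction Phi u z (k : X -> chain X) (r : X -> int) : Prop :=
  [/\ on (fun v => Phi v /\ ctag v = u) z, bd z = 0, ev r z = 1
    & forall s, Phi s -> [/\ on (fun v => Phi v /\ ctag v = (ctag s).+1) (k s),
        << s >> = bd (k s) + fglift k (cbd s) + z *~ r s,
        ctag s <> u -> r s = 0 & ev r (cbd s) = 0]].

Lemma contract_id Phi (k : X -> chain X) (r : X -> int) z :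
  (forall s, Phi s -> << s >> = bd (k s) + fglift k (cbd s) + z *~ r s) ->
  forall c, on Phi c -> c = bd (fglift k c) + fglift k (bd c) + z *~ ev r c.
Proof.
move=> H; apply: (@on_ind _ Phi (fun c => c = bd (fglift k c) + fglift k (bd c) + z *~ ev r c)).
- by rewrite !(fgliftE0, bd0, ev0) mulr0z !addr0.
- by move=> a a' ea ea'; rewrite !(fgliftEB, bdB, evB) mulrzBr {1}ea {1}ea'; abel.
- by move=> t Pt; rewrite fgliftU bdU evU; exact: H.
Qed.

(** No equivariance is asked for, so plain recursion on tags suffices; [k] and [r] are chosen
    together. *)
Lemma sphere_contraction Phi u z : face_closed Phi -> sphere_like Phi u z ->
  exists k r, contraction Phi u z k r.
Proof.
move=> fP [[zon zd] low top inj].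
pose Q s (v : chain X * int) (x : X -> chain X * int) := Phi s ->
  [/\ on (fun w => Phi w /\ ctag w = (ctag s).+1) v.1,
      << s >> = bd v.1 + fglift (fun t => (x t).1) (cbd s) + z *~ v.2,
      ctag s <> u -> v.2 = 0 & ev (fun t => (x t).2) (cbd s) = 0].
have [x xP] : exists x, forall s, Q s (x s) x.
  apply: (@rec_choice _ _ (@ctag gT X) Q (0, 0)) => [s v x x' xx'|s x IH].
    move=> H Ps; have [h1 h2 h3 h4] := H Ps.
    have e t : t \in dom (cbd s) -> x t = x' t by move=> /cbd_tag ts; apply: xx'; rewrite ts.
    split=> //.
      by rewrite [LHS]h2 (eq_fglift (g := fun t => (x' t).1)) // => t /e ->.
    by rewrite -h4; apply: eq_ev => t /e ->.
  have [Ps|nP] := pselect (Phi s); last by exists (0, 0).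
  pose k t := (x t).1; pose r t := (x t).2.
  have {}IH t : t \in dom (cbd s) -> [/\ on (fun w => Phi w /\ ctag w = ctag s) (k t),
      bd (k t) = << t >> - fglift k (cbd t) - z *~ r t,
      ctag t <> u -> r t = 0 & ev r (cbd t) = 0].
    move=> ts; have [||h1 h2 h3 h4] := IH t; [by rewrite (cbd_tag ts)|exact: fP ts|].
    split=> //; first by rewrite (cbd_tag ts).
    by apply/eqP; rewrite eq_sym !subr_eq; apply/eqP; rewrite [LHS]h2 addrAC.
  pose c := << s >> - fglift k (cbd s).
  have con : on (fun w => Phi w /\ ctag w = ctag s) c.
    apply: onB; first by apply: onU.
    by apply: on_fglift (@on_dom _ _) => t /IH[].
  have cd : bd c = z *~ ev r (cbd s).
    rewrite bdB bdU /bd fglift_comp.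
    rewrite (eq_fglift (g := fun t => << t >> - fglift k (cbd t) - z *~ r t)); last first.
      by move=> t /IH[].
    rewrite !fglift_sub fglift_id -(fglift_comp (@cbd gT X)) cbdK fgliftE0 subr0 subKr.
    have : forall b, fglift (fun t => z *~ r t) b = z *~ ev r b; last by apply.
    move=> b; apply: (@on_ind _ (fun=> True) (fun b => fglift (fun t => z *~ r t) b = z *~ ev r b)) => //.
    - by rewrite fgliftE0 ev0 mulr0z.
    - by move=> a a' ea ea'; rewrite fgliftEB evB mulrzBr ea ea'.
    - by move=> t _; rewrite fgliftU evU.
  (* At tag u + 1 a nonzero value would make a nonzero multiple of [z] bound; at other tags [r]
     vanishes on all faces. *)
  have r0 : ev r (cbd s) = 0.
    have [su|su] := eqVneq (ctag s) u.+1.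
      by apply: inj; exists c; [rewrite -su|].
    apply: ev_on0 (@on_dom _ _) _ => t ts; have [_ _ ru _] := IH t ts; apply: ru => tu.
    by rewrite (cbd_tag ts) tu eqxx in su.
  rewrite r0 mulr0z in cd.
  have [su|su] := eqVneq (ctag s) u.
    have [|a [v von vd]] := top c; first by split; rewrite -?su.
    exists (v, a) => _; split=> //=; first by rewrite su.
    by rewrite vd addrAC !subrK.
  have [|v von vd] := low (ctag s) c _ su; first by split.
  exists (v, 0) => _; split=> //=; rewrite vd /c mulr0z addr0 subrK.
  by [].
exists (fun t => (x t).1), (fun t => (x t).2).
split=> //.
pose k t := (x t).1; pose r t := (x t).2.
have zE : z = bd (fglift k z) + fglift k (bd z) + z *~ ev r z.
  apply: (@contract_id Phi); first by move=> t Pt; case: (xP t Pt).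
  by apply: onS zon => v [].
have : 1 - ev r z = 0; last by move/eqP; rewrite subr_eq0 => /eqP.
apply: inj; exists (fglift k z).
  apply: on_fglift zon => t [Pt tu]; have [h1 _ _ _] := xP t Pt.
  by rewrite -tu.
by rewrite mulrzBr mulr1z {2}zE zd fgliftE0; abel.
Qed.

Section Consequences.
Variables (Phi : X -> Prop) (u : nat) (z : chain X) (k : X -> chain X) (r : X -> int).
Hypothesis zkr : contraction Phi u z k r.

Lemma contractionE c : on Phi c -> c = bd (fglift k c) + fglift k (bd c) + z *~ ev r c.
Proof.
have [_ _ _ H] := zkr; apply: (@contract_id Phi) => s Ps; by case: (H s Ps).
Qed.

Lemma ev_bd c : on Phi c -> ev r (bd c) = 0.
Proof.
have [_ _ _ H] := zkr; move: c; apply: (@on_ind _ Phi (fun c => ev r (bd c) = 0)) => [|a a' ea ea'|t Pt].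
- by rewrite bd0 ev0.
- by rewrite bdB evB ea ea' subrr.
- by rewrite bdU; case: (H t Pt).
Qed.

(* On the homology Z, [x] acts by a sign of odd order. *)
Lemma ev_act x : odd #[x]%g -> (forall v, Phi v -> Phi (cact v x)) -> ev r (act x z) = 1.
Proof.
have [zon zd z1 H] := zkr => ox Px.
have Pc c : on Phi c -> on Phi (act x c) by apply: on_act.
have mul c : on Phi c -> bd c = 0 -> ev r (act x c) = ev r (act x z) * ev r c.
  move=> Pon cd; rewrite {1}(contractionE Pon) cd fgliftE0 addr0 actD actMz evD evMz -bd_act.
  rewrite ev_bd ?add0r //; apply: Pc; apply: on_fglift Pon => t Pt.
  by have [+ _ _ _] := H t Pt; apply: onS => v [].
have zP : on Phi z by apply: onS zon => v [].
have pw m : ev r (act (x ^+ m)%g z) = ev r (act x z) ^+ m /\ on Phi (act (x ^+ m)%g z) /\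
    bd (act (x ^+ m)%g z) = 0.
  elim: m => [|m [IH1 [IH2 IH3]]]; first by rewrite expg0 act1 expr0.
  rewrite expgSr actM mul // IH1 -exprS; split=> //; split; first exact: Pc.
  by rewrite bd_act IH3 act0.
have [+ _] := pw #[x]%g; rewrite expg_order act1 z1; move: (ev r (act x z)) => e /esym e1.
have : `|e| ^+ #[x]%g = 1 by rewrite -normrX e1 normr1.
move/eqP; rewrite pexpr_eq1 ?fingroup.order_gt0 //.
move/eqP => ne; have [e0|e0] := lerP 0 e; first by rewrite -ne ger0_norm.
have : e = -1 by rewrite -ne ltr0_norm // opprK.
by move=> eE; move: e1; rewrite eE -signr_odd ox expr1.
Qed.
End Consequences.
End Contraction.

Lemma sign_parity (a b c : nat) : odd (a + b) = ~~ odd c ->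
  (-1) ^+ a * (-1) ^+ b = - (-1) ^+ c :> int.
Proof.
move=> abc; rewrite -exprD -signr_odd -[in RHS]signr_odd abc.
by case: (odd c); rewrite ?expr1 ?expr0 ?opprK.
Qed.

Lemma sign_sqr (a : nat) : (-1) ^+ a * (-1) ^+ a = 1 :> int.
Proof. by rewrite -exprD addnn -signr_odd odd_double. Qed.

Lemma sign_succ (n : int) : (-1) ^+ `|n + 1| = - (-1) ^+ `|n| :> int.
Proof.
have := @sign_parity `|n + 1| 0 `|n|; rewrite addn0 expr0 mulr1; apply.
by lia.
Qed.

(** * The differential of the Hom complex and its contraction *)

Section HomBoundary.
Variables (gT : finGroupType) (Y X : gcomplex gT).
Implicit Types (f h : hom Y X).

Definition sgn (Z : gcomplex gT) (c : chain Z) : chain Z :=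
  fglift (fun u => << u >> *~ (-1) ^+ ctag u) c.

Lemma sgnB (Z : gcomplex gT) (c e : chain Z) : sgn (c - e) = sgn c - sgn e.
Proof. exact: fgliftEB. Qed.

Lemma sgn0 (Z : gcomplex gT) : sgn (0 : chain Z) = 0.
Proof. exact: fgliftE0. Qed.

Lemma bd_sgn (Z : gcomplex gT) (c : chain Z) : bd (sgn c) = - sgn (bd c).
Proof.
apply: (@on_ind _ (fun=> True) (fun c => bd (sgn c) = - sgn (bd c))) => // [|x y ex ey|u _].
- by rewrite bd0 sgn0 bd0 oppr0.
- by rewrite sgnB !bdB sgnB ex ey opprB opprK addrC.
rewrite /sgn fgliftU bdMz !bdU -fglift_opp -[cbd u]fglift_id -fglift_mulz.
rewrite fglift_comp; apply: eq_fglift => v uv; rewrite fgliftU (cbd_tag uv) exprS mulN1r.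
by rewrite mulrNz.
Qed.

Lemma sgn_act (Z : gcomplex gT) (c : chain Z) g : sgn (act g c) = act g (sgn c).
Proof.
rewrite /sgn /act !fglift_comp; congr (fglift _ _); apply/funext => u.
by rewrite fgliftU ctag_act raddfMz /= fgliftU.
Qed.

(** The sign is read off the tags in source and target, so the differential is one additive map on
    all of E without a degree argument. [hDE] recovers the usual sign on homogeneous maps. *)
Definition hD f : hom Y X := fun s => bd (f s) + sgn (fglift f (cbd s)) *~ (-1) ^+ ctag s.

Lemma fgliftHB f h (c : chain Y) : fglift (f - h) c = fglift f c - fglift h c.
Proof. exact: fglift_sub. Qed.

Lemma hDB f h : hD (f - h) = hD f - hD h.
Proof.
apply/funext => s; rewrite /hD !homBE bdB fgliftHB sgnB mulrzBl; abel.
Qed.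

HB.instance Definition _ := GRing.isZmodMorphism.Build (hom Y X) (hom Y X) hD hDB.

Lemma fglift_hact f g (c : chain Y) : fglift (hact g f) c = act g (fglift f (act g^-1%g c)).
Proof.
rewrite /act !fglift_comp; congr (fglift _ _); apply/funext => s.
by rewrite /hact fgliftU.
Qed.

Lemma hD_act f g : hD (hact g f) = hact g (hD f).
Proof.
apply/funext => s; rewrite /hD /hact actD bd_act; congr (_ + _).
rewrite actMz ctag_act fglift_hact sgn_act; congr (act g (sgn _) *~ _).
by rewrite cbd_act.
Qed.

Lemma hD_lift f (c : chain Y) m : on (fun s => ctag s = m) c ->
  fglift (hD f) c = bd (fglift f c) + sgn (fglift f (bd c)) *~ (-1) ^+ m.
Proof.
apply: (@on_ind _ _ (fun c => fglift (hD f) c = bd (fglift f c) + sgn (fglift f (bd c)) *~ (-1) ^+ m)).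
- by rewrite !(fgliftE0, bd0) sgn0 mul0rz addr0.
- by move=> x y ex ey; rewrite !(fgliftEB, bdB) sgnB mulrzBl ex ey; abel.
- by move=> s <-; rewrite !fgliftU bdU.
Qed.

Lemma hDK f : hD (hD f) = 0.
Proof.
apply/funext => s; rewrite {1}/hD {1}/hD bdD bdK add0r bdMz bd_sgn.
case E: (ctag s) => [|m].
  have -> : cbd s = 0.
    by apply: (@on_false _ (fun u => u \in dom (cbd s))) => // u us; have := cbd_tag us; rewrite E.
  by rewrite !fgliftE0 bd0 sgn0 oppr0 mul0rz addr0.
rewrite (@hD_lift f _ m); last by move=> u /cbd_tag; rewrite E => -[].
have -> : bd (cbd s) = 0 by exact: cbdK.
by rewrite fgliftE0 sgn0 mul0rz addr0 mulNrz addNr.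
Qed.

Lemma hDE n f s : homog n f -> hD f s = bd (f s) - fglift f (cbd s) *~ (-1) ^+ `|n|.
Proof.
move=> nf; rewrite /hD; congr (_ + _).
have : on (fun u => (ctag u)%:Z + 1 = (ctag s)%:Z + n) (fglift f (cbd s)).
  by apply: on_fglift (@on_dom _ _) => t /cbd_tag st; apply: onS (nf t) => u; lia.
apply: (@on_ind _ _ (fun c : chain X => sgn c *~ (-1) ^+ ctag s = - (c *~ (-1) ^+ `|n|))).
- by rewrite sgn0 !mul0rz oppr0.
- by move=> x y ex ey; rewrite sgnB !mulrzBl ex ey; abel.
- move=> u us; rewrite /sgn fgliftU -mulrzA -mulrNz; congr (_ *~ _).
  by apply: sign_parity; lia.
Qed.

Lemma hD_liftE n f (c : chain Y) : homog n f ->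
  fglift (hD f) c = bd (fglift f c) - fglift f (bd c) *~ (-1) ^+ `|n|.
Proof.
move=> nf; apply: (@on_ind _ (fun=> True) (fun c => fglift (hD f) c = bd (fglift f c) - fglift f (bd c) *~ (-1) ^+ `|n|)) => //.
- by rewrite !(fgliftE0, bd0) mul0rz subr0.
- by move=> x y ex ey; rewrite !(fgliftEB, bdB) mulrzBl ex ey; abel.
- by move=> s _; rewrite !fgliftU bdU (hDE _ nf).
Qed.

Lemma homog_D n f : homog (n + 1) f -> homog n (hD f).
Proof.
move=> nf s; rewrite (hDE _ nf); apply: onB.
  by apply: on_fglift (nf s) => v vs u /cbd_tag; lia.
apply: onMz; apply: on_fglift (@on_dom _ _) => t /cbd_tag ts.
by apply: onS (nf t) => u; lia.
Qed.

Section Homotopy.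
Variables (Phi2 : Y -> Prop) (u2 : nat) (z2 : chain Y) (k2 : Y -> chain Y) (r2 : Y -> int).
Variables (Phi1 : X -> Prop) (u1 : nat) (z1 : chain X) (k1 : X -> chain X) (r1 : X -> int).
Hypotheses (c2 : contraction Phi2 u2 z2 k2 r2) (c1 : contraction Phi1 u1 z1 k1 r1).
Hypothesis fc2 : face_closed Phi2.

(** Contract the source by [k2]; what survives is the value at [z2], which is contracted in the
    target by [k1]. *)
Definition hom_htpy n f : hom Y X := fun s =>
  if `[< Phi2 s >] then fglift f (k2 s) *~ (-1) ^+ `|n| + fglift k1 (fglift f z2) *~ r2 s else 0.

Definition hom_deg f : int := ev r1 (fglift f z2).

Lemma on2 : on Phi2 z2.
Proof. by case: c2 => [z2on _ _ _]; apply: onS z2on => s []. Qed.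

Lemma on_f_z2 n f : homog n f -> (forall s, Phi2 s -> on Phi1 (f s)) ->
  on (fun v => Phi1 v /\ (ctag v)%:Z = u2%:Z + n) (fglift f z2).
Proof.
move=> nf f1; have [z2on _ _ _] := c2; apply: on_fglift z2on => s [Ps su].
by apply: onI; [exact: f1|rewrite -su; exact: nf].
Qed.

Lemma homog_htpy n f : homog n f -> (forall s, Phi2 s -> on Phi1 (f s)) -> homog (n + 1) (hom_htpy n f).
Proof.
move=> nf f1 s; rewrite /hom_htpy; case: (asboolP (Phi2 s)) => Ps; last exact: on0.
have [_ _ _ H2] := c2; have [k2on _ r20 _] := H2 s Ps; have [_ _ _ H1] := c1.
apply: onD.
  apply: onMz; apply: on_fglift k2on => t [_ tt]; apply: onS (nf t) => u; lia.
have [su|su] := eqVneq (ctag s) u2; last by rewrite r20 ?mulr0z; [exact: on0|exact/eqP].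
apply: onMz; apply: on_fglift (on_f_z2 nf f1) => v [Pv vn].
by have [k1on _ _ _] := H1 v Pv; apply: onS k1on => u [_ ->]; lia.
Qed.

(** [L] is the modulus up to which [f] is a cycle: 0 for the whole complexes, and l for the fixed
    parts, where dropping non-fixed simplices commutes with the boundary only modulo l. *)
Lemma htpyP n f (er : Y -> chain X) (L : int) : homog n f -> (forall s, Phi2 s -> on Phi1 (f s)) ->
  (forall s, Phi2 s -> bd (f s) = fglift f (cbd s) *~ (-1) ^+ `|n| + er s *~ L) ->
  forall s, Phi2 s ->
    exists w, f s = hD (hom_htpy n f) s + z1 *~ (hom_deg f * r2 s) + w *~ L.
Proof.
move=> nf f1 fd s Ps; set e : int := (-1) ^+ `|n| in fd *; have ee : e * e = 1 by exact: sign_sqr.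
have eK (c : chain X) : c *~ e *~ e = c by rewrite -mulrzA ee mulr1z.
have fl (c : chain Y) : on Phi2 c -> bd (fglift f c) = fglift f (bd c) *~ e + fglift er c *~ L.
  apply: (@on_ind _ Phi2 (fun c => bd (fglift f c) = fglift f (bd c) *~ e + fglift er c *~ L)).
  - by rewrite !(fgliftE0, bd0) !mul0rz addr0.
  - by move=> x y ex ey; rewrite !(fgliftEB, bdB) !mulrzBl ex ey; abel.
  - by move=> t Pt; rewrite !fgliftU bdU; exact: fd.
have [_ zd2 _ H2] := c2; have [k2on sE _ rs0] := H2 s Ps.
set W := fglift k1 (fglift f z2); set a := hom_deg f.
have fzE : fglift f z2 = bd W + fglift k1 (fglift er z2) *~ L + z1 *~ a.
  rewrite {1}(contractionE c1 (c := fglift f z2)); last by apply: onS (on_f_z2 nf f1) => v [].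
  rewrite (fl _ on2) zd2 fgliftE0 mul0rz add0r [X in _ + X + _]raddfMz.
  by [].
have bs : fglift (hom_htpy n f) (cbd s) = fglift f (fglift k2 (cbd s)) *~ e.
  rewrite (eq_fglift (g := fun t => fglift f (k2 t) *~ e + W *~ r2 t)); last first.
    by move=> t ts; rewrite /hom_htpy asboolT //; exact: fc2 ts.
  rewrite fglift_add fglift_mulz fglift_comp.
  have -> : fglift (fun t => W *~ r2 t) (cbd s) = W *~ ev r2 (cbd s).
    move: (cbd s) => b; apply: (@on_ind _ (fun=> True) (fun b => fglift (fun t => W *~ r2 t) b = W *~ ev r2 b)) => //.
    - by rewrite fgliftE0 ev0 mulr0z.
    - by move=> x x' ex ex'; rewrite fgliftEB evB mulrzBr ex ex'.
    - by move=> t _; rewrite fgliftU evU.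
  by rewrite rs0 mulr0z addr0.
have hE : hom_htpy n f s = fglift f (k2 s) *~ e + W *~ r2 s by rewrite /hom_htpy asboolT.
have DE : hD (hom_htpy n f) s = fglift f (bd (k2 s)) + fglift er (k2 s) *~ L *~ e +
    bd W *~ r2 s + fglift f (fglift k2 (cbd s)).
  rewrite (hDE _ (homog_htpy nf f1)) sign_succ -/e bs mulrNz opprK eK hE bdD !bdMz.
  rewrite fl; last by apply: onS k2on => t [].
  by rewrite mulrzDl eK.
exists (fglift k1 (fglift er z2) *~ r2 s - fglift er (k2 s) *~ e).
have fsE : f s = fglift f (bd (k2 s)) + fglift f (fglift k2 (cbd s)) + fglift f z2 *~ r2 s.
  rewrite -{1}(fgliftU f s) sE [LHS]raddfD /=; congr (_ + _); first exact: raddfD.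
  exact: raddfMz.
have H (M : zmodType) (x y w k v z : M) (i j m l : int) :
    x + y + (w + k *~ l + z *~ j) *~ i =
    x + v *~ l *~ m + w *~ i + y + z *~ (j * i) + (k *~ i - v *~ m) *~ l.
  rewrite !mulrzDl mulNrz [z *~ (j * i)]mulrzA [k *~ l *~ i]mulrzAC [v *~ l *~ m]mulrzAC; abel.
rewrite DE fsE fzE; exact: H.
Qed.
End Homotopy.
End HomBoundary.

Section FixedPart.
Variables (gT : finGroupType) (X : gcomplex gT) (g : gT) (l : nat).
Hypotheses (pr_l : prime l) (ord_g : #[g]%g = l).
Implicit Types (c : chain X).

Definition fixpart c : chain X := fglift (fun u => if `[< fixd g u >] then << u >> else 0) c.

Lemma fixpartB c e : fixpart (c - e) = fixpart c - fixpart e. Proof. exact: fgliftEB. Qed.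
Lemma fixpart0 : fixpart 0 = 0. Proof. exact: fgliftE0. Qed.
Lemma fixpartMz c m : fixpart (c *~ m) = fixpart c *~ m. Proof. by rewrite /fixpart raddfMz. Qed.

Lemma on_fixpart c : on (fixd g) (fixpart c).
Proof.
apply: (@on_fglift _ _ (fun=> True)) => // u _; case: (asboolP (fixd g u)) => fu; last exact: on0.
exact: onU.
Qed.

Lemma on_fixpartS (A : X -> Prop) c : on A c -> on A (fixpart c).
Proof.
apply: on_fglift => u Au; case: (asboolP (fixd g u)) => fu; last exact: on0.
exact: onU.
Qed.

Lemma fixpart_id c : on (fixd g) c -> fixpart c = c.
Proof.
move=> fc; rewrite -[RHS]fglift_id; apply: eq_fglift => u /fc fu.
by rewrite asboolT.
Qed.

Lemma coeff_fixpart u c : fixd g u -> coeff u (fixpart c) = coeff u c.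
Proof.
move=> fu; apply: (@on_ind _ (fun=> True) (fun c => coeff u (fixpart c) = coeff u c)) => // [|x y ex ey|v _].
- by rewrite fixpart0.
- by rewrite fixpartB !coeffB ex ey.
rewrite /fixpart fgliftU; case: (asboolP (fixd g v)) => // nv; rewrite coeff0 coeffU mul1r.
by case: eqP => // e; rewrite e in nv.
Qed.

Lemma fixd_actE x (v : X) : (forall u : X, fixd g u <-> fixd g (cact u x)) -> `[< fixd g (cact v x) >] = `[< fixd g v >].
Proof. by move=> fx; apply: asbool_equiv_eq; exact: iff_sym (fx v). Qed.

Lemma fixpart_act x c : (forall u : X, fixd g u <-> fixd g (cact u x)) -> fixpart (act x c) = act x (fixpart c).
Proof.
move=> fx; rewrite /fixpart /act !fglift_comp; apply: eq_fglift => u _.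
by rewrite fgliftU fixd_actE //; case: ifP => _; rewrite ?fgliftU ?fgliftE0.
Qed.

Lemma fixd_act_self (u : X) : fixd g u <-> fixd g (cact u g).
Proof.
split=> [fu|]; first by rewrite /fixd fu fu.
by rewrite /fixd => /cact_inj.
Qed.

Lemma fixpart_norm c : fixpart (norm g l c) = fixpart c *~ l%:Z.
Proof.
have e : fixpart (act g c) = fixpart c.
  by rewrite fixpart_act; [rewrite act_id //; exact: on_fixpart|exact: fixd_act_self].
rewrite /norm [fixpart _]raddf_sum /= -pmulrn -[in RHS](card_ord l) -sumr_const.
apply: eq_bigr => i _; elim: (i : nat) => [|j IH]; first by rewrite expg0 act1.
rewrite -[RHS]IH -/(fixpart _) expgSr actM fixpart_act; last exact: fixd_act_self.
by rewrite act_id //; exact: on_fixpart.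
Qed.

Lemma norm_bd c : norm g l (bd c) = bd (norm g l c).
Proof. by rewrite /norm [RHS]raddf_sum; apply: eq_bigr => i _ /=; rewrite bd_act. Qed.

Lemma fixpart_bd c : face_closed (X := X) (fixd g) -> act g c = c ->
  exists w, fixpart (bd c) = bd (fixpart c) + w *~ l%:Z.
Proof.
move=> fc gc; have [|||e _ eE] := @chain_normP gT X g l pr_l ord_g (fun=> True) (c - fixpart c).
- by [].
- by rewrite actB gc act_id //; exact: on_fixpart.
- by move=> u fu; rewrite coeffB coeff_fixpart // subrr dvdz0.
exists (fixpart (bd e)); rewrite -fixpart_norm norm_bd -eE bdB fixpartB.
rewrite [fixpart (bd (fixpart c))]fixpart_id; first by rewrite addrC subrK.
by apply: on_fglift (@on_fixpart c) => t ft u tu; exact: fc tu.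
Qed.
End FixedPart.

(** * The Hom complex of two spheres under a cyclic group of prime order *)

Section CyclicHoms.
Variables (gT : finGroupType) (Y X : gcomplex gT) (g : gT) (l : nat).
Hypotheses (odd_gT : odd #|gT|) (pr_l : prime l) (ord_g : #[g]%g = l).
Hypotheses (fcY : face_closed (X := Y) (fixd g)) (fcX : face_closed (X := X) (fixd g)).
Variables (U1 U2 V1 V2 : nat) (Z1 : chain X) (Z2 : chain Y) (W1 : chain X) (W2 : chain Y).
Variables (K1 M1 : X -> chain X) (K2 M2 : Y -> chain Y) (R1 Q1 : X -> int) (R2 Q2 : Y -> int).
Hypotheses (cX : contraction (fun=> True) U1 Z1 K1 R1) (cY : contraction (fun=> True) U2 Z2 K2 R2).
Hypotheses (fX : contraction (fixd g) V1 W1 M1 Q1) (fY : contraction (fixd g) V2 W2 M2 Q2).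
Implicit Types (y h : hom Y X).

Let N : int := U1%:Z - U2%:Z.
Let f : int := V1%:Z - V2%:Z.
Local Notation deg := (hom_deg Z2 R1).

Lemma odd_order (x : gT) : odd #[x]%g.
Proof.
apply: dvdn_odd odd_gT; rewrite orderE -cardsT; apply: cardSg; exact: finset.subsetT.
Qed.

Definition gen (a : int) : hom Y X := fun s => Z1 *~ (a * R2 s).

Lemma degB y h : deg (y - h) = deg y - deg h.
Proof. by rewrite /hom_deg fgliftHB evB. Qed.

Lemma deg_D n h : homog n h -> deg (hD h) = 0.
Proof.
have [_ zd _ _] := cY; move=> nh; rewrite /hom_deg (hD_liftE _ nh) zd fgliftE0 mul0rz subr0.
exact: (ev_bd cX (c := fglift h Z2)).
Qed.

Lemma gen_lift a c : fglift (gen a) c = Z1 *~ (a * ev R2 c).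
Proof.
apply: (@on_ind _ (fun=> True) (fun c => fglift (gen a) c = Z1 *~ (a * ev R2 c))) => //.
- by rewrite fgliftE0 ev0 mulr0 mulr0z.
- by move=> x y ex ey; rewrite fgliftEB evB mulrBr mulrzBr ex ey.
- by move=> t _; rewrite fgliftU evU.
Qed.

Lemma homog_gen a : homog N (gen a).
Proof.
have [zon _ _ _] := cX; have [_ _ _ H2] := cY; move=> s.
have [su|su] := eqVneq (ctag s) U2; last first.
  have [_ _ r0 _] := H2 s I; rewrite /gen r0 ?mulr0 ?mulr0z; first exact: on0.
  exact/eqP.
by apply: onMz; apply: onS zon => v [_ vu]; rewrite /N; clear - su vu; lia.
Qed.

Lemma D_gen a : hD (gen a) = 0.
Proof.
have [_ zd _ _] := cX; have [_ _ _ H2] := cY; apply/funext => s.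
have [_ _ _ r0] := H2 s I.
by rewrite (hDE s (@homog_gen a)) gen_lift r0 /gen bdMz zd mul0rz mulr0 mulr0z mul0rz subrr.
Qed.

Lemma deg_gen a : deg (gen a) = a.
Proof.
have [_ _ z1 _] := cX; have [_ _ z2 _] := cY.
by rewrite /hom_deg gen_lift evMz z1 z2 mulr1 mul1r.
Qed.

Lemma hom_decomp n y : homog n y -> hD y = 0 ->
  exists2 h, homog (n + 1) h & y = hD h + gen (deg y).
Proof.
move=> ny Dy; have tr : face_closed (X := Y) (fun=> True) by [].
have on1 s : True -> on (fun _ : X => True) (y s) by [].
exists (hom_htpy (fun=> True) Z2 K2 R2 K1 n y); first exact: (homog_htpy cY cX ny on1).
apply/funext => s; have [|w ->] := htpyP cY cX tr (er := fun=> 0) (L := 0) ny on1 _ (s := s) I.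
  move=> t _; have := congr1 (fun h : hom Y X => h t) Dy; rewrite (hDE _ ny) mul0rz addr0.
  by move/eqP; rewrite subr_eq0 => /eqP.
by rewrite mulr0z addr0.
Qed.

Lemma hom_bounds n y : homog n y -> hD y = 0 -> (n = N -> deg y = 0) ->
  exists2 h, homog (n + 1) h & y = hD h.
Proof.
move=> ny Dy nN; have [h nh yE] := hom_decomp ny Dy; exists h => //.
suff d0 : deg y = 0.
  rewrite yE d0 -[RHS]addr0; congr (_ + _); apply/funext => s.
  by rewrite /gen mul0r mulr0z.
have [nN'|nN'] := eqVneq n N; first exact: nN.
have [_ _ _ H1] := cX.
apply: (ev_on0 (A := fun v => True /\ (ctag v)%:Z = U2%:Z + n)).
  by apply: (on_f_z2 cY ny).
move=> v [_ vn]; have [_ _ r0 _] := H1 v I; apply: r0 => vu.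
by move/eqP: nN'; apply; rewrite /N; clear - vn vu; lia.
Qed.

(** Up to a boundary [y] is a multiple of the generator, where x acts through the classes of the two
    spheres; [ev_act] gives the factor 1 for both. *)
Lemma deg_act n x y : homog n y -> hD y = 0 -> deg (hact x y) = deg y.
Proof.
move=> ny Dy; have [h nh yE] := hom_decomp ny Dy.
rewrite {1}yE hactD -[hact x (hD h)]hD_act.
have degD a b : deg (a + b) = deg a + deg b by rewrite /hom_deg [fglift (a + b) _]fglift_add evD.
rewrite degD (deg_D (homog_act (g := x) nh)) add0r /hom_deg fglift_hact gen_lift actMz evMz.
have [_ _ z1 _] := cX; have [_ _ z2 _] := cY.
rewrite (ev_act cX (odd_order x)) // (ev_act cY (odd_order x^-1%g)) // mul1r mulr1.
by [].
Qed.

(** Multiples of the generator modulo norms. They are invariant, being supported on fixed simplices,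
    but only cycles up to a norm, see [D_norm_fgen]. *)
Definition fgen (a : int) : hom Y X := fun s => if `[< fixd g s >] then W1 *~ (a * Q2 s) else 0.

(** Only the residue modulo l is meaningful, because norms contribute multiples of l. *)
Definition fdeg y : 'F_l := (ev Q1 (fixpart g (fglift y W2)))%:~R.

Lemma intr_Fl_eq0 (m : int) : (m%:~R == 0 :> 'F_l) = (l%:Z %| m)%Z.
Proof. by rewrite (dvdz_pcharf (pchar_Fp pr_l)). Qed.

Lemma on_W2 : on (fixd g) W2.
Proof. by case: fY => [+ _ _ _]; apply: onS => s []. Qed.

Lemma fgen_lift a (c : chain Y) : on (fixd g) c -> fglift (fgen a) c = W1 *~ (a * ev Q2 c).
Proof.
apply: (@on_ind _ (fixd g) (fun c => fglift (fgen a) c = W1 *~ (a * ev Q2 c))) => //.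
- by rewrite fgliftE0 ev0 mulr0 mulr0z.
- by move=> x y ex ey; rewrite fgliftEB evB mulrBr mulrzBr ex ey.
- by move=> t ft; rewrite fgliftU evU /fgen asboolT.
Qed.

Lemma homog_fgen a : homog f (fgen a).
Proof.
have [zon _ _ _] := fX; have [_ _ _ H2] := fY; move=> s; rewrite /fgen.
case: (asboolP (fixd g s)) => fs; last exact: on0.
have [su|su] := eqVneq (ctag s) V2; last first.
  by have [_ _ r0 _] := H2 s fs; rewrite r0 ?mulr0 ?mulr0z; [exact: on0|exact/eqP].
by apply: onMz; apply: onS zon => v [_]; rewrite /f; lia.
Qed.

Lemma on_W1 : on (fixd g) W1.
Proof. by case: fX => [+ _ _ _]; apply: onS => s []. Qed.

Lemma hact_fixed_support y : (forall s, fixd g s -> on (fixd g) (y s)) ->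
  (forall s, ~ fixd g s -> y s = 0) -> hact g y = y.
Proof.
move=> y1 y2; apply/funext => s; rewrite /hact; have [fs|ns] := pselect (fixd g s).
  by rewrite -{1}fs cactK act_id //; exact: y1.
by rewrite !y2 ?act0 //; move/fixdV.
Qed.

Lemma hact_fgen a : hact g (fgen a) = fgen a.
Proof.
apply: hact_fixed_support => s fs; rewrite /fgen; last by rewrite asboolF.
by rewrite asboolT //; apply: onMz; exact: on_W1.
Qed.

Lemma D_fgen_fixed a s : fixd g s -> hD (fgen a) s = 0.
Proof.
move=> fs; have [_ zd _ _] := fX; have [_ _ _ H2] := fY; have [_ _ _ r0] := H2 s fs.
rewrite (hDE s (@homog_fgen a)) fgen_lift ?r0; last by move=> t; exact: fcY.
by rewrite /fgen asboolT // bdMz zd mul0rz mulr0 mulr0z mul0rz subrr.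
Qed.

Lemma hact_tauP y : htau g y = 0 <-> hact g y = y.
Proof.
rewrite /htau; split=> [/eqP|->]; last exact: subrr.
by rewrite subr_eq0 => /eqP.
Qed.

Lemma act_fixed_value y s : hact g y = y -> fixd g s -> act g (y s) = y s.
Proof. by move=> gy fs; rewrite -{2}gy /hact -{2}fs cactK. Qed.

Lemma D_norm_fgen a : exists2 e, homog (f - 1) e & hD (fgen a) = hnorm g l e.
Proof.
apply: (hom_normP pr_l ord_g).
- by apply: homog_D; rewrite subrK; exact: homog_fgen.
- by rewrite -hD_act hact_fgen.
- by move=> s u fs _; rewrite D_fgen_fixed // coeff0 dvdz0.
Qed.

Lemma fixpart_lift_norm (x : hom Y X) (c : chain Y) : on (fixd g) c ->
  fixpart g (fglift (hnorm g l x) c) = fixpart g (fglift x c) *~ l%:Z.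
Proof.
move=> fc; rewrite -(fixpart_norm g l); congr (fixpart g _); move: c fc.
apply: (@on_ind _ _ (fun c => fglift (hnorm g l x) c = norm g l (fglift x c))).
- by rewrite !fgliftE0 norm0.
- by move=> c e ec ee; rewrite !fgliftEB normB ec ee.
- by move=> s fs; rewrite !fgliftU hnorm_fixd.
Qed.

Lemma fdeg_norm x : fdeg (hnorm g l x) = 0.
Proof.
apply/eqP; rewrite intr_Fl_eq0 fixpart_lift_norm ?evMz; last exact: on_W2.
exact: dvdz_mull.
Qed.

Lemma act_fixed_lift y (c : chain Y) : hact g y = y -> on (fixd g) c -> act g (fglift y c) = fglift y c.
Proof.
move=> gy; move: c; apply: (@on_ind _ _ (fun c => act g (fglift y c) = fglift y c)).
- by rewrite fgliftE0 act0.
- by move=> c e ec ee; rewrite fgliftEB actB ec ee.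
- by move=> s fs; rewrite fgliftU act_fixed_value.
Qed.

Lemma fdeg_D n x : homog n x -> hact g x = x -> fdeg (hD x) = 0.
Proof.
move=> nx gx; have [_ zd _ _] := fY; apply/eqP; rewrite intr_Fl_eq0 (hD_liftE _ nx) zd fgliftE0 mul0rz subr0.
have [w ->] := fixpart_bd pr_l ord_g fcX (act_fixed_lift gx on_W2).
by rewrite evD (ev_bd fX) ?add0r ?evMz; [exact: dvdz_mull|exact: on_fixpart].
Qed.

Lemma fdegB y h : fdeg (y - h) = fdeg y - fdeg h.
Proof. by rewrite /fdeg fgliftHB fixpartB evB intrB. Qed.

Lemma fdegD y h : fdeg (y + h) = fdeg y + fdeg h.
Proof.
have fdeg0 : fdeg 0 = 0 by rewrite -{1}(subrr (0 : hom Y X)) fdegB subrr.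
by rewrite -[y + h]/(y + h) -{1}[h]opprK fdegB -[- h]sub0r fdegB fdeg0 sub0r opprK.
Qed.

Lemma fdeg_fgen a : fdeg (fgen a) = a%:~R.
Proof.
have [_ _ z1 _] := fX; have [_ _ z2 _] := fY.
rewrite /fdeg fgen_lift ?z2 ?mulr1; last exact: on_W2.
by rewrite fixpart_id ?evMz ?z1 ?mul1r //; apply: onMz; exact: on_W1.
Qed.

Lemma hnorm_invariant y : hact g y = y -> hnorm g l y = y *+ l.
Proof.
move=> gy; rewrite /hnorm -[in RHS](card_ord l) -sumr_const; apply: eq_bigr => i _.
by elim: (i : nat) => [|j IH]; rewrite ?expg0 ?hact1 // expgS hactM gy.
Qed.

(* On the fixed simplices, y becomes a chain map modulo l once the non-fixed part of its values is dropped. *)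
Lemma Phi_decomp n y e1 : homog n y -> hact g y = y -> hD y = hnorm g l e1 ->
  exists (h e : hom Y X) (a : int), [/\ homog (n + 1) h, hact g h = h, homog n e,
    y = hD h + hnorm g l e + fgen a & (n <> f -> a = 0) /\ fdeg y = a%:~R].
Proof.
move=> ny gy Dy; pose y' : hom Y X := fun s => fixpart g (y s).
have ny' : homog n y' by move=> s; apply: on_fixpartS.
have on1 s : fixd g s -> on (fixd g) (y' s) by move=> _; exact: on_fixpart.
have lift' (c : chain Y) : fixpart g (fglift y c) = fglift y' c by rewrite /fixpart fglift_comp.
have /boolp.choice[er erP] : forall s, exists w, fixd g s ->
    bd (y' s) = fglift y' (cbd s) *~ (-1) ^+ `|n| + w *~ l%:Z.
  move=> s; have [fs|ns] := pselect (fixd g s); last by exists 0.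
  have [w wE] := fixpart_bd pr_l ord_g fcX (act_fixed_value gy fs).
  exists (fixpart g (e1 s) - w) => _; have := congr1 (fun h : hom Y X => fixpart g (h s)) Dy.
  rewrite /= (hDE s ny) hnorm_fixd // fixpart_norm // fixpartB fixpartMz lift' wE mulrzBl => <-.
  have H (M : zmodType) (x z v : M) : x = z + (x + v - z - v) by abel.
  exact: H.
pose a := ev Q1 (fglift y' W2).
have aE : fdeg y = a%:~R by rewrite /fdeg lift'.
have na : n <> f -> a = 0.
  move=> nf; have [_ _ _ H1] := fX.
  apply: ev_on0 (on_f_z2 fY ny' on1) _ => v [fv vn].
  by have [_ _ r0 _] := H1 v fv; apply: r0 => vu; apply: nf; rewrite /f; lia.
pose h := hom_htpy (fixd g) W2 M2 Q2 M1 n y'.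
have nh : homog (n + 1) h by exact: (homog_htpy fY fX ny' on1).
have [_ _ _ H1] := fX; have [_ _ _ H2] := fY.
have lift_on (c : chain Y) : on (fixd g) (fglift y' c).
  by apply: (@on_fglift _ _ (fun=> True)) => // t _; exact: on_fixpart.
have gh : hact g h = h.
  apply: hact_fixed_support => s fs; rewrite /h /hom_htpy; last by rewrite asboolF.
  rewrite asboolT //; apply: onD; apply: onMz; first exact: lift_on.
  by apply: on_fglift (lift_on W2) => t ft; have [+ _ _ _] := H1 t ft; apply: onS => v [].
have nW : homog n (y - hD h - fgen a).
  apply: homogB; first by apply: homogB => //; exact: homog_D.
  have [->|/eqP/na ->] := eqVneq n f; first exact: homog_fgen.
  by move=> s; rewrite /fgen mul0r mulr0z if_same; exact: on0.
have [|s u fs fu|e ne eE] := hom_normP pr_l ord_g nW.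
- by rewrite !hactB gy -hD_act gh hact_fgen.
- have [w wE] := htpyP fY fX fcY ny' on1 erP fs.
  have E : y' s - hD h s - fgen a s = w *~ l%:Z.
    have H (M : zmodType) (b z v : M) : b + z + v - b - z = v by abel.
    by rewrite wE /fgen asboolT //; exact: H.
  rewrite [(_ - _) s]homBE [(_ - _) s]homBE !coeffB -(coeff_fixpart (y s) fu) -!coeffB E.
  by rewrite [coeff u _]raddfMz /= mulrzz dvdz_mull.
exists h, e, a; split=> //; rewrite -eE; abel.
Qed.

Lemma Phi_exact n y e1 : homog n y -> hact g y = y -> hD y = hnorm g l e1 ->
  (n = f -> fdeg y = 0) ->
  exists h e, [/\ homog (n + 1) h, hact g h = h, homog n e & y = hD h + hnorm g l e].
Proof.
move=> ny gy Dy y0; have [h [e [a [nh gh ne yE [na aE]]]]] := Phi_decomp ny gy Dy.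
have [nf|/eqP/na a0] := eqVneq n f; last first.
  exists h, e; split=> //; rewrite {1}yE a0 -[RHS]addr0; congr (_ + _).
  by apply/funext => s; rewrite /fgen mul0r mulr0z if_same.
have : (a%:~R == 0 :> 'F_l) by rewrite -aE y0.
rewrite intr_Fl_eq0 => /dvdzP[b ab]; exists h, (e + fgen b); split=> //.
  by apply: homogD => //; rewrite nf; exact: homog_fgen.
(* As [fgen b] is invariant, its norm is l times itself, which is [fgen a] for a = b l. *)
have -> : hnorm g l (e + fgen b) = hnorm g l e + hnorm g l (fgen b).
  by rewrite /hnorm -big_split; apply: eq_bigr => i _; exact: hactD.
rewrite addrA {1}yE; congr (_ + _); rewrite hnorm_invariant ?hact_fgen //.
apply/funext => s; have -> : (fgen b *+ l) s = fgen b s *~ l%:Z.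
  by rewrite -pmulrn; elim: (l) => [|j IH]; rewrite ?mulr0n // !mulrS homDE IH.
rewrite /fgen; case: ifP => _; last by rewrite mul0rz.
by rewrite -mulrzA ab; congr (_ *~ _); ring.
Qed.

Definition normalizer_exp : Type := {xk : gT * nat | (g ^ xk.1 == g ^+ xk.2)%g}.

Lemma conj_exp (x : gT) k i : (g ^ x = g ^+ k)%g -> (g ^ (x ^+ i) = g ^+ (k ^ i))%g.
Proof.
move=> gx; elim: i => [|i IH]; first by rewrite expg0 conjg1 expn0 expg1.
by rewrite expgSr conjgM IH conjXg gx -expgM -expnS.
Qed.

Lemma conjV_exp (x : gT) k : (g ^ x = g ^+ k)%g -> exists j, (g ^ x^-1 = g ^+ j)%g.
Proof.
move=> gx; exists (k ^ #[x]%g.-1)%N; rewrite -(conj_exp _ gx); congr (g ^ _)%g.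
by apply: (mulgI x); rewrite mulgV -expgS prednK ?fingroup.order_gt0 // expg_order.
Qed.

Lemma fixd_conj (Z : gcomplex gT) (x : gT) k (s : Z) : (g ^ x = g ^+ k)%g -> fixd g s -> fixd g (cact s x^-1%g).
Proof.
move=> gx fs; rewrite /fixd -cactM; have -> : (x^-1 * g = g ^+ k * x^-1)%g.
  by rewrite -gx conjgE -!mulgA mulgV mulg1.
by rewrite cactM fixdX.
Qed.

Lemma fixd_conjE (Z : gcomplex gT) (x : gT) k (s : Z) : (g ^ x = g ^+ k)%g -> (fixd g s <-> fixd g (cact s x)).
Proof.
move=> gx; split=> [fs|]; last by rewrite -{2}(cactK x s); exact: fixd_conj gx.
have [j gj] := conjV_exp gx; rewrite -[x]invgK; exact: fixd_conj gj fs.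
Qed.

Lemma hact_conj y (x : gT) k : (g ^ x = g ^+ k)%g -> hact g y = y -> hact g (hact x y) = hact x y.
Proof.
move=> gx gy; have [j gj] := conjV_exp gx.
have -> : hact g (hact x y) = hact x (hact (g ^+ j)%g y).
  by rewrite -!hactM -gj conjgE invgK !mulgA mulgKV.
congr (hact x _); elim: j {gj} => [|j IH]; first by rewrite expg0 hact1.
by rewrite expgS hactM gy.
Qed.

(** Conjugation permutes the powers of g: multiplication by an exponent prime to l is a bijection
    modulo l. *)
Lemma hnorm_conj y (x : gT) k : (g ^ x = g ^+ k)%g -> hnorm g l (hact x y) = hact x (hnorm g l y).
Proof.
move=> gx; have gi i : hact (g ^+ i)%g (hact x y) = hact x (hact (g ^+ i ^ x^-1)%g y).
  by rewrite -!hactM conjgE invgK !mulgA mulgKV.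
have [j gj] := conjV_exp gx; have jl : ~~ (l %| j)%N.
  apply/negP => /dvdnP[m jm]; have : (g ^ x^-1 = 1)%g.
    by rewrite gj jm mulnC expgM (expg_l ord_g) expg1n.
  move/eqP; rewrite conjg_eq1 => /eqP g1; move: pr_l; rewrite -ord_g g1 order1.
  by [].
rewrite /hnorm raddf_sum /=; under eq_bigr => i _ do rewrite gi conjXg gj -expgM.
pose h (i : 'I_l) : 'I_l := Ordinal (ltn_pmod (j * i) (order_gt0 pr_l)).
have hi : injective h.
  move=> i i' /(congr1 val) /= /eqP; wlog ii : i i' / (i <= i')%N.
    by move=> H; case/orP: (leq_total i i') => ii; [|rewrite eq_sym]; move/(H _ _ ii) => // ->.
  rewrite eq_sym eqn_mod_dvd ?leq_mul // -mulnBr Euclid_dvdM // (negPf jl) /= => d.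
  apply/val_inj/eqP; rewrite eqn_leq ii /= -subn_eq0; apply: contraLR d.
  rewrite -lt0n => d; rewrite gtnNdvd //; exact: leq_ltn_trans (leq_subr _ _) (ltn_ord i').
rewrite [RHS](reindex_inj hi); apply: eq_bigr => i _ /=.
by rewrite (expg_mod_l ord_g).
Qed.

(** By [Phi_decomp] only a multiple of the generator matters. The element x permutes the fixed
    simplices, and having odd order it acts by 1 on the classes of the fixed spheres. *)
Lemma fdeg_act n y e1 (x : gT) k : (g ^ x = g ^+ k)%g -> homog n y -> hact g y = y ->
  hD y = hnorm g l e1 -> fdeg (hact x y) = fdeg y.
Proof.
move=> gx ny gy Dy; have [h [e [a [nh gh ne yE [na aE]]]]] := Phi_decomp ny gy Dy.
have -> : fdeg (hact x y) = fdeg (hD (hact x h)) + fdeg (hact x (hnorm g l e)) + fdeg (hact x (fgen a)).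
  by rewrite hD_act -2!fdegD -2!hactD -yE.
rewrite aE.
rewrite (fdeg_D (homog_act (g := x) nh)) ?(hact_conj gx) // add0r.
rewrite -(hnorm_conj _ gx) fdeg_norm add0r.
have [w2on _ _ _] := fY; have Pv (v : Y) : fixd g v -> fixd g (cact v x^-1%g) by exact: fixd_conj gx.
rewrite /fdeg fglift_hact fgen_lift; last by apply: on_act on_W2.
rewrite (ev_act fY (odd_order _)) // mulr1 actMz fixpartMz evMz fixpart_id; last first.
  by apply: on_act on_W1 => v /(fixd_conjE _ gx).
by rewrite (ev_act fX (odd_order _)) ?mul1r // => v /(fixd_conjE _ gx).
Qed.

Definition contracted_above (Z : gcomplex gT) (d : nat) : Prop :=
  exists2 h : Z -> chain Z, equivar h & forall s,
    on (fun u => ctag u = (ctag s).+1) (h s) /\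
    ((d < ctag s)%N -> bd (h s) + fglift h (cbd s) = << s >>).

Definition hcyc n y := [/\ homog n y, hact g y = y & hD y = 0].
Definition hbnd n y := exists h, [/\ homog (n + 1) h, hact g h = h & y = hD h].

Lemma cycle_bd n y (c : chain Y) : homog n y -> hD y = 0 ->
  bd (fglift y c) = fglift y (bd c) *~ (-1) ^+ `|n|.
Proof.
move=> ny Dy; have := hD_liftE c ny; rewrite Dy.
have -> : fglift (0 : hom Y X) c = 0 by exact: (fglift0 _ c).
by move/esym/eqP; rewrite subr_eq0 => /eqP.
Qed.

(** In high degrees all values of [y] lie in tags where X is contracted. In low degrees [y] vanishes
    on tags up to d2, and above them Y is contracted. *)
Lemma hom_vanish d1 d2 : contracted_above X d1 -> contracted_above Y d2 ->
  exists M : int, forall n, M <= n \/ n <= - M -> forall y, hcyc n y -> hbnd n y.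
Proof.
move=> [h1 eh1 H1] [h2 eh2 H2]; exists (d1%:Z + d2%:Z + 1) => n nM y [ny gy Dy].
set e : int := (-1) ^+ `|n|; have eK (c : chain X) : c *~ e *~ e = c by rewrite -mulrzA sign_sqr mulr1z.
case: nM => nM.
  have nh : homog (n + 1) (fun s => fglift h1 (y s)).
    by move=> s; apply: on_fglift (ny s) => u us; have [h1on _] := H1 u; apply: onS h1on => v ->; lia.
  exists (fun s => fglift h1 (y s)); split=> //.
    by apply/funext => s; rewrite /hact -(equiv_fglift _ _ eh1) -[in RHS]gy.
  apply/funext => s; rewrite (hDE s nh) sign_succ mulrNz opprK.
  have -> : fglift (fun s => fglift h1 (y s)) (cbd s) = fglift h1 (bd (y s)) *~ e.
    have := cycle_bd << s >> ny Dy; rewrite fgliftU bdU -/e => ->.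
    by rewrite [fglift h1 (_ *~ _)]raddfMz /= eK fglift_comp.
  rewrite eK; have : on (fun u => (d1 < ctag u)%N) (y s) by apply: onS (ny s) => u us; lia.
  move: (y s); apply: (@on_ind _ _ (fun c => c = bd (fglift h1 c) + fglift h1 (bd c))).
  - by rewrite !(fgliftE0, bd0) addr0.
  - by move=> a b ea eb; rewrite !(fgliftEB, bdB) {1}ea {1}eb; abel.
  - by move=> u du; rewrite fgliftU bdU; have [_ ->] := H1 u.
have nh : homog (n + 1) (fun s => fglift y (h2 s) *~ e).
  move=> s; apply: onMz; have [h2on _] := H2 s; apply: on_fglift h2on => t tt.
  by apply: onS (ny t) => u; lia.
exists (fun s => fglift y (h2 s) *~ e); split=> //.
  apply/funext => s; rewrite /hact actMz eh2; congr (_ *~ _).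
  by have := fglift_hact y g (h2 s); rewrite gy => ->.
apply/funext => s; rewrite (hDE s nh) sign_succ mulrNz opprK fglift_mulz eK bdMz.
rewrite (cycle_bd _ ny Dy) eK -(fglift_comp h2 y).
have y0 (c : chain Y) : on (fun t => (ctag t <= d2)%N) c -> fglift y c = 0.
  apply: (@on_ind _ _ (fun c => fglift y c = 0)) => [|a b ea eb|t td].
  - exact: fgliftE0.
  - by rewrite fgliftEB ea eb subrr.
  - by rewrite fgliftU; apply: (on_false _ (ny t)) => u; lia.
have [h2on h2E] := H2 s; have [ds|ds] := ltnP d2 (ctag s).
  rewrite -[in LHS](fgliftU y s) -h2E // [LHS]raddfD.
  by [].
rewrite y0 ?y0 ?addr0; first by apply: (on_false _ (ny s)) => u; lia.
  apply: on_fglift (@on_dom _ _) => t ts; have [ton _] := H2 t; apply: onS ton => u ->.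
  by rewrite -(cbd_tag ts).
by apply: on_fglift h2on => t tt u /cbd_tag; rewrite tt => -[<-].
Qed.

Hypothesis parity : exists c : int, N = f + 2 * c.
Variables d1 d2 : nat.
Hypotheses (caX : contracted_above X d1) (caY : contracted_above Y d2).

Definition hgood n (w : nat -> 'F_l) := exists chi : hom Y X -> 'F_l,
  [/\ forall y z, hcyc n y -> hcyc n z -> chi (y - z) = chi y - chi z,
      forall y, hcyc n y -> (chi y = 0 <-> hbnd n y),
      exists2 y, hcyc n y & chi y = 1
    & forall x k y, (g ^ x = g ^+ k)%g -> hcyc n y -> chi (hact x y) = w k * chi y].

Lemma cyclic_homology :
  [/\ forall n, n <> N -> (forall j : nat, n = f + 2 * j%:Z -> N <= n) ->
        (forall i : nat, n = f - 2 * i.+1%:Z - 1 -> n <= N) -> forall y, hcyc n y -> hbnd n y,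
      forall y, hcyc N y -> (deg y = 0 <-> hbnd N y),
      (exists2 y, hcyc N y & deg y = if f <= N then 1 else l%:Z) /\
        (forall y, hcyc N y -> ((if f <= N then 1 else l%:Z) %| deg y)%Z),
      forall j : nat, f + 2 * j%:Z < N -> hgood (f + 2 * j%:Z) (fun k => k%:R ^+ j)
    & forall i : nat, N < f - 2 * i.+1%:Z - 1 ->
        hgood (f - 2 * i.+1%:Z - 1) (fun k => k%:R ^- i.+1)].
Proof.
pose gr n (y : hom Y X) := homog n y.
have tP y : htau g y = 0 <-> hact g y = y by exact: hact_tauP.
have cP n y : hcyc n y <-> cyc gr (@hD gT Y X) (htau g) n y.
  by split=> -[? /tP ? ?]; split.
have bP n y : hbnd n y <-> bnd gr (@hD gT Y X) (htau g) n y.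
  by split=> -[h [? /tP ? ?]]; exists h; split.
have [e0 ge0 De0] := D_norm_fgen 1.
have HV : exists M : int, forall n, M <= n \/ n <= - M -> van gr (@hD gT Y X) (htau g) n.
  have [M HM] := hom_vanish caX caY; exists M => n /HM H y /cP /H /bP.
  by [].
pose I := normalizer_exp.
have sumD (k : nat) (y : hom Y X) : hD (\sum_(i < k) hact (g ^+ i)%g y) = \sum_(i < k) hact (g ^+ i)%g (hD y).
  by rewrite raddf_sum; apply: eq_bigr => i _ /=; rewrite hD_act.
have sum_inv (k : nat) (y : hom Y X) : hact g y = y -> \sum_(i < k) hact (g ^+ i)%g y = y *+ k.
  move=> gy; rewrite -[in RHS](card_ord k) -sumr_const; apply: eq_bigr => i _.
  by elim: (i : nat) => [|j IH]; rewrite ?expg0 ?hact1 // expgS hactM gy.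
have deg_sum (k : nat) (y : hom Y X) : homog N y -> hD y = 0 ->
    deg (\sum_(i < k) hact (g ^+ i)%g y) = deg y *+ k.
  move=> ny Dy; elim: k => [|k IH].
    by rewrite big_ord0 mulr0n /hom_deg [fglift _ _]fglift0 ev0.
  rewrite big_ord_recr /= mulrSr -IH -(deg_act (g ^+ k)%g ny Dy).
  by rewrite /hom_deg [fglift (_ + _) _]fglift_add evD.
have Dta y : hD (htau g y) = htau g (hD y) by rewrite /htau hDB hD_act.
have tasg y : htau g (hnorm g l y) = 0 by rewrite /htau (hact_norm pr_l ord_g) subrr.
have ce_sg y : homog N y -> hD y = 0 -> deg (hnorm g l y) = deg y *+ l by exact: deg_sum.
have ce_ta y : homog N y -> hD y = 0 -> deg (htau g y) = 0.
  by move=> ny Dy; rewrite /htau degB (deg_act g ny Dy) subrr.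
have HPhi n y e1 : gr n y -> htau g y = 0 -> hD y = hnorm g l e1 -> (n = f -> fdeg y = 0) ->
    exists a e, [/\ gr (n + 1) a, htau g a = 0, gr n e & y = hD a + hnorm g l e].
  move=> ny /tP gy Dy y0; have [h [e [nh /tP gh ne yE]]] := Phi_exact ny gy Dy y0.
  by exists h, e.
pose al (i : I) (y : hom Y X) : hom Y X := hact (val i).1 y.
pose S (i : I) (y : hom Y X) : hom Y X := \sum_(j < (val i).2) hact (g ^+ j)%g y.
pose ka (i : I) : nat := (val i).2.
have SB k (y z : hom Y X) : \sum_(j < k) hact (g ^+ j)%g (y - z) =
    \sum_(j < k) hact (g ^+ j)%g y - \sum_(j < k) hact (g ^+ j)%g z.
  by rewrite -sumrB; apply: eq_bigr => j _; exact: hactB.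
have taS i y : htau g (S i (al i y)) = al i (htau g y).
  have gx := eqP (valP i); rewrite /S /al; move: (val i) gx => [x k] /= gx.
  have -> : hact x (htau g y) = hact x y - hact (g ^+ k)%g (hact x y).
    rewrite /htau hactB -!hactM; congr (_ - hact _ y).
    by rewrite -gx conjgE !mulgA mulgV mul1g.
  elim: k {gx} => [|k IH]; first by rewrite big_ord0 /htau [hact g 0]raddf0 subr0 expg0 hact1 subrr.
  rewrite big_ord_recr /= /htau hactD opprD addrACA -/(htau g _) IH -[hact g _]hactM -expgSr.
  by rewrite addrA subrK.
have ka_unit i : (ka i)%:R != 0 :> 'F_l.
  have gx := eqP (valP i); rewrite /ka; move: (val i) gx => [x k] /= gx.
  rewrite pmulrn intr_Fl_eq0; apply/negP => /dvdnP[m]; rewrite !absz_nat => km.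
  have : (g ^ x = 1)%g by rewrite gx km mulnC expgM (expg_l ord_g) expg1n.
  move/eqP; rewrite conjg_eq1 => /eqP g1; move: pr_l; rewrite -ord_g g1 order1.
  by [].
have [T1 T2 T3 T4 T5] := @tate_homology (hom Y X) gr (@hD gT Y X) (htau g) (hnorm g l) l N f pr_l
  (@homog0 _ _ _) (@homogB _ _ _) (@hDB _ _ _) (@hDK _ _ _) (@homog_D _ _ _) (htauB g) (hnormB g l)
  (@homog_tau _ _ _ g) (@homog_norm _ _ _ g l) Dta (sumD l) (hnorm_tau pr_l ord_g) tasg
  (@hom_ker_norm _ _ _ g l pr_l ord_g) parity deg (gen 1) (@hom_bounds) degB (@deg_D _) ce_sg ce_ta
  (@homog_gen 1) (D_gen 1) (deg_gen 1) fdeg (fgen 1) e0 HPhi fdegB (fun x _ => fdeg_norm x)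
  (fun x nx tx => fdeg_D nx (iffLR (tP x) tx)) (@homog_fgen 1) (iffRL (tP _) (hact_fgen 1)) ge0 De0
  (fdeg_fgen 1) HV I al S ka (fun i x y => hactB _ x y) (fun i n x nx => homog_act (g := _) nx)
  (fun i x => hD_act x _) (fun i x => hnorm_conj x (eqP (valP i)))
  (fun i x tx => iffRL (tP _) (hact_conj (eqP (valP i)) (iffLR (tP _) tx)))
  (fun i n x nx => homog_sum (fun j _ => homog_act (g := _) nx)) (fun i x => sumD _ x) taS
  (fun i x tx => sum_inv _ _ (iffLR (tP _) tx))
  (fun i y e ny ty Dy => fdeg_act (eqP (valP i)) ny (iffLR (tP _) ty) Dy) ka_unit.
have gP n w : good gr (@hD gT Y X) (htau g) al ka n w -> hgood n w.
  move=> [chi [c1 c2 c3 c4]]; exists chi; split.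
  - by move=> y z /cP cy /cP cz; exact: c1.
  - by move=> y /cP/c2 ->; rewrite bP.
  - by case: c3 => y /cP cy y1; exists y.
  - move=> x k y gx /cP cy; have := c4 (exist _ (x, k) (introT eqP gx)) y cy.
    by [].
split.
- by move=> n nN n1 n2 y /cP/(T1 _ nN n1 n2)/bP.
- by move=> y /cP/T2 ->; rewrite bP.
- have [[y /cP cy y1] T3'] := T3; split; first by exists y.
  by move=> z /cP/T3'.
- by move=> j /T4/gP.
- by move=> i /T5/gP.
Qed.
End CyclicHoms.

(** * Representation spheres and a cyclic group of prime order *)

Local Open Scope classical_set_scope.

Section RepSphereContractions.
Variables (R : realType) (gT : finGroupType) (n : nat).
Variable rG : mx_representation R [set: gT]%G n.
Notation V := 'rV[R]_n.
Notation SV := (rep_sphere rG).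
Notation C := (simp R SV).

Definition fixdim (g : gT) : nat := \rank (eigenspace (rG g) 1).

(** Fixed simplices are those in the compactified eigenspace for 1; the pseudo-inverse of a basis
    supplies the coordinates that [linear_sphere] wants. *)
Lemma sphere_fixd g : exists z, sphere_like (X := C) (fixd g) (fixdim g).+1 z.
Proof.
pose B := row_base (eigenspace (rG g) 1).
have BM : B *m pinvmx B = 1%:M by apply: mulmxVp; exact: row_base_free.
have [z zP] := linear_sphere rG BM; exists z.
have -> // : fixd g = inside (infpart (rG := rG) [set v | v = v *m pinvmx B *m B]) :> (C -> Prop).
have LP (v : V) : v = v *m pinvmx B *m B <-> v *m rG g = v.
  have E : (v <= B)%MS = (v <= eigenspace (rG g) 1)%MS by rewrite eq_row_base.
  split=> [vB|vg].
    have : (v <= B)%MS by rewrite vB submxMl.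
    by rewrite E => /eigenspaceP; rewrite scale1r.
  by rewrite mulmxKpV // E; apply/eigenspaceP; rewrite scale1r.
apply/funext => s; apply/propext; rewrite /fixd simplex_fixP; split=> H x.
  by have := H x; case: (tagged s x) => [v|] //= [] /LP.
by have := H x; case: (tagged s x) => [v|] //= /LP ->.
Qed.

Lemma sphere_all : exists z, sphere_like (X := C) (fun=> True) n.+1 z.
Proof.
have BM : 1%:M *m 1%:M = 1%:M :> 'M[R]_n by rewrite mulmx1.
have [z zP] := linear_sphere rG BM; exists z.
have -> // : (fun=> True) = inside (infpart (rG := rG) [set v | v = v *m 1%:M *m 1%:M]) :> (C -> Prop).
apply/funext => s; apply/propext; split=> // _ x.
by case: (tagged s x) => [v|] //=; rewrite !mulmx1.
Qed.

Lemma fixd_face g : face_closed (X := C) (fixd g).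
Proof. by move=> s u fs us; exact: stab_face us fs. Qed.

Lemma contracted_sphere : exists d, contracted_above C d.
Proof.
have [h eh hP] := rep_sphere_findim rG; exists #|{: gT * 'I_n * bool}|.+2; exists h => // s.
by have [h1 h2] := hP s (fun x => I); split=> //; apply: onS h1 => u [].
Qed.
End RepSphereContractions.

Section SphereHoms.
Variables (gT : finGroupType) (Y X : gcomplex gT).
Implicit Types (y h : hom Y X).

Definition cyclic_data (deg : hom Y X -> int) (N f : int) (g : gT) (l : nat) : Prop :=
  [/\ forall n, n <> N -> (forall j : nat, n = f + 2 * j%:Z -> N <= n) ->
        (forall i : nat, n = f - 2 * i.+1%:Z - 1 -> n <= N) -> forall y, hcyc g n y -> hbnd g n y,
      forall y, hcyc g N y -> (deg y = 0 <-> hbnd g N y),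
      (exists2 y, hcyc g N y & deg y = if f <= N then 1 else l%:Z) /\
        (forall y, hcyc g N y -> ((if f <= N then 1 else l%:Z) %| deg y)%Z),
      forall j : nat, f + 2 * j%:Z < N -> hgood Y X g (l := l) (f + 2 * j%:Z) (fun k => k%:R ^+ j)
    & forall i : nat, N < f - 2 * i.+1%:Z - 1 ->
        hgood Y X g (l := l) (f - 2 * i.+1%:Z - 1) (fun k => k%:R ^- i.+1)].

Definition degree_data (deg : hom Y X -> int) (N : int) : Prop :=
  [/\ forall y h, deg (y - h) = deg y - deg h,
      forall n h, homog n h -> deg (hD h) = 0,
      forall n y, homog n y -> hD y = 0 -> (n = N -> deg y = 0) ->
        exists2 h, homog (n + 1) h & y = hD h,
      forall n x y, homog n y -> hD y = 0 -> deg (hact x y) = deg y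
    & exists y, [/\ homog N y, hD y = 0 & deg y = 1]].
End SphereHoms.

Section SphereData.
Variables (R : realType) (gT : finGroupType) (n1 n2 : nat).
Variables (r1 : mx_representation R [set: gT]%G n1) (r2 : mx_representation R [set: gT]%G n2).
Notation X := (simp R (rep_sphere r1)).
Notation Y := (simp R (rep_sphere r2)).

Lemma sphere_data : odd #|gT| -> exists deg : hom Y X -> int,
  degree_data deg (n1%:Z - n2%:Z) /\
  forall g l, prime l -> #[g]%g = l ->
    (exists c, n1%:Z - n2%:Z = (fixdim r1 g)%:Z - (fixdim r2 g)%:Z + 2 * c) ->
    cyclic_data deg (n1%:Z - n2%:Z) ((fixdim r1 g)%:Z - (fixdim r2 g)%:Z) g l.
Proof.
move=> oG; have trX : face_closed (X := X) (fun=> True) by [].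
have trY : face_closed (X := Y) (fun=> True) by [].
have [Z1 /(sphere_contraction trX)[K1 [R1 cX]]] := sphere_all r1.
have [Z2 /(sphere_contraction trY)[K2 [R2 cY]]] := sphere_all r2.
have succ_sub (a b : nat) : a%:Z - b%:Z = a.+1%:Z - b.+1%:Z by lia.
exists (hom_deg Z2 R1); split.
  rewrite succ_sub; split.
  - exact: degB.
  - by move=> n h nh; exact: (deg_D cX cY nh).
  - by move=> n y ny Dy; exact: (hom_bounds cX cY ny Dy).
  - by move=> n x y ny Dy; exact: (deg_act oG cX cY x ny Dy).
  - exists (gen Z1 R2 1); split; [exact: (homog_gen (a := 1) cX cY)|exact: (D_gen cX cY 1)|exact: (deg_gen cX cY 1)].
move=> g l pr_l og par; rewrite (succ_sub n1 n2) (succ_sub (fixdim r1 g) (fixdim r2 g)) in par *.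
have [W1 /(sphere_contraction (@fixd_face _ _ _ r1 g))[M1 [Q1 fX]]] := sphere_fixd r1 g.
have [W2 /(sphere_contraction (@fixd_face _ _ _ r2 g))[M2 [Q2 fY]]] := sphere_fixd r2 g.
have [d1 ca1] := contracted_sphere r1; have [d2 ca2] := contracted_sphere r2.
exact: (cyclic_homology oG pr_l og (@fixd_face _ _ _ r2 g) (@fixd_face _ _ _ r1 g) cX cY fX fY par ca1 ca2).
Qed.
End SphereData.

Local Close Scope classical_set_scope.

(** * The group of order pq and its representations *)

Section GroupPQ.
Variables (p q : nat) (k : int) (gT : finGroupType) (a b : gT).
Hypotheses (pr_p : prime p) (pr_q : prime q) (ltpq : (p < q)%N) (k1 : (k != 1 %[mod q])%Z).
Hypothesis pq : group_pq p q k a b.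
Local Open Scope group_scope.

Let cardG : #|gT| = (p * q)%N. Proof. by case: pq. Qed.

Lemma order_dvd_prime (x : gT) l : prime l -> x ^+ l = 1 -> x = 1 \/ #[x] = l.
Proof.
move=> pl /eqP; rewrite -order_dvdn => /(prime_nt_dvdP pl) H.
by have [/eqP|] := eqVneq #[x] 1%N; [rewrite order_eq1 => /eqP; left|move/H; right].
Qed.

Lemma gen_ab : <<[set a; b]>> = [set: gT]. Proof. by case: pq. Qed.

Lemma order_le (x : gT) l : prime l -> x ^+ l = 1 -> (#[x] <= l)%N.
Proof. by move=> pl /(order_dvd_prime pl)[->|->//]; rewrite order1 prime_gt0. Qed.

Lemma order_b : #[b] = q.
Proof.
have [_ _ ap bq _] := pq; have [b1|//] := order_dvd_prime pr_q bq.
have : <<[set a; b]>> \subset <[a]>.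
  by rewrite gen_subG b1; apply/fintype.subsetP => x; rewrite !inE => /orP[]/eqP->; rewrite ?cycle_id ?group1.
move/subset_leq_card; rewrite gen_ab cardsT cardG -orderE => /leq_trans /(_ (order_le pr_p ap)).
by rewrite -{2}[p]muln1 leq_pmul2l ?prime_gt0 // leqNgt prime_gt1.
Qed.

Lemma order_a : #[a] = p.
Proof.
have [_ _ ap bq _] := pq; have [a1|//] := order_dvd_prime pr_p ap.
have : <<[set a; b]>> \subset <[b]>.
  by rewrite gen_subG a1; apply/fintype.subsetP => x; rewrite !inE => /orP[]/eqP->; rewrite ?cycle_id ?group1.
move/subset_leq_card; rewrite gen_ab cardsT cardG -orderE order_b.
by rewrite -{2}[q]mul1n leq_pmul2r ?prime_gt0 // leqNgt prime_gt1.
Qed.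

Definition kn : nat := `|(k %% q)%Z|%N.

Lemma knE : kn%:Z = (k %% q)%Z.
Proof. by rewrite /kn gez0_abs // modz_ge0 // eqz_nat -lt0n prime_gt0. Qed.

Lemma expgz_kn : expgz b k = b ^+ kn.
Proof.
have bq : b ^+ q = 1 by case: pq.
have bm (c : nat) : b ^+ (c * q) = 1 by rewrite mulnC expgM bq expg1n.
have := divz_eq k q; rewrite -knE; move: (k %/ q)%Z => c; case: k => m /= mc.
  have [[c' c'E]|[c' c'E]] : (exists c' : nat, c = c') \/ (exists c' : nat, c = - c'%:Z).
    by case: c {mc} => c; [left|right]; [exists c|exists c.+1; rewrite NegzE].
  - have -> : m = (c' * q + kn)%N by rewrite c'E in mc; lia.
    by rewrite expgD bm mul1g.
  - have -> : kn = (c' * q + m)%N by rewrite c'E in mc; lia.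
    by rewrite expgD bm mul1g.
have [[c' c'E]|[c' c'E]] : (exists c' : nat, c = c') \/ (exists c' : nat, c = - c'%:Z).
  by case: c {mc} => c; [left|right]; [exists c|exists c.+1; rewrite NegzE].
- by rewrite c'E NegzE in mc; lia.
- apply: (mulgI (b ^+ m.+1)); rewrite mulgV -expgD.
  have -> : (m.+1 + kn = c' * q)%N by rewrite c'E NegzE in mc; lia.
  by rewrite bm.
Qed.

Lemma conj_ba : b ^ a = b ^+ kn.
Proof. by rewrite -expgz_kn conjgE; case: pq => _ _ _ _ ->; rewrite mulKg. Qed.

Lemma normal_b : <[b]> <| [set: gT].
Proof.
rewrite /normal finset.subsetT -gen_ab gen_subG; apply/fintype.subsetP => x.
case/set2P=> ->; last exact: (fintype.subsetP (normG <[b]>%G) b (cycle_id b)).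
by apply/normP/eqP; rewrite eqEcard cardJg leqnn andbT -cycleJ conj_ba cycle_subG mem_cycle.
Qed.

Lemma coprime_ab : coprime #|<[a]>| #|<[b]>|.
Proof. by rewrite -!orderE order_a order_b prime_coprime // dvdn_prime2 // ltn_eqF. Qed.

Lemma mul_ab : <[a]> * <[b]> = [set: gT].
Proof.
apply/eqP; rewrite eqEcard finset.subsetT cardsT cardG coprime_cardMg ?coprime_ab //.
by rewrite -[#|<[a]>%G|]/(#[a]) -[#|<[b]>%G|]/(#[b]) order_a order_b leqnn.
Qed.

Lemma elt_ab (x : gT) : exists i j, x = a ^+ i * b ^+ j.
Proof.
have : x \in <[a]> * <[b]> by rewrite mul_ab finset.in_setT.
by case/mulsgP => _ _ /cycleP[i ->] /cycleP[j ->] ->; exists i, j.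
Qed.

Lemma capab : <[a]> :&: <[b]> = 1.
Proof. exact: coprime_TIg coprime_ab. Qed.

Lemma expa_in_b i : (a ^+ i \in <[b]>) = (p %| i)%N.
Proof.
rewrite -order_a order_dvdn; apply/idP/eqP => [ab|->]; last exact: group1.
by apply/set1gP; rewrite -capab !inE ab mem_cycle.
Qed.

(** Commuting forces q to divide (k - 1) j, and k is not 1 modulo q. *)
Lemma commute_b j : commute a (b ^+ j) -> b ^+ j = 1.
Proof.
move=> cab; have : (b ^+ j) ^ a = b ^+ j by rewrite conjgE -cab mulKg.
rewrite conjXg conj_ba -expgM => /eqP; rewrite eq_expg_mod_order order_b.
move=> e; apply/eqP; rewrite -order_dvdn order_b.
have : (kn%:Z * j%:Z == 1 * j%:Z %[mod q])%Z by rewrite mul1r -PoszM !modz_nat (eqP e).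
rewrite eqz_mod_dvd -mulrBl dvdzE abszM absz_nat Euclid_dvdM // => /orP[|//].
rewrite -[q in (q %| _)%N]absz_nat -dvdzE -eqz_mod_dvd knE modz_mod => k1'.
by case/negP: k1.
Qed.

(** If b^j normalizes the group of a, the commutator of a and b^j lies in the groups of both a and
    b, so it is 1 and [commute_b] applies. *)
Lemma norm_a x : <[a]> :^ x = <[a]> -> x \in <[a]>.
Proof.
have [i [j ->]] := elt_ab x; rewrite conjsgM.
have -> : <[a]> :^ (a ^+ i) = <[a]>.
  by apply/normP; apply: (fintype.subsetP (normG _)); exact: mem_cycle.
move=> nb; rewrite (@commute_b j) ?mulg1 ?mem_cycle //; apply/commgP/eqP/set1gP.
rewrite -capab inE; apply/andP; split.
  have aj : a ^ (b ^+ j) \in <[a]> by rewrite -nb memJ_conjg cycle_id.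
  by rewrite commgEl groupM ?groupV ?cycle_id.
have /normP nab : a \in 'N(<[b]>) by case/andP: normal_b => _ /fintype.subsetP; apply; exact: finset.in_setT.
have bj : (b ^- j) ^ a \in <[b]> by rewrite -nab memJ_conjg groupV mem_cycle.
by rewrite commgEr groupM ?mem_cycle.
Qed.

Lemma index_b : #|[set: gT] : <[b]>| = p.
Proof. by rewrite -divgS ?finset.subsetT // cardsT cardG -orderE order_b mulnK ?prime_gt0. Qed.

Lemma sub_a (H : {group gT}) : (p %| #|H|)%N -> exists x, <[a]> :^ x \subset H.
Proof.
move=> /(Cauchy pr_p)[y Hy oy].
have syl : p.-Sylow([set: gT]) <[a]>.
  rewrite pHallE finset.subsetT -orderE order_a cardsT cardG /=.
  by rewrite partnM ?prime_gt0 // part_pnat_id ?pnat_id // part_p'nat ?muln1 // p'natE // dvdn_prime2 // ltn_eqF.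
have py : p.-group <[y]> by rewrite /pgroup -orderE oy pnat_id.
have [x _ yx] := Sylow_subJ syl (finset.subsetT _) py; exists x.
suff <- : <[y]> = <[a]> :^ x :> {set gT} by rewrite cycle_subG.
by apply/eqP; rewrite eqEcard yx cardJg -!orderE oy order_a leqnn.
Qed.

Lemma sub_b (H : {group gT}) : (q %| #|H|)%N -> <[b]> \subset H.
Proof.
move=> /(Cauchy pr_q)[y Hy oy].
have syl : q.-Sylow([set: gT]) <[b]>.
  rewrite pHallE finset.subsetT -orderE order_b cardsT cardG /=.
  by rewrite partnM ?prime_gt0 // [X in (_ * X)%N]part_pnat_id ?pnat_id // part_p'nat ?mul1n // p'natE // dvdn_prime2 // gtn_eqF.
have qy : q.-group <[y]> by rewrite /pgroup -orderE oy pnat_id.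
have [x _ yx] := Sylow_subJ syl (finset.subsetT _) qy.
have /normP nx : x \in 'N(<[b]>) by case/andP: normal_b => _ /fintype.subsetP; apply; exact: finset.in_setT.
rewrite nx in yx; suff -> : <[b]> = <[y]> by rewrite cycle_subG.
by apply/eqP; rewrite eq_sym eqEcard yx -!orderE oy order_b leqnn.
Qed.

Lemma card_dvd (H : {group gT}) : (#|H| %| p * q)%N.
Proof. by rewrite -cardG -cardsT cardSg ?finset.subsetT. Qed.

Lemma coset_exponentP (x : gT) : let e := coset_exponent p a b x in
  (e < p)%N /\ exists j, x = a ^+ e * b ^+ j.
Proof.
rewrite /= /coset_exponent; set P := fun i => _.
have hP : has P (iota 0 p).
  have [i [j xE]] := elt_ab x; apply/hasP; exists (i %% p)%N.
    by rewrite mem_iota /= ltn_mod prime_gt0.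
  by rewrite /P xE -order_a expg_mod_order mulKg mem_cycle.
have le : (find P (iota 0 p) < p)%N by rewrite -[X in (_ < X)%N](size_iota 0 p) -has_find.
split=> //; have := nth_find 0%N hP; rewrite nth_iota // add0n => /cycleP[j jE].
by exists j; rewrite -jE mulKVg.
Qed.
End GroupPQ.

(** * Dimensions of fixed spaces *)

Section FixedDimension.
Variables (R : realType) (gT : finGroupType).
Implicit Types (U : representation R [set: gT]%G) (g : gT).

Lemma fixdimE n (rG : mx_representation R [set: gT]%G n) g :
  (fixdim rG g + \rank (rG g - 1%:M)%R)%N = n.
Proof. by rewrite /fixdim /eigenspace mxrank_ker subnK ?rank_leq_row. Qed.

(** Computed through the rank of g - 1, which is block diagonal on a direct sum. *)
Lemma fixdim_dadd U1 U2 g : fixdim (dadd_grepr U1 U2) g = (fixdim U1 g + fixdim U2 g)%N.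
Proof.
have /= := fixdimE (dadd_grepr U1 U2) g; have := fixdimE U1 g; have := fixdimE U2 g.
rewrite scalar_mx_block opp_block_mx add_block_mx !oppr0 !addr0 rank_diag_block_mx => e2 e1 e.
apply: (@addIn (\rank (U1 g - 1%:M)%R + \rank (U2 g - 1%:M)%R)).
rewrite [RHS]addnACA e1 e2; exact: e.
Qed.

Lemma fixdim0 g : fixdim (grepr0 : representation R [set: gT]%G) g = 0%N.
Proof. by have /= := fixdimE (grepr0 : representation R [set: gT]%G) g; clear; lia. Qed.

Lemma fixdim_sum (I : Type) (r : seq I) (P : pred I) (U : I -> representation R [set: gT]%G) g :
  fixdim (\big[dadd_grepr/grepr0]_(i <- r | P i) U i) g = (\sum_(i <- r | P i) fixdim (U i) g)%N.
Proof. by apply: (big_morph (fun U => fixdim U g)) => [U1 U2|]; [exact: fixdim_dadd|exact: fixdim0]. Qed.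

Lemma fixdim_muln U m g : fixdim (muln_grepr U m) g = (m * fixdim U g)%N.
Proof. by rewrite /muln_grepr fixdim_sum sum_nat_const card_ord. Qed.

Lemma rdegree_sum (I : Type) (r : seq I) (P : pred I) (U : I -> representation R [set: gT]%G) :
  rdegree (\big[dadd_grepr/grepr0]_(i <- r | P i) U i) = (\sum_(i <- r | P i) rdegree (U i))%N.
Proof. by apply: (big_morph (@rdegree _ _ _)). Qed.

Lemma rdegree_muln U m : rdegree (muln_grepr U m) = (m * rdegree U)%N.
Proof. by rewrite /muln_grepr rdegree_sum sum_nat_const card_ord. Qed.

Lemma fixdim_eq0 n (rG : mx_representation R [set: gT]%G n) g :
  (forall v : 'rV_n, v *m rG g = v -> v = 0) -> fixdim rG g = 0%N.
Proof.
move=> H; apply/eqP; rewrite /fixdim mxrank_eq0 -submx0; apply/rV_subP => v.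
by move=> /eigenspaceP; rewrite scale1r => /H ->; rewrite sub0mx.
Qed.

Lemma fixdim_id n (rG : mx_representation R [set: gT]%G n) g : rG g = 1%:M -> fixdim rG g = n.
Proof. by have := fixdimE rG g => + e; rewrite e subrr mxrank0 addn0. Qed.

Lemma cos_lt1 (x : R) : 0 < x < 2 * pi -> cos x < 1.
Proof.
move=> /andP[x0 x2]; have -> : cos x = cos ((x / 2) *+ 2) by congr cos; rewrite -mulr_natr mulfVK ?pnatr_eq0.
rewrite cos_mulr2n -[X in _ - X]mulr1n.
have s0 : 0 < sin (x / 2).
  by apply: sin_gt0_pi; rewrite divr_gt0 //= ltr_pdivrMr // mulrC.
have := cos2Dsin2 (x / 2); have : 0 < sin (x / 2) ^+ 2 by rewrite exprn_gt0.
set c := cos _; set s := sin _ in s0 *; rewrite !mulr2n; lra.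
Qed.

Lemma rotation_fixed (x : R) (v : 'rV_2) : cos x < 1 -> v *m rotation x = v -> v = 0.
Proof.
move=> cx vE; have e0 := congr1 (fun w : 'rV_2 => w 0 0) vE; have e1 := congr1 (fun w : 'rV_2 => w 0 1) vE.
rewrite /= !mxE !big_ord_recl !big_ord0 !mxE /= in e0 e1.
have -> : v = \row_j (if j == 0 then v 0 0 else v 0 1).
  by apply/rowP => j; rewrite mxE; case: (unliftP 0 j) => [j' ->|->] //=; rewrite ord1; congr (v 0 _); apply/val_inj.
have l0 : fintype.lift ord0 (ord0 : 'I_1) = 1 :> 'I_2 by apply/val_inj.
rewrite !l0 in e0 e1.
have cs := cos2Dsin2 x; move: e0 e1 cs cx; set c := cos x; set s := sin x.
move: (v 0 0) (v 0 1) => v0 v1 e0 e1 cs cx.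
have h0 : v0 * (1 - c) + v1 * s = 0 by lra.
have h1 : v1 * (1 - c) - v0 * s = 0 by lra.
(* This is the determinant (1 - c)^2 + s^2 of the linear system. *)
have cp : 2 * (1 - c) != 0 by rewrite mulf_neq0 ?pnatr_eq0 // subr_eq0 gt_eqF.
have f0 : v0 * (2 * (1 - c)) = 0.
  have -> : v0 * (2 * (1 - c)) = (1 - c) * (v0 * (1 - c) + v1 * s) - s * (v1 * (1 - c) - v0 * s)
    + v0 * (1 - (c ^+ 2 + s ^+ 2)) by ring.
  by rewrite h0 h1 cs subrr !mulr0 subrr addr0.
have f1 : v1 * (2 * (1 - c)) = 0.
  have -> : v1 * (2 * (1 - c)) = (1 - c) * (v1 * (1 - c) - v0 * s) + s * (v0 * (1 - c) + v1 * s)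
    + v1 * (1 - (c ^+ 2 + s ^+ 2)) by ring.
  by rewrite h0 h1 cs subrr !mulr0 !addr0.
have -> : v0 = 0 by move/eqP: f0; rewrite mulf_eq0 (negPf cp) orbF => /eqP.
have -> : v1 = 0 by move/eqP: f1; rewrite mulf_eq0 (negPf cp) orbF => /eqP.
by apply/rowP => j; rewrite !mxE if_same.
Qed.

Lemma fixed_power n (H : {group gT}) (rH : mx_representation R H n) (h x : gT) (v : 'rV_n) :
  h \in H -> x \in <[h]>%g -> v *m rH h = v -> v *m rH x = v.
Proof.
move=> Hh /cycleP[i ->] vh; elim: i => [|i IH]; first by rewrite expg0 repr_mx1 mulmx1.
by rewrite expgS repr_mxM ?groupX // mulmxA vh.
Qed.

Section Induced.
Variables (p q : nat) (k : int) (a b : gT).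
Hypotheses (pr_p : prime p) (pr_q : prime q) (ltpq : (p < q)%N) (k1 : (k != 1 %[mod q])%Z).
Hypothesis pq : group_pq p q k a b.
Variables (j : nat) (V' : mx_representation R <[b]>%G 2).
Hypotheses (j0 : (0 < j < q)%N) (V'b : V' b = rotation (2 * pi * j%:R / q%:R)).
Let W := Representation (ind_repr (finset.subsetT <[b]>%G) V').
Let T := 'I_#|rcosets <[b]>%G [set: gT]|.
Let t (x : T) : gT := ind_transv x.

Let blk (g : gT) (x y : T) : 'M[R]_2 :=
  if (t x * g * (t y)^-1)%g \in <[b]>%g then V' (t x * g * (t y)^-1)%g else 0.

Lemma indE g : W g = \mxblock_(x, y) blk g x y. Proof. by []. Qed.

Lemma index_rcosets : #|rcosets <[b]>%G [set: gT]| = p.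
Proof. exact: (index_b pr_p pr_q pq). Qed.

Lemma rdegree_ind : rdegree W = (2 * p)%N.
Proof. by rewrite /= sum_nat_const card_ord index_rcosets mulnC. Qed.

Lemma mul_ind m (v : 'M[R]_(m, \sum_(x < #|rcosets <[b]>%G [set: gT]|) 2)) g (y : T) :
  submxrow (v *m W g) y = \sum_x submxrow v x *m blk g x y.
Proof. by rewrite -{1}(submxrowK v) indE mul_mxrow_mxblock mxrowK. Qed.

Lemma V'_fixed (v : 'rV_2) : v *m V' b = v -> v = 0.
Proof.
rewrite V'b; apply: rotation_fixed; apply: cos_lt1.
have q0 : 0 < q%:R :> R by rewrite ltr0n prime_gt0.
case/andP: j0 => jp jq; rewrite divr_gt0 //=; last by rewrite !mulr_gt0 ?pi_gt0 ?ltr0n.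
by rewrite ltr_pdivrMr // ltr_pM2l ?ltr_nat // mulr_gt0 ?pi_gt0.
Qed.

(** As the group of b is normal, b is block diagonal, with blocks given by conjugates of b. Each
    conjugate generates the same group, so a vector fixed by it is fixed by b. *)
Lemma fixdim_ind_b : fixdim W b = 0%N.
Proof.
apply: fixdim_eq0 => v vE; apply/matrixP => i s.
rewrite -[v]submxrowK; have -> : \mxrow_x submxrow v x = 0; last by [].
rewrite -[RHS]submxrowK; apply: eq_mxrow => y; rewrite submxrow0.
have nb := normal_b pr_p pr_q ltpq k1 pq.
have bJ x : (t x * b * (t x)^-1)%g \in <[b]>%g.
  have : (b ^ (t x)^-1)%g \in <[b]>%g.
    by rewrite memJ_norm ?cycle_id //; case/andP: nb => _ /fintype.subsetP; apply; rewrite finset.in_setT.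
  by rewrite conjgE invgK mulgA.
have := congr1 (fun w => submxrow w y) vE; rewrite mul_ind (bigD1 y) //= big1 ?addr0 => [|x xy]; last first.
  rewrite /blk ifN ?mulmx0 //; apply: contra xy => H.
  rewrite -ind_transvP -/(t x) -/(t y) -(groupMl _ (bJ x)).
  by rewrite !mulgA mulgKV.
rewrite /blk bJ => vy; apply: V'_fixed; apply: fixed_power (bJ y) _ vy.
have -> : <[t y * b * (t y)^-1]>%g = <[b]>%g; last exact: cycle_id.
apply/eqP; rewrite eqEcard cycle_subG bJ -!orderE.
by rewrite (_ : (t y * b * (t y)^-1)%g = (b ^ (t y)^-1)%g) ?orderJ ?leqnn // conjgE invgK mulgA.
Qed.

Lemma coset_pow (y : T) : exists i, (a ^+ i * (t y)^-1)%g \in <[b]>%g.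
Proof.
have [i [m yE]] := elt_ab pr_p pr_q ltpq pq (t y); exists i.
have /andP[_ /fintype.subsetP nb] := normal_b pr_p pr_q ltpq k1 pq.
rewrite yE invMg mulgA; have -> : (a ^+ i * b ^- m * a ^- i = (b ^- m) ^ (a ^- i))%g by rewrite conjgE invgK mulgA.
by rewrite memJ_norm ?groupV ?mem_cycle // nb ?finset.in_setT.
Qed.

(** The powers of a permute the p cosets simply transitively. So a fixed vector is determined by its
    block at the trivial coset, which gives the upper bound, and summing the translates of a block
    placed there gives fixed vectors with any such block, hence the lower bound. *)
Lemma fixdim_ind_a : fixdim W a = 2%N.
Proof.
clear j0 V'b; have /andP[_ /fintype.subsetP nb] := normal_b pr_p pr_q ltpq k1 pq.
have bJ (g h : gT) : g \in <[b]>%g -> (h * g * h^-1)%g \in <[b]>%g.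
  move=> bg; have -> : (h * g * h^-1 = g ^ h^-1)%g by rewrite conjgE invgK mulgA.
  by rewrite memJ_norm // nb ?finset.in_setT.
have H0 : (<[b]>%g : {set gT}) \in rcosets <[b]>%G [set: gT].
  by apply/rcosetsP; exists 1%g; rewrite ?finset.in_setT // mulg1.
pose x0 : T := enum_rank_in H0 <[b]>%g.
have tx0 : t x0 \in <[b]>%g.
  have := ind_transvE x0; rewrite /x0 enum_rankK_in // => e.
  by move/setP: e => /(_ (t x0)) <-; exact: rcoset_refl.
pose P : 'M[R]_(\sum_(x < #|rcosets <[b]>%G [set: gT]|) 2, 2) := submxrow 1%:M x0.
have PE m (v : 'M_(m, _)) : v *m P = submxrow v x0 by rewrite mul_submxrow mulmx1.
pose K := eigenspace (W a) 1.
have blk0 i (x y : T) : (a ^+ i * (t y)^-1)%g \in <[b]>%g -> x != x0 -> blk (a ^+ i)%g x y = 0.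
  move=> iy xx; rewrite /blk ifN //; apply: contra xx => H.
  rewrite -ind_transvP -/(t x) -/(t x0).
  by rewrite groupMr ?groupV // -(groupMr _ iy) mulgA.
apply/eqP; rewrite eqn_leq; apply/andP; split.
  have inj : \rank (K *m P) = \rank K.
    apply/(@mxrank_injP _ _ _ _ K P); rewrite -mxrank_eq0 mxrank_eq0; apply/rowV0P => v.
    rewrite sub_capmx => /andP[/eigenspaceP]; rewrite scale1r => va /sub_kermxP; rewrite PE => v0.
    have vai i : v *m W (a ^+ i)%g = v.
      elim: i => [|i IH]; first by rewrite expg0 repr_mx1 mulmx1.
      by rewrite expgS repr_mxM ?finset.in_setT // mulmxA va.
    rewrite -[v]submxrowK -[RHS]submxrowK; apply: eq_mxrow => y; rewrite submxrow0.
    have [i iy] := coset_pow y; rewrite -(vai i) mul_ind big1 // => x _.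
    have [->|xx] := eqVneq x x0; first by rewrite v0 mul0mx.
    by rewrite blk0 ?mulmx0.
  by rewrite /fixdim -/K -inj rank_leq_col.
pose E : 'M[R]_(2, \sum_(x < #|rcosets <[b]>%G [set: gT]|) 2) := \mxrow_x (if x == x0 then 1%:M else 0).
pose F := \sum_(i < p) E *m W (a ^+ i)%g.
have FK : (F <= K)%MS.
  apply/eigenspaceP; rewrite scale1r /F mulmx_suml.
  have step i : E *m W (a ^+ i)%g *m W a = E *m W (a ^+ i.+1)%g.
    by rewrite expgSr repr_mxM ?finset.in_setT // mulmxA.
  have oa := order_a pr_p pr_q pq; have := prime_gt0 pr_p; case: (p) oa => // m oa _.
  rewrite (eq_bigr (fun i : 'I_m.+1 => E *m W (a ^+ i.+1)%g)) => [|i _]; last exact: step.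
  rewrite big_ord_recr [RHS]big_ord_recl addrC; congr (_ + _).
  by congr (_ *m W _); rewrite -[RHS](expg_order a) oa.
have FP : F *m P = 1%:M.
  rewrite PE /F submxrow_sum (bigD1 (Ordinal (prime_gt0 pr_p))) //.
rewrite [(a ^+ _)%g]expg0 (repr_mx1 W) mulmx1 mxrowK eqxx.
  rewrite [X in _ + X = _]big1; first exact: addr0.
  move=> i /= i0; rewrite mul_ind big1 // => x _; rewrite mxrowK.
  case: eqP => [->|_]; last by rewrite mul0mx.
  rewrite mul1mx /blk ifN // groupMr ?groupV // groupMl // (expa_in_b pr_p pr_q ltpq pq).
  by rewrite gtnNdvd // lt0n.
apply: leq_trans (mxrankS FK); rewrite -[X in (X <= _)%N](mxrank1 R 2) -FP.
exact: mxrankM_maxl.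
Qed.
End Induced.

Lemma fixdim_triv g : fixdim (triv_grepr R [set: gT]%G) g = 1%N.
Proof. exact: fixdim_id. Qed.

Section Totals.
Variables (p q : nat) (k : int) (a b : gT).
Hypotheses (pr_p : prime p) (pr_q : prime q) (ltpq : (p < q)%N) (k1 : (k != 1 %[mod q])%Z).
Hypothesis pq : group_pq p q k a b.
Variables (V : 'I_(p.-1./2) -> mx_representation R [set: gT]%G 2)
  (V' : 'I_q -> mx_representation R <[b]>%G 2) (J : {set 'I_q}).
Hypothesis (VE : forall i, V i a = rotation (2 * pi * i.+1%:R / p%:R) /\ V i b = 1%:M).
Hypothesis (V'E : forall j, V' j b = rotation (2 * pi * j%:R / q%:R)).
Hypothesis J0 : forall j, j \in J -> (0 < j)%N.
Let Vg i := Representation (V i).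
Let Wg j := Representation (ind_repr (finset.subsetT <[b]>%G) (V' j)).
Let rep t r s := dadd_grepr (muln_grepr (triv_grepr R [set: gT]%G) t)
    (dadd_grepr (sum_grepr predT Vg r) (sum_grepr (mem J) Wg s)).

Lemma fixdim_Va i : fixdim (Vg i) a = 0%N.
Proof.
apply: fixdim_eq0 => v; rewrite /= (VE i).1; apply: rotation_fixed; apply: cos_lt1.
have p0 : 0 < p%:R :> R by rewrite ltr0n prime_gt0.
apply/andP; split; first by rewrite divr_gt0 // !mulr_gt0 ?pi_gt0 ?ltr0n.
rewrite ltr_pdivrMr // ltr_pM2l ?mulr_gt0 ?pi_gt0 //.
by rewrite ltr_nat; have := ltn_ord i; have := prime_gt1 pr_p; clear; lia.
Qed.

Lemma fixdim_Vb i : fixdim (Vg i) b = 2%N.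
Proof. by apply: fixdim_id; rewrite /= (VE i).2. Qed.

Let j0 j : j \in J -> (0 < j < q)%N. Proof. by move=> /J0 ->; rewrite ltn_ord. Qed.

Lemma rdegree_total t r s :
  rdegree (rep t r s) = (t + 2 * \sum_i r i + 2 * p * \sum_(j in J) s j)%N.
Proof.
rewrite [LHS]/= -[in LHS]/(rdegree (muln_grepr _ t)) rdegree_muln muln1 -addnA; congr (_ + (_ + _))%N.
  by rewrite rdegree_sum big_distrr; apply: eq_bigr => i _; rewrite rdegree_muln mulnC.
rewrite rdegree_sum big_distrr; apply: eq_bigr => j Jj.
by rewrite rdegree_muln (rdegree_ind pr_p pr_q pq) mulnC.
Qed.

Lemma fixdim_total_a t r s : fixdim (rep t r s) a = (t + 2 * \sum_(j in J) s j)%N.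
Proof.
rewrite fixdim_dadd fixdim_muln fixdim_triv muln1 fixdim_dadd !fixdim_sum; congr (_ + _)%N.
rewrite big1 ?add0n => [|i _]; last by rewrite fixdim_muln fixdim_Va muln0.
rewrite big_distrr; apply: eq_bigr => j Jj.
by rewrite fixdim_muln (fixdim_ind_a pr_p pr_q ltpq k1 pq); exact: mulnC.
Qed.

Lemma fixdim_total_b t r s : fixdim (rep t r s) b = (t + 2 * \sum_i r i)%N.
Proof.
rewrite fixdim_dadd fixdim_muln fixdim_triv muln1 fixdim_dadd !fixdim_sum; congr (_ + _)%N.
have -> : (\sum_(j in mem J) fixdim (muln_grepr (Wg j) (s j)) b = 0)%N.
  by apply: big1 => j Jj; rewrite fixdim_muln (fixdim_ind_b pr_p pr_q ltpq k1 pq (j0 Jj) (V'E j)) muln0.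
rewrite addn0 big_distrr; apply: eq_bigr => i _; rewrite fixdim_muln fixdim_Vb; exact: mulnC.
Qed.
End Totals.
End FixedDimension.

(** * Transfer and Mackey functors *)

(** Without fixed points all orbits have l elements. The list of representatives is the same for
    every summand [F]. *)
Lemma sum_free_orbits (T : finType) (s : {perm T}) (S : {set T}) (l : nat) :
  prime l -> (forall x, (s ^+ l)%g x = x) -> (forall x, (s x \in S) = (x \in S)) ->
  (forall x, x \in S -> s x != x) ->
  exists r : seq T, forall (M : nmodType) (F : T -> M),
    \sum_(x in S) F x = \sum_(i < l) \sum_(x <- r) F ((s ^+ i)%g x).
Proof.
move=> pr_l sl sS sx.
have sSi i x : ((s ^+ i)%g x \in S) = (x \in S).
  by elim: i => [|i IH]; rewrite ?perm1 // expgSr permM sS.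
have card_orb x : x \in S -> #|porbit s x| = l.
  move=> xS; have dl : (#|porbit s x| %| l)%N.
    apply/eqP; set c := #|_|; have c0 : (0 < c)%N by rewrite /c; apply/card_gt0P; exists x; exact: porbit_id.
    have e : iter (l %% c) s x = x.
      have sx' m : (s ^+ (m * c))%g x = x.
        by elim: m => [|m IH]; rewrite ?perm1 // mulSn expgD permM [X in (s ^+ _)%g X]permX iter_porbit.
      by have := sl x; rewrite {1}(divn_eq l c) expgD permM sx' permX.
    have := uniq_traject_porbit s x; rewrite -/c; case E: (l %% c)%N e => [//|m] e u.
    have lm : (m.+1 < c)%N by rewrite -E ltn_mod.
    have := nth_uniq x _ _ u => /(_ 0%N m.+1); rewrite !size_traject c0 lm => /(_ isT isT).
    by rewrite !nth_traject // e eqxx.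
  have [/eqP c1|/(prime_nt_dvdP pr_l) H] := eqVneq #|porbit s x| 1%N; last exact: H.
  have := iter_porbit s x; rewrite (eqP c1) /= => e; case/negP: (sx x xS); exact/eqP.
have [->|[x0 _]] := set_0Vmem S.
  by exists [::] => M F; rewrite big_set0 big1 // => i _; rewrite big_nil.
pose rep (P : {set T}) := odflt x0 [pick z in P].
exists (map rep (enum (porbit s @: S))) => M F.
rewrite exchange_big big_map big_enum /= (partition_big_imset (porbit s)) /=.
apply: eq_bigr => P /imsetP[x xS ->]; set y := rep _.
have yx : y \in porbit s x.
  by rewrite /y /rep; case: pickP => //= /(_ x); rewrite porbit_id.
have yS : y \in S by have /porbitP[i ->] := yx; rewrite sSi.
have exy : porbit s x = porbit s y by apply/eqP; rewrite eq_porbit_mem porbit_sym.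
have -> : \sum_(z in S | porbit s z == porbit s x) F z = \sum_(z in porbit s y) F z.
  apply: eq_bigl => z; rewrite exy eq_porbit_mem; apply: andb_idl.
  by move=> /porbitP[i ->]; rewrite sSi.
have e := porbit_traject s y; have u := uniq_traject_porbit s y.
rewrite (eq_bigl _ _ e) -big_uniq //= card_orb // (big_nth y) size_traject big_mkord.
by apply: eq_bigr => i _; rewrite nth_traject // permX.
Qed.

Lemma homogMz (gT : finGroupType) (Y X : gcomplex gT) n (h : hom Y X) (m : int) :
  homog n h -> homog n (h *~ m).
Proof.
move=> nh; have nk k : homog n (h *+ k).
  by elim: k => [|k IH]; rewrite ?mulr0n ?mulrS; [exact: homog0|exact: homogD].
case: m => k; first by rewrite -pmulrn.
by rewrite NegzE mulrNz -pmulrn -sub0r; apply: homogB => //; exact: homog0.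
Qed.

Lemma ord1_eq (x y : 'I_1) : x = y. Proof. by rewrite [x]ord1 [y]ord1. Qed.

Lemma hactMz (gT : finGroupType) (Y X : gcomplex gT) (h : hom Y X) g (m : int) :
  hact g (h *~ m) = hact g h *~ m.
Proof. exact: raddfMz. Qed.

Section Transfer.
Variables (gT : finGroupType) (Y X : gcomplex gT).
Implicit Types (H K : {group gT}) (y z h : hom Y X) (n : int).

Definition hfix H y := forall g, g \in H -> hact g y = y.
Definition icyc H n y := [/\ homog n y, hfix H y & hD y = 0].
Definition ibnd H n y := exists h, [/\ homog (n + 1) h, hfix H h & y = hD h].
Definition htr H K y : hom Y X := \sum_(C in rcosets K H) hact (repr C) y.

Lemma hfixB H y z : hfix H y -> hfix H z -> hfix H (y - z).
Proof. by move=> fy fz g Hg; rewrite hactB fy ?fz. Qed.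

Lemma hfix0 H : hfix H 0. Proof. by move=> g _; exact: raddf0. Qed.

Lemma hfix_sub H K y : K \subset H -> hfix H y -> hfix K y.
Proof. by move=> /fintype.subsetP s fy g /s; exact: fy. Qed.

Lemma icycB H n y z : icyc H n y -> icyc H n z -> icyc H n (y - z).
Proof.
by move=> [ny fy dy] [nz fz dz]; split; [exact: homogB|exact: hfixB|rewrite hDB dy dz subrr].
Qed.

Lemma icyc0 H n : icyc H n 0.
Proof. by split; [exact: homog0|exact: hfix0|exact: raddf0]. Qed.

Lemma icycD H n y z : icyc H n y -> icyc H n z -> icyc H n (y + z).
Proof. by move=> cy cz; rewrite -[z]opprK -[- z]sub0r; apply: icycB cy (icycB _ cz); exact: icyc0. Qed.

Lemma icycMn H n y m : icyc H n y -> icyc H n (y *+ m).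
Proof. by move=> cy; elim: m => [|m IH]; [exact: icyc0|rewrite mulrS; exact: icycD]. Qed.

Lemma icyc_sub H K n y : K \subset H -> icyc H n y -> icyc K n y.
Proof. by move=> s [ny fy dy]; split=> //; exact: hfix_sub fy. Qed.

Lemma ibnd_cyc H n y : ibnd H n y -> icyc H n y.
Proof.
move=> [h [nh fh ->]]; split; [exact: homog_D|by move=> g Hg; rewrite -hD_act fh|exact: hDK].
Qed.

Lemma ibndB H n y z : ibnd H n y -> ibnd H n z -> ibnd H n (y - z).
Proof.
move=> [h [nh fh ->]] [e [ne fe ->]]; exists (h - e).
by split; [exact: homogB|exact: hfixB|rewrite hDB].
Qed.

Lemma ibndMz H n y (m : int) : ibnd H n y -> ibnd H n (y *~ m).
Proof.
move=> [h [nh fh ->]]; exists (h *~ m); split; last by rewrite raddfMz.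
  exact: homogMz.
by move=> g Hg; rewrite hactMz fh.
Qed.

Lemma ibnd_sub H K n y : K \subset H -> ibnd H n y -> ibnd K n y.
Proof. by move=> s [h [nh fh ->]]; exists h; split=> //; exact: hfix_sub fh. Qed.

Lemma ibnd_coprime H n y m m' : coprime m m' -> ibnd H n (y *+ m) -> ibnd H n (y *+ m') -> ibnd H n y.
Proof.
move=> co b1 b2; have [u [v e]] : exists u v : int, u * m%:Z + v * m'%:Z = 1.
  have [u [v e]] := Bezoutz m%:Z m'%:Z; exists u, v; rewrite e /gcdz /=.
  by move: co; rewrite /coprime => /eqP ->.
have -> : y = (y *+ m) *~ u - (y *+ m') *~ (- v).
  by rewrite mulrNz opprK !pmulrn -!mulrzA -mulrzDr [m%:Z * u]mulrC [m'%:Z * v]mulrC e.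
by apply: ibndB; exact: ibndMz.
Qed.

Lemma hfix_act H y g : hfix H y -> hfix (H :^ g)%G (hact g y).
Proof.
by move=> fy x /imsetP[u Hu ->]; rewrite -hactM -conjgC hactM fy.
Qed.

Lemma icyc_act H n y g : icyc H n y -> icyc (H :^ g)%G n (hact g y).
Proof.
move=> [ny fy dy]; split; [exact: homog_act|exact: hfix_act|by rewrite hD_act dy; exact: raddf0].
Qed.

Lemma ibnd_act H n y g : ibnd H n y -> ibnd (H :^ g)%G n (hact g y).
Proof.
move=> [h [nh fh ->]]; exists (hact g h).
by split; [exact: homog_act|exact: hfix_act|rewrite hD_act].
Qed.

Lemma hact_repr K y x : hfix K y -> hact (repr (K :* x)%g) y = hact x y.
Proof. by move=> fy; have [v Kv ->] := rcosetP (mem_repr_rcoset K x); rewrite hactM fy. Qed.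

Lemma htrMn H K y m : htr H K (y *+ m) = htr H K y *+ m.
Proof. by rewrite /htr -sumrMnl; apply: eq_bigr => C _; rewrite raddfMn. Qed.

Lemma hfix_tr H K y : K \subset H -> hfix K y -> hfix H (htr H K y).
Proof.
move=> sKH fy g Hg; rewrite [LHS]raddf_sum /htr [RHS](reindex_inj (@rcoset_inj _ g)) /=.
have memC (C : {set gT}) : ((C :* g)%g \in rcosets K H) = (C \in rcosets K H).
  apply/rcosetsP/rcosetsP => -[u Hu eC]; last by exists (u * g)%g; rewrite ?groupM // eC rcosetM.
  exists (u * g^-1)%g; rewrite ?groupM ?groupV //.
  by rewrite rcosetM -eC -rcosetM mulgV mulg1.
rewrite (eq_bigl _ _ memC); apply: eq_bigr => C /rcosetsP[u Hu ->].
by rewrite -rcosetM !hact_repr // hactM.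
Qed.

Lemma hD_tr H K y : hD (htr H K y) = htr H K (hD y).
Proof. by rewrite [LHS]raddf_sum; apply: eq_bigr => C _; exact: hD_act. Qed.

Lemma homog_tr H K n y : homog n y -> homog n (htr H K y).
Proof. by move=> ny; apply: homog_sum => C _; exact: homog_act. Qed.

Lemma icyc_tr H K n y : K \subset H -> icyc K n y -> icyc H n (htr H K y).
Proof.
move=> s [ny fy dy]; split; [exact: homog_tr|exact: hfix_tr|].
by rewrite hD_tr dy /htr big1 // => C _; exact: raddf0.
Qed.

Lemma ibnd_tr H K n y : K \subset H -> ibnd K n y -> ibnd H n (htr H K y).
Proof.
move=> s [h [nh fh ->]]; exists (htr H K h).
by split; [exact: homog_tr|exact: hfix_tr|rewrite hD_tr].
Qed.

Lemma htr_fixed H K y : K \subset H -> hfix H y -> htr H K y = y *+ #|H : K|%g.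
Proof.
move=> s fy; rewrite /htr -sumr_const; apply: eq_bigr => C /rcosetsP[u Hu ->].
by rewrite hact_repr ?fy //; exact: hfix_sub fy.
Qed.

(** Restriction followed by transfer is multiplication by the index. *)
Lemma ibnd_index H K n y : K \subset H -> icyc H n y -> ibnd K n y -> ibnd H n (y *+ #|H : K|%g).
Proof. by move=> s [_ fy _] /(ibnd_tr s); rewrite htr_fixed. Qed.

Lemma hcycP g n y : hcyc g n y <-> icyc <[g]>%G n y.
Proof.
split=> [[ny gy dy]|[ny fy dy]]; split=> //; last by apply: fy; exact: cycle_id.
by move=> x /cycleP[i ->]; elim: i => [|i IH]; rewrite ?expg0 ?hact1 // expgS hactM gy.
Qed.

Lemma hbndP g n y : hbnd g n y <-> ibnd <[g]>%G n y.
Proof.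
split=> -[h [nh gh e]]; exists h; split=> //; last by apply: gh; exact: cycle_id.
by move=> x /cycleP[i ->]; elim: i => [|i IH]; rewrite ?expg0 ?hact1 // expgS hactM gh.
Qed.

Section Degree.
Variables (deg : hom Y X -> int) (N : int).
Hypothesis dD : degree_data deg N.

Lemma deg_bnd H n y : ibnd H n y -> deg y = 0.
Proof. by case: dD => _ d2 _ _ _ [h [nh _ ->]]; exact: d2 nh. Qed.

(** Over the trivial group only the homology of E remains, where [y] bounds; transfer from there
    multiplies by the order. *)
Lemma ibnd_order H n y : icyc H n y -> (n = N -> deg y = 0) -> ibnd H n (y *+ #|H|).
Proof.
move=> [ny fy dy] nN; have [_ _ d3 _ _] := dD; have [h nh yh] := d3 n y ny dy nN.
have cy : ibnd 1%G n y by exists h; split=> // g /set1gP->; rewrite hact1.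
by have := ibnd_index (sub1G H) (And3 ny fy dy) cy; rewrite indexg1.
Qed.

Lemma deg0 : deg 0 = 0.
Proof. by case: dD => dB _ _ _ _; have := dB 0 0; rewrite subr0 subrr. Qed.

Lemma degD y z : deg (y + z) = deg y + deg z.
Proof.
have [dB _ _ _ _] := dD; have dN w : deg (- w) = - deg w by rewrite -sub0r dB deg0 sub0r.
by rewrite -[z]opprK dB !dN !opprK.
Qed.

Lemma degMz y (m : int) : deg (y *~ m) = deg y * m.
Proof.
have [dB _ _ _ _] := dD.
have dMn k : deg (y *+ k) = deg y * k%:Z.
  by elim: k => [|k IH]; rewrite ?mulr0n ?deg0 ?mulr0 // mulrS degD IH; lia.
by case: m => k; rewrite ?NegzE ?mulrNz -?pmulrn ?dMn // -sub0r dB deg0 dMn; lia.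
Qed.

Lemma deg_hact H n y g : icyc H n y -> deg (hact g y) = deg y.
Proof. by case: dD => _ _ _ d4 _ [ny _ dy]; exact: d4 ny dy. Qed.

Lemma deg_tr H K y n : K \subset H -> icyc K n y -> deg (htr H K y) = deg y * #|H : K|%g%:Z.
Proof.
move=> sKH cy.
rewrite /htr (big_morph deg degD deg0) (eq_bigr (fun=> deg y)) => [|C _]; last exact: deg_hact cy.
by rewrite sumr_const -mulr_natr natz.
Qed.
End Degree.

(** A map of Mackey functors described on cycles, so that quotients are handled only once, in
    [mackey_iso_of]. *)
Record compat n (M : mackey gT) (F : forall H, hom Y X -> M H) : Prop := Compat {
  compatB : forall H y z, icyc H n y -> icyc H n z -> F H (y - z) = F H y - F H z;
  compat_res : forall H K (s : K \subset H) y, icyc H n y -> F K y = mres s (F H y);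
  compat_tr : forall H K (s : K \subset H) y, icyc K n y -> F H (htr H K y) = mtr s (F K y);
  compat_conj : forall g H K (e : K = (H :^ g)%g :> {set gT}) y, icyc H n y ->
    F K (hact g y) = mconj e (F H y) }.

(** [F] identifies [M] with the cycles modulo those that satisfy [L]. The exponent [m] allows parts
    with coprime exponents to be added. *)
Record part n (m : nat) (L : {group gT} -> hom Y X -> Prop) (M : mackey gT)
    (F : forall H, hom Y X -> M H) : Prop := Part {
  part_compat : compat n F;
  part_ker : forall H y, icyc H n y -> (F H y = 0 <-> L H y);
  part_surj : forall H (u : M H), exists2 y, icyc H n y & F H y = u;
  part_exp : forall H (u : M H), u *+ m = 0 }.

Section CycleFunction.
Variables (V : zmodType) (H : {group gT}) (n : int) (f : hom Y X -> V).
Hypothesis fB : forall y z, icyc H n y -> icyc H n z -> f (y - z) = f y - f z.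

Lemma icyc_fun0 : f 0 = 0. Proof. by rewrite -{1}(subrr 0) fB ?subrr //; exact: icyc0. Qed.

Lemma icyc_funD y z : icyc H n y -> icyc H n z -> f (y + z) = f y + f z.
Proof.
move=> cy cz; have cN : icyc H n (- z) by rewrite -sub0r; apply: icycB cz; exact: icyc0.
by rewrite -[z in LHS]opprK fB // -[- z]sub0r fB ?icyc_fun0 ?sub0r ?opprK //; exact: icyc0.
Qed.

Lemma icyc_funMn y m : icyc H n y -> f (y *+ m) = f y *+ m.
Proof.
move=> cy; elim: m => [|m IH]; rewrite ?mulr0n ?icyc_fun0 // !mulrS icyc_funD ?IH //; exact: icycMn.
Qed.
End CycleFunction.

Lemma part0 n : @part n 1 (fun _ _ => True) (mackey0 gT) (fun _ _ => 0).
Proof.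
split; first split=> //.
- by move=> *; rewrite subrr.
- by [].
- by move=> H u; exists 0; [exact: icyc0|exact: ord1_eq].
- by move=> H u; exact: ord1_eq.
Qed.

Lemma part_iff n m L L' M F : @part n m L M F -> (forall H y, icyc H n y -> L H y <-> L' H y) ->
  part n m L' F.
Proof. by move=> [c k s e] LL; split=> // H y cy; rewrite k // LL. Qed.

Lemma compat_add n M M' F F' : @compat n M F -> @compat n M' F' ->
  compat n (fun H y => (F H y, F' H y) : mackey_add M M' H).
Proof.
move=> c c'; split.
- by move=> H y z cy cz; rewrite (compatB c) ?(compatB c').
- by move=> H K sKH y cy /=; rewrite (compat_res c sKH) ?(compat_res c' sKH).
- by move=> H K sKH y cy /=; rewrite (compat_tr c sKH) ?(compat_tr c' sKH).
- by move=> g H K eK y cy /=; rewrite (compat_conj c eK) ?(compat_conj c' eK).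
Qed.

Lemma part_add n m m' L L' M M' F F' : coprime m m' ->
  @part n m L M F -> @part n m' L' M' F' ->
  part n (m * m') (fun H y => L H y /\ L' H y)
    (fun H y => (F H y, F' H y) : mackey_add M M' H).
Proof.
move=> co [c k s e] [c' k' s' e']; split; first exact: compat_add.
- move=> H y cy; rewrite -(k H y cy) -(k' H y cy); split=> [[-> ->] //|[-> ->] //].
- move=> H [u u']; have [y cy Fy] := s H u; have [z cz Fz] := s' H u'.
  (* [A] is 1 modulo m and 0 modulo m', [B] the reverse, so A y + B z has the prescribed image in
     each part. *)
  pose A := chinese m m' 1 0; pose B := chinese m m' 0 1.
  have Mm (V : zmodType) l (w : V) a b : w *+ l = 0 -> a = b %[mod l] -> w *+ a = w *+ b.
    move=> wl ab; rewrite (divn_eq a l) (divn_eq b l) ab !mulrnDr; congr (_ + _).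
    by rewrite ![(_ * l)%N]mulnC !mulrnA wl !mul0rn.
  exists (y *+ A + z *+ B); first by apply: icycD; exact: icycMn.
  congr pair.
    have FB := @compatB _ _ _ c H.
    rewrite (icyc_funD FB) ?(icyc_funMn FB) //; try exact: icycMn.
    rewrite Fy (Mm _ m _ A 1%N) ?e //; last exact: chinese_modl.
    by rewrite (Mm _ m (F H z) B 0%N) ?e ?mulr0n ?addr0 //; exact: chinese_modl.
  have FB := @compatB _ _ _ c' H.
  rewrite (icyc_funD FB) ?(icyc_funMn FB) //; try exact: icycMn.
  rewrite Fz (Mm _ m' (F' H y) A 0%N) ?e' //; last exact: chinese_modr.
  by rewrite (Mm _ m' u' B 1%N) ?e' ?mulr0n ?add0r //; exact: chinese_modr.
- move=> H w; have Mn i : (w *+ i = (w.1 *+ i, w.2 *+ i)).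
    by elim: i => [|i IH]; rewrite ?mulr0n // !mulrS IH.
  by rewrite Mn mulrnA e mul0rn mulnC mulrnA e' mul0rn.
Qed.

(** The common form of [mackeyZp] and [mackeyZq], both of which are convertible to instances of
    it. *)
Definition levelZ l (c : {group gT} -> bool) (tr : {group gT} -> {group gT} -> 'F_l -> 'F_l)
    (cj : gT -> 'F_l -> 'F_l) : mackey gT :=
  @Mackey gT (fun H => level (c H) 'F_l)
    (fun H K _ => @level_map _ (c H) (c K) id)
    (fun H K _ => @level_map _ (c K) (c H) (tr H K))
    (fun g H K _ => @level_map _ (c H) (c K) (cj g)).

Lemma level_part l n L (c : {group gT} -> bool) tr cj (Phi : {group gT} -> hom Y X -> 'F_l) : prime l ->
  (forall H y z, icyc H n y -> icyc H n z -> c H -> Phi H (y - z) = Phi H y - Phi H z) ->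
  (forall H K y, K \subset H -> icyc H n y -> c K -> Phi K y = if c H then Phi H y else 0) ->
  (forall H K y, K \subset H -> icyc K n y -> c H ->
    Phi H (htr H K y) = if c K then tr H K (Phi K y) else 0) ->
  (forall g H K y, K = (H :^ g)%g :> {set gT} -> icyc H n y -> c K ->
    c H /\ Phi K (hact g y) = cj g (Phi H y)) ->
  (forall H y, icyc H n y -> (c H -> Phi H y = 0) <-> L H y) ->
  (forall H, c H -> exists2 y, icyc H n y & Phi H y != 0) ->
  part n l L (fun H y => @level_map _ true (c H) id (Phi H y) : levelZ c tr cj H).
Proof.
move=> pr_l hB hres htrn hconj hker hsurj; split.
- split.
  + move=> H y z cy cz /=; have := hB H y z cy cz; case: (c H) => [->//|_]; exact: ord1_eq.
  + move=> H K s y cy /=; have := hres H K y s cy; case: (c K) => [->//|_]; last exact: ord1_eq.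
    by case: (c H).
  + move=> H K s y cy /=; have := htrn H K y s cy; case: (c H) => [->//|_]; last exact: ord1_eq.
    by case: (c K).
  + move=> g H K e y cy /=; have := hconj g H K y e cy; case: (c K) => [[]//|_]; last exact: ord1_eq.
    by case: (c H).
- move=> H y cy; rewrite -hker //.
  have E b (x : 'F_l) : (@level_map _ true b id x = 0 :> level b 'F_l) <-> (b -> x = 0).
    by case: b => /=; split=> e; first [exact: e|exact: e isT|exact: ord1_eq|move=> _; exact: e|by []].
  exact: E.
- move=> H /=; have := hsurj H; have := hB H; case: (c H) => /= [hBH|_ _ u].
    move=> /(_ isT)[y cy y0] u; have FB y1 z1 c1 c2 := hBH y1 z1 c1 c2 isT.
    exists (y *+ (u / Phi H y)%R); first exact: icycMn.
    rewrite (icyc_funMn FB) // -mulr_natr.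
    by rewrite natr_Zp mulrC divfK.
  by exists 0; [exact: icyc0|exact: ord1_eq].
- move=> H u; move: u; rewrite /=; case: (c H) => /= u; last exact: ord1_eq.
  by rewrite -mulr_natr; have /andP[_ /eqP ->] := pchar_Fp pr_l; rewrite mulr0.
Qed.
End Transfer.

(** * The p-part, the q-part and the top degree over all subgroups *)

Section Assembly.
Variables (p q : nat) (k : int) (gT : finGroupType) (a b : gT).
Hypotheses (pr_p : prime p) (pr_q : prime q) (ltpq : (p < q)%N) (k1 : (k != 1 %[mod q])%Z).
Hypothesis pq : group_pq p q k a b.
Implicit Types (H K : {group gT}).

Lemma coprime_pq : coprime p q.
Proof. by rewrite prime_coprime // (dvdn_prime2 pr_p pr_q) neq_ltn ltpq. Qed.

Lemma card_pq : #|gT| = (p * q)%N. Proof. by case: pq. Qed.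

Lemma cardE H : #|H| = ((if p %| #|H| then p else 1) * (if q %| #|H| then q else 1))%N.
Proof.
have := card_dvd pq H; set h := #|H| => hpq; have co := coprime_pq.
have eq1 (x y : nat) : (x %| y)%N -> (y %| x)%N -> x = y by move=> xy yx; apply/eqP; rewrite eqn_dvd xy.
case: (boolP (p %| h)%N) => ph; case: (boolP (q %| h)%N) => qh.
- by apply: eq1 => //; rewrite Gauss_dvd ?ph.
- rewrite muln1; apply: eq1 => //; move: hpq; rewrite Gauss_dvdl //.
  by rewrite coprime_sym prime_coprime.
- rewrite mul1n; apply: eq1 => //; move: hpq; rewrite Gauss_dvdr //.
  by rewrite coprime_sym prime_coprime.
- apply/eqP; rewrite muln1 -dvdn1; move: hpq; rewrite -{1}[p]mul1n -mulnA Gauss_dvdl.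
    by [].
  by rewrite coprimeMr ![coprime h _]coprime_sym !prime_coprime // ph.
Qed.

Lemma full_group H : (p %| #|H|)%N -> (q %| #|H|)%N -> forall x, x \in H.
Proof.
move=> ph qh; have e := cardE H; rewrite ph qh in e.
have : (H : {set gT}) == [set: gT] by rewrite eqEcard finset.subsetT cardsT card_pq e /=.
by move/eqP => eH x; rewrite eH finset.in_setT.
Qed.

Lemma card_a x : #|(<[a]> :^ x)%g| = p. Proof. by rewrite cardJg -orderE (order_a pr_p pr_q pq). Qed.
Lemma card_b : #|<[b]>%g| = q. Proof. by rewrite -orderE (order_b pr_p pr_q pq). Qed.

Lemma sub_aE H x : (<[a]> :^ x)%g \subset H -> (p %| #|H|)%N.
Proof. by move=> s; rewrite -(card_a x) cardSg. Qed.

Lemma sub_bE H : (<[b]>%g \subset H) = (q %| #|H|)%N.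
Proof.
apply/idP/idP; last exact: (sub_b pr_p pr_q ltpq k1 pq).
by move=> s; rewrite -card_b cardSg.
Qed.

Variables (Y X : gcomplex gT) (deg : hom Y X -> int) (N : int).
Hypothesis dD : degree_data deg N.
Implicit Types (y z : hom Y X) (n : int).

(** The class is moved back to the group of a itself, so that one character there serves all its
    conjugates. *)
Definition ploc n H y := forall x, (<[a]> :^ x)%g \subset H -> ibnd <[a]>%G n (hact x^-1%g y).
Definition qloc n H y := (q %| #|H|)%N -> ibnd <[b]>%G n y.

Lemma icyc_a H n y x : (<[a]> :^ x)%g \subset H -> icyc H n y -> icyc <[a]>%G n (hact x^-1%g y).
Proof. by move=> s cy; apply: icyc_sub (icyc_act x^-1%g cy); rewrite -sub_conjg. Qed.

Lemma icyc_b H n y : (q %| #|H|)%N -> icyc H n y -> icyc <[b]>%G n y.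
Proof. by rewrite -sub_bE => s; exact: icyc_sub. Qed.

(** The multiple of [y] by #|H| bounds. A local boundary at p improves this to #|H| / p, one at q to
    #|H| / q; if both primes divide the order, these multiples are coprime. *)
Lemma ibnd_loc n H y : icyc H n y -> (n = N -> deg y = 0) -> ibnd H n y <-> ploc n H y /\ qloc n H y.
Proof.
move=> cy nN; split=> [by_|[pl ql]].
  split=> [x s|]; last by rewrite /qloc -sub_bE => s; exact: ibnd_sub by_.
  by apply: ibnd_sub (ibnd_act (x^-1)%g by_); rewrite -sub_conjg.
have b1 : ibnd H n (y *+ #|H|) := ibnd_order dD cy nN.
have bp : (p %| #|H|)%N -> ibnd H n (y *+ (#|H| %/ p)).
  move=> ph; have [x sx] := sub_a pr_p pr_q ltpq pq ph.
  have := ibnd_index (K := (<[a]> :^ x)%G) sx cy; rewrite -divgS // card_a; apply.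
  have := ibnd_act x (pl x sx); rewrite -hactM mulVg hact1.
  by apply: ibnd_sub.
have bq : (q %| #|H|)%N -> ibnd H n (y *+ (#|H| %/ q)).
  move=> qh; have sb : <[b]>%g \subset H by rewrite sub_bE.
  by have := ibnd_index (K := <[b]>%G) sb cy (ql qh); rewrite -divgS // card_b.
have := cardE H; move: b1 bp bq; case: (p %| #|H|)%N; case: (q %| #|H|)%N => /= b1 bp bq e.
- apply: ibnd_coprime (bp isT) (bq isT); rewrite e mulKn ?prime_gt0 // mulnK ?prime_gt0 //.
  by rewrite coprime_sym coprime_pq.
- by have := bp isT; rewrite e muln1 divnn prime_gt0.
- by have := bq isT; rewrite e mul1n divnn prime_gt0.
- by move: b1; rewrite e.
Qed.

Lemma Fl_order l H (x : 'F_l) : prime l -> ~~ (l %| #|H|)%N -> x *+ #|H| = 0 -> x = 0.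
Proof.
move=> pr_l lh /eqP; rewrite -mulr_natr mulf_eq0 => /orP[/eqP //|].
by rewrite -(dvdn_pcharf (pchar_Fp pr_l)) (negPf lh).
Qed.

(* Away from degree N the multiple |K| y bounds, and |K| is invertible modulo l. *)
Lemma tr_coprime l H K n y (f : hom Y X -> 'F_l) : prime l -> n <> N -> K \subset H ->
  ~~ (l %| #|K|)%N -> icyc K n y ->
  (forall z w, icyc H n z -> icyc H n w -> f (z - w) = f z - f w) ->
  (forall z, ibnd H n z -> f z = 0) -> f (htr H K y) = 0.
Proof.
move=> pr_l nN s lK cy fB fb; apply: (Fl_order (H := K) pr_l lK).
rewrite -(icyc_funMn fB); last exact: icyc_tr.
by rewrite -htrMn; apply: fb; apply: ibnd_tr s _; apply: (ibnd_order dD cy) => /nN.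
Qed.

Section PPart.
Variables (n : int) (w : nat -> 'F_p) (chi : hom Y X -> 'F_p).
Hypothesis nN : n <> N.
Hypotheses (chiB : forall y z, hcyc a n y -> hcyc a n z -> chi (y - z) = chi y - chi z)
  (chi0 : forall y, hcyc a n y -> (chi y = 0 <-> hbnd a n y))
  (chi1 : exists2 y, hcyc a n y & chi y = 1).

Let xsel H : gT := odflt 1%g [pick x | (<[a]> :^ x)%g \subset H].
Let Phi H y := chi (hact (xsel H)^-1%g y).

(** If H has order p, two conjugators carry the group of a onto H and differ by an element of its
    normalizer, which is the group of a itself. If q divides the order as well, H is everything and
    fixes [y]. *)
Lemma Phi_sel H x n' y : (<[a]> :^ x)%g \subset H -> icyc H n' y ->
  hact (xsel H)^-1%g y = hact x^-1%g y.
Proof.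
move=> sx [_ fy _]; have ph := sub_aE sx.
have sx' : (<[a]> :^ xsel H)%g \subset H.
  by rewrite /xsel; case: pickP => //= /(_ x); rewrite sx.
have [qh|qh] := boolP (q %| #|H|)%N; first by rewrite !fy // full_group.
have cH : #|H| = p by have := cardE H; rewrite ph (negPf qh) muln1.
have eH (z : gT) : (<[a]> :^ z)%g \subset H -> (<[a]> :^ z)%g = H.
  by move=> s; apply/eqP; rewrite eqEcard s card_a cH /=.
have na : (xsel H * x^-1)%g \in <[a]>%g.
  apply: (norm_a pr_p pr_q ltpq k1 pq).
  by rewrite conjsgM (eH _ sx') -(eH _ sx) conjsgK.
have -> : ((xsel H)^-1 = ((xsel H * x^-1)^-1) ^ x * x^-1)%g.
  by rewrite conjgE invMg invgK !mulgA mulVg mul1g mulgK.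
rewrite hactM fy // -[X in X \in _]invgK groupV -conjVg invgK.
by move/fintype.subsetP: sx; apply; rewrite memJ_conjg.
Qed.

Lemma p_part : part n p (ploc n) (fun H y => @level_map _ true (p %| #|H|)%N id (Phi H y) :
  levelZ (fun H => p %| #|H|)%N (fun _ _ => id) (fun _ => id) H).
Proof.
have PhiE H x y : (<[a]> :^ x)%g \subset H -> icyc H n y -> Phi H y = chi (hact x^-1%g y).
  by move=> s cy; rewrite /Phi (Phi_sel s cy).
have sel H : (p %| #|H|)%N -> exists x, (<[a]> :^ x)%g \subset H by exact: (sub_a pr_p pr_q ltpq pq).
have cB H y z : icyc H n y -> icyc H n z -> (p %| #|H|)%N -> Phi H (y - z) = Phi H y - Phi H z.
  move=> cy cz /sel[x s]; rewrite (PhiE _ x) ?(PhiE _ x) //; last exact: icycB.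
  by rewrite hactB chiB //; apply/hcycP; exact: icyc_a s _.
have ker H y : icyc H n y -> ((p %| #|H|)%N -> Phi H y = 0) <-> ploc n H y.
  move=> cy; split=> [P0 x s|pl /sel[x s]].
    by apply/hbndP; apply/chi0; [apply/hcycP; exact: icyc_a s cy|rewrite -(PhiE _ _ _ s cy) P0 // (sub_aE s)].
  by rewrite (PhiE _ x) //; apply/chi0; [apply/hcycP; exact: icyc_a s cy|apply/hbndP; exact: pl].
have trP H K y : K \subset H -> icyc K n y -> (p %| #|H|)%N ->
    Phi H (htr H K y) = if (p %| #|K|)%N then Phi K y else 0.
  move=> sKH cy ph; case: ifPn => pK; last first.
    apply: (tr_coprime pr_p nN sKH pK cy) => [z u cz cu|z bz]; first exact: cB.
    by apply: (ker H z (ibnd_cyc bz)).2 => //; exact: ((ibnd_loc (ibnd_cyc bz) (fun e => False_ind _ (nN e))).1 bz).1.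
  have [x s] := sel K pK; have sH := fintype.subset_trans s sKH.
  have [qK|qK] := boolP (q %| #|K|)%N.
    have eK : htr H K y = y.
      case: cy => _ fy _; rewrite htr_fixed // => [|g _]; last by apply: fy; exact: full_group.
      suff -> : #|H : K|%g = 1%N by [].
      by apply/eqP; rewrite indexg_eq1; apply/fintype.subsetP => g _; exact: full_group.
    by rewrite eK !(PhiE _ x) //; case: cy => ny fy dy; split=> // g _; apply: fy; exact: full_group.
  have cK : #|K| = p by have := cardE K; rewrite pK (negPf qK) muln1.
  have KE : (K : {set gT}) = (<[a]> :^ x)%g by apply/esym/eqP; rewrite eqEcard s card_a cK /=.
  have [qH|qH] := boolP (q %| #|H|)%N; last first.
    have cH : #|H| = p by have := cardE H; rewrite ph (negPf qH) muln1.
    have HK : (H : {set gT}) = K by apply/esym/eqP; rewrite eqEcard sKH cK cH /=.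
    have cyH : icyc H n y by apply: icyc_sub cy; rewrite HK.
    by rewrite htr_fixed ?HK ?indexgg ?(PhiE _ x) //; case: cyH.
  have HT g : g \in H by exact: full_group.
  pose v := hact x^-1%g y; have cv : icyc <[a]>%G n v by exact: icyc_a s cy.
  have co := coprime_ab pr_p pr_q ltpq pq.
  have inj : {in <[b]>%g &, injective (fun c => (K :* (x^-1 * c))%g)}.
    move=> c d bc bd_ /eqP e; have {e} : ((x^-1 * c) * (x^-1 * d)^-1)%g \in K.
      by rewrite -mem_rcoset -(eqP e) rcoset_refl.
    rewrite KE mem_conjg => ac.
    have : (c * d^-1)%g \in <[a]>%g :&: <[b]>%g.
      apply/finset.setIP; split; last by rewrite groupM ?groupV.
      move: ac; by rewrite conjgE invMg !invgK !mulgA mulgV mul1g mulgK.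
    by rewrite (capab pr_p pr_q ltpq pq) => /set1gP/eqP; rewrite -eq_mulgV1 => /eqP.
  have rc : rcosets K H = (fun c => (K :* (x^-1 * c))%g) @: <[b]>%g.
    apply/esym/eqP; rewrite eqEcard; apply/andP; split.
      by apply/fintype.subsetP => C /imsetP[c _ ->]; apply/rcosetsP; exists (x^-1 * c)%g.
    rewrite (card_in_imset inj) card_b; change (#|H : K|%g <= q)%N; rewrite -divgS // cK.
    by have := cardE H; rewrite ph qH => ->; rewrite mulKn ?prime_gt0.
  (* H is the whole group and K a conjugate of the group of a, so the powers of b represent the
     cosets. The trivial power gives [v]; the rest will be a boundary over the group of a. *)
  have trE : htr H K y = v + \sum_(c in <[b]>^#%g) hact c v.
    rewrite /htr rc big_imset //= (big_setD1 1%g) //= ; congr (_ + _).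
      by rewrite hact_repr ?mulg1 //; case: cy.
    by apply: eq_bigr => c _; rewrite hact_repr ?hactM //; case: cy.
  rewrite (PhiE K x) // -/v.
  have ct : icyc H n (htr H K y) by exact: icyc_tr.
  have s1 : (<[a]> :^ 1)%g \subset H by apply/fintype.subsetP => g _.
  rewrite (PhiE H 1%g) // invg1 hact1.
  have ca : icyc <[a]>%G n (htr H K y) by apply: icyc_sub ct; apply/fintype.subsetP.
  set S := \sum_(c in _) _ in trE.
  have cS : icyc <[a]>%G n S.
    have -> : S = htr H K y - v by rewrite trE [v + S]addrC addrK.
    exact: icycB.
  suff bS : ibnd <[a]>%G n S.
    have fB y1 y2 : icyc <[a]>%G n y1 -> icyc <[a]>%G n y2 -> chi (y1 - y2) = chi y1 - chi y2.
      by move=> /hcycP c1 /hcycP c2; exact: chiB.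
    by rewrite trE (icyc_funD fB) // [X in _ + X](chi0 _).2 ?addr0 //; [exact/hcycP|exact/hbndP].
  (* Conjugation by a acts freely on the nontrivial powers of b, so the remaining sum is a norm for
     a. As n <> N, [v] bounds some [h] without equivariance, and the norm of the partial sum [E] of
     translates of [h] is an invariant bounding chain. *)
  have inja : injective (fun c : gT => (c ^ a)%g) by exact: conjg_inj.
  pose sg : {perm gT} := perm inja.
  have sgE i c : (sg ^+ i)%g c = (c ^ (a ^+ i))%g.
    elim: i => [|i IH]; first by rewrite expg0 perm1 conjg1.
    by rewrite expgSr permM IH permE -conjgM expgSr.
  have oa := order_a pr_p pr_q pq.
  have /andP[_ /fintype.subsetP nb] := normal_b pr_p pr_q ltpq k1 pq.
  have [r rE] : exists r : seq gT, forall (M : nmodType) (F : gT -> M),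
      \sum_(c in <[b]>^#%g) F c = \sum_(i < p) \sum_(c <- r) F ((sg ^+ i)%g c).
    apply: sum_free_orbits => //.
    - by move=> c; rewrite sgE -oa expg_order conjg1.
    - move=> c; rewrite permE !finset.in_setD !inE -[(c ^ a == 1)%g]/(_) conjg_eq1.
      by rewrite memJ_norm // nb ?finset.in_setT.
    - move=> c; rewrite permE finset.in_setD inE => /andP[c1 /cycleP[j cE]].
      apply/eqP => /conjg_fixP/commgP; rewrite cE => /commute_sym/(commute_b pr_p pr_q ltpq k1 pq) e.
      by case/negP: c1; rewrite cE e.
  have [nv fv dv] := cv; have [_ _ d3 _ _] := dD.
  have [h nh vh] := d3 n v nv dv (fun e => False_ind _ (nN e)).
  pose E := \sum_(c <- r) hact c h.
  have nE : homog (n + 1) E by apply: homog_sum => c _; exact: homog_act.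
  apply/hbndP; exists (hnorm a p E); split.
  - exact: homog_norm.
  - exact: (hact_norm _ oa).
  rewrite /S rE /hnorm raddf_sum; apply: eq_bigr => i _.
  have dE : hD E = \sum_(c <- r) hact c v.
    by rewrite [LHS]raddf_sum; apply: eq_bigr => c _; rewrite [LHS]hD_act -vh.
  rewrite [RHS](hD_act E (a ^+ i)%g) dE [RHS]raddf_sum; apply: eq_bigr => c _.
  rewrite sgE conjgE hactM [LHS]hactM; congr hact; congr hact.
  by apply: fv; rewrite groupV mem_cycle.
apply: level_part => //.
- move=> H K y sKH cy pK; have [x s] := sel K pK; have sH := fintype.subset_trans s sKH.
  by rewrite (sub_aE sH) !(PhiE _ x) //; exact: icyc_sub cy.
- move=> g H K y eK cy pK; have cE : #|K| = #|H| by rewrite eK cardJg.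
  have pH : (p %| #|H|)%N by rewrite -cE.
  split=> //; have [x s] := sel H pH.
  have s' : (<[a]> :^ (x * g))%g \subset K by rewrite conjsgM eK conjSg.
  rewrite (PhiE H x) // (PhiE K (x * g)%g) //; last by apply: icyc_sub (icyc_act g cy); rewrite eK.
  by rewrite -hactM invMg mulgA mulgV mul1g.
- move=> H pH; have [x s] := sel H pH; have [y /hcycP cy y1] := chi1.
  have cx := icyc_act x cy; exists (htr H (<[a]> :^ x)%G (hact x y)); first exact: icyc_tr.
  rewrite trP //= card_a dvdnn (PhiE _ x) // -hactM mulgV hact1 y1; exact: oner_neq0.
Qed.
End PPart.

Lemma conj_b_elt e j : (b ^ (a ^+ e * b ^+ j) = b ^+ (kn q k ^ e))%g.
Proof.
rewrite conjgM; have -> : (b ^ (a ^+ e) = b ^+ (kn q k ^ e))%g.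
  elim: e => [|e IH]; first by rewrite expg0 conjg1 expn0 expg1.
  by rewrite expgSr conjgM IH conjXg (conj_ba pr_p pr_q ltpq k1 pq) -expgM expnS.
by rewrite conjXg; congr (_ ^+ _)%g; apply/conjg_fixP/commgP; exact: commuteX.
Qed.

Section QPart.
Variables (n : int) (eps : 'F_q) (w : nat -> 'F_q) (chi : hom Y X -> 'F_q).
Hypotheses (nN : n <> N) (weps : forall e, w (kn q k ^ e)%N = eps ^+ e).
Hypotheses (chiB : forall y z, hcyc b n y -> hcyc b n z -> chi (y - z) = chi y - chi z)
  (chi0 : forall y, hcyc b n y -> (chi y = 0 <-> hbnd b n y))
  (chi1 : exists2 y, hcyc b n y & chi y = 1)
  (chiw : forall x m y, (b ^ x = b ^+ m)%g -> hcyc b n y -> chi (hact x y) = w m * chi y).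

Let lev H := (q %| #|H|)%N && ((eps == 1) || ~~ (p %| #|H|)%N).

Lemma q_part : part n q (qloc n) (fun H y => @level_map _ true (lev H) id (chi y) :
  levelZ lev (fun H K x => x *+ #|H : K|%g) (fun g x => eps ^+ coset_exponent p a b g * x) H).
Proof.
have fB y z : icyc <[b]>%G n y -> icyc <[b]>%G n z -> chi (y - z) = chi y - chi z.
  by move=> /hcycP cy /hcycP cz; exact: chiB.
have chi_act g y : icyc <[b]>%G n y -> chi (hact g y) = eps ^+ coset_exponent p a b g * chi y.
  move=> /hcycP cy; have [_ [j gE]] := coset_exponentP pr_p pr_q ltpq pq g.
  by rewrite (chiw (m := (kn q k ^ coset_exponent p a b g)%N)) ?weps // {1}gE conj_b_elt.
(* Over the whole group [y] is fixed by a, which multiplies the character by [eps]. *)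
have chi_full H y : (q %| #|H|)%N -> (p %| #|H|)%N -> eps != 1 -> icyc H n y -> chi y = 0.
  move=> qH pH e1 cy; have /hcycP cb := icyc_b qH cy.
  have := chiw (x := a) (m := kn q k) (conj_ba pr_p pr_q ltpq k1 pq) cb.
  have [_ fy _] := cy; rewrite fy ?full_group // -[kn q k]expn1 weps expr1.
  move/eqP; rewrite -subr_eq0 -{1}[chi y]mul1r -mulrBl mulf_eq0 subr_eq0 eq_sym (negPf e1).
  by move/eqP.
have lev0 H y : (q %| #|H|)%N -> ~~ lev H -> icyc H n y -> chi y = 0.
  rewrite /lev => qH; rewrite qH negb_or negbK => /andP[e1 pH]; exact: chi_full.
have ker H y : icyc H n y -> (lev H -> chi y = 0) <-> qloc n H y.
  move=> cy; split=> [c0 qH|ql /andP[qH _]].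
    apply/hbndP/chi0; first by apply/hcycP; exact: icyc_b cy.
    by have [/c0 //|lH] := boolP (lev H); exact: lev0 lH cy.
  by apply/chi0; [apply/hcycP; exact: icyc_b cy|apply/hbndP; exact: ql].
have nbH x : (<[b]> :^ x)%g = <[b]>%g.
  have /andP[_ /fintype.subsetP nb] := normal_b pr_p pr_q ltpq k1 pq.
  by apply/normP; exact: nb.
have trP H K y : K \subset H -> icyc K n y -> lev H ->
    chi (htr H K y) = if lev K then chi y *+ #|H : K|%g else 0.
  move=> sKH cy lH; have /andP[qH eH] := lH; case: ifPn => lK; last first.
    have qK : ~~ (q %| #|K|)%N.
      apply: contra lK => qK; rewrite /lev qK; case/orP: eH => [->//|pH].
      by apply/orP; right; apply: contra pH => pK; exact: dvdn_trans pK (cardSg sKH).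
    apply: (tr_coprime pr_q nN sKH qK cy) => [z u cz cu|z bz]; first by apply: fB; [exact: icyc_b cz|exact: icyc_b cu].
    by apply: (ker H z (ibnd_cyc bz)).2 => //; exact: ((ibnd_loc (ibnd_cyc bz) (fun e => False_ind _ (nN e))).1 bz).2.
  have /andP[qK _] := lK; have cb := icyc_b qK cy.
  have chC C : C \in rcosets K H -> chi (hact (repr C) y) = chi y.
    move=> /rcosetsP[g Hg ->]; rewrite hact_repr; last by case: cy.
    rewrite chi_act //; case/orP: eH => [/eqP->|pH]; first by rewrite expr1n mul1r.
    have KH : (K : {set gT}) = H.
      apply/eqP; rewrite eqEcard sKH (cardE H) (cardE K) qH qK (negPf pH).
      by rewrite /= leq_pmul2r; [case: ifP => _ //|]; exact: prime_gt0.
    have gK : g \in K by rewrite KH.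
    by rewrite -chi_act //; case: cy => _ -> .
  have [s1 _] : chi (htr H K y) = \sum_(C in rcosets K H) chi y /\ icyc <[b]>%G n (htr H K y).
    rewrite /htr; elim/big_rec2: _ => [|C c z HC [<- cz]].
      by split; [exact: icyc_fun0 fB|exact: icyc0].
    have cC : icyc <[b]>%G n (hact (repr C) y).
      by apply: icyc_sub (icyc_act (repr C) cb); rewrite /= nbH.
    by split; [rewrite (icyc_funD fB) // chC|exact: icycD].
  by rewrite s1 sumr_const.
apply: level_part => //.
- by move=> H y z cy cz /andP[qH _]; apply: fB; [exact: icyc_b cy|exact: icyc_b cz].
- move=> H K y sKH cy /andP[qK _]; case: ifPn => // lH.
  by apply: lev0 lH cy; exact: dvdn_trans qK (cardSg sKH).
- move=> g H K y eK cy; rewrite /lev eK cardJg => lK; split=> //.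
  by apply: chi_act; case/andP: lK => qK _; exact: icyc_b cy.
- move=> H lH; have /andP[qH _] := lH; have [y /hcycP cy y1] := chi1.
  have sb : <[b]>%G \subset H by rewrite sub_bE.
  exists (htr H <[b]>%G y); first exact: icyc_tr.
  have lb : lev <[b]>%G.
    by rewrite /lev card_b dvdnn (dvdn_prime2 pr_p pr_q) (ltn_eqF ltpq) orbT.
  rewrite trP // lb y1 -(dvdn_pcharf (pchar_Fp pr_q)) -divgS // card_b.
  have := cardE H; rewrite qH => ->; rewrite mulnK ?prime_gt0 //.
  case: ifP => _; last by rewrite dvdn1 neq_ltn prime_gt1 ?orbT.
  by rewrite (dvdn_prime2 pr_q pr_p) (gtn_eqF ltpq).
Qed.
End QPart.

Section DegreePart.
Variables (fa fb : int).
Hypotheses (ca : cyclic_data deg N fa a p) (cb : cyclic_data deg N fb b q).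
Let al := if fa <= N then 1%N else p.
Let be := if fb <= N then 1%N else q.
(** The positive generator of the ideal of degrees of H-invariant cycles; [al] and [be] are the
    generators over the groups of a and b. *)
Let dg H := ((if p %| #|H| then al else 1) * (if q %| #|H| then be else 1))%N.
Let F H y : int := (deg y %/ dg H)%Z.

Lemma coprime_albe : coprime al be.
Proof. by rewrite /al /be; do 2![case: ifP => _]; rewrite ?coprime1n ?coprimen1 ?coprime_pq. Qed.

Lemma al_gt0 : (0 < al)%N. Proof. by rewrite /al; case: ifP => _ //; exact: prime_gt0. Qed.
Lemma be_gt0 : (0 < be)%N. Proof. by rewrite /be; case: ifP => _ //; exact: prime_gt0. Qed.

Lemma dg_gt0 H : (0 < dg H)%N.
Proof. by rewrite /dg muln_gt0; do 2![case: ifP => _]; rewrite ?al_gt0 ?be_gt0. Qed.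

Lemma deg_dvd H y : icyc H N y -> (dg H %| deg y)%Z.
Proof.
move=> cy; have dp : (p %| #|H|)%N -> (al%:Z %| deg y)%Z.
  move=> /(sub_a pr_p pr_q ltpq pq)[x s]; rewrite -(deg_hact dD x^-1%g cy).
  have [_ _ [_ c3] _ _] := ca; have := c3 _ ((hcycP _ _ _).2 (icyc_a s cy)).
  by rewrite /al; case: ifP.
have dq : (q %| #|H|)%N -> (be%:Z %| deg y)%Z.
  move=> qH; have [_ _ [_ c3] _ _] := cb; have := c3 _ ((hcycP _ _ _).2 (icyc_b qH cy)).
  by rewrite /be; case: ifP.
move: dp dq; rewrite /dg !dvdzE !absz_nat; case: ifP => _; case: ifP => _ dp dq; rewrite ?muln1 ?mul1n ?dvd1n //.
- by rewrite Gauss_dvd ?coprime_albe // dp ?dq.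
- exact: dp.
- exact: dq.
Qed.

Lemma icycMz H n y (m : int) : icyc H n y -> icyc H n (y *~ m).
Proof.
move=> cy; case: m => m; first exact: icycMn.
by rewrite NegzE mulrNz -sub0r; apply: icycB; [exact: icyc0|exact: icycMn].
Qed.

Lemma deg_surj H : exists2 y, icyc H N y & deg y = dg H.
Proof.
have sA : (p %| #|H|)%N -> exists2 y, icyc H N y & deg y = (al * (#|H| %/ p))%N.
  move=> /(sub_a pr_p pr_q ltpq pq)[x s].
  have [_ _ [[y /hcycP cy dy] _] _ _] := ca; have cx := icyc_act x cy.
  exists (htr H (<[a]> :^ x)%G (hact x y)); first exact: icyc_tr.
  rewrite (deg_tr dD _ cx) // (deg_hact dD _ cy) dy PoszM -divgS // card_a.
  by congr (_ * _); rewrite /al; case: ifP.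
have sB : (q %| #|H|)%N -> exists2 y, icyc H N y & deg y = (be * (#|H| %/ q))%N.
  rewrite -sub_bE => s.
  have [_ _ [[y /hcycP cy dy] _] _ _] := cb.
  exists (htr H <[b]>%G y); first exact: icyc_tr.
  rewrite (deg_tr dD _ cy) // dy PoszM -divgS // card_b.
  by congr (_ * _); rewrite /be; case: ifP.
have := cardE H; rewrite /dg; case: ifP sA sB => pH sA; case: ifP => qH sB hE.
- have [y cy dy] := sA isT; have [z cz dz] := sB isT.
  (* The transfers from the groups of a and b have degrees al q and be p. If [al] or [be] is not 1,
     one of these is already al be; only al = be = 1 needs the Bezout relation of p and q. *)
  have [u [v uv]] : exists u v : int, al%:Z * q%:Z * u + be%:Z * p%:Z * v = al%:Z * be%:Z.
    have [u [v uv]] := Bezoutz p%:Z q%:Z; have e : u * p%:Z + v * q%:Z = 1.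
      by rewrite uv /gcdz /=; have := coprime_pq; rewrite /coprime => /eqP ->.
    rewrite /al /be; case: ifP => _; case: ifP => _.
    - by exists v, u; rewrite !mul1r mulrC [X in _ + X]mulrC addrC e.
    - by exists 1, 0; ring.
    - by exists 0, 1; ring.
    - by exists 1, 0; ring.
  exists (y *~ u + z *~ v); first by apply: icycD; exact: icycMz.
  rewrite (degD dD) !(degMz dD) dy dz hE mulKn ?prime_gt0 // mulnK ?prime_gt0 //.
- have [y cy dy] := sA isT; exists y => //.
  by rewrite dy hE muln1 divnn prime_gt0 // !muln1.
- have [y cy dy] := sB isT; exists y => //.
  by rewrite dy hE mul1n divnn prime_gt0 // muln1 mul1n.
- have [_ _ _ _ [y [ny dy d1]]] := dD; exists y => //; split=> // g.
  have /eqP := hE; rewrite muln1 -trivg_card1 => /eqP ->; move=> /set1gP ->; exact: hact1.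
Qed.

(** As p q is square-free, each prime divides at most one of #|K| and the index. All identities for
    restriction and transfer then reduce to a case analysis prime by prime. *)
Lemma index_pq H K : K \subset H ->
  [/\ (p %| #|H|)%N = (p %| #|K|)%N || (p %| #|H : K|%g)%N, (q %| #|H|)%N = (q %| #|K|)%N || (q %| #|H : K|%g)%N,
      ~~ ((p %| #|K|)%N && (p %| #|H : K|%g)%N), ~~ ((q %| #|K|)%N && (q %| #|H : K|%g)%N)
    & #|H : K|%g = ((if p %| #|H : K|%g then p else 1) * (if q %| #|H : K|%g then q else 1))%N].
Proof.
move=> s; have L := Lagrange s; have := cardE H; have := cardE K; rewrite -L !Euclid_dvdM //.
have K0 := cardG_gt0 K; have p0 := prime_gt0 pr_p; have q0 := prime_gt0 pr_q.
have hd : (#|K| * #|H : K|%g %| p * q)%N by rewrite L; exact: (card_dvd pq).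
have np : ~~ ((p %| #|K|)%N && (p %| #|H : K|%g)%N).
  apply/negP => /andP[u v]; have := dvdn_trans (dvdn_mul u v) hd.
  by rewrite dvdn_pmul2l // (dvdn_prime2 pr_p pr_q) (ltn_eqF ltpq).
have nq : ~~ ((q %| #|K|)%N && (q %| #|H : K|%g)%N).
  apply/negP => /andP[u v]; have := dvdn_trans (dvdn_mul u v) hd.
  by rewrite dvdn_pmul2r // (dvdn_prime2 pr_q pr_p) (gtn_eqF ltpq).
move=> eK eH; split=> //; apply/eqP; rewrite -(eqn_pmul2l K0) eH; move: eK np nq.
case: (p %| #|K|)%N; case: (q %| #|K|)%N; case: (p %| _)%N; case: (q %| _)%N => //= -> _ _;
  by rewrite ?muln1 ?mul1n ?muln1 // mulnC.
Qed.

Lemma F_deg H y : icyc H N y -> deg y = F H y * (dg H)%:Z.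
Proof. by move=> cy; rewrite /F divzK // deg_dvd. Qed.

Lemma deg_F H y m : deg y = m * (dg H)%:Z -> F H y = m.
Proof. by move=> e; rewrite /F e mulzK // eqz_nat -lt0n dg_gt0. Qed.

Lemma degree_compat : compat N (F : forall H, hom Y X -> mackeyZ gT p q al be H).
Proof.
have [dB _ _ _ _] := dD.
have e1 : (al * (p %/ al) = p)%N by rewrite /al; case: ifP => _; rewrite ?divn1 ?mul1n ?divnn ?prime_gt0 ?muln1.
have e2 : (be * (q %/ be) = q)%N by rewrite /be; case: ifP => _; rewrite ?divn1 ?mul1n ?divnn ?prime_gt0 ?muln1.
split.
- by move=> H y z cy cz; apply: deg_F; rewrite dB (F_deg cy) (F_deg cz) -mulrBl.
- move=> H K s y cy; apply: deg_F; rewrite /= (F_deg cy) -mulr_natr -mulrA; congr (_ * _).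
  have [eP eQ np nq _] := index_pq s; rewrite natz -PoszM; congr Posz; rewrite /dg eP eQ; move: np nq.
  case: (p %| #|K|)%N; case: (q %| #|K|)%N; case: (p %| _)%N; case: (q %| _)%N => //= _ _;
    by rewrite ?muln1 ?mul1n // mulnC.
- move=> H K s y cy; apply: deg_F; rewrite /= (deg_tr dD s cy) (F_deg cy) -[LHS]mulrA -mulr_natr -mulrA; congr (_ * _).
  have [eP eQ np nq eI] := index_pq s; rewrite natz -!PoszM; congr Posz; rewrite {1}eI /dg eP eQ.
  have num (A B u v : nat) (c1 c2 c3 c4 : bool) : ~~ (c1 && c3) -> ~~ (c2 && c4) ->
      ((if c1 then A else 1) * (if c2 then B else 1) *
       ((if c3 then A * u else 1) * (if c4 then B * v else 1)) =
       (if c3 then u else 1) * (if c4 then v else 1) *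
       ((if c1 || c3 then A else 1) * (if c2 || c4 then B else 1)))%N.
    by case: c1 c2 c3 c4 => [] [] [] [] //= _ _; ring.
  by have := num al be (p %/ al)%N (q %/ be)%N _ _ _ _ np nq; rewrite e1 e2.
- move=> g H K eK y cy; apply: deg_F; rewrite (deg_hact dD g cy) (F_deg cy) /dg; congr (_ * _).
  by rewrite eK cardJg.
Qed.

Lemma degree_ker H y : icyc H N y -> F H y = 0 <-> ibnd H N y.
Proof.
move=> cy; split=> [F0|/(deg_bnd dD) d0]; last by rewrite /F d0 div0z.
have d0 : deg y = 0 by rewrite (F_deg cy) F0 mul0r.
apply/(ibnd_loc cy) => //; split=> [x s|qH].
  have [_ c2 _ _ _] := ca; apply/hbndP/c2; first by apply/hcycP; exact: icyc_a s cy.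
  by rewrite (deg_hact dD _ cy).
by have [_ c2 _ _ _] := cb; apply/hbndP/c2 => //; apply/hcycP; exact: icyc_b cy.
Qed.

Lemma degree_onto H (u : int) : exists2 y, icyc H N y & F H y = u.
Proof.
have [y cy dy] := deg_surj H; exists (y *~ u); first exact: icycMz.
by apply: deg_F; rewrite (degMz dD) dy mulrC.
Qed.
End DegreePart.
End Assembly.

(** * From cycles to the homology Mackey functor *)

Section MackeyIso.
Variables (R : realType) (gT : finGroupType) (Y X : gspace gT) (n : int).
Notation CY := (simp R Y).
Notation CX := (simp R X).

Lemma hom_bdE m (f : chain_hom R Y X) : homogeneous m f -> hom_bd m f = hD (f : hom CY CX).
Proof. by move=> nf; apply/funext => s; rewrite (@hDE gT CY CX m f s nf). Qed.

Lemma hom_cycleE (H : {group gT}) f : hom_cycle H n f <-> icyc H n (f : hom CY CX).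
Proof.
by split=> -[nf Hf df]; split=> //; have := df; rewrite (hom_bdE nf).
Qed.

Lemma hom_boundaryE (H : {group gT}) f : hom_boundary H n f <-> ibnd H n (f : hom CY CX).
Proof. by split=> -[h [nh Hh ->]]; exists h; split=> //; rewrite (hom_bdE nh). Qed.

Variables (M : mackey gT) (F : forall H : {group gT}, hom CY CX -> M H).
Arguments F : clear implicits.
Hypotheses (cF : compat n F) (kF : forall (H : {group gT}) y, icyc H n y -> (F H y = 0 <-> ibnd H n y))
  (sF : forall (H : {group gT}) (u : M H), exists2 y, icyc H n y & F H y = u).

Let cycV (H : {group gT}) (z : cycles R Y X H n) : icyc H n (val z : hom CY CX).
Proof. by apply/hom_cycleE; have /asboolP := valP z. Qed.

(** Evaluated at the representative that the quotient provides; [kF] makes the choice immaterial. *)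
Let phi (H : {group gT}) (x : homology R Y X H n) : M H := F H (val (generic_quotient.repr x)).

Let phiE (H : {group gT}) (z : cycles R Y X H n) : phi (\pi_(homology R Y X H n)%qT z) = F H (val z).
Proof.
rewrite /phi; set y := generic_quotient.repr _.
have : y - z \in @boundary_pred R gT Y X H n by rewrite Quotient.idealrBE reprK.
move=> /asboolP/hom_boundaryE b; apply/eqP; rewrite -subr_eq0 -(compatB cF) //; apply/eqP.
apply/kF; [exact: icycB|exact: b].
Qed.

Let phiB (H : {group gT}) : zmod_morphism (@phi H).
Proof.
move=> x y; rewrite -[x]reprK -[y]reprK -[X in phi X]raddfB !phiE.
by rewrite -(compatB cF); [congr F; exact: raddfB|exact: cycV|exact: cycV].
Qed.

Lemma mackey_iso_of : mackey_iso (mackey_homology R Y X n) M.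
Proof.
pose phiA (H : {group gT}) : {additive homology R Y X H n -> M H} :=
  HB.pack (@phi H) (GRing.isZmodMorphism.Build _ _ (@phi H) (@phiB H)).
exists phiA; split.
- move=> H; have inj : injective (@phi H).
    move=> x y e; have : phi (x - y) = 0 by rewrite phiB e subrr.
    move=> /(kF (cycV _))/hom_boundaryE b; apply/eqP; rewrite -subr_eq0 -[x - y]reprK.
    have pi0 : 0 = \pi_(homology R Y X H n)%qT 0 by rewrite raddf0.
    by rewrite pi0 -Quotient.idealrBE subr0; apply/asboolP.
  have S (u : M H) : exists x : homology R Y X H n, phi x = u.
    have [y /hom_cycleE cy Fy] := sF u.
    by exists (\pi_(homology R Y X H n)%qT (exist _ y (asboolT cy))); rewrite phiE.
  by exists (fun u => sval (cid (S u))) => x /=; [apply: inj|]; exact: svalP (cid (S _)).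
- move=> H K s x; rewrite -[x]reprK [mres _ _]homology_resE [LHS]phiE [phiA H _]phiE.
  exact: (compat_res cF s (cycV _)).
- move=> H K s x; rewrite -[x]reprK [mtr _ _]homology_trE [LHS]phiE [phiA K _]phiE.
  exact: (compat_tr cF s (cycV _)).
- move=> g H K e x; rewrite -[x]reprK [mconj _ _]homology_conjE [LHS]phiE [phiA H _]phiE.
  exact: (compat_conj cF e (cycV _)).
Qed.
End MackeyIso.

(** Within one family of summands the degrees are distinct, so a given degree selects at most
    one. *)
Lemma filter_iota (T : Type) (deg : nat -> int) (M : nat -> T) (s l : nat) (n : int) : injective deg ->
  (exists2 i, (s <= i < s + l)%N & n = deg i /\
    [seq x.2 | x <- [seq (deg i, M i) | i <- iota s l] & x.1 == n] = [:: M i]) \/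
  ((forall i, (s <= i < s + l)%N -> n <> deg i) /\
    [seq x.2 | x <- [seq (deg i, M i) | i <- iota s l] & x.1 == n] = [::]).
Proof.
move=> inj; rewrite filter_map -map_comp.
have [/hasP[i]|/hasPn no] := boolP (has (fun i => deg i == n) (iota s l)).
  rewrite mem_iota => si /eqP ni; left; exists i => //; split=> //.
  rewrite (eq_filter (a2 := pred1 i)) => [|j /=]; last by rewrite -ni (inj_eq inj).
  by rewrite filter_pred1_uniq ?iota_uniq // mem_iota.
right; split=> [i si e|]; first by have := no i; rewrite mem_iota si e eqxx => /(_ isT).
rewrite (eq_in_filter (a2 := pred0)) ?filter_pred0 // => i /no /negPf /=; exact.
Qed.

(** * Matching the homology with the list of summands *)

Section Torsion.
Variables (gT : finGroupType) (Y X : gcomplex gT) (deg : hom Y X -> int) (N f m : int) (g : gT) (l : nat).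
Hypotheses (cd : cyclic_data deg N f g l) (NE : N = f + 2 * m).
Variables (T : Type) (Mpos Mneg : nat -> T) (n : int).

(** Both torsion families have this shape. For a: f = t + 2 s and m = r + (p - 1) s. For b: f = t +
    2 r and m = p s. In both cases N = f + 2 m. *)
Definition torsion : seq (int * T) :=
  (if 0 < m then [seq (f + 2 * i%:Z, Mpos i) | i <- iota 0 (absz m)] else [::])
  ++ (if m < 0 then [seq (f - 2 * i%:Z - 1, Mneg i) | i <- iota 1 (absz (m + 1))] else [::]).

Notation sel := [seq x.2 | x <- torsion & x.1 == n].

Let injpos : injective (fun i : nat => f + 2 * i%:Z). Proof. by move=> i j; clear; lia. Qed.
Let injneg : injective (fun i : nat => f - 2 * i%:Z - 1). Proof. by move=> i j; clear; lia. Qed.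

Lemma torsion_top : n = N -> sel = [::].
Proof.
move=> nN; rewrite /torsion filter_cat map_cat.
have -> : [seq x.2 | x <- (if 0 < m then [seq (f + 2 * i%:Z, Mpos i) | i <- iota 0 (absz m)] else [::])
    & x.1 == n] = [::].
  case: ifP => // m0; have [[i si [ni _]]|[_ //]] := filter_iota Mpos 0 (absz m) n injpos.
  by move: si ni nN NE m0; clear; lia.
case: ifP => // m0; have [[i si [ni _]]|[_ //]] := filter_iota Mneg 1 (absz (m + 1)) n injneg.
by move: si ni nN NE m0; clear; lia.
Qed.

Lemma torsionP : n <> N ->
  [\/ sel = [::] /\ (forall y : hom Y X, hcyc g n y -> hbnd g n y),
      exists i, sel = [:: Mpos i] /\ hgood Y X g (l := l) n (fun k => k%:R ^+ i)
    | exists i, sel = [:: Mneg i] /\ hgood Y X g (l := l) n (fun k => k%:R ^- i)].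
Proof.
move=> nN; have [c1 _ _ c4 c5] := cd; rewrite /torsion filter_cat map_cat.
case: ifPn => mp.
  rewrite (lt_gtF mp) /= cats0.
  have [[i si [ni ->]]|[no ->]] := filter_iota Mpos 0 (absz m) n injpos.
    by apply: Or32; exists i; split=> //; rewrite ni; apply: c4; move: si mp NE; clear; lia.
  apply: Or31; split=> //; apply: c1 => // [j nj|i ni]; last by move: ni mp NE; clear; lia.
  by move: (no j) nj mp NE; clear; lia.
case: ifPn => mn /=.
  have [[i si [ni ->]]|[no ->]] := filter_iota Mneg 1 (absz (m + 1)) n injneg.
    case: i si ni => // i si ni.
    by apply: Or33; exists i.+1; split=> //; rewrite ni; apply: c5; move: si mn NE; clear; lia.
  apply: Or31; split=> //; apply: c1 => // [j nj|i ni]; first by move: nj mn NE; clear; lia.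
  by move: (no i.+1) ni mn NE; clear; lia.
apply: Or31; split=> //; apply: c1 => // [j nj|i ni]; first by move: nj mp mn NE; clear; lia.
by move: ni mp mn NE; clear; lia.
Qed.
End Torsion.

Section Summands.
Variables (p q : nat) (k : int) (gT : finGroupType) (a b : gT).
Hypotheses (pr_p : prime p) (pr_q : prime q) (ltpq : (p < q)%N) (k1 : (k != 1 %[mod q])%Z).
Hypothesis pq : group_pq p q k a b.
Variables (R : realType) (Y X : gspace gT) (deg : hom (simp R Y) (simp R X) -> int) (N fa fb m m' : int).
Hypothesis dD : degree_data deg N.
Hypotheses (ca : cyclic_data deg N fa a p) (cb : cyclic_data deg N fb b q).
Hypotheses (Na : N = fa + 2 * m) (Nb : N = fb + 2 * m').
Let kq : 'F_q := k%:~R.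

Lemma kn_kq : (kn q k)%:R = kq.
Proof.
rewrite /kq {2}(divz_eq k q) rmorphD rmorphM /= -(knE k pr_q) -!pmulrn.
by have /andP[_ /eqP ->] := pchar_Fp pr_q; rewrite mulr0 add0r.
Qed.

Let Ta := torsion fa m (fun=> mackeyZp gT p) (fun=> mackeyZp gT p).
Let Tb := torsion fb m' (fun i => mackeyZq p a b (kq ^+ i)) (fun i => mackeyZq p a b (kq ^- i)).
Let selb n := [seq x.2 | x <- Tb & x.1 == n].
Let sela n := [seq x.2 | x <- Ta & x.1 == n].

Let q_detected n (M : mackey gT) :=
  exists l (F : forall H : {group gT}, hom (simp R Y) (simp R X) -> M H),
    coprime p l /\ part n l (qloc q b n) F.

Lemma b_summand n : n <> N -> q_detected n (mackey_sum (selb n)).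
Proof.
move=> nN; have good eps w : (forall e, w (kn q k ^ e)%N = eps ^+ e) ->
    hgood (simp R Y) (simp R X) b (l := q) n w -> selb n = [:: mackeyZq p a b eps] ->
    q_detected n (mackey_sum (selb n)).
  move=> we [chi [cB c0 c1 cw]] ->.
  have P := q_part pr_p pr_q ltpq k1 pq dD nN we cB c0 c1 cw.
  do 2![eexists]; split; last first.
    apply: part_iff (part_add (coprimen1 q) P (part0 _ _ n)) _.
    by move=> H y _; split=> [[]|].
  by rewrite muln1 (coprime_pq pr_p pr_q ltpq).
have [[e H]|[i [e H]]|[i [e H]]] := torsionP cb Nb (fun i => mackeyZq p a b (kq ^+ i))
    (fun i => mackeyZq p a b (kq ^- i)) nN.
- rewrite /selb e; do 2![eexists]; split; last first.
    apply: part_iff (part0 _ _ n) _ => G y cy; split=> // _ qG.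
    by apply/hbndP/H/hcycP; exact: (icyc_b pr_p pr_q ltpq k1 pq qG cy).
  exact: coprimen1.
- apply: good H e => d; by rewrite natrX kn_kq -!exprM mulnC.
- apply: good H e => d; by rewrite natrX kn_kq exprVn -!exprM mulnC.
Qed.

Lemma summands_off n : n <> N -> mackey_iso (mackey_homology R Y X n) (mackey_sum (sela n ++ selb n)).
Proof.
move=> nN; have [l [F [cpl P]]] := b_summand nN.
have fin (M : mackey gT) l' (F' : forall H : {group gT}, hom (simp R Y) (simp R X) -> M H) :
    part n l' (fun H y => ploc a n H y /\ qloc q b n H y) F' ->
    mackey_iso (mackey_homology R Y X n) M.
  move=> [c k' s _]; apply: (mackey_iso_of c) => // H y cy; rewrite k' //.
  by split=> [|]; apply (ibnd_loc pr_p pr_q ltpq k1 pq dD cy) => /nN.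
have good w : hgood (simp R Y) (simp R X) a (l := p) n w -> sela n = [:: mackeyZp gT p] ->
    mackey_iso (mackey_homology R Y X n) (mackey_sum (sela n ++ selb n)).
  move=> [chi [cB c0 c1 _]] ->.
  apply: fin; exact: part_add cpl (p_part pr_p pr_q ltpq k1 pq dD nN cB c0 c1) P.
have [[e H]|[i [e H]]|[i [e H]]] := torsionP ca Na (fun=> mackeyZp gT p) (fun=> mackeyZp gT p) nN.
- rewrite /sela e; apply: fin; apply: part_iff P _ => G y cy; split=> [qG|[]//]; split=> // x s.
  by apply/hbndP/H/hcycP; exact: icyc_a s cy.
- exact: good H e.
- exact: good H e.
Qed.

Lemma summands_top : mackey_iso (mackey_homology R Y X N)
  (mackey_sum (mackeyZ gT p q (if fa <= N then 1%N else p) (if fb <= N then 1%N else q) :: sela N ++ selb N)).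
Proof.
rewrite /sela /selb (torsion_top Na) // (torsion_top Nb) //.
have C := degree_compat pr_p pr_q ltpq k1 pq dD ca cb.
have C0 := part_compat (part0 (simp R Y) (simp R X) N).
apply: (mackey_iso_of (compat_add C C0)).
  move=> H y cy; rewrite -(degree_ker pr_p pr_q ltpq k1 pq dD ca cb cy).
  by split=> [[]|->].
move=> H [u v]; have [y cy Fy] := degree_onto pr_p pr_q ltpq k1 pq dD ca cb H u.
by exists y => //; rewrite Fy; congr pair; exact: ord1_eq.
Qed.
End Summands.

Theorem theorem6p5 (R : realType) (p q : nat) (k : int)
    (gT : finGroupType) (a b : gT)
    (V : 'I_(p.-1./2) -> mx_representation R [set: gT]%G 2)
    (V' : 'I_q -> mx_representation R <[b]>%G 2)
    (J : {set 'I_q})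
    (t : int) (r : 'I_(p.-1./2) -> int) (s : 'I_q -> int)
    (t1 t2 : nat) (r1 r2 : 'I_(p.-1./2) -> nat) (s1 s2 : 'I_q -> nat) :
  prime p -> prime q -> odd p -> odd q -> (p < q)%N -> (p %| q.-1)%N ->
  (k ^+ p == 1 %[mod q])%Z -> (k != 1 %[mod q])%Z ->
  group_pq p q k a b ->
  (forall i, V i a = rotation (2 * pi * i.+1%:R / p%:R) /\ V i b = 1%:M) ->
  (forall j, V' j b = rotation (2 * pi * j%:R / q%:R)) ->
  let Vg i := Representation (V i) in
  let Wg j := Representation (ind_repr (finset.subsetT <[b]>%G) (V' j)) in
  let triv := triv_grepr R [set: gT]%G in
  (forall j, j \in J -> (0 < j)%N) -> #|J| = (q.-1 %/ (2 * p))%N ->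
  complete_irr (triv :: [seq Vg i | i <- enum 'I_(p.-1./2)]
                     ++ [seq Wg j | j <- enum J]) ->
  let rep t r s := dadd_grepr (muln_grepr triv t)
    (dadd_grepr (sum_grepr predT Vg r) (sum_grepr (mem J) Wg s)) in
  t = t1%:Z - t2%:Z ->
  (forall i, r i = (r1 i)%:Z - (r2 i)%:Z) ->
  (forall j, j \in J -> s j = (s1 j)%:Z - (s2 j)%:Z) ->
  let rr : int := \sum_i r i in
  let ss : int := \sum_(j in J) s j in
  let m : int := rr + (p%:Z - 1) * ss in
  let kq : 'F_q := k%:~R in
  let summands : seq (int * mackey gT) :=
    [:: (t + 2 * rr + 2 * p%:Z * ss,
         mackeyZ gT p q (if (0 <= m)%R then 1%N else p) (if (0 <= ss)%R then 1%N else q))]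
    ++ (if 0 < m then
          [seq (t + 2 * ss + 2 * i%:Z, mackeyZp gT p) | i <- iota 0 (absz m)]
        else [::])
    ++ (if m < 0 then
          [seq (t + 2 * ss - 2 * i%:Z - 1, mackeyZp gT p)
             | i <- iota 1 (absz (m + 1))]
        else [::])
    ++ (if 0 < ss then
          [seq (t + 2 * rr + 2 * i%:Z, mackeyZq p a b (kq ^+ i))
             | i <- iota 0 (absz (p%:Z * ss))]
        else [::])
    ++ (if ss < 0 then
          [seq (t + 2 * rr - 2 * i%:Z - 1, mackeyZq p a b (kq ^- i))
             | i <- iota 1 (absz (p%:Z * ss + 1))]
        else [::]) in
  forall n : int,
    mackey_iso (sphere_homology (rep t1 r1 s1) (rep t2 r2 s2) n)
               (mackey_sum [seq M.2 | M <- summands & M.1 == n]).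
Proof.
move=> pr_p pr_q odd_p odd_q ltpq _ _ k1 pq VE V'E Vg Wg triv J0 _ _ rep tE rE sE rr ss m kq summands n.
have oG : odd #|gT| by have [_ -> _ _ _] := pq; rewrite oddM odd_p.
have [deg [dD cD]] := sphere_data (rep t1 r1 s1) (rep t2 r2 s2) oG.
have rrE : rr = (\sum_i r1 i)%N%:Z - (\sum_i r2 i)%N%:Z.
  by rewrite /rr (eq_bigr _ (fun i _ => rE i)) sumrB !(big_morph Posz PoszD (erefl (Posz 0))).
have ssE : ss = (\sum_(j in J) s1 j)%N%:Z - (\sum_(j in J) s2 j)%N%:Z.
  by rewrite /ss (eq_bigr _ sE) sumrB !(big_morph Posz PoszD (erefl (Posz 0))).
have NE : (rdegree (rep t1 r1 s1))%:Z - (rdegree (rep t2 r2 s2))%:Z = t + 2 * rr + 2 * p%:Z * ss.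
  rewrite !(rdegree_total pr_p pr_q pq) tE rrE ssE !PoszD !PoszM; ring.
have faE : (fixdim (rep t1 r1 s1) a)%:Z - (fixdim (rep t2 r2 s2) a)%:Z = t + 2 * ss.
  rewrite !(fixdim_total_a pr_p pr_q ltpq k1 pq V' J VE) tE ssE !PoszD; ring.
have fbE : (fixdim (rep t1 r1 s1) b)%:Z - (fixdim (rep t2 r2 s2) b)%:Z = t + 2 * rr.
  rewrite !(fixdim_total_b pr_p pr_q ltpq k1 pq VE V'E J0) tE rrE !PoszD; ring.
have ca := cD a p pr_p (order_a pr_p pr_q pq); have cb := cD b q pr_q (order_b pr_p pr_q pq).
move: deg dD {cD} ca cb; rewrite NE faE fbE => deg dD ca cb.
set N := t + 2 * rr + 2 * p%:Z * ss in dD ca cb *.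
(* This identity and the next supply the parity condition for a and for b, and turn the comparisons
   of f with N into signs of [m] and [ss]. *)
have Na : N = t + 2 * ss + 2 * m by rewrite /N /m; ring.
have Nb : N = t + 2 * rr + 2 * (p%:Z * ss) by rewrite /N; ring.
have {}ca : cyclic_data deg N (t + 2 * ss) a p by apply: ca; exists m; rewrite Na; ring.
have {}cb : cyclic_data deg N (t + 2 * rr) b q by apply: cb; exists (p%:Z * ss); rewrite Nb; ring.
have ale : (t + 2 * ss <= N) = (0 <= m) by rewrite Na lerDl pmulr_rge0.
have ble : (t + 2 * rr <= N) = (0 <= ss).
  by rewrite Nb lerDl pmulr_rge0 // pmulr_rge0 // ltz_nat prime_gt0.
have p0 : 0 < p%:Z by rewrite ltz_nat prime_gt0.
have bpos : (0 < p%:Z * ss) = (0 < ss) by rewrite pmulr_rgt0.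
have bneg : (p%:Z * ss < 0) = (ss < 0) by rewrite pmulr_rlt0.
have [nN|nN] := eqVneq n N.
  have := summands_top pr_p pr_q ltpq k1 pq dD ca cb Na Nb; rewrite ale ble /torsion bpos bneg -nN.
  by rewrite /summands /= -/N nN eqxx /= !filter_cat !map_cat -!catA.
have := summands_off pr_p pr_q ltpq k1 pq dD ca cb Na Nb (elimN eqP nN).
rewrite /torsion bpos bneg.
by rewrite /summands /= -/N eq_sym (negPf nN) !filter_cat !map_cat -!catA.
Qed.
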